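(* Let $d\in\mathbb{N}$, $0<T<\infty$, $Q\in\mathbb{R}^{d\times d}$, $\alpha:=Q^\top Q$, $b_0\in\mathbb{S}_d$, let $B:\mathbb{S}_d\to\mathbb{S}_d$ be linear, and set $b(x)=b_0+B(x)$. Let $K(t)=k(t)\,\mathrm{Id}_d$ where $k:\mathbb{R}_+\to\mathbb{R}_+$ is a nonnegative bounded scalar kernel such that $k(0)>0$ and $k$ is continuous, nonincreasing and preserves nonnegativity. Assume: 1. $b_0\succeq k(0)(d-1)\alpha$, and $\mathrm{Tr}(B(x)u)\ge 0$ for all $x,u\in\mathbb{S}_d^+$ with $\mathrm{Tr}(xu)=0$; 2. there exist $\gamma\in(0,1]$ and $c\in(0,\infty)$ such that for all $0\le s<t\le T$, $$\int_s^t |k(t-u)|^2\,du\le c(t-s)^\gamma,\qquad \int_0^s \bigl(k(t-u)-k(s-u)\bigr)^2du\le c(t-s)^\gamma .$$ Then for every $X_0\in\mathbb{S}_d^+$ the stochastic Volterra equation $$X_t=X_0+\int_0^t K(t-s)b(X_s)\,ds+\int_0^tK(t-s)\Bigl(\sqrt{X_s}\,dW_s\,Q+Q^\top dW_s^\top\sqrt{X_s}\Bigr),\qquad t\in[0,T],$$ admits a continuous $\mathbb{S}_d^+$-valued weak solution.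
   Context: $\mathbb{S}_d$ is the space of real symmetric $d\times d$ matrices with inner product $\langle x,y\rangle=\mathrm{Tr}(xy)$; $\mathbb{S}_d^+$ is the cone of positive semidefinite matrices; $x\succeq y$ means $x-y\in\mathbb{S}_d^+$; $\sqrt{x}$ is the positive semidefinite square root of $x\in\mathbb{S}_d^+$; $\mathrm{Id}_d$ is the identity matrix. $W$ denotes a standard $d\times d$ matrix of independent Brownian motions. A continuous $\mathbb{S}_d^+$-valued weak solution is a continuous adapted $\mathbb{S}_d^+$-valued process $X$, on some filtered probability space carrying such a $W$, satisfying the equation. A nonnegative kernel $k:\mathbb{R}_+\to\mathbb{R}_+$ with $k(0)>0$ preserves nonnegativity if for every $n$, every $0=t_0<t_1<\dots<t_n$ and every $x_0,\dots,x_n\in\mathbb{R}$ satisfying $\sum_{j=0}^i x_jk(t_i-t_j)\ge0$ for $i=0,\dots,n$, one has $\sum_{j:\,t_j\le t}x_jk(t-t_j)\ge0$ for all $t\ge0$. *)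

(* Defs.v *)
From HB Require Import structures.
From mathcomp Require Import all_boot all_order all_algebra.
From mathcomp Require Import all_classical all_reals all_analysis.

Set Implicit Arguments.
Unset Strict Implicit.
Unset Printing Implicit Defensive.

Import Order.TTheory GRing.Theory Num.Theory.
Import numFieldNormedType.Exports.

Local Open Scope classical_set_scope.
Local Open Scope ring_scope.

Section Matrices.
Context {R : realType} {d : nat}.
Implicit Types x y : 'M[R]_d.

Definition psd x : Prop :=
  x \is symmetricmx /\ forall v : 'cV[R]_d, 0 <= (v^T *m x *m v) 0 0.

Definition loewner_ge x y : Prop := psd (x - y).

(* Every positive semidefinite x has exactly one positive semidefinite square
   root; the value 0 is returned when x is not positive semidefinite. *)
Definition psd_sqrt x : 'M[R]_d := xget 0 [set y | psd y /\ y *m y = x].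

(* A linear map S_d -> S_d, as a function on all matrices whose values off S_d
   are unconstrained. *)
Definition sym_linear (B : 'M[R]_d -> 'M[R]_d) : Prop :=
  (forall x, x \is symmetricmx -> B x \is symmetricmx) /\
  (forall (a : R) x y, x \is symmetricmx -> y \is symmetricmx ->
     B (a *: x + y) = a *: B x + B y).

End Matrices.

Definition preserves_nonnegativity {R : realType} (k : R -> R) : Prop :=
  forall (n : nat) (t x : 'I_n.+1 -> R),
    t ord0 = 0 ->
    (forall i j : 'I_n.+1, (i < j)%N -> t i < t j) ->
    (forall i : 'I_n.+1, 0 <= \sum_(j < n.+1 | (j <= i)%N) x j * k (t i - t j)) ->
    forall s : R, 0 <= s -> 0 <= \sum_(j < n.+1 | t j <= s) x j * k (s - t j).

(* Time is [0, +oo[; processes are total functions of a real time, and nothing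
   is ever required of them at negative times. *)
Section Processes.
Context {R : realType} {disp : measure_display} {Om : measurableType disp}.
Implicit Types (F : R -> set (set Om)) (P : probability Om R).

Local Notation mu := (@lebesgue_measure R).

Definition filtration F : Prop :=
  [/\ forall t : R, 0 <= t -> sigma_algebra [set: Om] (F t),
      forall t : R, 0 <= t -> F t `<=` measurable
    & forall s t : R, 0 <= s -> s <= t -> F s `<=` F t].

Definition measurable_wrt (G : set (set Om)) (Y : Om -> R) : Prop :=
  forall A : set R, measurable A -> G (Y @^-1` A).

(* W is a d x d matrix of independent standard Brownian motions relative to F:
   over ]s, t] the d^2 entries of the increment are N(0, t - s), independent of
   each other and (jointly) of F s. *)
Definition brownian_matrix (d : nat) P F (W : R -> Om -> 'M[R]_d) : Prop :=
  [/\ forall (t : R) i j, 0 <= t -> measurable_wrt (F t) (fun w => W t w i j),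
      {ae P, forall w, W 0 w = 0},
      forall w, {within `[0, +oo[, continuous (fun t => W t w)},
      forall (s t : R) i j (C : set R), 0 <= s -> s < t -> measurable C ->
        P [set w | C (W t w i j - W s w i j)] =
        normal_prob 0 (Num.sqrt (t - s)) C
    & forall (s t : R) (A : set Om) (C : 'I_d -> 'I_d -> set R), 0 <= s -> s < t ->
        F s A -> (forall i j, measurable (C i j)) ->
        P (A `&` [set w | forall i j, C i j (W t w i j - W s w i j)]) =
        (P A * \prod_(i < d) \prod_(j < d)
                 P [set w | C i j (W t w i j - W s w i j)%R])%E].

(* Simple integrands: sum of sp_coef i * 1_]sp_time i, sp_time i.+1] for
   i < sp_size, with bounded F (sp_time i)-measurable coefficients. *)
Record simple_process F := SimpleProcess {
  sp_size : nat;
  sp_time : nat -> R;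
  sp_coef : nat -> Om -> R;
  sp_time_ge0 : 0 <= sp_time 0;
  sp_time_le : forall i, (i < sp_size)%N -> sp_time i <= sp_time i.+1;
  sp_coef_meas : forall i, (i < sp_size)%N ->
    measurable_wrt (F (sp_time i)) (sp_coef i);
  sp_coef_bounded : exists M : R,
    forall i w, (i < sp_size)%N -> `|sp_coef i w| <= M }.

Definition simple_eval F (H : simple_process F) (u : R) (w : Om) : R :=
  \sum_(i < sp_size H)
    sp_coef H i w * \1_(`]sp_time H i, sp_time H i.+1]) u.

Definition simple_integral F (H : simple_process F) (W : R -> Om -> R)
    (t : R) (w : Om) : R :=
  \sum_(i < sp_size H) sp_coef H i w *
    (W (Num.min (sp_time H i.+1) t) w - W (Num.min (sp_time H i) t) w).

Definition vanish_in_probability P (Y : nat -> Om -> \bar R) : Prop :=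
  forall e : R, 0 < e ->
    P [set w | (e%:E <= Y n w)%E] @[n --> \oo] --> (0 : \bar R).

(* I is a version of the Ito integral of H against W over [0, t]: H is a
   measurable adapted process with almost surely finite integral of H^2, and I
   is the limit in probability of the integrals of simple processes H_n such
   that the integral of (H_n - H)^2 tends to 0 in probability. This determines
   I up to almost sure equality when W is a Brownian motion relative to F. *)
Definition is_ito_integral P F (W : R -> Om -> R) (t : R)
    (H : R -> Om -> R) (I : Om -> R) : Prop :=
  [/\ measurable_fun (`[0, t] `*` [set: Om])
        (fun z : measurableTypeR R * Om => H z.1 z.2),
      forall u : R, 0 <= u <= t -> measurable_wrt (F u) (H u),
      {ae P, forall w, (\int[mu]_(u in `[0%R, t]) ((H u w) ^+ 2)%:E < +oo)%E},
      measurable_fun [set: Om] I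
    & exists Hn : nat -> simple_process F,
        vanish_in_probability P (fun n w =>
          \int[mu]_(u in `[0%R, t]) ((simple_eval (Hn n) u w - H u w) ^+ 2)%:E)%E /\
        vanish_in_probability P (fun n w =>
          (`|simple_integral (Hn n) W t w - I w|)%:E)].

(* The matrix stochastic integral of A_u dW_u B_u over [0, t], where
   (A dW B) i j is the sum over l, m of A i l * B m j dW l m. *)
Definition is_mx_ito_integral (d : nat) P F (W : R -> Om -> 'M[R]_d) (t : R)
    (A B : R -> Om -> 'M[R]_d) (I : Om -> 'M[R]_d) : Prop :=
  exists J : 'I_d -> 'I_d -> 'I_d -> 'I_d -> Om -> R,
    (forall i j l m,
       is_ito_integral P F (fun u w => W u w l m) t
         (fun u w => A u w i l * B u w m j) (J i j l m)) /\
    (forall w i j, I w i j = \sum_(l < d) \sum_(m < d) J i j l m w).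

(* X is a continuous S_d^+-valued solution on [0, T], driven by W, of
     X_t = X0 + int_0^t K(t-s) b(X_s) ds
         + int_0^t K(t-s) (sqrt(X_s) dW_s Q + Q^T dW_s^T sqrt(X_s)). *)
Definition sve_solution (d : nat) P F (W : R -> Om -> 'M[R]_d) (T : R)
    (K : R -> 'M[R]_d) (b : 'M[R]_d -> 'M[R]_d) (Q X0 : 'M[R]_d)
    (X : R -> Om -> 'M[R]_d) : Prop :=
  [/\ forall (t : R) w, 0 <= t <= T -> psd (X t w),
      forall (t : R) i j, 0 <= t <= T -> measurable_wrt (F t) (fun w => X t w i j),
      forall w, {within `[0, T], continuous (fun t => X t w)}
    & forall t : R, 0 <= t <= T -> exists I1 I2 : Om -> 'M[R]_d,
        [/\ is_mx_ito_integral P F W t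
              (fun s w => K (t - s) *m psd_sqrt (X s w)) (fun _ _ => Q) I1,
            is_mx_ito_integral P F (fun s w => (W s w)^T) t
              (fun s _ => K (t - s) *m Q^T) (fun s w => psd_sqrt (X s w)) I2
          & {ae P, forall w, X t w = X0
               + \matrix_(i, j) (\int[mu]_(s in `[0, t])
                                   (K (t - s) *m b (X s w)) i j)%R
               + (I1 w + I2 w)}]].

End Processes.

Definition has_weak_solution {R : realType} (d : nat) (T : R)
    (K : R -> 'M[R]_d) (b : 'M[R]_d -> 'M[R]_d) (Q X0 : 'M[R]_d) : Prop :=
  exists (disp : measure_display) (Om : measurableType disp)
         (P : probability Om R) (F : R -> set (set Om))
         (W X : R -> Om -> 'M[R]_d),
    [/\ filtration F, brownian_matrix P F W
      & sve_solution P F W T K b Q X0 X].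

(* Main.v *)
Require Import Defs.
From HB Require Import structures.
From mathcomp Require Import all_boot all_order all_algebra.
From mathcomp Require Import all_classical all_reals all_analysis.
From mathcomp Require Import measurable_realfun ring lra zify.

Set Implicit Arguments.
Unset Strict Implicit.
Unset Printing Implicit Defensive.

Import Order.TTheory GRing.Theory Num.Theory.
Import numFieldNormedType.Exports.

Local Open Scope classical_set_scope.
Local Open Scope ring_scope.

(* The solution is obtained as a Loeb-space limit of an Euler scheme driven by
   coin flips. On the grid of mesh h put X_J = X0 + sum_(j < J) k((J - j) h) D_j,
   with D_j a function of X_j and of a matrix z_j of signs scaled by sqrt h. The
   increment is arranged so that X_j + k(0) D_j is positive semidefinite: when
   X_j has a unit vector v with v^T X_j v small, the noise p z Q with
   p = 1 - v v^T turns the square (sqrt X_j + k(0) p z Q)^T (sqrt X_j + k(0) p z Q)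
   into X_j + k(0) (noise) + k(0)^2 Q^T z^T p z Q, whose last term has mean
   k(0)^2 h (d - 1) Q^T Q, which is what the hypothesis on b0 pays for. As k
   preserves nonnegativity, X_(J+1) is then positive semidefinite.

   Monotonicity of k bounds the moments of the increments of the scheme by
   powers of the time lag. On the ultraproduct of the coin spaces, with its Loeb
   measure, the standard parts of the walk and of the scheme are almost surely
   continuous by Kolmogorov's chaining argument. The walk has Gaussian increments
   by Stein's equation, whose discrete form is an integration by parts under the
   flip of one coin. Internal sums against the walk have as standard parts the Ito
   integrals, since they are close in mean square to the sums over a coarse
   standard partition; passing to standard parts in the scheme gives the equation. *)

(** * Quadratic forms and square roots *)

(** Positivity has to hold exactly and for every outcome, because the nonnegativity property of the
    kernel has no tolerance and each state depends on all earlier increments. Hence bounded signs as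
    noise: where x is at least th in every direction, x alone dominates noise of size sqrt h;
    elsewhere the step is an exact sum of positive semidefinite terms. The price is a perturbed
    equation, with a compressed square root, an extra drift th * tr x and a centred quadratic noise,
    whose errors have mean squares of order th, th and h. The drift B limits h to the order of th^2,
    so th is fixed first and h afterwards. On the Loeb space the walk and the scheme remain
    functions of the same coins, so the limit noise needs no separate construction, and an
    infinitesimal mean-square error becomes an almost sure identity. Continuity and positivity are
    required at every sample point, so paths are redefined on null sets; adaptedness survives
    because the filtration contains all null sets. *)

Lemma cvg_sumr {R : realType} {T I : Type} (F : set_system T) {FF : Filter F}
    (r : seq I) (P : pred I) (f : I -> T -> R) (l : I -> R) :
  (forall i, P i -> f i x @[x --> F] --> l i) ->
  (\sum_(i <- r | P i) f i x) @[x --> F] --> \sum_(i <- r | P i) l i.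
Proof.
move=> h; elim: r => [|i r IH].
  rewrite big_nil [X in X @ _ --> _](_ : _ = (fun=> 0)); first exact: cvg_cst.
  by apply/funext => x; rewrite big_nil.
rewrite big_cons; case: ifPn => Pi.
  rewrite [X in X @ _ --> _](_ : _ = (fun x => f i x + \sum_(j <- r | P j) f j x)).
    by apply: cvgD => //; exact: h.
  by apply/funext => x; rewrite big_cons Pi.
rewrite [X in X @ _ --> _](_ : _ = (fun x => \sum_(j <- r | P j) f j x))//.
by apply/funext => x; rewrite big_cons (negbTE Pi).
Qed.

Section QuadraticForms.
Context {R : realType} {d : nat}.
Implicit Types (x y : 'M[R]_d) (u v w : 'cV[R]_d) (a : R).

Definition bform x u v : R := (u^T *m x *m v) 0 0.
Definition dot u v : R := (u^T *m v) 0 0.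

Lemma bformDl x u v w : bform x (u + v) w = bform x u w + bform x v w.
Proof. by rewrite /bform linearD /= !mulmxDl mxE. Qed.
Lemma bformDr x u v w : bform x w (u + v) = bform x w u + bform x w v.
Proof. by rewrite /bform mulmxDr mxE. Qed.
Lemma bformZl x a u v : bform x (a *: u) v = a * bform x u v.
Proof. by rewrite /bform linearZ /= -!scalemxAl mxE. Qed.
Lemma bformZr x a u v : bform x u (a *: v) = a * bform x u v.
Proof. by rewrite /bform -scalemxAr mxE. Qed.
Lemma bformMD x y u v : bform (x + y) u v = bform x u v + bform y u v.
Proof. by rewrite /bform mulmxDr mulmxDl mxE. Qed.
Lemma bformMZ a x u v : bform (a *: x) u v = a * bform x u v.
Proof. by rewrite /bform -scalemxAr -scalemxAl mxE. Qed.
Lemma bformMN x u v : bform (- x) u v = - bform x u v.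
Proof. by rewrite -scaleN1r bformMZ mulN1r. Qed.
Lemma bformMB x y u v : bform (x - y) u v = bform x u v - bform y u v.
Proof. by rewrite bformMD bformMN. Qed.

Lemma bform_tr x u v : bform x^T u v = bform x v u.
Proof.
rewrite /bform -[in RHS](trmxK (v^T *m x *m u)) [in RHS]mxE.
by rewrite !trmx_mul trmxK mulmxA.
Qed.

Lemma bform_dot x u v : bform x u v = dot u (x *m v).
Proof. by rewrite /bform /dot mulmxA. Qed.

Lemma dotE u v : dot u v = \sum_i u i 0 * v i 0.
Proof. by rewrite /dot mxE; apply: eq_bigr => i _; rewrite mxE. Qed.

Lemma dotC u v : dot u v = dot v u.
Proof. by rewrite !dotE; apply: eq_bigr => i _; rewrite mulrC. Qed.

Lemma dot_mulmx x u v : dot (x *m u) v = dot u (x^T *m v).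
Proof. by rewrite /dot trmx_mul mulmxA. Qed.

Lemma bform1 u v : bform 1%:M u v = dot u v.
Proof. by rewrite /bform mulmx1. Qed.

Lemma dot_ge0 u : 0 <= dot u u.
Proof. by rewrite dotE sumr_ge0// => i _; rewrite -expr2 sqr_ge0. Qed.

Lemma dot_eq0 u : dot u u = 0 -> u = 0.
Proof.
rewrite dotE => /eqP; rewrite psumr_eq0; last first.
  by move=> i _; rewrite -expr2 sqr_ge0.
move=> /allP h; apply/matrixP => i j; rewrite mxE (ord1 j).
have /implyP/(_ isT) := h i (mem_index_enum i).
by rewrite mulf_eq0 orbb => /eqP.
Qed.

Lemma symmxP x : reflect (x^T = x) (x \is symmetricmx).
Proof.
rewrite is_hermitianmxE expr0 scale1r.
have -> : map_mx idfun x^T = x^T by apply/matrixP => i j; rewrite !mxE.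
by apply: (iffP eqP).
Qed.

Lemma psdP x : psd x <-> x^T = x /\ forall u, 0 <= bform x u u.
Proof. by split=> -[/symmxP]. Qed.

Lemma psd_tr x : psd x -> x^T = x. Proof. by case/psdP. Qed.
Lemma psd_ge0 x u : psd x -> 0 <= bform x u u. Proof. by case/psdP. Qed.

Lemma bform_sym x u v : x^T = x -> bform x u v = bform x v u.
Proof. by move=> {1}<-; rewrite bform_tr. Qed.

Lemma bform0 u v : bform 0 u v = 0.
Proof. by rewrite /bform mulmx0 mul0mx mxE. Qed.

Lemma psd_CS x u v : psd x -> bform x u v ^+ 2 <= bform x u u * bform x v v.
Proof.
move=> px; have xT := psd_tr px.
have h a b : 0 <= a ^+ 2 * bform x u u + 2 * a * b * bform x u v + b ^+ 2 * bform x v v.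
  have := psd_ge0 (a *: u + b *: v) px.
  rewrite !(bformDl, bformDr, bformZl, bformZr) (bform_sym v u xT).
  by congr (_ <= _); ring.
have hu := psd_ge0 u px; have hv := psd_ge0 v px.
move: h hu hv; set A := bform x u u; set B := bform x u v; set C := bform x v v => h hu hv.
(* For [C != 0] the form is evaluated at [C *: u - B *: v]. For [C = 0] it is affine in the
   coefficient of v, and the coefficient [- (A + 1) / B] would make it negative. *)
have [C0|C0] := eqVneq C 0; last first.
  have Cp : 0 < C by rewrite lt_neqAle eq_sym C0.
  have := h C (- B); rewrite (_ : _ + _ = C * (A * C - B ^+ 2)); last by ring.
  by rewrite pmulr_rge0// subr_ge0.
rewrite C0 mulr0; rewrite leNgt; apply/negP => B2.
have B0 : B != 0 by move: B2; case: eqP => // ->; rewrite expr0n ltxx.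
have := h 1 (- (A + 1) / B); rewrite C0 expr1n mul1r mulr0 addr0 mulr1.
rewrite (_ : 2 * _ * _ = - 2 * (A + 1)); last by field.
lra.
Qed.

Lemma dot_CS u v : dot u v ^+ 2 <= dot u u * dot v v.
Proof.
rewrite -!bform1; apply: psd_CS; apply/psdP; split; first exact: trmx1.
by move=> w; rewrite bform1 dot_ge0.
Qed.

(** Cauchy-Schwarz between [x *m u] and u: their mixed form is the squared length of [x *m u]. *)
Lemma psd_null x u : psd x -> bform x u u = 0 -> x *m u = 0.
Proof.
move=> px h; apply: dot_eq0; rewrite -bform_dot.
have := psd_CS (x *m u) u px; rewrite h mulr0 => h2.
by apply/eqP; rewrite -sqrf_eq0 eq_le h2 sqr_ge0.
Qed.

Lemma psd0 : psd (0 : 'M[R]_d).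
Proof. by apply/psdP; rewrite trmx0; split => // u; rewrite bform0. Qed.

Lemma psdD x y : psd x -> psd y -> psd (x + y).
Proof.
move=> /psdP[xT hx] /psdP[yT hy]; apply/psdP; rewrite linearD /= xT yT.
by split => // u; rewrite bformMD addr_ge0.
Qed.

Lemma psdZ a x : 0 <= a -> psd x -> psd (a *: x).
Proof.
move=> a0 /psdP[xT hx]; apply/psdP; rewrite linearZ /= xT.
by split => // u; rewrite bformMZ mulr_ge0.
Qed.

Lemma psd_gram m (A : 'M[R]_(m, d)) : psd (A^T *m A).
Proof.
apply/psdP; rewrite trmx_mul trmxK; split => // u.
rewrite /bform mulmxA -trmx_mul -mulmxA mxE sumr_ge0// => i _.
by rewrite mxE -expr2 sqr_ge0.
Qed.

Lemma psd_outer u : psd (u *m u^T).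
Proof. by rewrite -{1}(trmxK u); exact: psd_gram. Qed.

Lemma bform_delta x i j : bform x (delta_mx i 0) (delta_mx j 0) = x i j.
Proof. by rewrite /bform trmx_delta -rowE -colE !mxE. Qed.

Lemma psd_diag_ge0 x i : psd x -> 0 <= x i i.
Proof. by move=> px; rewrite -bform_delta; exact: psd_ge0. Qed.

Lemma psd_tr_ge0 x : psd x -> 0 <= \tr x.
Proof. by move=> px; rewrite sumr_ge0// => i _; exact: psd_diag_ge0. Qed.

Lemma psd_diag_le x i : psd x -> x i i <= \tr x.
Proof.
move=> px; rewrite /mxtrace (bigD1 i)//= lerDl sumr_ge0// => j _.
exact: psd_diag_ge0.
Qed.

Lemma psd_entry_le x i j : psd x -> `|x i j| <= \tr x.
Proof.
move=> px.
have h := psd_CS (delta_mx i 0) (delta_mx j 0) px.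
rewrite !bform_delta in h.
rewrite -(@ler_pXn2r _ 2)// ?nnegrE ?psd_tr_ge0// real_normK ?num_real//.
apply: (le_trans h); rewrite expr2 ler_pM// ?psd_diag_ge0// psd_diag_le//.
Qed.

Lemma bformE x u v : bform x u v = \sum_i \sum_j u i 0 * x i j * v j 0.
Proof.
rewrite /bform mxE exchange_big /=; apply: eq_bigr => i _.
by rewrite mxE mulr_suml; apply: eq_bigr => j _; rewrite mxE.
Qed.

Definition l1mx x : R := \sum_i \sum_j `|x i j|.

Lemma l1mx_ge0 x : 0 <= l1mx x.
Proof. by apply: sumr_ge0 => i _; apply: sumr_ge0 => j _. Qed.

Lemma entry_le_l1mx x i j : `|x i j| <= l1mx x.
Proof.
rewrite /l1mx (bigD1 i)//= (bigD1 j)//= -addrA lerDl addr_ge0// ?sumr_ge0//.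
by move=> k _; rewrite sumr_ge0.
Qed.

Lemma vec_entry_le u i : u i 0 ^+ 2 <= dot u u.
Proof.
rewrite dotE (bigD1 i)//= -expr2 lerDl sumr_ge0// => j _.
by rewrite -expr2 sqr_ge0.
Qed.

Lemma bform_le_l1mx x u : `|bform x u u| <= l1mx x * dot u u.
Proof.
rewrite bformE; apply: (le_trans (ler_norm_sum _ _ _)).
rewrite /l1mx mulr_suml; apply: ler_sum => i _.
apply: (le_trans (ler_norm_sum _ _ _)); rewrite mulr_suml; apply: ler_sum => j _.
rewrite !normrM mulrAC mulrC ler_wpM2l//.
have hi := vec_entry_le u i; have hj := vec_entry_le u j.
rewrite -normrM ler_norml.
have := sqr_ge0 (u i 0 + u j 0); have := sqr_ge0 (u i 0 - u j 0).
by rewrite !sqrrD mulrN sqrrN => h1 h2; apply/andP; split; lra.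
Qed.

(** Polarisation at e_i + e_j and e_i - e_j. Both have squared length 2 when i and j differ, and the
    division by 4 gives back exactly a. *)
Lemma sym_entry_le x a i j : x^T = x ->
  (forall u, `|bform x u u| <= a * dot u u) -> `|x i j| <= a.
Proof.
move=> xT h.
pose e k : 'cV[R]_d := delta_mx k 0.
have de k l : dot (e k) (e l) = (k == l)%:R.
  by rewrite -bform1 bform_delta mxE.
have [<-|ij] := eqVneq i j.
  by have := h (e i); rewrite bform_delta de eqxx mulr1.
have h1 := h (e i + e j); have h2 := h (e i - e j).
have dd u v : dot (u + v) (u + v) = dot u u + 2 * dot u v + dot v v.
  by rewrite -!bform1 !(bformDl, bformDr) !bform1 (dotC v u); ring.
have ddN u v : dot (u - v) (u - v) = dot u u - 2 * dot u v + dot v v.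
  rewrite dd -scaleN1r -!bform1 !(bformZl, bformZr); ring.
rewrite dd !de !eqxx (negbTE ij) mulr1n mulr0n in h1; rewrite ddN !de !eqxx (negbTE ij) mulr1n mulr0n in h2.
have -> : x i j = (bform x (e i + e j) (e i + e j) - bform x (e i - e j) (e i - e j)) / 4.
  rewrite -[e i - e j]/(e i + - e j) -[- e j]scaleN1r.
  rewrite !(bformDl, bformDr, bformZl, bformZr) !bform_delta.
  have -> : x j i = x i j by rewrite -{1}xT mxE.
  by field.
rewrite ler_norml; move: h1 h2; rewrite !ler_norml => /andP[h1 h2] /andP[h3 h4].
apply/andP; split; lra.
Qed.

Lemma bform_continuous x : continuous (fun r : 'rV[R]_d => bform x r^T r^T).
Proof.
move=> r; rewrite /continuous_at bformE.
rewrite [X in X @ _ --> _](_ : _ =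
    (fun r : 'rV[R]_d => \sum_i \sum_j r 0 i * x i j * r 0 j)); last first.
  apply/funext => w; rewrite bformE; apply: eq_bigr => i _.
  by apply: eq_bigr => j _; rewrite !mxE.
have FF : Filter (nbhs r) := nbhs_filter r.
apply: cvg_sumr => i _; apply: cvg_sumr => j _; rewrite !mxE.
apply: cvgM; last exact: coord_continuous.
by apply: cvgM; [exact: coord_continuous|exact: cvg_cst].
Qed.

End QuadraticForms.

Section SquareRoots.
Context {R : realType} {d : nat}.
Implicit Types (x y s t : 'M[R]_d) (u v w : 'cV[R]_d) (a : R).

Lemma dot_gt0 u : u != 0 -> 0 < dot u u.
Proof.
by move=> u0; rewrite lt_neqAle dot_ge0 andbT eq_sym; apply: contra_neq u0; exact: dot_eq0.
Qed.

Lemma dotZZ a u : dot (a *: u) (a *: u) = a ^+ 2 * dot u u.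
Proof. by rewrite -!bform1 bformZl bformZr expr2 mulrA. Qed.

Lemma unit_ind x a : (forall u, dot u u = 1 -> a <= bform x u u) ->
  forall u, a * dot u u <= bform x u u.
Proof.
move=> h u; have [->|u0] := eqVneq u 0.
  by rewrite -bform1 -(scale0r 0) !bformZl !mul0r mulr0.
have p := dot_gt0 u0.
have e : dot ((Num.sqrt (dot u u))^-1 *: u) ((Num.sqrt (dot u u))^-1 *: u) = 1.
  by rewrite dotZZ exprVn sqr_sqrtr ?(ltW p)// mulVf// gt_eqF.
have := h _ e.
rewrite bformZl bformZr mulrA -invrM ?unitfE ?sqrtr_eq0 -?ltNge// -expr2 sqr_sqrtr ?(ltW p)//.
by rewrite ler_pdivlMl// mulrC.
Qed.

Lemma psd_unit x : x^T = x -> (forall u, dot u u = 1 -> 0 <= bform x u u) -> psd x.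
Proof.
move=> xT h; apply/psdP; split => // u.
by have := unit_ind h u; rewrite mul0r.
Qed.

Lemma vec_trivial u : (d = 0)%N -> u = 0.
Proof. by move=> d0; apply/matrixP => i; exfalso; case: i; rewrite d0. Qed.

(** The unit sphere is compact, and nonempty since d > 0, so the form attains its maximum there;
    homogeneity carries the bound to all vectors. *)
Lemma rayleigh_max x : (0 < d)%N ->
  exists2 v, dot v v = 1 & forall u, bform x u u <= bform x v v * dot u u.
Proof.
move=> d0.
pose A := [set r : 'rV[R]_d | dot r^T r^T = 1].
have A0 : A !=set0.
  exists (delta_mx 0 (Ordinal d0)).
  by rewrite /A /= trmx_delta -bform1 bform_delta mxE eqxx.
have cA : compact A.
  apply: bounded_closed_compact.
    exists 1; split; first exact: num_real.
    move=> M M1 r /= Ar; rewrite [leLHS]/Num.norm /= mx_normrE.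
    apply/bigmax_leP; split => [|[i j] _ /=]; first by rewrite (le_trans _ (ltW M1)).
    have := vec_entry_le r^T j; rewrite Ar mxE (ord1 i) => h.
    rewrite (le_trans _ (ltW M1))//.
    by rewrite -(@ler_pXn2r _ 2)// ?nnegrE// real_normK ?num_real// expr1n.
  rewrite (_ : A = (fun r : 'rV[R]_d => bform 1%:M r^T r^T) @^-1` [set 1]).
    apply: closed_comp; last exact: closed_eq.
    by move=> r _; exact: bform_continuous.
  by apply/seteqP; split => r /=; rewrite bform1.
have := EVT_max_rV A0 cA (continuous_subspaceT (bform_continuous (x := x))).
move=> [r]; rewrite inE => Ar h; exists r^T => // u.
have := @unit_ind (- x) (- bform x r^T r^T) _ u.
rewrite bformMN mulNr lerN2; apply => w w1; rewrite bformMN lerN2.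
by have := h w^T; rewrite trmxK; apply; rewrite inE /A /= trmxK.
Qed.

(** Maximality makes l 1 - x positive semidefinite, with l the maximal value, and v is a null vector
    of its form; [psd_null] then gives the eigenvalue equation. *)
Lemma rayleigh_eigen x v : x^T = x -> dot v v = 1 ->
  (forall u, bform x u u <= bform x v v * dot u u) -> x *m v = bform x v v *: v.
Proof.
move=> xT v1 h; apply/eqP; rewrite -subr_eq0 -opprB oppr_eq0; apply/eqP.
have -> : bform x v v *: v - x *m v = (bform x v v *: 1%:M - x) *m v.
  by rewrite mulmxBl -scalemxAl mul1mx.
apply: psd_null; last by rewrite bformMB bformMZ bform1 v1 mulr1 subrr.
apply/psdP; rewrite linearB linearZ /= trmx1 xT; split => // u.
by rewrite bformMB bformMZ bform1 subr_ge0.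
Qed.

Lemma mx_of_vec x : (forall u, x *m u = 0) -> x = 0.
Proof.
move=> h; apply/matrixP => i j.
have := congr1 (fun w : 'cV[R]_d => w i 0) (h (delta_mx j 0)).
by rewrite -colE !mxE.
Qed.

Lemma psd_form0 x : psd x -> (forall u, bform x u u = 0) -> x = 0.
Proof. by move=> px h; apply: mx_of_vec => u; exact: psd_null. Qed.

(* Deflation: subtracting the top eigenvalue times its spectral projection
   lowers the rank. *)
Lemma psd_sqrt_ex x : psd x -> exists y, psd y /\ y *m y = x.
Proof.
have [n] := ubnP (\rank x); elim: n => // n IH in x * => /ltnSE rx px.
have [->|x0] := eqVneq x 0; first by exists 0; rewrite mulmx0; split => //; exact: psd0.
have d0 : (0 < d)%N.
  rewrite lt0n; apply: contra_neq x0 => d0; apply: mx_of_vec => u.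
  by rewrite (vec_trivial (x *m u) d0).
have [v v1 hv] := rayleigh_max x d0.
have xT := psd_tr px.
have xv := rayleigh_eigen xT v1 hv.
set l := bform x v v in hv xv.
have l_ge0 : 0 <= l by exact: psd_ge0.
have l_gt0 : 0 < l.
  rewrite lt_neqAle l_ge0 andbT eq_sym; apply: contra_neq x0 => l0.
  apply: psd_form0 => // u; apply/eqP; rewrite eq_le psd_ge0// andbT.
  by have := hv u; rewrite l0 mul0r.
have v11 : v^T *m v = 1%:M.
  by apply/matrixP => i j; rewrite (ord1 i) (ord1 j) [RHS]mxE eqxx; exact: v1.
have vx : v^T *m x = l *: v^T by rewrite -{1}xT -trmx_mul xv linearZ.
pose x' := x - l *: (v *m v^T).
have x'E : x' = (1%:M - v *m v^T) *m x.
  by rewrite mulmxBl mul1mx -mulmxA vx -scalemxAr.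
have x'v : x' *m v = 0.
  by rewrite mulmxBl xv -scalemxAl -mulmxA v11 mulmx1 subrr.
(* Cauchy-Schwarz between u and v: since x v = l v, the mixed term is l times the dot product, so
   the subtracted form is at most that of x. *)
have px' : psd x'.
  apply/psdP; rewrite /x' linearB linearZ /= trmx_mul trmxK xT; split => // u.
  have := psd_CS u v px; rewrite -/l.
  have -> : bform x u v = l * dot u v by rewrite bform_dot xv -!bform1 bformZr.
  have e : bform (v *m v^T) u u = dot u v ^+ 2.
    by rewrite /bform mulmxA -mulmxA mxE big_ord1 -/(dot u v) -/(dot v u) (dotC v u) expr2.
  rewrite bformMB bformMZ e exprMn mulrC => h.
  rewrite subr_ge0 -(ler_pM2r l_gt0); apply: le_trans h.
  by rewrite (_ : l * _ * l = dot u v ^+ 2 * l ^+ 2)//; ring.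
(* The row space of x' lies in that of x. It is smaller because x' kills v, whereas x v = l v is
   nonzero. *)
have rx' : (\rank x' < n)%N.
  apply: leq_trans rx; apply: rank_ltmx; rewrite /ltmx x'E submxMl /=.
  apply/negP => /submxP [D xD].
  have := congr1 (fun M => M *m v) xD; rewrite /= -x'E -mulmxA x'v mulmx0 xv => /eqP.
  rewrite scaler_eq0 (gt_eqF l_gt0) /= => /eqP v0.
  by move: v1 => /eqP; rewrite v0 -bform1 -(scale0r 0) bformZl mul0r eq_sym oner_eq0.
have [y' [py' yy']] := IH x' rx' px'.
have y'v : y' *m v = 0.
  apply: dot_eq0; rewrite dot_mulmx (psd_tr py') mulmxA yy' x'v.
  by rewrite -bform1 -(scale0r 0) bformZr mul0r.
have vy' : v^T *m y' = 0 by rewrite -(psd_tr py') -trmx_mul y'v trmx0.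
exists (y' + Num.sqrt l *: (v *m v^T)); split.
  by apply: psdD => //; apply: psdZ; [exact: sqrtr_ge0|exact: psd_outer].
rewrite mulmxDl !mulmxDr -!scalemxAl -!scalemxAr -!mulmxA vy' (mulmxA y') y'v.
rewrite (mulmxA v^T) v11 mul1mx mulmx0 mul0mx scaler0 addr0 add0r yy' scalerA.
by rewrite -expr2 sqr_sqrtr// subrK.
Qed.

Lemma psd_sqrtP x : psd x -> psd (psd_sqrt x) /\ psd_sqrt x *m psd_sqrt x = x.
Proof.
move=> px; have [y hy] := psd_sqrt_ex px.
exact: (@xgetPex _ 0 [set z | psd z /\ z *m z = x] (ex_intro _ y hy)).
Qed.

(* At a top unit eigenvector v of s - t, with eigenvalue l >= 0, one has
   v^T (s^2 - t^2) v = l v^T (s + t) v >= l^2. *)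
Lemma sqrt_holder1 s t a : psd s -> psd t ->
  (forall u, bform (s *m s - t *m t) u u <= a * dot u u) ->
  forall u, bform (s - t) u u <= Num.sqrt a * dot u u.
Proof.
move=> ps pt h u.
have [d0|d0] := posnP d.
  by rewrite (vec_trivial u d0) -bform1 -(scale0r 0) !bformZr !mul0r mulr0.
have [v v1 hv] := rayleigh_max (s - t) d0.
have sT := psd_tr ps; have tT := psd_tr pt.
have DT : (s - t)^T = s - t by rewrite linearB /= sT tT.
have xv := rayleigh_eigen DT v1 hv.
apply: (le_trans (hv u)); rewrite ler_wpM2r ?dot_ge0//.
set l := bform _ v v in xv *.
have [l0|l0] := leP l 0; first by rewrite (le_trans l0)// sqrtr_ge0.
have e : bform (s *m s - t *m t) v v = l * (bform s v v + bform t v v).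
  have -> : s *m s - t *m t = s *m (s - t) + (s - t) *m t.
    by rewrite mulmxBr mulmxBl addrA subrK.
  have vD : v^T *m (s - t) = l *: v^T by rewrite -{1}DT -trmx_mul xv linearZ.
  rewrite bformMD mulrDr; congr (_ + _).
    by rewrite bform_dot -mulmxA xv -scalemxAr -!bform1 bformZr bform1 -bform_dot.
  by rewrite /bform mulmxA vD -!scalemxAl mxE.
have := h v; rewrite e v1 mulr1 => h1.
have l2 : l ^+ 2 <= a.
  apply: le_trans h1; rewrite expr2 ler_pM2l//.
  have := psd_ge0 v pt; rewrite /l bformMB; lra.
by rewrite -(ger0_norm (ltW l0)) -sqrtr_sqr ler_wsqrtr.
Qed.

(** The one-sided bound [sqrt_holder1] is used twice with x and y exchanged, which bounds the form
    of the difference in absolute value; its entries follow by polarisation. This Hoelder exponent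
    1/2 is what makes the noise coefficients converge. *)
Lemma psd_sqrt_holder x y i j : psd x -> psd y ->
  `|psd_sqrt x i j - psd_sqrt y i j| <= Num.sqrt (l1mx (x - y)).
Proof.
move=> px py.
have [ps es] := psd_sqrtP px; have [pt et] := psd_sqrtP py.
have -> : psd_sqrt x i j - psd_sqrt y i j = (psd_sqrt x - psd_sqrt y) i j by rewrite !mxE.
apply: sym_entry_le; first by rewrite linearB /= (psd_tr ps) (psd_tr pt).
move=> u; rewrite ler_norml; apply/andP; split; last first.
  apply: sqrt_holder1 => // w; rewrite es et.
  exact: (le_trans (ler_norm _) (bform_le_l1mx _ _)).
rewrite lerNl -bformMN opprB.
apply: sqrt_holder1 => // w; rewrite es et -opprB bformMN.
by apply: (le_trans (ler_norm _)); rewrite normrN bform_le_l1mx.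
Qed.

Lemma psd_sqrt_sum x : psd x -> \sum_i \sum_j psd_sqrt x i j ^+ 2 = \tr x.
Proof.
move=> px; have [ps es] := psd_sqrtP px.
rewrite -{2}es /mxtrace; apply: eq_bigr => i _; rewrite mxE.
by apply: eq_bigr => j _; rewrite expr2 -{2}(psd_tr ps) mxE.
Qed.

Lemma psd_sqrt_entry x i j : psd x -> psd_sqrt x i j ^+ 2 <= \tr x.
Proof.
move=> px; rewrite -psd_sqrt_sum// (bigD1 i)//= (bigD1 j)//= -addrA lerDl.
rewrite addr_ge0// sumr_ge0// => k _; first exact: sqr_ge0.
by rewrite sumr_ge0// => l _; rewrite sqr_ge0.
Qed.

Lemma psd_sqrt_entry_norm x i j : psd x -> `|psd_sqrt x i j| <= Num.sqrt (\tr x).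
Proof. by move=> px; rewrite -sqrtr_sqr ler_wsqrtr// psd_sqrt_entry. Qed.

Lemma dot_mulmx_le x u : dot (x *m u) (x *m u) <= (\sum_i \sum_j x i j ^+ 2) * dot u u.
Proof.
rewrite dotE mulr_suml; apply: ler_sum => i _.
have -> : (x *m u) i 0 = dot (row i x)^T u.
  by rewrite dotE mxE; apply: eq_bigr => j _; rewrite !mxE.
rewrite -expr2; apply: (le_trans (dot_CS _ _)); rewrite ler_wpM2r ?dot_ge0//.
by rewrite dotE; apply: ler_sum => j _; rewrite !mxE expr2.
Qed.

End SquareRoots.

(** * A positivity-preserving Euler scheme *)

Section InwardDrift.
Context {R : realType} {d : nat}.
Implicit Types (x y s t : 'M[R]_d) (u v w : 'cV[R]_d) (a : R).
Variable B : 'M[R]_d -> 'M[R]_d.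
Hypothesis hB : sym_linear B.

(** [B] is controlled on symmetric matrices only, so it has to be expanded along a symmetric
    spanning family. *)
Definition sym_unit (i j : 'I_d) : 'M[R]_d := 2^-1 *: (delta_mx i j + delta_mx j i).

Lemma sym_unit_tr i j : (sym_unit i j)^T = sym_unit i j.
Proof. by rewrite /sym_unit linearZ linearD /= !trmx_delta addrC. Qed.

Lemma sym_unit_sum x : x^T = x -> x = \sum_i \sum_j x i j *: sym_unit i j.
Proof.
move=> xT; rewrite {1}(matrix_sum_delta x).
have h : x = \sum_i \sum_j x i j *: delta_mx j i.
  rewrite -{1}xT {1}(matrix_sum_delta x) linear_sum; apply: eq_bigr => i _.
  by rewrite linear_sum; apply: eq_bigr => j _; rewrite linearZ /= trmx_delta.
have -> : \sum_i \sum_j x i j *: sym_unit i j = 2^-1 *: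
    ((\sum_i \sum_j x i j *: delta_mx i j) + \sum_i \sum_j x i j *: delta_mx j i).
  rewrite -big_split scaler_sumr; apply: eq_bigr => i _ /=.
  rewrite -big_split scaler_sumr; apply: eq_bigr => j _ /=.
  by rewrite /sym_unit scalerA -scalerDr scalerA mulrC.
rewrite -h -matrix_sum_delta -[x in x + x]scale1r -scalerDl scalerA.
by rewrite (_ : 2^-1 * _ = 1) ?scale1r//; field.
Qed.

Lemma sym_linear0 : B 0 = 0.
Proof.
have s0 : (0 : 'M[R]_d) \is symmetricmx by apply/symmxP; rewrite trmx0.
have := hB.2 1 0 0 s0 s0; rewrite scaler0 addr0 scale1r => /eqP.
by rewrite -{1}[B 0]addr0 (inj_eq (addrI _)) eq_sym => /eqP.
Qed.

Lemma sym_linear_sum (I : Type) (r : seq I) (f : I -> R) (g : I -> 'M[R]_d) :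
  (forall i, (g i)^T = g i) ->
  B (\sum_(i <- r) f i *: g i) = \sum_(i <- r) f i *: B (g i).
Proof.
move=> gT; elim: r => [|i r IH]; first by rewrite !big_nil sym_linear0.
rewrite !big_cons hB.2 ?IH//; first exact/symmxP.
apply/symmxP; rewrite linear_sum; apply: eq_bigr => k _.
by rewrite linearZ /= gT.
Qed.

Lemma sym_linearE x : x^T = x -> B x = \sum_i \sum_j x i j *: B (sym_unit i j).
Proof.
move=> xT; rewrite {1}(sym_unit_sum xT) !pair_big /=.
rewrite (sym_linear_sum _ (fun p => x p.1 p.2) (g := fun p => sym_unit p.1 p.2))//.
by move=> [i j]; exact: sym_unit_tr.
Qed.

Definition sym_linear_bound : R := \sum_i \sum_j l1mx (B (sym_unit i j)).

Lemma sym_linear_bound_ge0 : 0 <= sym_linear_bound.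
Proof. by apply: sumr_ge0 => i _; apply: sumr_ge0 => j _; exact: l1mx_ge0. Qed.

Lemma sym_linear_entry x i j : x^T = x -> `|B x i j| <= sym_linear_bound * l1mx x.
Proof.
move=> xT; rewrite (sym_linearE xT) summxE.
apply: (le_trans (ler_norm_sum _ _ _)); rewrite /sym_linear_bound mulr_suml.
apply: ler_sum => k _; rewrite summxE; apply: (le_trans (ler_norm_sum _ _ _)).
rewrite mulr_suml; apply: ler_sum => l _.
by rewrite mxE normrM mulrC ler_pM// entry_le_l1mx.
Qed.

Lemma l1mx_le x a : (forall i j, `|x i j| <= a) -> l1mx x <= d%:R ^+ 2 * a.
Proof.
move=> h; rewrite /l1mx.
apply: (@le_trans _ _ (\sum_(i < d) \sum_(j < d) a)).
  by apply: ler_sum => i _; apply: ler_sum => j _; exact: h.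
by rewrite !sumr_const !card_ord -mulrnA -[leLHS]mulr_natl natrM expr2.
Qed.

Lemma l1mx_psd_le x : psd x -> l1mx x <= d%:R ^+ 2 * \tr x.
Proof. by move=> px; apply: l1mx_le => i j; exact: psd_entry_le. Qed.

Lemma trmxB_sym x : x^T = x -> (B x)^T = B x.
Proof. by move=> xT; apply/symmxP; apply: hB.1; exact/symmxP. Qed.

Hypothesis B_inward : forall x u : 'M[R]_d, psd x -> psd u ->
     \tr (x *m u) = 0 -> 0 <= \tr (B x *m u).

Lemma trace_outer x u : \tr (x *m (u *m u^T)) = bform x u u.
Proof. by rewrite mulmxA mxtrace_mulC mulmxA /bform [LHS]big_ord1. Qed.

(* Compress x to the complement of u; the compressed matrix is orthogonal to
   u u^T, and differs from x by at most sqrt (tr x) * sqrt (u^T x u). *)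
Lemma inward_bound x u : psd x -> dot u u = 1 ->
  - (sym_linear_bound * d%:R ^+ 4 * 3 * (Num.sqrt (\tr x) * Num.sqrt (bform x u u)))
    <= bform (B x) u u.
Proof.
move=> px u1; have xT := psd_tr px.
have [ps es] := psd_sqrtP px; set s := psd_sqrt x in ps es; have sT := psd_tr ps.
pose p := 1%:M - u *m u^T.
have pT : p^T = p by rewrite /p linearB /= trmx1 trmx_mul trmxK.
have u11 : u^T *m u = 1%:M.
  by apply/matrixP => i j; rewrite (ord1 i) (ord1 j) [RHS]mxE eqxx; exact: u1.
have pu : p *m u = 0 by rewrite /p mulmxBl mul1mx -mulmxA u11 mulmx1 subrr.
pose y := p *m x *m p.
have py : psd y.
  have -> : y = (s *m p)^T *m (s *m p) by rewrite trmx_mul sT pT !mulmxA -(mulmxA p) es.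
  exact: psd_gram.
have yT := psd_tr py.
have h0 : 0 <= bform (B y) u u.
  rewrite -trace_outer; apply: B_inward => //; first exact: psd_outer.
  by rewrite trace_outer /bform /y -!mulmxA pu !mulmx0 mxE.
have [ge1 ge2] := (psd_ge0 u px, psd_tr_ge0 px).
set r := Num.sqrt _ * Num.sqrt _.
have r0 : 0 <= r by rewrite mulr_ge0// sqrtr_ge0.
have r2 : r ^+ 2 = \tr x * bform x u u by rewrite exprMn !sqr_sqrtr.
pose w := x *m u.
have w2 : dot w w <= r ^+ 2.
  have -> : w = s *m (s *m u) by rewrite mulmxA es.
  apply: (le_trans (dot_mulmx_le _ _)); rewrite psd_sqrt_sum// r2.
  by rewrite dot_mulmx sT mulmxA es -bform_dot.
have wi i : `|w i 0| <= r.
  rewrite -(@ler_pXn2r _ 2)// ?nnegrE// real_normK ?num_real//.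
  exact: le_trans (vec_entry_le _ _) w2.
have ui i : `|u i 0| <= 1.
  rewrite -(@ler_pXn2r _ 2)// ?nnegrE// real_normK ?num_real// expr1n -u1.
  exact: vec_entry_le.
have q1 : `|bform x u u| <= r.
  rewrite -(@ler_pXn2r _ 2)// ?nnegrE// real_normK ?num_real//.
  rewrite bform_dot; apply: (le_trans (dot_CS _ _)).
  by rewrite u1 mul1r.
(* Each of the three terms of x - p x p has entries at most r, whence the factor 3. The factor d^4
   comes from applying [l1mx_le] once to x - y and once to its image under B. *)
have e i j : (x - y) i j = w i 0 * u j 0 + u i 0 * w j 0 - bform x u u * (u i 0 * u j 0).
  have -> : x - y = w *m u^T + u *m w^T - bform x u u *: (u *m u^T).
    rewrite /y /p !(mulmxBl, mulmxBr) !mul1mx !mulmx1 /w trmx_mul xT.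
    rewrite -!mulmxA (mulmxA u^T) (mulmxA (u^T *m x)).
    have -> : u^T *m x *m u = (bform x u u)%:M.
      by apply/matrixP => a b; rewrite (ord1 a) (ord1 b) [RHS]mxE eqxx.
    by rewrite mul_scalar_mx -scalemxAr opprB addrCA subKr addrAC.
  by rewrite !mxE !big_ord1 !mxE.
have l1 : l1mx (x - y) <= d%:R ^+ 2 * (3 * r).
  apply: l1mx_le => i j; rewrite e.
  apply: (le_trans (ler_normB _ _)); rewrite (_ : 3 * r = r + r + r); last by ring.
  apply: lerD.
    apply: (le_trans (ler_normD _ _)); rewrite !normrM; apply: lerD.
      by rewrite -[leRHS]mulr1 ler_pM.
    by rewrite -[leRHS]mul1r ler_pM.
  rewrite !normrM -[leRHS]mulr1 ler_pM//.
  by rewrite -[leRHS]mul1r ler_pM.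
have xyT : (x - y)^T = x - y by rewrite linearB /= xT yT.
have -> : B x = B (x - y) + B y.
  have := hB.2 1 (x - y) y; rewrite !scale1r subrK; apply; exact/symmxP.
rewrite bformMD -[leLHS]addr0; apply: lerD => //.
rewrite lerNl; apply: (le_trans (ler_norm _)); rewrite normrN.
apply: (le_trans (bform_le_l1mx _ _)); rewrite u1 mulr1.
apply: (le_trans (l1mx_le (a := sym_linear_bound * l1mx (x - y)) _)).
  by move=> i j; exact: sym_linear_entry.
rewrite mulrCA (_ : _ * _ * 3 * r = sym_linear_bound * (d%:R ^+ 2 * (d%:R ^+ 2 * (3 * r)))); last by ring.
by rewrite ler_wpM2l ?sym_linear_bound_ge0// ler_wpM2l// exprn_ge0.
Qed.

Definition inward_const : R := sym_linear_bound * d%:R ^+ 4 * 3.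

(** By [inward_bound] the form at a unit vector u is at least a quadratic polynomial in sqrt (u^T x
    u) and sqrt (tr x). The last hypothesis says that its discriminant is not positive; the proof
    completes the square. *)
Lemma psd_drift x (eta del kap : R) : psd x -> 0 < eta -> 0 <= del -> 0 <= kap ->
  kap * inward_const ^+ 2 <= 4 * eta * del ->
  psd (eta *: x + kap *: (B x + (del * \tr x)%:M)).
Proof.
move=> px eta0 del0 kap0 hk; have xT := psd_tr px.
apply: psd_unit.
  by rewrite linearD !linearZ /= linearD /= (trmxB_sym xT) xT tr_scalar_mx.
move=> u u1.
rewrite bformMD !bformMZ bformMD -[_%:M]mulmx1 mul_scalar_mx bformMZ bform1 u1 mulr1.
have := inward_bound px u1; rewrite -/inward_const.
rewrite -{2}(sqr_sqrtr (psd_tr_ge0 px)) -{2}(sqr_sqrtr (psd_ge0 u px)).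
set b := Num.sqrt (\tr x); set a := Num.sqrt (bform x u u); set C := inward_const => h.
have h1 : 0 <= 4 * eta * (eta * a ^+ 2 + kap * (- (C * (b * a)) + del * b ^+ 2)).
  have -> : 4 * eta * (eta * a ^+ 2 + kap * (- (C * (b * a)) + del * b ^+ 2)) =
    (2 * eta * a - kap * C * b) ^+ 2 + b ^+ 2 * kap * (4 * eta * del - kap * C ^+ 2) by ring.
  apply: addr_ge0; first exact: sqr_ge0.
  by apply: mulr_ge0; [apply: mulr_ge0; [exact: sqr_ge0|]|rewrite subr_ge0].
rewrite pmulr_rge0 ?mulr_gt0// in h1; apply: (le_trans h1).
by rewrite lerD2l ler_wpM2l// lerD2r.
Qed.

End InwardDrift.

Section OneStep.
Context {R : realType} {d : nat}.
Implicit Types (x y s t z : 'M[R]_d) (u v w : 'cV[R]_d) (a : R).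
Variables (Q b0 : 'M[R]_d) (B : 'M[R]_d -> 'M[R]_d) (k0 : R).

Definition near_null (th : R) x : set 'cV[R]_d :=
  [set v | dot v v = 1 /\ bform x v v < th].

(** A single direction is removed, however many are nearly null: the perfect square works for any
    orthogonal projection, and one direction already lowers the trace from d to d - 1. That the
    direction is nearly null keeps sqrt x times the projection close to sqrt x. *)
Definition step_proj th x : 'M[R]_d :=
  if pselect (near_null th x !=set0) is left _
  then 1%:M - xget 0 (near_null th x) *m (xget 0 (near_null th x))^T else 1%:M.

Definition step_flag th x : R :=
  if pselect (near_null th x !=set0) is left _ then 1 else 0.

Definition step_coef th x : 'M[R]_d :=
  Num.sqrt (1 - th) *: (psd_sqrt x *m step_proj th x).

Definition step_quad th x z : 'M[R]_d :=
  Q^T *m (z^T *m step_proj th x *m z) *m Q.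

(* One Euler step with noise z. When x has a unit vector v with v^T x v < th,
   the noise is compressed to the complement of v; the quadratic term makes the
   increment a perfect square and has mean h (d - 1) Q^T Q. The factor
   sqrt (1 - th) and the multiple of the identity leave room for B. *)
Definition step th h x z : 'M[R]_d :=
  step_coef th x *m z *m Q + (step_coef th x *m z *m Q)^T
  + h *: (b0 + B x + (th * \tr x)%:M)
  + (step_flag th x * k0) *:
      (step_quad th x z - (h * (d%:R - 1)) *: (Q^T *m Q)).

Lemma step_projP th x :
  (step_flag th x = 1 /\ exists2 v, near_null th x v & step_proj th x = 1%:M - v *m v^T) \/
  [/\ step_flag th x = 0, step_proj th x = 1%:M &
      forall v, dot v v = 1 -> th <= bform x v v].
Proof.
rewrite /step_flag /step_proj; case: pselect => [[v hv]|h].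
  left; split => //; exists (xget 0 (near_null th x)) => //.
  exact: (@xgetPex _ 0 (near_null th x) (ex_intro _ v hv)).
right; split => // v v1; rewrite leNgt; apply/negP => lt; apply: h.
by exists v.
Qed.

Lemma unit_outer v : dot v v = 1 -> v^T *m v = 1%:M.
Proof.
by move=> v1; apply/matrixP => i j; rewrite (ord1 i) (ord1 j) [RHS]mxE eqxx; exact: v1.
Qed.

Lemma proj_tr v : (1%:M - v *m v^T)^T = 1%:M - v *m v^T.
Proof. by rewrite linearB /= trmx1 trmx_mul trmxK. Qed.

Lemma proj_idem v : dot v v = 1 ->
  (1%:M - v *m v^T) *m (1%:M - v *m v^T) = 1%:M - v *m v^T.
Proof.
move=> v1; rewrite mulmxBl mul1mx -mulmxA mulmxBr mulmx1 (mulmxA v^T) unit_outer//.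
by rewrite mul1mx subrr mulmx0 subr0.
Qed.

Lemma step_proj_tr th x : (step_proj th x)^T = step_proj th x.
Proof.
by case: (step_projP th x) => [[_ [v _ ->]]|[_ -> _]]; [exact: proj_tr|exact: trmx1].
Qed.

Lemma step_proj_trace th x : step_flag th x = 1 -> \tr (step_proj th x) = d%:R - 1.
Proof.
case: (step_projP th x) => [[_ [v [v1 _] ->]] _|[-> _ _] /eqP]; last first.
  by rewrite eq_sym oner_eq0.
by rewrite linearB /= mxtrace1 mxtrace_mulC (unit_outer v1) mxtrace1.
Qed.

Lemma step_flag01 th x : step_flag th x = 0 \/ step_flag th x = 1.
Proof. by case: (step_projP th x) => [[-> _]|[-> _ _]]; [right|left]. Qed.

Lemma unit_entry_le v i : dot v v = 1 -> `|v i 0| <= 1.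
Proof.
move=> v1; rewrite -(@ler_pXn2r _ 2)// ?nnegrE// real_normK ?num_real// expr1n -v1.
exact: vec_entry_le.
Qed.

Lemma step_proj_entry th x i j : `|step_proj th x i j| <= 2.
Proof.
case: (step_projP th x) => [[_ [v [v1 _] ->]]|[_ -> _]]; last first.
  by rewrite mxE; case: (i == j); rewrite ?normr1 ?normr0//; lra.
rewrite !mxE big_ord1 mxE; apply: (le_trans (ler_normB _ _)).
rewrite (_ : 2 = 1 + 1)//; apply: lerD.
  by case: (i == j); rewrite ?normr1 ?normr0.
by rewrite normrM -[leRHS]mulr1 ler_pM// unit_entry_le.
Qed.

Hypothesis hB : sym_linear B.
Hypothesis B_inward : forall x u : 'M[R]_d, psd x -> psd u ->
     \tr (x *m u) = 0 -> 0 <= \tr (B x *m u).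
Hypothesis k0_gt0 : 0 < k0.
Hypothesis b0_ge : loewner_ge b0 ((k0 * (d%:R - 1)) *: (Q^T *m Q)).
Hypothesis hb0 : b0 \is symmetricmx.

Lemma drift_psd : psd b0.
Proof.
have [d0|d0] := posnP d.
  apply/psdP; split; first exact/symmxP.
  by move=> u; rewrite (vec_trivial u d0) /bform mulmx0 mxE.
rewrite -(subrK ((k0 * (d%:R - 1)) *: (Q^T *m Q)) b0); apply: psdD => //.
apply: psdZ; last exact: psd_gram.
by rewrite mulr_ge0 ?(ltW k0_gt0)// subr_ge0 ler1n.
Qed.

(** [h * noise_size] bounds the squared length of 2 k0 z Q u for a unit vector u, when the squared
    entries of z are at most h. *)
Definition noise_size : R :=
  4 * k0 ^+ 2 * (d%:R ^+ 2 * (\sum_i \sum_j Q i j ^+ 2)).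

(** The state is split into [(1 - th) *: x], which absorbs the noise, and [th *: x], which absorbs B
    through [psd_drift]. Without a nearly null direction there is no quadratic correction: the form
    of x is at least th on unit vectors, and the bound on [h * noise_size] lets it dominate the
    linear noise. *)
Lemma step_psd th h x z : psd x -> 0 < th -> th < 1 -> 0 < h ->
  k0 * h * inward_const B ^+ 2 <= 4 * th * th ->
  h * noise_size <= (1 - th) * th ->
  (forall i j, z i j ^+ 2 <= h) ->
  psd (x + k0 *: step th h x z).
Proof.
move=> px th0 th1 h0 hI hN hz.
have xT := psd_tr px; have [ps es] := psd_sqrtP px.
set s := psd_sqrt x in ps es; have sT := psd_tr ps.
set c := Num.sqrt (1 - th).
have c2 : c ^+ 2 = 1 - th by rewrite sqr_sqrtr// subr_ge0 ltW.
have c0 : 0 <= c by rewrite sqrtr_ge0.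
have pd : psd (th *: x + (k0 * h) *: (B x + (th * \tr x)%:M)).
  by apply: psd_drift => //; [exact: ltW|rewrite mulr_ge0 ?(ltW k0_gt0)// ltW].
case: (step_projP th x) => [[f1 [v [v1 _] pE]]|[f0 pE hv]].
- set p := 1%:M - v *m v^T in pE.
  have pT : p^T = p by exact: proj_tr.
  have pp : p *m p = p by exact: proj_idem.
  have -> : x + k0 *: step th h x z =
    (c *: s + k0 *: (p *m z *m Q))^T *m (c *: s + k0 *: (p *m z *m Q))
    + (th *: x + (k0 * h) *: (B x + (th * \tr x)%:M))
    + (k0 * h) *: (b0 - (k0 * (d%:R - 1)) *: (Q^T *m Q)).
    have -> : (c *: s + k0 *: (p *m z *m Q))^T *m (c *: s + k0 *: (p *m z *m Q)) =
       (1 - th) *: x + k0 *: (step_coef th x *m z *m Q + (step_coef th x *m z *m Q)^T)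
       + k0 *: (k0 *: step_quad th x z).
      have -> : (c *: s + k0 *: (p *m z *m Q))^T = c *: s + k0 *: (p *m z *m Q)^T.
        by rewrite linearD !linearZ /= sT.
      rewrite mulmxDl !mulmxDr -!scalemxAl -!scalemxAr es.
      rewrite !scalerA -expr2 c2 -!addrA; congr (_ + _).
      rewrite /step_coef pE -/s -/c scalerDr -addrA; congr (_ + _).
        by rewrite scalerA mulrC !mulmxA.
      congr (_ + _).
        rewrite linearZ /= scalerA; congr (_ *: _).
        by rewrite !trmx_mul sT pT !mulmxA.
      rewrite /step_quad pE; congr (_ *: _).
      by rewrite !trmx_mul pT !mulmxA -(mulmxA (Q^T *m z^T) p p) pp.
    rewrite /step f1 mul1r.
    set G := _ + (_ *m _ *m Q)^T; set q := step_quad _ _ _; set a := Q^T *m Q.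
    apply/matrixP => i j; rewrite !mxE; ring.
  by apply: psdD; [apply: psdD => //; exact: psd_gram|
     apply: psdZ => //; rewrite mulr_ge0 ?(ltW k0_gt0)// ltW].
- have -> : x + k0 *: step th h x z =
    ((1 - th) *: x + k0 *: (c *: (s *m z *m Q + (s *m z *m Q)^T)))
    + (th *: x + (k0 * h) *: (B x + (th * \tr x)%:M))
    + (k0 * h) *: b0.
    rewrite /step f0 mul0r scale0r addr0 /step_coef pE mulmx1 -/s -/c.
    rewrite -!scalemxAl linearZ /= -scalerDr.
    set G := _ + _^T; apply/matrixP => i j; rewrite !mxE; ring.
  apply: psdD; last by apply: psdZ; [rewrite mulr_ge0 ?(ltW k0_gt0)// ltW|exact: drift_psd].
  apply: psdD => //; apply: psd_unit.
    move: (s *m z *m Q) => G; apply/matrixP => i j; rewrite !mxE (addrC (G j i)).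
    by rewrite -{1}xT mxE.
  move=> u u1.
  rewrite bformMD !bformMZ bformMD bform_tr.
  pose g := s *m u; pose n := z *m Q *m u.
  have gE : bform x u u = dot g g by rewrite /g dot_mulmx sT mulmxA es -bform_dot.
  have nE : bform (s *m z *m Q) u u = dot g n.
    by rewrite bform_dot /g dot_mulmx sT /n !mulmxA.
  rewrite gE nE.
  have g2 : th <= dot g g by rewrite -gE; exact: hv.
  have n2 : dot n n <= d%:R ^+ 2 * h * (\sum_i \sum_j Q i j ^+ 2).
    rewrite /n -mulmxA; apply: (le_trans (dot_mulmx_le _ _)); apply: ler_pM.
    - by rewrite sumr_ge0// => i _; rewrite sumr_ge0// => j _; rewrite sqr_ge0.
    - exact: dot_ge0.
    - apply: (@le_trans _ _ (\sum_(i < d) \sum_(j < d) h)).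
        by apply: ler_sum => i _; apply: ler_sum => j _; exact: hz.
      by rewrite !sumr_const !card_ord -mulrnA -[leLHS]mulr_natl natrM expr2.
    - by rewrite -[leRHS]mulr1 -u1; exact: dot_mulmx_le.
  (* This is the discriminant condition for (1 - th) |g|^2 + 2 k0 c g.n to be nonnegative, with c^2
     = 1 - th. *)
  have key : 4 * k0 ^+ 2 * dot n n <= (1 - th) * dot g g.
    apply: (@le_trans _ _ ((1 - th) * th)); last by rewrite ler_wpM2l// subr_ge0 ltW.
    apply: le_trans hN; rewrite /noise_size.
    apply: (@le_trans _ _ (4 * k0 ^+ 2 * (d%:R ^+ 2 * h * \sum_i \sum_j Q i j ^+ 2))).
      by rewrite ler_wpM2l// mulr_ge0// sqr_ge0.
    rewrite le_eqVlt; apply/orP; left; apply/eqP; ring.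
  have -> : (1 - th) * dot g g + k0 * (c * (dot g n + dot g n)) =
    (1 - th) * dot g g - (- (2 * k0 * c * dot g n)) by ring.
  rewrite subr_ge0; apply: (le_trans (ler_norm _)); rewrite normrN.
  have A0 : 0 <= (1 - th) * dot g g by rewrite mulr_ge0 ?dot_ge0// subr_ge0 ltW.
  rewrite -(@ler_pXn2r _ 2)// ?nnegrE// real_normK ?num_real//.
  rewrite exprMn (_ : (2 * k0 * c) ^+ 2 = (1 - th) * (4 * k0 ^+ 2)); last by rewrite -c2; ring.
  apply: (@le_trans _ _ ((1 - th) * (4 * k0 ^+ 2) * (dot g g * dot n n))).
    by rewrite ler_wpM2l ?dot_CS// mulr_ge0 ?subr_ge0 ?ltW// mulr_gt0// exprn_gt0.
  rewrite (_ : _ * _ = (1 - th) * dot g g * (4 * k0 ^+ 2 * dot n n)); last by ring.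
  by rewrite [leRHS]expr2 ler_wpM2l.
Qed.

Lemma step_coef_entry th x i j : psd x -> 0 < th -> th < 1 ->
  `|step_coef th x i j| <= 2 * d%:R * Num.sqrt (\tr x).
Proof.
move=> px th0 th1; rewrite mxE normrM ger0_norm ?sqrtr_ge0// -[leRHS]mul1r.
apply: ler_pM => //.
  by rewrite -[leRHS]sqrtr1 ler_wsqrtr// gerBl ltW.
rewrite mxE; apply: (le_trans (ler_norm_sum _ _ _)).
apply: (@le_trans _ _ (\sum_(k < d) (2 * Num.sqrt (\tr x)))).
  apply: ler_sum => k _; rewrite normrM mulrC ler_pM// ?step_proj_entry//.
  exact: psd_sqrt_entry_norm.
by rewrite sumr_const card_ord -[leLHS]mulr_natl mulrA (mulrC _ 2).
Qed.

(** The compression changes s = sqrt x by (s v) v^T, and |s v|^2 = v^T x v is below th. The scaling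
    changes it by the factor 1 - sqrt (1 - th), at most th and hence at most sqrt th. *)
Lemma step_coef_close th x i j : psd x -> 0 < th -> th < 1 ->
  `|step_coef th x i j - psd_sqrt x i j| <= Num.sqrt th * (1 + Num.sqrt (\tr x)).
Proof.
move=> px th0 th1; have [ps es] := psd_sqrtP px.
set c := Num.sqrt (1 - th).
have c1 : c <= 1 by rewrite -[leRHS]sqrtr1 ler_wsqrtr// gerBl ltW.
have c0 : 0 <= c by rewrite sqrtr_ge0.
have c2 : c ^+ 2 = 1 - th by rewrite sqr_sqrtr// subr_ge0 ltW.
have hp : `|(psd_sqrt x *m step_proj th x - psd_sqrt x) i j| <= Num.sqrt th.
  case: (step_projP th x) => [[_ [v [v1 vth] ->]]|[_ -> _]]; last first.
    by rewrite mulmx1 subrr mxE normr0 sqrtr_ge0.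
  rewrite mulmxBr mulmx1 addrAC subrr add0r mulmxA mxE normrN mxE big_ord1.
  rewrite normrM [v^T _ _]mxE -[leRHS]mulr1.
  apply: ler_pM => //; last exact: unit_entry_le.
  rewrite -sqrtr_sqr ler_wsqrtr//.
  apply: (le_trans (vec_entry_le _ _)).
  by rewrite dot_mulmx (psd_tr ps) mulmxA es -bform_dot ltW.
have -> : step_coef th x i j - psd_sqrt x i j =
   c * (psd_sqrt x *m step_proj th x - psd_sqrt x) i j - (1 - c) * psd_sqrt x i j.
  rewrite /step_coef -/c; set M := _ *m step_proj _ _.
  by rewrite !mxE; ring.
apply: (le_trans (ler_normB _ _)); rewrite mulrDr mulr1 !normrM.
rewrite (ger0_norm c0) (@ger0_norm _ (1 - c)) ?subr_ge0//; apply: lerD.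
  by rewrite -[leRHS]mul1r ler_pM.
apply: ler_pM => //; rewrite ?subr_ge0//; last exact: psd_sqrt_entry_norm.
have st2 : Num.sqrt th ^+ 2 = th by rewrite sqr_sqrtr// ltW.
have st0 : 0 <= Num.sqrt th by rewrite sqrtr_ge0.
have : Num.sqrt th <= 1 by rewrite -sqrtr1 ler_wsqrtr// ltW.
move=> a1; apply: (@le_trans _ _ th); last by rewrite -{1}st2 expr2 ger_pMr// sqrtr_gt0.
rewrite (_ : th = 1 - c ^+ 2); last by rewrite c2; ring.
by rewrite lerD2l lerN2 expr2 ger_pMr// sqrtr_gt0 subr_gt0.
Qed.

End OneStep.

(** * The kernel on a time grid *)

Section KernelSequences.
Context {R : realType}.
Variable G : nat -> R.
Hypothesis G_ge0 : forall n, 0 <= G n.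
Hypothesis G_noninc : forall m n, (m <= n)%N -> G n <= G m.

(** The weight of the j-th increment in the difference of the states at J and I; the increments from
    I on are absent from the earlier state. *)
Definition incr_weight (I J j : nat) : R :=
  G (J - j)%N - (if (j < I)%N then G (I - j)%N else 0).

Lemma kernel_telescope m I :
  \sum_(j < I) (G (I + m - j)%N - G (I + m.+1 - j)%N) = G m.+1 - G (I + m).+1.
Proof.
rewrite (reindex_inj rev_ord_inj) /=.
rewrite (eq_bigr (fun j : 'I_I => G (m.+1 + j)%N - G (m.+1 + j).+1)); last first.
  move=> j _; have jI := ltn_ord j.
  congr (G _ - G _); rewrite !subnBA ?(ltnW jI)//; lia.
elim: I => [|I IH]; first by rewrite big_ord0 add0n subrr.
rewrite big_ord_recr /= IH (_ : m.+1 + I = (I + m).+1)%N; last by lia.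
by rewrite addrA subrK addSn.
Qed.

(** A nonincreasing kernel gives all weights with j < I the same sign, so they telescope: one more
    step adds at most one value of G. Each of the J - I new increments has weight at most [G 0]. *)
Lemma sum_incr_weight I J : (I <= J)%N ->
  \sum_(j < J) `|incr_weight I J j| <= 2 * G 0 * (J - I)%:R.
Proof.
move=> IJ; have [m ->] : exists m, J = (I + m)%N by exists (J - I)%N; rewrite subnKC.
rewrite big_split_ord /= addKn.
rewrite (_ : 2 * G 0 * _ = G 0 * m%:R + G 0 * m%:R); last by ring.
apply: lerD; last first.
  apply: (@le_trans _ _ (\sum_(j < m) G 0)); last first.
    by rewrite sumr_const card_ord mulr_natr.
  apply: ler_sum => j _; rewrite /incr_weight ltnNge leq_addr /= subr0.
  by rewrite ger0_norm// G_noninc.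
rewrite (eq_bigr (fun j : 'I_I => G (I - j)%N - G (I + m - j)%N)); last first.
  move=> j _; rewrite /incr_weight ltn_ord distrC ger0_norm//.
  by rewrite subr_ge0 G_noninc// leq_sub2r// leq_addr.
elim: m {IJ} => [|m IH].
  rewrite big1 ?mulr0// => j _; rewrite addn0 subrr//.
rewrite -addn1 natrD mulrDr mulr1.
rewrite (eq_bigr (fun j : 'I_I => (G (I - j)%N - G (I + m - j)%N) +
   (G (I + m - j)%N - G (I + m.+1 - j)%N))); last by move=> j _; rewrite addn1 addrA subrK.
rewrite big_split /=; apply: lerD => //.
rewrite kernel_telescope; apply: (@le_trans _ _ (G m.+1)); first by rewrite gerBl.
exact: G_noninc.
Qed.

Lemma incr_weight_le I J j : (I <= J)%N -> `|incr_weight I J j| <= G 0.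
Proof.
move=> IJ; rewrite /incr_weight; case: ifPn => jI.
  rewrite distrC ger0_norm ?subr_ge0 ?G_noninc ?leq_sub2r//.
  by apply: (@le_trans _ _ (G (I - j)%N)); [rewrite gerBl|exact: G_noninc].
by rewrite subr0 ger0_norm// G_noninc.
Qed.

Lemma sum_incr_weight2 I J : (I <= J)%N ->
  \sum_(j < J) incr_weight I J j ^+ 2 <= 2 * G 0 ^+ 2 * (J - I)%:R.
Proof.
move=> IJ.
apply: (@le_trans _ _ (\sum_(j < J) G 0 * `|incr_weight I J j|)).
  apply: ler_sum => j _; rewrite -real_normK ?num_real// expr2 ler_wpM2r//.
  exact: incr_weight_le.
rewrite -mulr_sumr (_ : 2 * G 0 ^+ 2 * _ = G 0 * (2 * G 0 * (J - I)%:R)); last by ring.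
by rewrite ler_wpM2l// sum_incr_weight.
Qed.

Hypothesis G0_gt0 : 0 < G 0.

(* Masses y_j placed on the grid so that the convolution with the kernel equals
   the constant a at every grid point; monotonicity of G makes them nonnegative. *)
Lemma constant_masses (a : R) n : 0 <= a -> exists y : nat -> R,
  (forall j, 0 <= y j) /\
  forall i, (i <= n)%N -> \sum_(j < i.+1) y j * G (i - j)%N = a.
Proof.
move=> a0; elim: n => [|n [y [y0 hy]]].
  exists (fun=> a / G 0); split => [j|i]; first by rewrite divr_ge0.
  by rewrite leqn0 => /eqP ->; rewrite big_ord1 subnn divfK// gt_eqF.
pose r := \sum_(j < n.+1) y j * G (n.+1 - j)%N.
have ra : r <= a.
  rewrite -(hy n)//; apply: ler_sum => j _; apply: ler_wpM2l => //.
  by apply: G_noninc; rewrite leq_sub2r.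
exists (fun j => if (j <= n)%N then y j else if j == n.+1 then (a - r) / G 0 else 0).
split => [j|i].
  case: ifP => // _; case: ifP => // _.
  by rewrite divr_ge0// subr_ge0.
rewrite leq_eqVlt => /orP[/eqP ->|].
  rewrite big_ord_recr /= ltnn eqxx subnn divfK ?gt_eqF//.
  rewrite (eq_bigr (fun j : 'I_n.+1 => y j * G (n.+1 - j)%N)) -/r; first by ring.
  by move=> j _; rewrite -ltnS ltn_ord.
rewrite ltnS => im; rewrite -{2}(hy i im); apply: eq_bigr => j _.
by rewrite (leq_trans _ im)// -ltnS ltn_ord.
Qed.

End KernelSequences.

Section PreservesNonnegativity.
Context {R : realType}.
Variable k : R -> R.
Hypothesis k_ge0 : forall t : R, 0 <= t -> 0 <= k t.
Hypothesis k0_gt0 : 0 < k 0.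
Hypothesis k_nonincreasing : forall s t : R, 0 <= s -> s <= t -> k t <= k s.
Hypothesis k_preserves : preserves_nonnegativity k.

Definition kgrid (h : R) (n : nat) : R := k (h * n%:R).

Lemma kgrid_ge0 h n : 0 < h -> 0 <= kgrid h n.
Proof. by move=> h0; rewrite k_ge0// mulr_ge0// ltW. Qed.

Lemma kgrid_noninc h m n : 0 < h -> (m <= n)%N -> kgrid h n <= kgrid h m.
Proof.
move=> h0 mn; apply: k_nonincreasing; first by rewrite mulr_ge0// ltW.
by rewrite ler_wpM2l ?(ltW h0)// ler_nat.
Qed.

Lemma kgrid0 h : kgrid h 0 = k 0.
Proof. by rewrite /kgrid mulr0. Qed.

Lemma kgrid_preserves h (x : nat -> R) n : 0 < h ->
  (forall i, (i <= n)%N -> 0 <= \sum_(j < i.+1) x j * kgrid h (i - j)) ->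
  0 <= \sum_(j < n.+1) x j * kgrid h (n.+1 - j).
Proof.
move=> h0 hx.
pose t (i : 'I_n.+1) : R := h * i%:R.
have tB (m : nat) (j : 'I_n.+1) : (j <= m)%N -> h * m%:R - t j = h * (m - j)%:R.
  by move=> jm; rewrite natrB// mulrBr.
have := k_preserves (t := t) (x := fun j => x j).
move=> /(_ _ _ _ (h * n.+1%:R)); rewrite (eq_bigl xpredT); last first.
  by move=> j; rewrite ler_pM2l// ler_nat ltnW.
rewrite [X in _ -> _ -> _ -> _ -> 0 <= X](eq_bigr (fun j : 'I_n.+1 => x j * kgrid h (n.+1 - j))); last first.
  by move=> j _; rewrite tB// ltnW.
apply.
- by rewrite /t mulr0.
- by move=> i j ij; rewrite ltr_pM2l// ltr_nat.
- move=> i; have := hx i; rewrite -ltnS ltn_ord => /(_ isT).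
  rewrite (big_ord_widen n.+1 (fun j => x j * kgrid h (i - j)))//.
  rewrite [X in 0 <= X -> _](eq_bigr (fun j : 'I_n.+1 => x j * k (t i - t j)))//.
  by move=> j; rewrite ltnS => ji; rewrite tB.
- by rewrite mulr_ge0// ltW.
Qed.

(** [preserves_nonnegativity] speaks of pure convolutions. The constant a is made into one by the
    masses of [constant_masses]; at the next grid point, where no mass has been placed, their
    convolution is at most a because the kernel is nonincreasing. *)
Lemma kgrid_preserves_const h (x : nat -> R) (a : R) n : 0 < h -> 0 <= a ->
  (forall i, (i <= n)%N -> 0 <= a + \sum_(j < i.+1) x j * kgrid h (i - j)) ->
  0 <= a + \sum_(j < n.+1) x j * kgrid h (n.+1 - j).
Proof.
move=> h0 a0 hx.
have [y [y0 hy]] := @constant_masses _ (kgrid h) (fun n => kgrid_ge0 n h0)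
  (fun m n => @kgrid_noninc h m n h0) (ltac:(by rewrite kgrid0)) a n a0.
have : 0 <= \sum_(j < n.+1) (x j + y j) * kgrid h (n.+1 - j).
  apply: (kgrid_preserves (x := fun j => x j + y j)) => // i im.
  rewrite (eq_bigr (fun j : 'I_i.+1 => x j * kgrid h (i - j) + y j * kgrid h (i - j))).
    by rewrite big_split /= (hy i im) addrC hx.
  by move=> j _; rewrite mulrDl.
rewrite (eq_bigr (fun j : 'I_n.+1 => x j * kgrid h (n.+1 - j) + y j * kgrid h (n.+1 - j))); last first.
  by move=> j _; rewrite mulrDl.
rewrite big_split /= => h1; apply: (le_trans h1); rewrite addrC lerD2r -(hy n)//.
apply: ler_sum => j _; apply: ler_wpM2l => //.
by apply: kgrid_noninc => //; rewrite leq_sub2r.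
Qed.

(** Positive semidefiniteness is tested on one vector u at a time, where the matrix convolution
    becomes a scalar one with initial value u^T X0 u. *)
Lemma kgrid_preserves_psd d (h : R) (X0 : 'M[R]_d) (Z : nat -> 'M[R]_d) n :
  0 < h -> psd X0 -> (forall j, (Z j)^T = Z j) ->
  (forall i, (i <= n)%N -> psd (X0 + \sum_(j < i.+1) kgrid h (i - j) *: Z j)) ->
  psd (X0 + \sum_(j < n.+1) kgrid h (n.+1 - j) *: Z j).
Proof.
move=> h0 pX ZT hZ; apply/psdP; split.
  rewrite linearD /= (psd_tr pX); congr (_ + _).
  by rewrite linear_sum; apply: eq_bigr => j _; rewrite linearZ /= ZT.
move=> u.
have e m p : bform (X0 + \sum_(j < m) kgrid h (p - j) *: Z j) u u =
    bform X0 u u + \sum_(j < m) bform (Z j) u u * kgrid h (p - j).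
  rewrite bformMD; congr (_ + _); elim: m => [|m IH].
    by rewrite !big_ord0 bform0.
  by rewrite !big_ord_recr /= bformMD IH bformMZ mulrC.
rewrite e; apply: (kgrid_preserves_const (x := fun j => bform (Z j) u u)) => //.
  exact: psd_ge0.
by move=> i im; rewrite -e; apply: psd_ge0; exact: hZ.
Qed.

End PreservesNonnegativity.

(** * Moments on a space of coin flips *)

Lemma sqr_sum_le {R : realType} n (f g : 'I_n -> R) :
  (\sum_i f i * g i) ^+ 2 <= (\sum_i f i ^+ 2) * \sum_i g i ^+ 2.
Proof.
have := dot_CS (\col_i f i) (\col_i g i); rewrite !dotE.
rewrite [X in X ^+ 2 <= _](eq_bigr (fun i => f i * g i)); last by move=> i _; rewrite !mxE.
rewrite [X in _ <= X * _](eq_bigr (fun i => f i ^+ 2)); last by move=> i _; rewrite !mxE expr2.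
by rewrite [X in _ <= _ * X](eq_bigr (fun i => g i ^+ 2))// => i _; rewrite !mxE expr2.
Qed.

Lemma sqr_sum_le_card {R : realType} n (f : 'I_n -> R) :
  (\sum_i f i) ^+ 2 <= n%:R * \sum_i f i ^+ 2.
Proof.
have := sqr_sum_le (fun _ : 'I_n => 1) f.
under eq_bigr do rewrite mul1r.
by under [X in _ <= X * _ -> _]eq_bigr do rewrite expr1n; rewrite sumr_const card_ord.
Qed.

Lemma sqr_sum_le_fin {R : realType} (I : finType) (f : I -> R) :
  (\sum_i f i) ^+ 2 <= #|I|%:R * \sum_i f i ^+ 2.
Proof.
have e (F : I -> R) : \sum_s F s = \sum_(i < #|I|) F (enum_val i).
  by rewrite (reindex _ (onW_bij _ (@enum_val_bij I))).
by rewrite !e; exact: sqr_sum_le_card.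
Qed.

Lemma sqr_wsum_le {R : realType} n (w f : 'I_n -> R) :
  (\sum_i w i * f i) ^+ 2 <= (\sum_i `|w i|) * \sum_i `|w i| * f i ^+ 2.
Proof.
have := sqr_sum_le (fun i => Num.sqrt `|w i| * Num.sg (w i)) (fun i => Num.sqrt `|w i| * f i).
have sq i : Num.sqrt `|w i| ^+ 2 = `|w i| by rewrite sqr_sqrtr.
rewrite (eq_bigr (fun i => w i * f i)); last first.
  by move=> i _; rewrite mulrACA -expr2 sq mulrA (mulrC `|w i|) -numEsg.
move=> /le_trans; apply; apply: ler_pM.
- by apply: sumr_ge0 => i _; rewrite sqr_ge0.
- by apply: sumr_ge0 => i _; rewrite sqr_ge0.
- apply: ler_sum => i _; rewrite exprMn sq -[leRHS]mulr1 ler_wpM2l//.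
  by rewrite sqr_sg lern1 leq_b1.
- by apply: ler_sum => i _; rewrite exprMn sq.
Qed.

Section Expectation.
Context {R : realType} {S : finType}.
Hypothesis S_gt0 : (0 < #|S|)%N.
Implicit Types (f g : S -> R).

Definition Ex f : R := (\sum_s f s) / #|S|%:R.

Lemma ExD f g : Ex (fun s => f s + g s) = Ex f + Ex g.
Proof. by rewrite /Ex big_split mulrDl. Qed.
Lemma ExZ a f : Ex (fun s => a * f s) = a * Ex f.
Proof. by rewrite /Ex -mulr_sumr mulrA. Qed.
Lemma Ex_sum (I : Type) (r : seq I) (P : pred I) (f : I -> S -> R) :
  Ex (fun s => \sum_(i <- r | P i) f i s) = \sum_(i <- r | P i) Ex (f i).
Proof. by rewrite /Ex exchange_big mulr_suml. Qed.
Lemma Ex_cst a : Ex (fun=> a) = a.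
Proof.
by rewrite /Ex sumr_const -[a *+ _]mulr_natr mulfK// pnatr_eq0 -lt0n.
Qed.
Lemma eq_Ex f g : f =1 g -> Ex f = Ex g.
Proof. by move=> fg; rewrite /Ex; congr (_ / _); apply: eq_bigr. Qed.
Lemma ler_Ex f g : (forall s, f s <= g s) -> Ex f <= Ex g.
Proof. by move=> fg; rewrite /Ex ler_wpM2r ?invr_ge0// ler_sum. Qed.
Lemma Ex_ge0 f : (forall s, 0 <= f s) -> 0 <= Ex f.
Proof. by move=> f0; rewrite /Ex divr_ge0// sumr_ge0. Qed.

Lemma Ex_CS f g : Ex (fun s => f s * g s) ^+ 2 <= Ex (fun s => f s ^+ 2) * Ex (fun s => g s ^+ 2).
Proof.
rewrite /Ex mulrACA -invfM -expr2 expr_div_n ler_wpM2r ?invr_ge0 ?sqr_ge0//.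
have e (F : S -> R) : \sum_s F s = \sum_(i < #|S|) F (enum_val i).
  by rewrite (reindex _ (onW_bij _ (@enum_val_bij S))).
rewrite !e; exact: sqr_sum_le.
Qed.

Lemma Ex_CS_le f g a b : 0 <= a -> 0 <= b ->
  Ex (fun s => f s ^+ 2) <= a ^+ 2 -> Ex (fun s => g s ^+ 2) <= b ^+ 2 ->
  Ex (fun s => f s * g s) <= a * b.
Proof.
move=> a0 b0 fa gb; apply: (le_trans (ler_norm _)).
rewrite -(@ler_pXn2r _ 2)// ?nnegrE ?mulr_ge0// real_normK ?num_real//.
apply: (le_trans (Ex_CS _ _)); rewrite exprMn.
by apply: ler_pM => //; apply: Ex_ge0 => s; rewrite sqr_ge0.
Qed.

Lemma Ex_norm_le f a : 0 <= a -> Ex (fun s => f s ^+ 2) <= a ^+ 2 ->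
  Ex (fun s => `|f s|) <= a.
Proof.
move=> a0 fa; rewrite -[leRHS]mulr1.
have := @Ex_CS_le (fun s => `|f s|) (fun=> 1) a 1.
rewrite (@eq_Ex (fun s => `|f s| * 1) (fun s => `|f s|)); last by move=> s; rewrite mulr1.
apply => //; last by rewrite Ex_cst expr1n.
by rewrite (@eq_Ex _ (fun s => f s ^+ 2))// => s; rewrite real_normK ?num_real.
Qed.

Definition Pr (A : set S) : R := Ex (\1_A).

Lemma Pr_ge0 A : 0 <= Pr A.
Proof. by apply: Ex_ge0 => s; rewrite indicE. Qed.
Lemma Pr_le A B : A `<=` B -> Pr A <= Pr B.
Proof.
move=> AB; apply: ler_Ex => s; rewrite !indicE ler_nat.
case: (boolP (s \in A)) => // /set_mem /AB h.
by rewrite (mem_set h).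
Qed.
Lemma Pr_le1 A : Pr A <= 1.
Proof.
by rewrite -[leRHS]Ex_cst; apply: ler_Ex => s; rewrite indicE lern1 leq_b1.
Qed.
Lemma PrT : Pr setT = 1.
Proof. by rewrite -[RHS]Ex_cst; apply: eq_Ex => s; rewrite indicT. Qed.
Lemma Pr0 : Pr set0 = 0.
Proof.
have -> : 0 = Ex (fun=> 0) by rewrite Ex_cst.
by apply: eq_Ex => s; rewrite indic0.
Qed.
Lemma PrU_le A B : Pr (A `|` B) <= Pr A + Pr B.
Proof.
rewrite /Pr -ExD; apply: ler_Ex => s; rewrite !indicE in_setU -natrD ler_nat.
by case: (s \in A) => //=; case: (s \in B).
Qed.
Lemma PrID A B : Pr A = Pr (A `&` B) + Pr (A `&` ~` B).
Proof.
rewrite /Pr -ExD; apply: eq_Ex => s; rewrite !indicE !in_setI in_setC -natrD.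
by case: (s \in A) => //=; case: (s \in B).
Qed.

Lemma Pr_bigU_le (I : Type) (r : seq I) (A : I -> set S) :
  Pr (\big[setU/set0]_(i <- r) A i) <= \sum_(i <- r) Pr (A i).
Proof.
elim: r => [|i r IH]; first by rewrite !big_nil Pr0.
by rewrite !big_cons (le_trans (PrU_le _ _))// lerD2l.
Qed.

Lemma markov_Pr (A : set S) f a : 0 < a -> (forall s, 0 <= f s) ->
  (forall s, A s -> a <= f s) -> Pr A <= Ex f / a.
Proof.
move=> a0 f0 Af; rewrite ler_pdivlMr// mulrC -ExZ; apply: ler_Ex => s.
rewrite indicE; case: (boolP (s \in A)) => [/set_mem /Af|_]; first by rewrite mulr1.
by rewrite mulr0.
Qed.

End Expectation.

Section MartingaleTransforms.
Context {R : realType} {S : finType}.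
Hypothesis S_gt0 : (0 < #|S|)%N.
Variables (fl : nat -> S -> S) (xi H : nat -> S -> R) (h : R).
Hypothesis fl_Ex : forall j (f : S -> R), Ex (fun s => f (fl j s)) = Ex f.
Hypothesis xi_fl : forall i j s, xi i (fl j s) = if i == j then - xi j s else xi i s.
Hypothesis H_fl : forall i j s, (i <= j)%N -> H i (fl j s) = H i s.
Hypothesis xi_sqr : forall j s, xi j s ^+ 2 <= h.

(** The martingale property without conditional expectations: flipping coin j preserves the mean,
    fixes f and negates xi_j. In this language [H_fl] is predictability: H at time i does not see
    the coins from i on. *)
Lemma Ex_mul_flip0 j (f : S -> R) : (forall s, f (fl j s) = f s) ->
  Ex (fun s => f s * xi j s) = 0.
Proof.
move=> hf.
have : Ex (fun s => f s * xi j s) = - Ex (fun s => f s * xi j s).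
  rewrite -{1}(fl_Ex j) -mulN1r -ExZ; apply: eq_Ex => s.
  by rewrite hf xi_fl eqxx mulrN mulN1r.
by move=> /eqP; rewrite -addr_eq0 -mulr2n mulrn_eq0 => /eqP.
Qed.

Definition mtransf (J : nat) (s : S) : R := \sum_(j < J) H j s * xi j s.

Lemma mtransf_fl J j s : (J <= j)%N -> mtransf J (fl j s) = mtransf J s.
Proof.
move=> Jj; apply: eq_bigr => i _; have ij := leq_trans (ltn_ord i) Jj.
by rewrite H_fl ?(ltnW ij)// xi_fl ltn_eqF.
Qed.

Lemma h_ge0 : 0 <= h.
Proof.
have /card_gt0P[s _] := S_gt0.
by apply: le_trans (xi_sqr 0 s); exact: sqr_ge0.
Qed.

Lemma mtransf_moment2 J :
  Ex (fun s => mtransf J s ^+ 2) <= \sum_(j < J) h * Ex (fun s => H j s ^+ 2).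
Proof.
elim: J => [|J IH].
  by rewrite big_ord0 -(Ex_cst S_gt0 0); apply: ler_Ex => s; rewrite /mtransf big_ord0 expr0n.
rewrite big_ord_recr /= (@eq_Ex _ _ _ (fun s => mtransf J s ^+ 2 +
    ((2 * mtransf J s * H J s) * xi J s + xi J s ^+ 2 * H J s ^+ 2))); last first.
  by move=> s; rewrite /mtransf big_ord_recr /=; ring.
rewrite !ExD Ex_mul_flip0 ?add0r; last by move=> s; rewrite mtransf_fl// H_fl.
apply: lerD => //; rewrite -ExZ; apply: ler_Ex => s.
by rewrite ler_wpM2r ?sqr_ge0.
Qed.

End MartingaleTransforms.

Section FourthMoment.
Context {R : realType} {S : finType}.
Hypothesis S_gt0 : (0 < #|S|)%N.
Variables (fl : nat -> S -> S) (xi H : nat -> S -> R) (h : R).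
Hypothesis fl_Ex : forall j (f : S -> R), Ex (fun s => f (fl j s)) = Ex f.
Hypothesis xi_fl : forall i j s, xi i (fl j s) = if i == j then - xi j s else xi i s.
Hypothesis H_fl : forall i j s, (i <= j)%N -> H i (fl j s) = H i s.
Hypothesis xi_sqr : forall j s, xi j s ^+ 2 <= h.
Variables (a : nat -> R) (kap : R).
Hypothesis kap_ge0 : 0 <= kap.

Let aH j s := a j * H j s.

Let aH_fl i j s : (i <= j)%N -> aH i (fl j s) = aH i s.
Proof. by move=> ij; rewrite /aH H_fl. Qed.

(** In the expansion of (M + a H xi)^4 the odd powers of xi vanish by flipping. Cauchy-Schwarz
    bounds the mean of M^2 H^2 by m kap, m being the bound before squaring; the constant 3 is chosen
    so that the cross term 6 m kap h a^2 is exactly that of the square, whose last term 9 exceeds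
    the needed 1. *)
Lemma mtransf_moment4 J : (forall j, (j < J)%N -> Ex (fun s => H j s ^+ 4) <= kap ^+ 2) ->
  Ex (fun s => mtransf xi aH J s ^+ 4) <= (3 * kap * h * \sum_(j < J) a j ^+ 2) ^+ 2.
Proof.
have h0 : 0 <= h by exact: (h_ge0 S_gt0 xi_sqr).
elim: J => [|J IH] HJ.
  rewrite (@eq_Ex _ _ _ (fun=> 0)) ?Ex_cst ?sqr_ge0// => s.
  by rewrite /mtransf big_ord0 expr0n.
have {}IH := IH (fun j jJ => HJ j (ltnW jJ)).
rewrite big_ord_recr /=.
have m0 : 0 <= 3 * kap * h * \sum_(j < J) a j ^+ 2.
  by rewrite !mulr_ge0// sumr_ge0// => j _; rewrite sqr_ge0.
rewrite mulrDr; set m := 3 * kap * h * \sum_(j < J) _ in IH m0 *.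
pose M := mtransf xi aH J.
rewrite (@eq_Ex _ _ _ (fun s => M s ^+ 4 + (6 * a J ^+ 2 * (M s ^+ 2 * (H J s ^+ 2 * xi J s ^+ 2)) +
     (a J ^+ 4 * (H J s ^+ 4 * xi J s ^+ 4) +
     (4 * M s ^+ 3 * a J * H J s + 4 * M s * (a J * H J s) ^+ 3 * xi J s ^+ 2) * xi J s))));
  last by move=> s; rewrite /M /mtransf /aH big_ord_recr /=; ring.
rewrite !ExD !ExZ (Ex_mul_flip0 fl_Ex xi_fl) ?addr0; last first.
  by move=> s; rewrite /M (mtransf_fl xi_fl aH_fl)// H_fl// xi_fl eqxx sqrrN.
have e1 : Ex (fun s => M s ^+ 2 * (H J s ^+ 2 * xi J s ^+ 2)) <= h * (m * kap).
  apply: (@le_trans _ _ (h * Ex (fun s => M s ^+ 2 * H J s ^+ 2))).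
    rewrite -ExZ; apply: ler_Ex => s; rewrite mulrA mulrC.
    by rewrite ler_wpM2r// mulr_ge0 ?sqr_ge0.
  rewrite ler_wpM2l//; apply: Ex_CS_le => //.
    by under eq_Ex do rewrite -exprM.
  by under eq_Ex do rewrite -exprM; exact: HJ.
have e2 : Ex (fun s => H J s ^+ 4 * xi J s ^+ 4) <= h ^+ 2 * kap ^+ 2.
  apply: (@le_trans _ _ (h ^+ 2 * Ex (fun s => H J s ^+ 4))).
    rewrite -ExZ; apply: ler_Ex => s; rewrite mulrC.
    rewrite ler_wpM2r//; first by rewrite (_ : 4 = 2 * 2)%N// exprM sqr_ge0.
    rewrite (_ : 4 = 2 * 2)%N// exprM ler_pXn2r// ?nnegrE// sqr_ge0//.
  by rewrite ler_wpM2l ?sqr_ge0//; exact: HJ.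
have A2 : 0 <= a J ^+ 2 by exact: sqr_ge0.
apply: (@le_trans _ _ (m ^+ 2 + (6 * a J ^+ 2 * (h * (m * kap)) + a J ^+ 4 * (h ^+ 2 * kap ^+ 2)))).
  apply: lerD => //; apply: lerD; first by rewrite ler_wpM2l// mulr_ge0.
  by rewrite ler_wpM2l// (_ : 4 = 2 * 2)%N// exprM sqr_ge0.
rewrite -subr_ge0.
rewrite (_ : _ - _ = 8 * (kap * h * a J ^+ 2) ^+ 2); last by ring.
by rewrite mulr_ge0// sqr_ge0.
Qed.

End FourthMoment.

Lemma weighted_moment2_sum {R : realType} {S : finType} (D : nat -> S -> R) (w : nat -> R) J :
  Ex (fun s => (\sum_(j < J) w j * D j s) ^+ 2) <=
  (\sum_(j < J) `|w j|) * \sum_(j < J) `|w j| * Ex (fun s => D j s ^+ 2).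
Proof.
under [X in _ <= _ * X]eq_bigr do rewrite -ExZ.
rewrite -Ex_sum -ExZ; apply: ler_Ex => s; exact: sqr_wsum_le.
Qed.

Lemma weighted_moment2 {R : realType} {S : finType} (D : nat -> S -> R) (w : nat -> R) (kap : R) J :
  (forall j, (j < J)%N -> Ex (fun s => D j s ^+ 2) <= kap) ->
  Ex (fun s => (\sum_(j < J) w j * D j s) ^+ 2) <= (\sum_(j < J) `|w j|) ^+ 2 * kap.
Proof.
move=> hD; apply: (le_trans (weighted_moment2_sum D w J)).
rewrite expr2 -mulrA ler_wpM2l ?sumr_ge0// mulr_suml; apply: ler_sum => j _.
by rewrite ler_wpM2l// hD.
Qed.

Section CoinFlips.
Context {R : realType} {T : finType}.
Local Notation S := {ffun T -> bool}.

Lemma card_coins : (0 < #|{: S}|)%N.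
Proof. by rewrite card_ffun card_bool expn_gt0. Qed.

Definition flip (t : T) (s : S) : S := [ffun u => if u == t then ~~ s u else s u].

Lemma flipK t : involutive (flip t).
Proof.
by move=> s; apply/ffunP => u; rewrite !ffunE; case: eqP => // _; rewrite negbK.
Qed.

Lemma Ex_flip t (f : S -> R) : Ex (fun s => f (flip t s)) = Ex f.
Proof.
rewrite /Ex; congr (_ / _); rewrite [RHS](reindex_inj (inv_inj (flipK t))).
by [].
Qed.

Definition coin (t : T) (s : S) : R := if s t then -1 else 1.

Lemma coin_flip t u s : coin t (flip u s) = if t == u then - coin u s else coin t s.
Proof.
rewrite /coin ffunE; case: eqP => [->|//].
by case: (s u); rewrite ?opprK.
Qed.

Lemma coin_sqr t s : coin t s ^+ 2 = 1.
Proof. by rewrite /coin; case: (s t); rewrite ?sqrrN expr1n. Qed.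

Definition depends_on (A : {set T}) (X : Type) (f : S -> X) :=
  forall s s' : S, (forall t, t \in A -> s t = s' t) -> f s = f s'.

Definition mix (A : {set T}) (s s' : S) : S := [ffun u => if u \in A then s u else s' u].

(* Exchanging the coordinates outside A between two independent copies is an
   involution of the product space. *)
Lemma coins_indep (A : {set T}) (f g : S -> R) :
  depends_on A f -> depends_on (~: A) g ->
  Ex (fun s => f s * g s) = Ex f * Ex g.
Proof.
move=> fA gA.
have c0 : #|{: S}|%:R != 0 :> R by rewrite pnatr_eq0 -lt0n card_coins.
have h : #|{: S}|%:R * (\sum_s f s * g s) = (\sum_s f s) * \sum_s g s.
  pose m (p : S * S) := (mix A p.1 p.2, mix A p.2 p.1).
  have mK : involutive m.
    by move=> [s s']; congr pair; apply/ffunP => u; rewrite !ffunE; case: (u \in A).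
  rewrite mulr_suml [RHS](eq_bigr (fun s => \sum_s' f s * g s')); last first.
    by move=> s _; rewrite mulr_sumr.
  rewrite pair_big /= (reindex_inj (inv_inj mK)) /=.
  rewrite [RHS](eq_bigr (fun p : S * S => f p.1 * g p.1)); last first.
    move=> [s s'] _ /=; congr (_ * _).
      by apply: fA => t tA; rewrite ffunE tA.
    by apply: gA => t; rewrite inE => tA; rewrite ffunE (negbTE tA).
  rewrite -(pair_big xpredT xpredT (fun s _ => f s * g s)) /= mulr_sumr.
  by apply: eq_bigr => s _; rewrite sumr_const mulr_natl.
rewrite /Ex mulrACA -h; move: c0; set c := #|_|%:R => c0.
by field.
Qed.

End CoinFlips.

(** * The scheme *)

Section StepCoefficients.
Context {R : realType} {d : nat}.
Implicit Types (x y z : 'M[R]_d).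
Variables (Q b0 : 'M[R]_d) (B : 'M[R]_d -> 'M[R]_d) (k0 : R).
Hypothesis hB : sym_linear B.
Hypothesis hb0 : b0 \is symmetricmx.
Hypothesis k0_gt0 : 0 < k0.

Lemma step_sym th h x z : x^T = x -> (step Q b0 B k0 th h x z)^T = step Q b0 B k0 th h x z.
Proof.
move=> xT; rewrite /step.
have qT : (step_quad Q th x z)^T = step_quad Q th x z.
  by rewrite /step_quad !trmx_mul !trmxK step_proj_tr !mulmxA.
have aT : (Q^T *m Q)^T = Q^T *m Q by rewrite trmx_mul trmxK.
have BT := trmxB_sym hB xT; have bT := elimT (symmxP _) hb0.
move: (B x) (step_quad _ _ _ _) (Q^T *m Q) (step_coef _ _ *m _ *m _) BT qT aT.
move=> Bx q A G BT qT aT; apply/matrixP => i j; rewrite !mxE (addrC (G j i)).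
have e (M : 'M[R]_d) : M^T = M -> M j i = M i j by move=> {2}<-; rewrite mxE.
by rewrite (e b0)// (e Bx)// (e q)// (e A)// (eq_sym j).
Qed.

Definition noise_coef th x (a b l m : 'I_d) : R :=
  step_coef th x a l * Q m b + step_coef th x b l * Q m a.

(** The quadratic noise has size h, so it is counted with the drift, divided by h, for the moment
    bounds. That it is centred is used only later, in the consistency error. *)
Definition drift_coef th h x z (a b : 'I_d) : R :=
  (b0 + B x + (th * \tr x)%:M) a b
  + step_flag th x * k0 * (h^-1 * step_quad Q th x z a b - (d%:R - 1) * (Q^T *m Q) a b).

Lemma mulmx3E (x y z : 'M[R]_d) a b :
  (x *m y *m z) a b = \sum_l \sum_m x a l * y l m * z m b.
Proof.
rewrite mxE exchange_big /=; apply: eq_bigr => m _.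
by rewrite mxE mulr_suml.
Qed.

Lemma stepE th h x z a b : h != 0 ->
  step Q b0 B k0 th h x z a b =
  \sum_l \sum_m noise_coef th x a b l m * z l m + h * drift_coef th h x z a b.
Proof.
move=> h0.
have e : \sum_l \sum_m noise_coef th x a b l m * z l m =
   (step_coef th x *m z *m Q + (step_coef th x *m z *m Q)^T) a b.
  rewrite mxE [_^T _ _]mxE !mulmx3E -big_split; apply: eq_bigr => l _ /=.
  by rewrite -big_split; apply: eq_bigr => m _ /=; rewrite /noise_coef; ring.
rewrite e /step /drift_coef; move: (step_coef th x *m z *m Q + _) => G.
move: (step_quad _ _ _ _) (Q^T *m Q) (b0 + B x + _) => q A D; rewrite !mxE.
by field.
Qed.

Lemma stepE_pair th h x z a b : h != 0 ->
  step Q b0 B k0 th h x z a b =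
  \sum_(t : 'I_d * 'I_d) noise_coef th x a b t.1 t.2 * z t.1 t.2
  + h * drift_coef th h x z a b.
Proof.
by move=> h0; rewrite stepE// (pair_bigA _ (fun l m => noise_coef th x a b l m * z l m)).
Qed.

Lemma mulmx3_le (x y z : 'M[R]_d) (p q r : R) a b :
  (forall i j, `|x i j| <= p) -> (forall i j, `|y i j| <= q) ->
  (forall i j, `|z i j| <= r) -> `|(x *m y *m z) a b| <= d%:R ^+ 2 * (p * q * r).
Proof.
move=> hx hy hz; rewrite mulmx3E; apply: (le_trans (ler_norm_sum _ _ _)).
apply: (@le_trans _ _ (\sum_(l < d) \sum_(m < d) (p * q * r))); last first.
  by rewrite !sumr_const !card_ord -mulrnA -[leLHS]mulr_natl natrM expr2.
apply: ler_sum => l _; apply: (le_trans (ler_norm_sum _ _ _)); apply: ler_sum => m _.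
by rewrite !normrM; apply: ler_pM => //; apply: ler_pM.
Qed.

(** The first summand serves the squares of the noise coefficients, the rest the absolute value of
    the drift coefficient; one constant for both keeps the moment estimates short. *)
Definition coef_bound : R :=
  16 * d%:R ^+ 2 * l1mx Q ^+ 2 +
  (l1mx b0 + sym_linear_bound B * d%:R ^+ 2 + 1 +
   k0 * (d%:R ^+ 2 * (l1mx Q * (d%:R ^+ 2 * 2) * l1mx Q)
      + `|d%:R - 1| * (l1mx (Q^T *m Q)))).

Let bound2_ge0 : 0 <= k0 * (d%:R ^+ 2 * (l1mx Q * (d%:R ^+ 2 * 2) * l1mx Q)
      + `|d%:R - 1| * (l1mx (Q^T *m Q))).
Proof.
apply: mulr_ge0; first exact: ltW.
by apply: addr_ge0; rewrite !mulr_ge0 ?l1mx_ge0.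
Qed.

Let bound1_ge0 : 0 <= l1mx b0 + sym_linear_bound B * d%:R ^+ 2 + 1 +
   k0 * (d%:R ^+ 2 * (l1mx Q * (d%:R ^+ 2 * 2) * l1mx Q)
      + `|d%:R - 1| * (l1mx (Q^T *m Q))).
Proof.
apply: addr_ge0 => //; rewrite !addr_ge0 ?l1mx_ge0//.
by rewrite mulr_ge0 ?exprn_ge0 ?sym_linear_bound_ge0.
Qed.

Lemma coef_bound_ge0 : 0 <= coef_bound.
Proof. by rewrite addr_ge0// !mulr_ge0// ?l1mx_ge0// exprn_ge0 ?l1mx_ge0. Qed.

Lemma noise_coef_sqr th x a b l m : psd x -> 0 < th -> th < 1 ->
  noise_coef th x a b l m ^+ 2 <= coef_bound * (1 + \tr x).
Proof.
move=> px th0 th1; have t0 := psd_tr_ge0 px.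
have h : `|noise_coef th x a b l m| <= 4 * d%:R * l1mx Q * Num.sqrt (\tr x).
  apply: (le_trans (ler_normD _ _)); rewrite !normrM.
  rewrite (_ : 4 * _ * _ * _ = 2 * d%:R * Num.sqrt (\tr x) * l1mx Q + 2 * d%:R * Num.sqrt (\tr x) * l1mx Q); last by ring.
  by apply: lerD; apply: ler_pM => //; rewrite ?step_coef_entry// entry_le_l1mx.
have h0 : 0 <= 4 * d%:R * l1mx Q * Num.sqrt (\tr x).
  by rewrite !mulr_ge0// ?l1mx_ge0// sqrtr_ge0.
rewrite -real_normK ?num_real//; apply: (@le_trans _ _ ((4 * d%:R * l1mx Q * Num.sqrt (\tr x)) ^+ 2)).
  by rewrite ler_pXn2r// nnegrE.
rewrite !exprMn sqr_sqrtr// (_ : 4 ^+ 2 = 16); last by ring.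
apply: ler_pM => //; last by rewrite lerDr.
  by rewrite !mulr_ge0// l1mx_ge0.
by rewrite lerDl.
Qed.

Lemma step_quad_entry th h x z a b : (forall i j, z i j ^+ 2 <= h) ->
  `|step_quad Q th x z a b| <= d%:R ^+ 2 * (l1mx Q * (d%:R ^+ 2 * (2 * h)) * l1mx Q).
Proof.
move=> hz.
apply: mulmx3_le => i j; rewrite ?entry_le_l1mx//; first by rewrite mxE entry_le_l1mx.
have h0 : 0 <= h by apply: le_trans (hz i j); exact: sqr_ge0.
have zh i' j' : `|z i' j'| <= Num.sqrt h by rewrite -sqrtr_sqr ler_wsqrtr.
rewrite (_ : 2 * h = Num.sqrt h * 2 * Num.sqrt h); last first.
  by rewrite mulrAC -expr2 sqr_sqrtr// mulrC.
by apply: mulmx3_le => i' j' //; [rewrite mxE|exact: step_proj_entry].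
Qed.

Lemma drift_coef_le th h x z a b : psd x -> 0 < th -> th < 1 -> 0 < h ->
  (forall i j, z i j ^+ 2 <= h) ->
  `|drift_coef th h x z a b| <= coef_bound * (1 + \tr x).
Proof.
move=> px th0 th1 h0 hz; have t0 := psd_tr_ge0 px; have xT := psd_tr px.
apply: (@le_trans _ _ ((l1mx b0 + sym_linear_bound B * d%:R ^+ 2 + 1 +
   k0 * (d%:R ^+ 2 * (l1mx Q * (d%:R ^+ 2 * 2) * l1mx Q)
      + `|d%:R - 1| * (l1mx (Q^T *m Q)))) * (1 + \tr x))); last first.
  rewrite ler_wpM2r ?addr_ge0// lerDr.
  by rewrite !mulr_ge0// l1mx_ge0.
rewrite /drift_coef [leRHS]mulrDl; apply: (le_trans (ler_normD _ _)); apply: lerD.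
  rewrite !mxE; apply: (le_trans (ler_normD _ _)); rewrite [leRHS]mulrDl mul1r; apply: lerD.
    apply: (le_trans (ler_normD _ _)); rewrite [leRHS]mulrDl; apply: lerD.
      by rewrite -[leLHS]mulr1 ler_pM ?entry_le_l1mx ?lerDl.
    apply: (le_trans (sym_linear_entry hB _ _ xT)); rewrite -mulrA ler_wpM2l ?sym_linear_bound_ge0//.
    by apply: (le_trans (l1mx_psd_le px)); rewrite ler_wpM2l ?exprn_ge0// lerDr.
  have ht : 0 <= th * \tr x by rewrite mulr_ge0// ltW.
  have ht2 : th * \tr x <= 1 + \tr x.
    by rewrite (@le_trans _ _ (\tr x)) ?lerDr// ler_piMl// ltW.
  case: (a == b); last by rewrite mulr0n normr0 addr_ge0.
  by rewrite mulr1n ger0_norm.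
rewrite -[leLHS]mulr1; apply: ler_pM => //; last by rewrite lerDl.
rewrite !normrM; apply: ler_pM; rewrite ?mulr_ge0//.
  rewrite (gtr0_norm k0_gt0) -[leRHS]mul1r ler_wpM2r ?(ltW k0_gt0)//.
  by case: (step_flag01 th x) => ->; rewrite ?normr0 ?normr1.
apply: (le_trans (ler_normB _ _)); apply: lerD; last first.
  by rewrite normrM ler_wpM2l// entry_le_l1mx.
rewrite normrM normfV (gtr0_norm h0) ler_pdivrMl//.
apply: (le_trans (step_quad_entry th x a b hz)).
by rewrite le_eqVlt; apply/orP; left; apply/eqP; ring.
Qed.

End StepCoefficients.

Section Scheme.
Context {R : realType} {d : nat}.
Implicit Types (x y : 'M[R]_d) (z : nat -> 'M[R]_d).
Variables (Q b0 : 'M[R]_d) (B : 'M[R]_d -> 'M[R]_d) (k : R -> R) (X0 : 'M[R]_d).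
Variables (th h : R).

(** The recursion carries the whole list of increments, since a Volterra state is a convolution with
    all of them and not a function of the previous state. *)
Fixpoint increments z n : seq 'M[R]_d :=
  if n is m.+1 then rcons (increments z m) (step Q b0 B (k 0) th h
      (X0 + \sum_(j < m) kgrid k h (m - j) *: (increments z m)`_j) (z m))
  else [::].

Definition scheme_incr z j : 'M[R]_d := (increments z j.+1)`_j.

Definition state z J : 'M[R]_d := X0 + \sum_(j < J) kgrid k h (J - j) *: scheme_incr z j.

Lemma size_increments z n : size (increments z n) = n.
Proof. by elim: n => //= n IH; rewrite size_rcons IH. Qed.

Lemma incrementsS z n : increments z n.+1 =
  rcons (increments z n) (step Q b0 B (k 0) th h
      (X0 + \sum_(j < n) kgrid k h (n - j) *: (increments z n)`_j) (z n)).
Proof. by []. Qed.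

Lemma nth_increments z n j : (j < n)%N -> (increments z n)`_j = scheme_incr z j.
Proof.
elim: n => // n IH; rewrite ltnS leq_eqVlt => /orP[/eqP ->|jn].
  by rewrite /scheme_incr.
by rewrite incrementsS nth_rcons size_increments jn IH.
Qed.

Lemma scheme_incrE z j : scheme_incr z j = step Q b0 B (k 0) th h (state z j) (z j).
Proof.
have e : X0 + \sum_(i < j) kgrid k h (j - i) *: (increments z j)`_i = state z j.
  by congr (_ + _); apply: eq_bigr => i _; rewrite nth_increments.
by rewrite {1}/scheme_incr incrementsS nth_rcons size_increments ltnn eqxx e.
Qed.

Lemma eq_increments z z' n : (forall j, (j < n)%N -> z j = z' j) ->
  increments z n = increments z' n.
Proof.
elim: n => [//|n IH] zz; rewrite !incrementsS (zz n (ltnSn n)).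
by rewrite (IH (fun j jn => zz j (ltnW jn))).
Qed.

Lemma eq_state z z' J : (forall j, (j < J)%N -> z j = z' j) -> state z J = state z' J.
Proof.
move=> zz; congr (_ + _); apply: eq_bigr => j _; congr (_ *: _).
rewrite /scheme_incr (@eq_increments z z')// => i ij; apply: zz.
by rewrite (leq_trans ij).
Qed.

Lemma state0 z : state z 0 = X0.
Proof. by rewrite /state big_ord0 addr0. Qed.

Hypothesis k_ge0 : forall t : R, 0 <= t -> 0 <= k t.
Hypothesis k0_gt0 : 0 < k 0.
Hypothesis k_nonincreasing : forall s t : R, 0 <= s -> s <= t -> k t <= k s.
Hypothesis k_preserves : preserves_nonnegativity k.
Hypothesis hB : sym_linear B.
Hypothesis B_inward : forall x u : 'M[R]_d, psd x -> psd u ->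
     \tr (x *m u) = 0 -> 0 <= \tr (B x *m u).
Hypothesis b0_ge : loewner_ge b0 ((k 0 * (d%:R - 1)) *: (Q^T *m Q)).
Hypothesis hb0 : b0 \is symmetricmx.
Hypothesis hX0 : psd X0.
Hypotheses (th_gt0 : 0 < th) (th_lt1 : th < 1) (h_gt0 : 0 < h).
Hypothesis h_small1 : k 0 * h * inward_const B ^+ 2 <= 4 * th * th.
Hypothesis h_small2 : h * noise_size Q (k 0) <= (1 - th) * th.

Lemma scheme_incr_sym z j : (scheme_incr z j)^T = scheme_incr z j.
Proof.
have [n] := ubnP j; elim: n => // n IH in j * => /ltnSE jn.
rewrite scheme_incrE; apply: step_sym => //; rewrite linearD /= (psd_tr hX0); congr (_ + _).
rewrite linear_sum; apply: eq_bigr => i _; rewrite linearZ /= IH//.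
exact: leq_trans jn.
Qed.

Lemma state_psd z J : (forall j l m, z j l m ^+ 2 <= h) -> psd (state z J).
Proof.
move=> hz; have [n] := ubnP J; elim: n => // n IH in J * => /ltnSE.
case: J => [|J] Jn; first by rewrite state0.
apply: kgrid_preserves_psd => //; first exact: scheme_incr_sym.
(* Including the term j = i adds k(0) times the i-th increment to the state at i, which is the
   matrix that [step_psd] controls. *)
move=> i iJ; rewrite big_ord_recr /= addrA subnn kgrid0 scheme_incrE.
apply: step_psd => //; apply: IH.
exact: leq_ltn_trans Jn.
Qed.

Lemma state_incr z I J a b : (I <= J)%N ->
  state z J a b - state z I a b =
  \sum_(j < J) incr_weight (kgrid k h) I J j * scheme_incr z j a b.
Proof.
move=> IJ; rewrite /state !mxE !summxE opprD addrACA subrr add0r.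
have -> : \sum_(j < I) (kgrid k h (I - j) *: scheme_incr z j) a b =
    \sum_(j < J) (if (j < I)%N then (kgrid k h (I - j) *: scheme_incr z j) a b else 0).
  by rewrite (big_ord_widen J (fun j => (kgrid k h (I - j) *: scheme_incr z j) a b) IJ) big_mkcond.
rewrite -sumrB; apply: eq_bigr => j _; rewrite /incr_weight mulrBl !mxE.
by case: ifP => _; rewrite ?mxE// mul0r.
Qed.

End Scheme.

Ltac nonneg := repeat (first [assumption | exact: ler0n | exact: l1mx_ge0
  | exact: sqr_ge0 | exact: normr_ge0 | exact: sqrtr_ge0 | exact: expR_ge0
  | apply: mulr_ge0 | apply: addr_ge0 | apply: exprn_ge0]).

Lemma sqr_le {R : realType} (a b : R) : 0 <= a -> a <= b -> a ^+ 2 <= b ^+ 2.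
Proof. by move=> a0 ab; rewrite !expr2 ler_pM. Qed.

Lemma sum_option {R : realType} (I : finType) (F : option I -> R) :
  \sum_i F i = F None + \sum_i F (Some i).
Proof.
have e : index_enum (option I) = None :: map Some (index_enum I).
  by rewrite /index_enum unlock /= {1}unlock.
by rewrite e big_cons big_map.
Qed.

(** The induction bears on A + c times the partial sum, which each step multiplies by at most 1 + c
    <= e^c. *)
Lemma discrete_gronwall {R : realType} (u : nat -> R) (A c : R) n :
  0 <= A -> 0 <= c ->
  (forall J, (J <= n)%N -> u J <= A + c * \sum_(j < J) u j) ->
  u n <= A * expR (c * n%:R).
Proof.
move=> A0 c0 hu.
have h J : (J <= n)%N -> A + c * \sum_(j < J) u j <= A * expR (c * J%:R).
  elim: J => [|J IH] Jn; first by rewrite big_ord0 !mulr0 addr0 expR0 mulr1.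
  rewrite big_ord_recr /= mulrDr addrA.
  apply: (@le_trans _ _ (A * expR (c * J%:R) * (1 + c))).
    rewrite mulrDr mulr1; apply: lerD; first exact: IH (ltnW Jn).
    rewrite mulrC ler_wpM2r//; apply: le_trans (IH (ltnW Jn)).
    exact: hu (ltnW Jn).
  rewrite -[J.+1%:R]natr1 [c * (_ + 1)]mulrDr mulr1 expRD mulrA ler_wpM2l ?expR_ge1Dx//.
  by rewrite mulr_ge0// expR_ge0.
exact: le_trans (hu n (leqnn n)) (h n (leqnn n)).
Qed.

(** * Moment bounds and consistency of the scheme *)

Section SchemeMoments.
Context {R : realType} {d : nat}.
Variables (Q b0 : 'M[R]_d) (B : 'M[R]_d -> 'M[R]_d) (k : R -> R) (X0 : 'M[R]_d).
Variables (th h : R) (N : nat).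

Definition coin_index : finType := ('I_N * ('I_d * 'I_d))%type.
Definition coin_space : finType := {ffun coin_index -> bool}.

(** Coins are numbered by natural numbers, with value 0 from N on, and flipping such a coin does
    nothing; the flip identities then hold without bounds on the index. *)
Definition xi (t : 'I_d * 'I_d) (j : nat) (s : coin_space) : R :=
  if insub j is Some i then Num.sqrt h * coin (i, t) s else 0.

Definition xi_flip (t : 'I_d * 'I_d) (j : nat) (s : coin_space) : coin_space :=
  if insub j is Some i then flip (i, t) s else s.

Definition noise (s : coin_space) (j : nat) : 'M[R]_d := \matrix_(l, m) xi (l, m) j s.

Definition euler_path (J : nat) (s : coin_space) : 'M[R]_d :=
  state Q b0 B k X0 th h (noise s) J.

Lemma xi_flip_Ex t j (f : coin_space -> R) : Ex (fun s => f (xi_flip t j s)) = Ex f.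
Proof. by rewrite /xi_flip; case: insub => [i|//]; exact: Ex_flip. Qed.

Lemma xi_flipE t u i j s : xi t i (xi_flip u j s) =
  if (i == j) && (t == u) then - xi t i s else xi t i s.
Proof.
rewrite /xi /xi_flip; case: insubP => [i' _ ei|ni]; last first.
  by case: ifP => // _; rewrite oppr0.
case: insubP => [j' _ ej|nj].
  rewrite coin_flip xpair_eqE -(inj_eq val_inj) /= ei ej.
  by case: ifP => [/andP[/eqP ij /eqP <-]|//]; rewrite mulrN; congr (- (_ * coin (_, _) _)); apply: val_inj; rewrite /= ei ej.
case: eqP => [ij|//]; move: nj; rewrite -ij -ei => /negP nj.
by case: nj; exact: ltn_ord.
Qed.

Lemma xi_flip1 t i j s : xi t i (xi_flip t j s) = if i == j then - xi t j s else xi t i s.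
Proof. by rewrite xi_flipE eqxx andbT; case: eqP => [->|//]. Qed.

Hypothesis h_gt0 : 0 < h.

Lemma xi_sqrE t j s : (j < N)%N -> xi t j s ^+ 2 = h.
Proof.
move=> jN; rewrite /xi insubT exprMn coin_sqr mulr1 sqr_sqrtr//.
exact: ltW.
Qed.

Lemma xi_sqr t j s : xi t j s ^+ 2 <= h.
Proof.
have [jN|jN] := ltnP j N; first by rewrite xi_sqrE.
by rewrite /xi insubF ?expr0n ?ltW// ltnNge jN.
Qed.

Lemma noise_sqr s j l m : noise s j l m ^+ 2 <= h.
Proof. by rewrite mxE xi_sqr. Qed.

Lemma path_flip t J j s : (J <= j)%N -> euler_path J (xi_flip t j s) = euler_path J s.
Proof.
move=> Jj; apply: eq_state => i iJ; apply/matrixP => l m; rewrite !mxE xi_flipE.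
by rewrite ltn_eqF// (leq_trans iJ).
Qed.

Hypothesis k_ge0 : forall t : R, 0 <= t -> 0 <= k t.
Hypothesis k0_gt0 : 0 < k 0.
Hypothesis k_nonincreasing : forall s t : R, 0 <= s -> s <= t -> k t <= k s.
Hypothesis k_preserves : preserves_nonnegativity k.
Hypothesis hB : sym_linear B.
Hypothesis B_inward : forall x u : 'M[R]_d, psd x -> psd u ->
     \tr (x *m u) = 0 -> 0 <= \tr (B x *m u).
Hypothesis b0_ge : loewner_ge b0 ((k 0 * (d%:R - 1)) *: (Q^T *m Q)).
Hypothesis hb0 : b0 \is symmetricmx.
Hypothesis hX0 : psd X0.
Hypotheses (th_gt0 : 0 < th) (th_lt1 : th < 1).
Hypothesis h_small1 : k 0 * h * inward_const B ^+ 2 <= 4 * th * th.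
Hypothesis h_small2 : h * noise_size Q (k 0) <= (1 - th) * th.

Local Notation K := (coef_bound Q b0 B (k 0)).
Local Notation G := (kgrid k h).
Local Notation pairs := ('I_d * 'I_d)%type.

Let S_gt0 : (0 < #|coin_space|)%N.
Proof. exact: card_coins. Qed.

Let K_ge0 : 0 <= K. Proof. exact: coef_bound_ge0. Qed.

Let G_ge0 n : 0 <= G n. Proof. exact: kgrid_ge0. Qed.

Let G_le n : G n <= k 0.
Proof. by rewrite -(kgrid0 k h); apply: kgrid_noninc. Qed.

Lemma path_psd J s : psd (euler_path J s).
Proof. by apply: state_psd => // j l m; exact: noise_sqr. Qed.

(** Being at least 1, its first moment is bounded by its second, so both the noise and the drift are
    controlled by [moment] alone. *)
Definition size1 (J : nat) (s : coin_space) : R := 1 + \tr (euler_path J s).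

Lemma size1_ge1 J s : 1 <= size1 J s.
Proof. by rewrite lerDl; apply: psd_tr_ge0; exact: path_psd. Qed.

Definition moment (J : nat) : R := Ex (fun s => size1 J s ^+ 2).

Lemma moment_ge0 J : 0 <= moment J.
Proof. by apply: Ex_ge0 => s; exact: sqr_ge0. Qed.

Lemma Ex_size1_le J : Ex (size1 J) <= moment J.
Proof.
apply: ler_Ex => s; rewrite expr2 ler_peMr ?size1_ge1//.
exact: le_trans (size1_ge1 J s).
Qed.

Definition pcoef a b (t : pairs) (j : nat) (s : coin_space) : R :=
  noise_coef Q th (euler_path j s) a b t.1 t.2.

Definition pdrift a b (j : nat) (s : coin_space) : R :=
  drift_coef Q b0 B (k 0) th h (euler_path j s) (noise s j) a b.

Lemma pcoef_flip a b t i j s : (i <= j)%N -> pcoef a b t i (xi_flip t j s) = pcoef a b t i s.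
Proof. by move=> ij; rewrite /pcoef path_flip. Qed.

Lemma pcoef_moment2 a b t j : Ex (fun s => pcoef a b t j s ^+ 2) <= K * moment j.
Proof.
apply: (@le_trans _ _ (K * Ex (size1 j))); last by rewrite ler_wpM2l// Ex_size1_le.
rewrite -ExZ; apply: ler_Ex => s; apply: noise_coef_sqr => //; exact: path_psd.
Qed.

Lemma pcoef_moment4 a b t j : Ex (fun s => pcoef a b t j s ^+ 4) <= K ^+ 2 * moment j.
Proof.
rewrite -ExZ; apply: ler_Ex => s; rewrite (_ : 4 = 2 * 2)%N// exprM -exprMn.
apply: sqr_le; first exact: sqr_ge0.
by apply: noise_coef_sqr => //; exact: path_psd.
Qed.

Lemma pdrift_moment2 a b j : Ex (fun s => pdrift a b j s ^+ 2) <= K ^+ 2 * moment j.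
Proof.
rewrite -ExZ; apply: ler_Ex => s; rewrite -exprMn -real_normK ?num_real//.
apply: sqr_le => //; apply: drift_coef_le => //; first exact: path_psd.
by move=> l m; exact: noise_sqr.
Qed.

Lemma scheme_incrE_path a b j s : scheme_incr Q b0 B k X0 th h (noise s) j a b =
  \sum_(t : pairs) pcoef a b t j s * xi t j s + h * pdrift a b j s.
Proof.
rewrite scheme_incrE stepE_pair ?gt_eqF//; congr (_ + _); apply: eq_bigr => -[l m] _ /=.
by rewrite mxE.
Qed.

Definition mart_part (w : nat -> R) a b t J s : R :=
  mtransf (xi t) (fun j s => w j * pcoef a b t j s) J s.

Definition drift_part (w : nat -> R) a b J s : R :=
  \sum_(j < J) (h * w j) * pdrift a b j s.

Lemma wsum_scheme_incr (w : nat -> R) a b J s :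
  \sum_(j < J) w j * scheme_incr Q b0 B k X0 th h (noise s) j a b =
  \sum_(t : pairs) mart_part w a b t J s + drift_part w a b J s.
Proof.
rewrite exchange_big -big_split; apply: eq_bigr => j _ /=.
rewrite scheme_incrE_path mulrDr mulr_sumr; congr (_ + _); last by ring.
by apply: eq_bigr => t _; rewrite mulrA.
Qed.

Lemma mart_part_moment2 w a b t J :
  Ex (fun s => mart_part w a b t J s ^+ 2) <= h * K * \sum_(j < J) w j ^+ 2 * moment j.
Proof.
apply: (le_trans (mtransf_moment2 S_gt0 (xi_flip_Ex t) (xi_flip1 t) _ (@xi_sqr t) J)).
  by move=> i j s ij; rewrite pcoef_flip.
rewrite mulr_sumr; apply: ler_sum => j _; rewrite -mulrA ler_wpM2l ?(ltW h_gt0)//.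
under eq_Ex do rewrite exprMn.
by rewrite ExZ [leRHS]mulrCA ler_wpM2l ?sqr_ge0// pcoef_moment2.
Qed.

Lemma drift_part_moment2 w a b J :
  Ex (fun s => drift_part w a b J s ^+ 2) <=
  (h * \sum_(j < J) `|w j|) * (h * K ^+ 2 * \sum_(j < J) `|w j| * moment j).
Proof.
apply: (le_trans (weighted_moment2_sum (pdrift a b) (fun j => h * w j) J)).
have e j : `|h * w j| = h * `|w j| by rewrite normrM gtr0_norm.
under eq_bigr do rewrite e; rewrite -mulr_sumr ler_wpM2l//.
  by rewrite mulr_ge0 ?(ltW h_gt0)// sumr_ge0.
rewrite mulr_sumr; apply: ler_sum => j _; rewrite e.
rewrite (_ : h * K ^+ 2 * _ = h * `|w j| * (K ^+ 2 * moment j)); last by ring.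
by rewrite ler_wpM2l ?pdrift_moment2// mulr_ge0// ltW.
Qed.

Variable T : R.

(** The two constants of the Gronwall inequality for [moment]. The factor 2 + d^2 counts the parts
    of an entry of the path (initial value, drift, one martingale per coin coordinate), and 1 + d
    counts the terms of 1 plus the trace. *)
Definition moment_A : R := (1 + d%:R) * (1 + (2 + d%:R ^+ 2) * \sum_a X0 a a ^+ 2).
Definition moment_C : R := (1 + d%:R) * (d%:R * ((2 + d%:R ^+ 2) *
  (d%:R ^+ 2 * (K * k 0 ^+ 2) + T * k 0 * (K ^+ 2 * k 0)))).

Lemma moment_A_ge0 : 0 <= moment_A.
Proof.
apply: mulr_ge0; first by rewrite addr_ge0.
apply: addr_ge0 => //; apply: mulr_ge0; first by rewrite addr_ge0// exprn_ge0.
by apply: sumr_ge0 => i _; exact: sqr_ge0.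
Qed.

Lemma moment_C_ge0 : 0 <= T -> 0 <= moment_C.
Proof.
move=> T0; have k0 := ltW k0_gt0.
have e1 : 0 <= d%:R ^+ 2 :> R by rewrite exprn_ge0.
have e2 : 0 <= k 0 ^+ 2 by rewrite exprn_ge0.
have e3 : 0 <= K ^+ 2 by rewrite exprn_ge0.
by repeat (first [exact: ler0n | assumption | apply: mulr_ge0 | apply: addr_ge0]).
Qed.

Lemma path_entry a b J s : euler_path J s a b = X0 a b +
   (\sum_(t : pairs) mart_part (fun j => G (J - j)) a b t J s +
    drift_part (fun j => G (J - j)) a b J s).
Proof.
rewrite -wsum_scheme_incr /euler_path /state mxE summxE; congr (_ + _).
by apply: eq_bigr => j _; rewrite mxE.
Qed.

Lemma sqr_sum_pairs (f : pairs -> R) (x y : R) :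
  (x + (\sum_t f t + y)) ^+ 2 <= (2 + d%:R ^+ 2) * (x ^+ 2 + (\sum_t f t ^+ 2 + y ^+ 2)).
Proof.
have := sqr_sum_le_fin (fun i : option (option pairs) =>
  if i is Some j then if j is Some t then f t else y else x).
rewrite !sum_option /= !card_option card_prod card_ord.
have -> : (d * d).+2%:R = 2 + d%:R ^+ 2 :> R by rewrite -addn2 natrD natrM expr2 addrC.
by rewrite [y + _]addrC [y ^+ 2 + _]addrC.
Qed.

Lemma path_moment2 a J : h * J%:R <= T ->
  Ex (fun s => euler_path J s a a ^+ 2) <= (2 + d%:R ^+ 2) * (X0 a a ^+ 2 +
    (d%:R ^+ 2 * (K * k 0 ^+ 2) + T * k 0 * (K ^+ 2 * k 0)) * (h * \sum_(j < J) moment j)).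
Proof.
move=> JT; have h0 := ltW h_gt0.
have sm : 0 <= \sum_(j < J) moment j by apply: sumr_ge0 => j _; exact: moment_ge0.
apply: (@le_trans _ _ ((2 + d%:R ^+ 2) * (X0 a a ^+ 2 +
    (\sum_(t : pairs) Ex (fun s => mart_part (fun j => G (J - j)) a a t J s ^+ 2) +
     Ex (fun s => drift_part (fun j => G (J - j)) a a J s ^+ 2))))).
  rewrite -{1}(Ex_cst S_gt0 (X0 a a ^+ 2)) -Ex_sum -!ExD -ExZ; apply: ler_Ex => s.
  by rewrite path_entry; exact: sqr_sum_pairs.
rewrite ler_wpM2l//.
rewrite lerD2l mulrDl; apply: lerD.
  apply: (@le_trans _ _ (\sum_(t : pairs) (K * k 0 ^+ 2) * (h * \sum_(j < J) moment j))).
    apply: ler_sum => t _; apply: (le_trans (mart_part_moment2 _ _ _ _ _)).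
    rewrite (_ : K * k 0 ^+ 2 * _ = h * K * (k 0 ^+ 2 * \sum_(j < J) moment j)); last by ring.
    rewrite ler_wpM2l ?mulr_ge0// mulr_sumr; apply: ler_sum => j _.
    by rewrite ler_wpM2r ?moment_ge0// ler_pXn2r ?nnegrE// ltW.
  by rewrite sumr_const card_prod card_ord -[leLHS]mulr_natl natrM -expr2 mulrA.
apply: (le_trans (drift_part_moment2 _ _ _ _)); rewrite -[leRHS]mulrA.
have GJ : h * (\sum_(j < J) `|G (J - j)|) <= T * k 0.
  apply: (@le_trans _ _ (h * (J%:R * k 0))); last by rewrite mulrA ler_wpM2r ?(ltW k0_gt0).
  rewrite ler_wpM2l//; apply: (@le_trans _ _ (\sum_(j < J) k 0)).
    by apply: ler_sum => j _; rewrite ger0_norm.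
  by rewrite sumr_const card_ord -[leLHS]mulr_natl.
apply: ler_pM => //.
- by rewrite mulr_ge0// sumr_ge0.
- by rewrite !mulr_ge0 ?exprn_ge0// sumr_ge0// => j _; rewrite mulr_ge0 ?moment_ge0.
rewrite (_ : K ^+ 2 * k 0 * _ = h * K ^+ 2 * (k 0 * \sum_(j < J) moment j)); last by ring.
rewrite ler_wpM2l ?mulr_ge0 ?exprn_ge0// mulr_sumr; apply: ler_sum => j _.
by rewrite ler_wpM2r ?moment_ge0// ger0_norm.
Qed.

Lemma moment_rec J : h * J%:R <= T ->
  moment J <= moment_A + moment_C * h * \sum_(j < J) moment j.
Proof.
move=> JT.
apply: (@le_trans _ _ ((1 + d%:R) * (1 + \sum_a Ex (fun s => euler_path J s a a ^+ 2)))).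
  have -> : 1 + \sum_a Ex (fun s => euler_path J s a a ^+ 2) =
      Ex (fun s => 1 + \sum_a euler_path J s a a ^+ 2) by rewrite ExD Ex_sum Ex_cst.
  rewrite -ExZ; apply: ler_Ex => s.
  have := sqr_sum_le_fin (fun i : option 'I_d => if i is Some a then euler_path J s a a else 1).
  by rewrite !sum_option /= card_option card_ord expr1n -natr1 (addrC d%:R).
apply: (@le_trans _ _ ((1 + d%:R) * (1 + \sum_(a < d) ((2 + d%:R ^+ 2) * (X0 a a ^+ 2 +
    (d%:R ^+ 2 * (K * k 0 ^+ 2) + T * k 0 * (K ^+ 2 * k 0)) * (h * \sum_(j < J) moment j)))))).
  rewrite ler_wpM2l ?addr_ge0// lerD2l; apply: ler_sum => a _; exact: path_moment2.
rewrite -mulr_sumr big_split /= sumr_const card_ord -[X in _ + X]mulr_natl.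
by rewrite le_eqVlt /moment_A /moment_C; apply/orP; left; apply/eqP; ring.
Qed.

Definition moment_max : R := moment_A * expR (moment_C * T).

Lemma moment_max_ge0 : 0 <= moment_max.
Proof. by rewrite mulr_ge0 ?moment_A_ge0// expR_ge0. Qed.

Lemma moment_le J : 0 <= T -> h * J%:R <= T -> moment J <= moment_max.
Proof.
move=> T0 JT; have h0 := ltW h_gt0.
have cC : 0 <= moment_C * h by rewrite mulr_ge0// moment_C_ge0.
apply: (le_trans (discrete_gronwall moment_A_ge0 cC _)).
  move=> I IJ; apply: moment_rec; apply: le_trans JT.
  by rewrite ler_wpM2l// ler_nat.
rewrite ler_wpM2l ?moment_A_ge0// ler_expR -mulrA ler_wpM2l ?moment_C_ge0//.
Qed.

Hypothesis T_ge0 : 0 <= T.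
Local Notation mm := moment_max.

Lemma path_incr a b I J s : (I <= J)%N ->
  euler_path J s a b - euler_path I s a b =
  \sum_(t : pairs) mart_part (incr_weight G I J) a b t J s
  + drift_part (incr_weight G I J) a b J s.
Proof. by move=> IJ; rewrite /euler_path state_incr// wsum_scheme_incr. Qed.

Lemma moment_lt J j : h * J%:R <= T -> (j < J)%N -> moment j <= mm.
Proof.
move=> JT jJ; apply: moment_le => //; apply: le_trans JT.
by rewrite ler_wpM2l ?(ltW h_gt0)// ler_nat ltnW.
Qed.

Lemma incr_mart4 a b t I J : (I <= J)%N -> h * J%:R <= T ->
  Ex (fun s => mart_part (incr_weight G I J) a b t J s ^+ 4) <=
  (6 * (K * Num.sqrt mm) * k 0 ^+ 2 * (h * (J - I)%:R)) ^+ 2.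
Proof.
move=> IJ JT; have h0 := ltW h_gt0.
(* The choice kap = K sqrt mm makes kap^2 the bound K^2 mm of the fourth moments of the
   coefficients. The 6 of the conclusion is the 3 of [mtransf_moment4] times the 2 of
   [sum_incr_weight2]. *)
have kap0 : 0 <= K * Num.sqrt mm by rewrite mulr_ge0// sqrtr_ge0.
have := @mtransf_moment4 _ _ S_gt0 (xi_flip t) (xi t) (pcoef a b t) h (xi_flip_Ex t)
  (xi_flip1 t) (pcoef_flip a b t) (@xi_sqr t) (incr_weight G I J) _ kap0 J.
move=> /(_ _)/le_trans; apply.
  move=> j jJ; rewrite exprMn sqr_sqrtr ?moment_max_ge0//.
  apply: (le_trans (pcoef_moment4 _ _ _ _)).
  by rewrite ler_wpM2l ?sqr_ge0// (moment_lt JT).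
have s0 : 0 <= \sum_(j < J) incr_weight G I J j ^+ 2.
  by apply: sumr_ge0 => j _; exact: sqr_ge0.
apply: sqr_le; first by rewrite !mulr_ge0.
rewrite (_ : 6 * _ * _ * _ = 3 * (K * Num.sqrt mm) * h * (2 * k 0 ^+ 2 * (J - I)%:R)); last by ring.
rewrite ler_wpM2l ?mulr_ge0//; have := sum_incr_weight2 G_ge0 _ IJ.
by rewrite kgrid0; apply => m n; exact: kgrid_noninc.
Qed.

Lemma incr_mart2 a b t I J : (I <= J)%N -> h * J%:R <= T ->
  Ex (fun s => mart_part (incr_weight G I J) a b t J s ^+ 2) <=
  2 * k 0 ^+ 2 * (K * mm) * (h * (J - I)%:R).
Proof.
move=> IJ JT; have h0 := ltW h_gt0.
apply: (le_trans (mart_part_moment2 _ _ _ _ _)).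
rewrite (_ : 2 * _ * _ * _ = h * K * (2 * k 0 ^+ 2 * (J - I)%:R * mm)); last by ring.
rewrite ler_wpM2l ?mulr_ge0//.
apply: (@le_trans _ _ ((\sum_(j < J) incr_weight G I J j ^+ 2) * mm)).
  rewrite mulr_suml; apply: ler_sum => j _.
  by rewrite ler_wpM2l ?sqr_ge0// (moment_lt JT).
rewrite ler_wpM2r ?moment_max_ge0//; have := sum_incr_weight2 G_ge0 _ IJ.
by rewrite kgrid0; apply => m n; exact: kgrid_noninc.
Qed.

Lemma incr_drift2 a b I J : (I <= J)%N -> h * J%:R <= T ->
  Ex (fun s => drift_part (incr_weight G I J) a b J s ^+ 2) <=
  (2 * k 0 * (h * (J - I)%:R)) ^+ 2 * (K ^+ 2 * mm).
Proof.
move=> IJ JT; have h0 := ltW h_gt0.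
apply: (le_trans (@weighted_moment2 _ _ (pdrift a b) (fun j => h * incr_weight G I J j) (K ^+ 2 * mm) J _)).
  move=> j jJ; apply: (le_trans (pdrift_moment2 _ _ _)).
  by rewrite ler_wpM2l ?sqr_ge0// (moment_lt JT).
apply: ler_wpM2r; first by rewrite mulr_ge0 ?sqr_ge0 ?moment_max_ge0.
apply: sqr_le; first exact: sumr_ge0.
under eq_bigr do rewrite normrM (gtr0_norm h_gt0).
rewrite -mulr_sumr mulrCA ler_wpM2l//; have := sum_incr_weight G_ge0 _ IJ.
by rewrite kgrid0; apply => m n; exact: kgrid_noninc.
Qed.

Definition tail_const : R := (1 + d%:R ^+ 2) ^+ 4 * (d%:R ^+ 2 * (6 * (K * Num.sqrt mm) * k 0 ^+ 2) ^+ 2)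
  + (1 + d%:R ^+ 2) ^+ 2 * ((2 * k 0) ^+ 2 * (K ^+ 2 * mm)).

(* The fourth moments of the martingale parts and the second moment of the drift
   are both quadratic in the time lag. *)
Lemma incr_tail a b I J (l : R) : (I <= J)%N -> h * J%:R <= T -> 0 < l ->
  Pr [set s | l <= `|euler_path J s a b - euler_path I s a b|] <=
  tail_const * (h * (J - I)%:R) ^+ 2 * (l ^- 2 + l ^- 4).
Proof.
move=> IJ JT l0; set n : R := 1 + d%:R ^+ 2.
have n0 : 0 < n by rewrite ltr_pwDl// exprn_ge0.
have cn : #|{: pairs}|%:R + 1 = n by rewrite card_prod card_ord natrM -expr2 addrC.
pose w := incr_weight G I J.
(* If the increment reaches l, one of its n = 1 + d^2 parts reaches l / n, so f is at least 1.
   Martingale parts enter with the power 4 and the drift with the power 2, and Markov's inequality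
   is applied once to f. *)
pose f s : R := \sum_(t : pairs) (n / l * mart_part w a b t J s) ^+ 4
   + (n / l * drift_part w a b J s) ^+ 2.
have pow4 (x : R) : 0 <= x ^+ 4 by rewrite (_ : 4 = 2 * 2)%N// exprM sqr_ge0.
have f0 s : 0 <= f s by rewrite addr_ge0 ?sqr_ge0// sumr_ge0.
have ln0 : 0 < l / n by rewrite divr_gt0.
have fP s : [set s | l <= `|euler_path J s a b - euler_path I s a b|] s -> 1 <= f s.
  rewrite /= path_incr// -/w => hs; rewrite leNgt; apply/negP => fs.
  have small (x : R) m : (0 < m)%N -> (n / l * x) ^+ m < 1 -> (n / l * x) ^+ m = `|n / l * x| ^+ m -> `|x| < l / n.
    move=> m0 + e; rewrite e -(@expr1n _ m) ltr_pXn2r ?nnegrE//.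
    rewrite normrM gtr0_norm ?divr_gt0// => hx.
    rewrite -(ltr_pM2l (divr_gt0 n0 l0)) (_ : n / l * (l / n) = 1)//.
    by field; rewrite !gt_eqF.
  have ev (x : R) : x ^+ 4 = `|x| ^+ 4 by rewrite -normrX ger0_norm.
  have ev2 (x : R) : x ^+ 2 = `|x| ^+ 2 by rewrite -normrX ger0_norm ?sqr_ge0.
  have hm t : `|mart_part w a b t J s| < l / n.
    apply: (@small _ 4) => //; apply: le_lt_trans fs.
    rewrite /f (bigD1 t)//= -addrA lerDl addr_ge0 ?sqr_ge0// sumr_ge0//.
  have hd : `|drift_part w a b J s| < l / n.
    apply: (@small _ 2) => //; apply: le_lt_trans fs.
    by rewrite /f lerDr sumr_ge0.
  have : `|\sum_(t : pairs) mart_part w a b t J s + drift_part w a b J s| < l.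
    apply: (le_lt_trans (ler_normD _ _)).
    have -> : l = (\sum_(t : pairs) l / n) + l / n.
      by rewrite sumr_const -[_ *+ _]mulr_natl -{2}[l / n]mul1r -mulrDl cn mulrCA divff ?gt_eqF// mulr1.
    apply: ler_ltD => //; apply: (le_trans (ler_norm_sum _ _ _)).
    by apply: ler_sum => t _; exact: ltW.
  by rewrite ltNge hs.
apply: (le_trans (markov_Pr (f := f) (a := 1) ltr01 f0 fP)); rewrite divr1.
rewrite /f ExD Ex_sum /=.
under eq_bigr => t _ do (under eq_Ex do rewrite exprMn); under eq_bigr do rewrite ExZ.
under [X in _ + X]eq_Ex do rewrite exprMn.
rewrite ExZ.
set D := h * (J - I)%:R.
apply: (@le_trans _ _ ((n / l) ^+ 4 * (d%:R ^+ 2 * (6 * (K * Num.sqrt mm) * k 0 ^+ 2 * D) ^+ 2)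
   + (n / l) ^+ 2 * ((2 * k 0 * D) ^+ 2 * (K ^+ 2 * mm)))).
  apply: lerD; last by rewrite ler_wpM2l ?sqr_ge0// incr_drift2.
  rewrite -mulr_sumr ler_wpM2l//.
  apply: (@le_trans _ _ (\sum_(t : pairs) (6 * (K * Num.sqrt mm) * k 0 ^+ 2 * D) ^+ 2)).
    by apply: ler_sum => t _; exact: incr_mart4.
  by rewrite sumr_const card_prod card_ord -[leLHS]mulr_natl natrM -expr2.
have q0 : 0 <= d%:R ^+ 2 * (6 * (K * Num.sqrt mm) * k 0 ^+ 2) ^+ 2.
  by rewrite mulr_ge0 ?sqr_ge0.
have q1 : 0 <= (2 * k 0) ^+ 2 * (K ^+ 2 * mm).
  by rewrite mulr_ge0 ?sqr_ge0// mulr_ge0 ?sqr_ge0 ?moment_max_ge0.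
rewrite /tail_const -/n mulrDr; set A := d%:R ^+ 2 * _ in q0 *; set A' := (2 * k 0) ^+ 2 * _ in q1 *.
have -> : (n / l) ^+ 4 * (d%:R ^+ 2 * (6 * (K * Num.sqrt mm) * k 0 ^+ 2 * D) ^+ 2) = n ^+ 4 * A * D ^+ 2 * l ^- 4.
  by rewrite /A exprMn exprVn; ring.
have -> : (n / l) ^+ 2 * ((2 * k 0 * D) ^+ 2 * (K ^+ 2 * mm)) = n ^+ 2 * A' * D ^+ 2 * l ^- 2.
  by rewrite /A' exprMn exprVn; ring.
rewrite addrC; have l2 : 0 <= l ^- 2 by rewrite invr_ge0 exprn_ge0// ltW.
have l4 : 0 <= l ^- 4 by rewrite invr_ge0 exprn_ge0// ltW.
have n4 : 0 <= n ^+ 4 * A by rewrite mulr_ge0.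
have n2 : 0 <= n ^+ 2 * A' by rewrite mulr_ge0 ?sqr_ge0.
apply: lerD; rewrite ler_wpM2r// ler_wpM2r ?sqr_ge0//.
  by rewrite lerDr.
by rewrite lerDl.
Qed.

Definition sq_const : R := (1 + d%:R ^+ 2) *
  (d%:R ^+ 2 * (2 * k 0 ^+ 2 * (K * mm)) + (2 * k 0) ^+ 2 * T * (K ^+ 2 * mm)).

Lemma incr_moment2 a b I J : (I <= J)%N -> h * J%:R <= T ->
  Ex (fun s => (euler_path J s a b - euler_path I s a b) ^+ 2) <= sq_const * (h * (J - I)%:R).
Proof.
move=> IJ JT; have h0 := ltW h_gt0; pose w := incr_weight G I J.
set D := h * (J - I)%:R.
have D0 : 0 <= D by rewrite mulr_ge0.
have DT : D <= T.
  by apply: le_trans JT; rewrite ler_wpM2l// ler_nat leq_subr.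
apply: (@le_trans _ _ ((1 + d%:R ^+ 2) * (\sum_(t : pairs) Ex (fun s => mart_part w a b t J s ^+ 2) +
     Ex (fun s => drift_part w a b J s ^+ 2)))).
  rewrite -Ex_sum -ExD -ExZ; apply: ler_Ex => s; rewrite path_incr// -/w.
  have := sqr_sum_le_fin (fun i : option pairs =>
    if i is Some t then mart_part w a b t J s else drift_part w a b J s).
  rewrite !sum_option card_option card_prod card_ord.
  have -> : (d * d).+1%:R = 1 + d%:R ^+ 2 :> R by rewrite -natr1 natrM expr2 addrC.
  by rewrite [drift_part _ _ _ _ _ + _]addrC [_ ^+ 2 + \sum_i _]addrC.
rewrite /sq_const -[leRHS]mulrA ler_wpM2l// mulrDl; apply: lerD.
  apply: (@le_trans _ _ (\sum_(t : pairs) 2 * k 0 ^+ 2 * (K * mm) * D)).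
    by apply: ler_sum => t _; exact: incr_mart2.
  by rewrite sumr_const card_prod card_ord -[leLHS]mulr_natl natrM -expr2 mulrA.
apply: (le_trans (incr_drift2 _ _ IJ JT)); rewrite -/D.
rewrite exprMn (_ : (2 * k 0) ^+ 2 * T * _ * D = (2 * k 0) ^+ 2 * (T * D) * (K ^+ 2 * mm)); last by ring.
apply: ler_wpM2r; first by rewrite mulr_ge0 ?sqr_ge0 ?moment_max_ge0.
by rewrite ler_wpM2l ?sqr_ge0// expr2 ler_wpM2r.
Qed.

Definition sqrt_coef (x : 'M[R]_d) a b (t : pairs) : R :=
  psd_sqrt x a t.1 * Q t.2 b + psd_sqrt x b t.1 * Q t.2 a.

Definition scheme_error a b J s : R :=
  euler_path J s a b - X0 a b - \sum_(j < J) G (J - j) * (h * (b0 + B (euler_path j s)) a b)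
  - \sum_(t : pairs) \sum_(j < J) G (J - j) * sqrt_coef (euler_path j s) a b t * xi t j s.

Definition quad_coef a b (p : pairs * pairs) (x : 'M[R]_d) : R :=
  if p.1 == p.2 then 0 else
  step_flag th x * k 0 * (Q p.1.2 a * Q p.2.2 b * step_proj th x p.1.1 p.2.1).

(* As xi^2 = h, the diagonal terms of the quadratic noise equal their mean, which
   leaves products of two distinct coins. *)
Lemma quad_expand a b j s : (j < N)%N ->
  step_flag th (euler_path j s) * k 0 * (step_quad Q th (euler_path j s) (noise s j) a b
     - h * ((d%:R - 1) * (Q^T *m Q) a b)) =
  \sum_(p : pairs * pairs) quad_coef a b p (euler_path j s) * (xi p.1 j s * xi p.2 j s).
Proof.
move=> jN; set x := euler_path j s.
case: (step_flag01 th x) => [f0|f1].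
  rewrite f0 !mul0r big1// => p _; rewrite /quad_coef f0 !mul0r.
  by case: ifP; rewrite mul0r.
pose F (p : pairs * pairs) := Q p.1.2 a * Q p.2.2 b * step_proj th x p.1.1 p.2.1 * (xi p.1 j s * xi p.2 j s).
have qE : step_quad Q th x (noise s j) a b = \sum_(p : pairs * pairs) F p.
  rewrite /step_quad mulmx3E pair_bigA /=.
  rewrite (eq_bigr (fun p : pairs => \sum_(q : pairs) F ((q.1, p.1), (q.2, p.2)))); last first.
    move=> [a' b'] _ /=; rewrite mulmx3E pair_bigA /= mulr_sumr mulr_suml.
    by apply: eq_bigr => -[l m] _ /=; rewrite /F !mxE /=; ring.
  rewrite pair_bigA /=.
  (* Regroups the four summation indices: the product expands over pairs of columns and pairs of
     rows of the noise, while [F] is indexed by two coins, each a row with a column. *)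
  pose sw (p : pairs * pairs) : pairs * pairs := ((p.2.1, p.1.1), (p.2.2, p.1.2)).
  pose sw' (p : pairs * pairs) : pairs * pairs := ((p.1.2, p.2.2), (p.1.1, p.2.1)).
  have swK : cancel sw' sw by move=> [[? ?] [? ?]].
  have swK' : cancel sw sw' by move=> [[? ?] [? ?]].
  by rewrite [RHS](reindex sw)//; exists sw' => p _; [exact: swK'|exact: swK].
have dE : h * ((d%:R - 1) * (Q^T *m Q) a b) = \sum_(p : pairs * pairs | p.1 == p.2) F p.
  rewrite -(step_proj_trace f1) /mxtrace mxE.
  have -> : \sum_(p : pairs * pairs | p.1 == p.2) F p = \sum_(p : pairs) F (p, p).
    rewrite (reindex_onto (fun p : pairs => (p, p)) (fun p => p.1)) /=.
      by apply: eq_bigl => p; rewrite !eqxx.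
    by move=> [p q] /= /eqP ->.
  rewrite (eq_bigr (fun p : pairs => F ((p.1, p.2), (p.1, p.2)))); last by case.
  rewrite -(pair_bigA _ (fun l m => F ((l, m), (l, m)))) /= mulr_suml mulr_sumr.
  apply: eq_bigr => l _; rewrite mulr_sumr mulr_sumr; apply: eq_bigr => m _.
  by rewrite /F /= -expr2 xi_sqrE// mxE; ring.
rewrite qE dE (bigID (fun p : pairs * pairs => p.1 == p.2)) /= addrAC subrr add0r f1 mul1r.
rewrite big_mkcond mulr_sumr; apply: eq_bigr => p _; rewrite /quad_coef.
by case: (p.1 == p.2); rewrite /= ?mulr0 ?mul0r// f1 mul1r /F mulrA.
Qed.

(** The three deviations from the equation: the compressed and rescaled square root, the multiple th
    * tr x of the identity in the drift, and the products of two distinct coins left by the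
    quadratic term. *)
Lemma scheme_errorE a b J s : (J <= N)%N ->
  scheme_error a b J s =
  \sum_(t : pairs) mtransf (xi t) (fun j s => G (J - j) *
      (pcoef a b t j s - sqrt_coef (euler_path j s) a b t)) J s
  + (\sum_(j < J) (h * G (J - j)) * (if a == b then th * \tr (euler_path j s) else 0)
  + \sum_(p : pairs * pairs) mtransf (fun j s => xi p.1 j s * xi p.2 j s)
       (fun j s => G (J - j) * quad_coef a b p (euler_path j s)) J s).
Proof.
move=> JN; rewrite /scheme_error path_entry /mart_part /drift_part /mtransf.
have e1 : \sum_(t : pairs) \sum_(j < J) G (J - j) * (pcoef a b t j s - sqrt_coef (euler_path j s) a b t) * xi t j s =
    \sum_(t : pairs) \sum_(j < J) G (J - j) * pcoef a b t j s * xi t j s -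
    \sum_(t : pairs) \sum_(j < J) G (J - j) * sqrt_coef (euler_path j s) a b t * xi t j s.
  rewrite -sumrB; apply: eq_bigr => t _; rewrite -sumrB; apply: eq_bigr => j _.
  by rewrite mulrBr mulrBl.
have e2 : \sum_(j < J) (h * G (J - j)) * pdrift a b j s =
    \sum_(j < J) G (J - j) * (h * (b0 + B (euler_path j s)) a b) +
    (\sum_(j < J) (h * G (J - j)) * (if a == b then th * \tr (euler_path j s) else 0)
  + \sum_(p : pairs * pairs) \sum_(j < J) G (J - j) * quad_coef a b p (euler_path j s) * (xi p.1 j s * xi p.2 j s)).
  rewrite [X in _ = _ + (_ + X)]exchange_big /= -!big_split; apply: eq_bigr => j _ /=.
  rewrite -[X in _ = _ + (_ + X)](eq_bigr _ (fun p _ => mulrA _ _ _)) -mulr_sumr -quad_expand; last first.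
    exact: leq_trans JN.
  rewrite /pdrift /drift_coef; move: (step_quad _ _ _ _) (Q^T *m Q) (b0 + B _) => q A D.
  have -> : (D + (th * \tr (euler_path j s))%:M) a b = D a b + (if a == b then th * \tr (euler_path j s) else 0).
    by rewrite !mxE; case: (a == b).
  move: (D a b) (q a b) (A a b) (if _ then _ else _) => D' q' A' c'.
  by field; rewrite gt_eqF.
rewrite e1 e2; ring.
Qed.

Definition error_const : R := 3 * (d%:R ^+ 2 * (d%:R ^+ 2 * (T * k 0 ^+ 2 * (8 * l1mx Q ^+ 2 * mm)))
   + (T * k 0) ^+ 2 * mm + d%:R ^+ 4 * (d%:R ^+ 4 * (T * k 0 ^+ 2 * (2 * k 0 * l1mx Q ^+ 2) ^+ 2))).

Lemma sqrt_coef_close a b t j s :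
  (pcoef a b t j s - sqrt_coef (euler_path j s) a b t) ^+ 2 <= 8 * l1mx Q ^+ 2 * (th * size1 j s).
Proof.
have px := path_psd j s; have t0 := psd_tr_ge0 px.
set q := l1mx Q; set x := euler_path j s.
have q0 : 0 <= q by exact: l1mx_ge0.
have hh : `|pcoef a b t j s - sqrt_coef x a b t| <= 2 * (Num.sqrt th * (1 + Num.sqrt (\tr x)) * q).
  rewrite /pcoef /noise_coef /sqrt_coef opprD addrACA -!mulrBl.
  apply: (le_trans (ler_normD _ _)); rewrite !normrM mulr_natl mulr2n; apply: lerD.
    by apply: ler_pM => //; rewrite ?step_coef_close// entry_le_l1mx.
  by apply: ler_pM => //; rewrite ?step_coef_close// entry_le_l1mx.
rewrite -real_normK ?num_real//; apply: (le_trans (sqr_le (normr_ge0 _) hh)).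
rewrite !exprMn sqr_sqrtr ?(ltW th_gt0)//.
have -> : 8 * q ^+ 2 * (th * size1 j s) = 2 ^+ 2 * (th * (2 * size1 j s) * q ^+ 2) by ring.
rewrite ler_wpM2l ?exprn_ge0// ler_wpM2r ?exprn_ge0// ler_wpM2l ?(ltW th_gt0)//.
rewrite /size1 -/x; have := sqr_sqrtr t0; rewrite -/x; move: (Num.sqrt _) => r <-.
have := sqr_ge0 (1 - r); rewrite sqrrB sqrrD => hr; lra.
Qed.

(** The squared means of the three deviations are of order th, th and h. For the coin products each
    summand has second moment of order h^2 and there are at most T / h of them. The outer 3 is the
    number of deviations, and d^2 and d^4 count coins and pairs of coins at one time. *)
Lemma scheme_error_moment2 a b J : (J <= N)%N -> h * J%:R <= T ->
  Ex (fun s => scheme_error a b J s ^+ 2) <= error_const * (th + h).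
Proof.
move=> JN JT; have h0 := ltW h_gt0; have mm0 := moment_max_ge0; have th0 := ltW th_gt0.
have k00 := ltW k0_gt0; have q0 : 0 <= l1mx Q by exact: l1mx_ge0.
pose M1 t s := mtransf (xi t) (fun j s => G (J - j) *
      (pcoef a b t j s - sqrt_coef (euler_path j s) a b t)) J s.
pose M2 s := \sum_(j < J) (h * G (J - j)) * (if a == b then th * \tr (euler_path j s) else 0).
pose M3 p s := mtransf (fun j s => xi p.1 j s * xi p.2 j s)
       (fun j s => G (J - j) * quad_coef a b p (euler_path j s)) J s.
have hG : h * (\sum_(j < J) G (J - j)) <= T * k 0.
  apply: (@le_trans _ _ (h * (J%:R * k 0))); last by rewrite mulrA ler_wpM2r.
  rewrite ler_wpM2l//; apply: (@le_trans _ _ (\sum_(j < J) k 0)).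
    by apply: ler_sum => j _.
  by rewrite sumr_const card_ord -[leLHS]mulr_natl.
have e1 t : Ex (fun s => M1 t s ^+ 2) <= T * k 0 ^+ 2 * (8 * l1mx Q ^+ 2 * mm) * th.
  apply: (le_trans (mtransf_moment2 S_gt0 (xi_flip_Ex t) (xi_flip1 t) _ (@xi_sqr t) J)).
    by move=> i j s ij; rewrite (pcoef_flip _ _ _ _ ij) (path_flip _ _ ij).
  apply: (@le_trans _ _ (\sum_(j < J) h * (k 0 ^+ 2 * (8 * l1mx Q ^+ 2 * mm) * th))).
    apply: ler_sum => j _; rewrite ler_wpM2l//.
    apply: (@le_trans _ _ (Ex (fun s => k 0 ^+ 2 * (8 * l1mx Q ^+ 2) * th * size1 j s))).
      apply: ler_Ex => s; rewrite exprMn.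
      have -> : k 0 ^+ 2 * (8 * l1mx Q ^+ 2) * th * size1 j s = k 0 ^+ 2 * (8 * l1mx Q ^+ 2 * (th * size1 j s)) by ring.
      by apply: ler_pM; rewrite ?sqr_ge0// ?sqr_le// sqrt_coef_close.
    rewrite ExZ (_ : k 0 ^+ 2 * (_ * mm) * th = k 0 ^+ 2 * (8 * l1mx Q ^+ 2) * th * mm); last by ring.
    rewrite ler_wpM2l ?mulr_ge0 ?exprn_ge0//; apply: (le_trans (Ex_size1_le _)).
    exact: (moment_lt JT).
  rewrite sumr_const card_ord -[leLHS]mulr_natl mulrA (mulrC J%:R).
  have -> : T * k 0 ^+ 2 * (8 * l1mx Q ^+ 2 * mm) * th =
      T * (k 0 ^+ 2 * (8 * l1mx Q ^+ 2 * mm) * th) by ring.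
  apply: ler_wpM2r => //; nonneg.
have e2 : Ex (fun s => M2 s ^+ 2) <= (T * k 0) ^+ 2 * mm * th.
  apply: (le_trans (@weighted_moment2 _ _ (fun j s => if a == b then th * \tr (euler_path j s) else 0)
     (fun j => h * G (J - j)) (th * mm) J _)).
    move=> j jJ; apply: (@le_trans _ _ (Ex (fun s => th * size1 j s ^+ 2))); last first.
      by rewrite ExZ ler_wpM2l// (moment_lt JT).
    apply: ler_Ex => s; have t0 := psd_tr_ge0 (path_psd j s).
    case: ifP => _; last by rewrite expr0n /= mulr_ge0// sqr_ge0.
    rewrite exprMn; apply: ler_pM; rewrite ?sqr_ge0//.
      by rewrite expr2 ler_piMr// ltW.
    by apply: sqr_le => //; rewrite lerDr.
  rewrite -[leRHS]mulrA (mulrC mm); apply: ler_wpM2r; first by nonneg.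
  apply: sqr_le; first exact: sumr_ge0.
  under eq_bigr do rewrite ger0_norm ?mulr_ge0//.
  by rewrite -mulr_sumr.
have e3 p : Ex (fun s => M3 p s ^+ 2) <= T * k 0 ^+ 2 * (2 * k 0 * l1mx Q ^+ 2) ^+ 2 * h.
  have [p12|p12] := eqVneq p.1 p.2.
    rewrite (@eq_Ex _ _ _ (fun=> 0)); first by rewrite Ex_cst// !mulr_ge0// ?exprn_ge0// !mulr_ge0 ?exprn_ge0.
    move=> s; rewrite /M3 /mtransf big1 ?expr0n// => j _.
    by rewrite /quad_coef p12 eqxx mulr0 mul0r.
  have hx j s : (xi p.1 j s * xi p.2 j s) ^+ 2 <= h ^+ 2.
    by rewrite exprMn [h ^+ 2]expr2 ler_pM ?sqr_ge0// xi_sqr.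
  (* Since p.1 and p.2 differ, flipping p.1 leaves the second factor alone and negates the product,
     which therefore behaves like a single coin of squared size at most h^2. *)
  apply: (le_trans (@mtransf_moment2 _ _ S_gt0 (xi_flip p.1) _ _ (h ^+ 2) (xi_flip_Ex p.1) _ _ hx J)).
  - move=> i j s; rewrite xi_flip1 xi_flipE.
    by rewrite [p.2 == _]eq_sym (negbTE p12) andbF; case: eqP => [->|//]; rewrite mulNr.
  - by move=> i j s ij; rewrite (path_flip _ _ ij).
  apply: (@le_trans _ _ (\sum_(j < J) h ^+ 2 * (k 0 ^+ 2 * (2 * k 0 * l1mx Q ^+ 2) ^+ 2))).
    apply: ler_sum => j _; rewrite ler_wpM2l ?exprn_ge0//.
    rewrite -[leRHS](Ex_cst S_gt0); apply: ler_Ex => s; rewrite exprMn.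
    apply: ler_pM; rewrite ?sqr_ge0//; first by apply: sqr_le.
    rewrite -real_normK ?num_real//; apply: sqr_le => //; rewrite /quad_coef (negbTE p12).
    rewrite !normrM (gtr0_norm k0_gt0) (_ : 2 * k 0 * _ = 1 * k 0 * (l1mx Q * l1mx Q * 2)); last by ring.
    apply: ler_pM; rewrite ?mulr_ge0//.
      rewrite ler_wpM2r//.
      by case: (step_flag01 th (euler_path j s)) => ->; rewrite ?normr0 ?normr1.
    apply: ler_pM; rewrite ?mulr_ge0//; last exact: step_proj_entry.
    by apply: ler_pM => //; exact: entry_le_l1mx.
  rewrite sumr_const card_ord -[leLHS]mulr_natl.
  set A := (2 * k 0 * l1mx Q ^+ 2) ^+ 2.
  rewrite (_ : J%:R * _ = h * J%:R * (k 0 ^+ 2 * A * h)); last by ring.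
  rewrite (_ : T * _ * A * h = T * (k 0 ^+ 2 * A * h)); last by ring.
  by rewrite ler_wpM2r// !mulr_ge0 ?exprn_ge0// /A sqr_ge0.
apply: (@le_trans _ _ (3 * (d%:R ^+ 2 * (\sum_t Ex (fun s => M1 t s ^+ 2)) + Ex (fun s => M2 s ^+ 2)
    + d%:R ^+ 4 * (\sum_p Ex (fun s => M3 p s ^+ 2))))).
  rewrite -!Ex_sum -!ExZ -!ExD -ExZ; apply: ler_Ex => s; rewrite scheme_errorE//.
  have h1 := sqr_sum_le_fin (fun t => M1 t s); have h3 := sqr_sum_le_fin (fun p => M3 p s).
  rewrite !card_prod !card_ord !natrM -!expr2 in h1 h3.
  rewrite (_ : (d%:R ^+ 2) ^+ 2 = d%:R ^+ 4 :> R) in h3; last by ring.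
  rewrite -/(M2 s); move: h1 h3; set S1 := \sum_t M1 t s; set S3 := \sum_p M3 p s.
  have := sqr_ge0 (S1 - M2 s); have := sqr_ge0 (S1 - S3); have := sqr_ge0 (M2 s - S3).
  move: (d%:R ^+ 2 * _) (d%:R ^+ 4 * _) => P1 P3; move: S1 (M2 s) S3 => u v w.
  move=> g1 g2 g3 g4 g5; nra.
rewrite /error_const -[leRHS]mulrA ler_wpM2l// [leRHS]mulrDl.
rewrite [X in _ <= X + _]mulrDl; apply: lerD; first apply: lerD.
- rewrite -[leRHS]mulrA ler_wpM2l ?exprn_ge0//.
  apply: (@le_trans _ _ (\sum_(t : pairs) (T * k 0 ^+ 2 * (8 * l1mx Q ^+ 2 * mm) * (th + h)))).
    apply: ler_sum => t _; apply: (le_trans (e1 t)); rewrite ler_wpM2l ?lerDl//.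
    nonneg.
  by rewrite sumr_const card_prod card_ord -[leLHS]mulr_natl natrM -expr2 mulrA.
- by apply: (le_trans e2); rewrite ler_wpM2l ?lerDl// mulr_ge0 ?sqr_ge0.
- rewrite -[leRHS]mulrA ler_wpM2l ?exprn_ge0//.
  apply: (@le_trans _ _ (\sum_(p : pairs * pairs) (T * k 0 ^+ 2 * (2 * k 0 * l1mx Q ^+ 2) ^+ 2 * (th + h)))).
    apply: ler_sum => t _; apply: (le_trans (e3 t)); rewrite ler_wpM2l ?lerDr//.
    nonneg.
  rewrite sumr_const !card_prod card_ord -[leLHS]mulr_natl !natrM.
  by rewrite (_ : d%:R * _ * _ = d%:R ^+ 4) ?mulrA//; ring.
Qed.

End SchemeMoments.

(** * Loeb spaces *)

Section UltraLimits.
Context {R : realType} (U : set_system nat) {UF : UltraFilter U}.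
Hypothesis U_free : \oo `<=` U.

Let UP : ProperFilter U := ultra_proper.

Lemma ultra_not (A : set nat) : ~ U A -> U (~` A).
Proof. by move=> nA; case: (in_ultra_setVsetC A UF). Qed.

Lemma ultra_ge (m : nat) : U [set n | (m <= n)%N].
Proof. by apply: U_free; exists m. Qed.

Definition ulim (a : nat -> R) : R := lim (a n @[n --> U]).

(** The limit is the supremum of the r that lie below a n for almost all n: an ultrafilter decides
    every comparison with a constant, so no subsequence has to be extracted. *)
Lemma ubounded_cvg (a : nat -> R) (M : R) :
  U [set n | `|a n| <= M] -> cvg (a n @[n --> U]).
Proof.
move=> aM; pose S := [set r : R | U [set n | r <= a n]].
have SM : S (- M).
  by apply: filterS aM => n /=; rewrite ler_norml => /andP[].
have uS : ubound S M.
  move=> r /= Sr; have [n [/= h1 h2]] := filter_ex (filterI Sr aM).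
  by apply: (le_trans h1); apply: le_trans h2; exact: ler_norm.
have hS : has_sup S by split; [exists (- M) | exists M].
apply/cvg_ex; exists (sup S); apply/cvgrPdist_lt => e e0.
have e2 : 0 < e / 2 by rewrite divr_gt0.
have [r Sr hr] := sup_adherent e0 hS.
have hn : U [set n | a n < sup S + e / 2].
  have : ~ U [set n | sup S + e / 2 <= a n].
    move=> h; have := ub_le_sup hS.2 h.
    by rewrite gerDl leNgt e2.
  by move=> /ultra_not; apply: filterS => n /= /negP; rewrite -ltNge.
apply: filterS (filterI Sr hn) => n /= [h1 h2].
rewrite ltr_norml; apply/andP; split; lra.
Qed.

Lemma ulim_cvg (a : nat -> R) (l : R) : a n @[n --> U] --> l -> ulim a = l.
Proof. by move=> h; apply: cvg_lim. Qed.

Lemma ulim_bounded (a : nat -> R) (M : R) :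
  U [set n | `|a n| <= M] -> a n @[n --> U] --> ulim a.
Proof. by move=> /ubounded_cvg. Qed.

Lemma ulim_junk (a : nat -> R) : ~ cvg (a n @[n --> U]) -> ulim a = 0.
Proof. by move=> h; rewrite /ulim dvgP. Qed.

Lemma cvg_bounded (a : nat -> R) (l : R) :
  a n @[n --> U] --> l -> U [set n | `|a n| <= `|l| + 1].
Proof.
move=> /cvgrPdist_lt /(_ 1 ltr01); apply: filterS => n /= h.
rewrite -lerBlDl; apply: (le_trans _ (ltW h)).
by rewrite (le_trans _ (ler_dist_dist _ _))// (le_trans (ler_norm _))// distrC.
Qed.

Lemma ulim_le (a b : nat -> R) (l m : R) : U [set n | a n <= b n] ->
  a n @[n --> U] --> l -> b n @[n --> U] --> m -> l <= m.
Proof. by move=> ab al bm; apply: (ler_cvg_to al bm). Qed.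

End UltraLimits.

Section LoebSpace.
Context {R : realType} (U : set_system nat) {UF : UltraFilter U}.
Hypothesis U_free : \oo `<=` U.
Variables (Om : nat -> finType) (pt : forall n, Om n).

Let UP : ProperFilter U := ultra_proper.

(** No quotient is formed: sample points are plain sequences, and an internal set contains with a
    sequence every other one that agrees with it along U. *)
Definition internal (A : forall n, set (Om n)) : set (forall n, Om n) :=
  [set w | U [set n | A n (w n)]].

Definition uPr (A : forall n, set (Om n)) : R := ulim U (fun n => Pr (A n)).

Let Om_gt0 n : (0 < #|Om n|)%N. Proof. by apply/card_gt0P; exists (pt n). Qed.

Lemma uPr_cvg A : Pr (A n) @[n --> U] --> uPr A.
Proof.
apply: (@ulim_bounded R U UF (fun n => Pr (A n)) 1); apply: filterE => n /=.
by rewrite ger0_norm ?Pr_ge0// Pr_le1.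
Qed.

Lemma uPr_le A B : U [set n | A n `<=` B n] -> uPr A <= uPr B.
Proof.
move=> AB; apply: (ulim_le _ (@uPr_cvg A) (@uPr_cvg B)).
by apply: filterS AB => n /=; exact: Pr_le.
Qed.

Lemma uPr_le_cst A r : U [set n | Pr (A n) <= r] -> uPr A <= r.
Proof.
move=> h; apply: (@ulim_le _ U _ (fun n => Pr (A n)) (fun=> r)) => //; last exact: cvg_cst.
exact: uPr_cvg.
Qed.

Lemma uPr_ge_cst A r : U [set n | r <= Pr (A n)] -> r <= uPr A.
Proof.
move=> h; apply: (@ulim_le _ U _ (fun=> r) (fun n => Pr (A n))) => //; first exact: cvg_cst.
exact: uPr_cvg.
Qed.

Lemma uPr_ge0 A : 0 <= uPr A.
Proof. by apply: uPr_ge_cst; apply: filterE => n; exact: Pr_ge0. Qed.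

Lemma uPrID A B : uPr A = uPr (fun n => A n `&` B n) + uPr (fun n => A n `&` ~` B n).
Proof.
apply: ulim_cvg; rewrite (_ : (fun n => _) = (fun n => Pr (A n `&` B n) + Pr (A n `&` ~` B n))).
  by apply: cvgD; exact: uPr_cvg.
by apply/funext => n; exact: PrID.
Qed.

(** Otherwise a counterexample can be picked in each of almost all coordinates, and the sequence of
    these points lies in the first internal set but not in the second. *)
Lemma internal_sub A B : internal A `<=` internal B -> U [set n | A n `<=` B n].
Proof.
move=> AB; apply: contrapT => /ultra_not h.
have hex n : exists s : Om n, ~ (A n `<=` B n) -> A n s /\ ~ B n s.
  have [AnBn|] := pselect (A n `<=` B n); first by exists (pt n).
  by move=> /existsNP[s /not_implyP[As nBs]]; exists s.
pose w n := sval (cid (hex n)); have hw n := svalP (cid (hex n)).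
have : internal A w by apply: filterS h => n /= /hw[].
move=> /AB Bw; have [n [/= h1 h2]] := filter_ex (filterI h Bw).
by have [_] := hw n h1.
Qed.

(* C n is D m n for the largest m <= n with Pr (D m n) <= r. *)
Lemma saturation (D : nat -> forall n, set (Om n)) (r : R) : 0 <= r ->
  (forall m n, D m n `<=` D m.+1 n) -> (forall m, U [set n | Pr (D m n) <= r]) ->
  exists C : forall n, set (Om n),
    (forall n, Pr (C n) <= r) /\ forall m, U [set n | D m n `<=` C n].
Proof.
move=> r0 Dmono Dr.
have Dle n m p : (m <= p)%N -> D m n `<=` D p n.
  move=> /subnK <-; elim: (p - m)%N => // q IH.
  by apply: (subset_trans IH); exact: Dmono.
have h n b : exists C : set (Om n), Pr C <= r /\
    forall m, (m <= b)%N -> Pr (D m n) <= r -> D m n `<=` C.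
  elim: b => [|b [C [Cr CD]]].
    have [D0|D0] := leP (Pr (D 0%N n)) r.
      by exists (D 0%N n); split => // m; rewrite leqn0 => /eqP -> _.
    exists set0; split; first by rewrite Pr0.
    by move=> m; rewrite leqn0 => /eqP ->; rewrite leNgt D0.
  have [Db|Db] := leP (Pr (D b.+1 n)) r.
    by exists (D b.+1 n); split => // m mb _; exact: Dle.
  exists C; split => // m; rewrite leq_eqVlt => /orP[/eqP ->|]; first by rewrite leNgt Db.
  by rewrite ltnS; exact: CD.
pose C n := sval (cid (h n n)); have hC n := svalP (cid (h n n)).
exists C; split => [n|m]; first by have [] := hC n.
apply: filterS (filterI (ultra_ge U_free m) (Dr m)) => n /= [mn Dmn].
by have [_] := hC n; apply.
Qed.

(** A single internal superset takes the place of the countable covers of the usual outer measure;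
    by saturation a countable union of internal sets is enclosed in one internal set at arbitrarily
    small cost. *)
Definition loeb_values (X : set (forall n, Om n)) : set R :=
  [set uPr B | B in [set B | X `<=` internal B]].

Definition loeb_real X : R := inf (loeb_values X).

Lemma loeb_values_lb X : has_lbound (loeb_values X).
Proof. by exists 0 => _ [B _ <-]; exact: uPr_ge0. Qed.

Lemma loeb_values_neq0 X : loeb_values X !=set0.
Proof.
exists (uPr (fun n => setT)), (fun n => setT) => // w _.
by apply: filterE.
Qed.

Lemma loeb_real_le X B : X `<=` internal B -> loeb_real X <= uPr B.
Proof. by move=> XB; apply: ge_inf; [exact: loeb_values_lb | exists B]. Qed.

Lemma loeb_real_ge X r : (forall B, X `<=` internal B -> r <= uPr B) -> r <= loeb_real X.
Proof.
move=> h; apply: lb_le_inf; first exact: loeb_values_neq0.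
by move=> _ [B XB <-]; exact: h.
Qed.

Lemma loeb_real_adherent X e : 0 < e -> exists2 B, X `<=` internal B & uPr B < loeb_real X + e.
Proof.
move=> e0; have [_ [B XB <-] hB] := inf_adherent e0 (conj (loeb_values_neq0 X) (loeb_values_lb X)).
by exists B.
Qed.

Lemma loeb_real_internal A : loeb_real (internal A) = uPr A.
Proof.
apply/eqP; rewrite eq_le loeb_real_le//=; apply: loeb_real_ge => B AB.
by apply: uPr_le; exact: internal_sub.
Qed.

Definition loeb_outer (X : set (forall n, Om n)) : \bar R := (loeb_real X)%:E.

Lemma loeb_outer0 : loeb_outer set0 = 0%E.
Proof.
congr EFin; apply/eqP; rewrite eq_le; apply/andP; split; last first.
  by apply: loeb_real_ge => B _; exact: uPr_ge0.
apply: (le_trans (@loeb_real_le _ (fun n => set0) _)) => //.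
by apply: uPr_le_cst; apply: filterE => n /=; rewrite Pr0.
Qed.

Lemma loeb_outer_ge0 X : (0 <= loeb_outer X)%E.
Proof. by rewrite lee_fin; apply: loeb_real_ge => B _; exact: uPr_ge0. Qed.

Lemma le_loeb_outer : {homo loeb_outer : A B / A `<=` B >-> (A <= B)%E}.
Proof.
move=> X Y XY; rewrite lee_fin; apply: loeb_real_ge => B YB.
by apply: loeb_real_le; exact: subset_trans YB.
Qed.

(** Each F i is enclosed in an internal set up to a geometric error summing to at most e / 2, and
    [saturation] encloses all of these in one internal set. The other e / 2 gives the strict
    inequality that passes from the limits [uPr] to the probabilities [Pr] for almost all n. *)
Lemma loeb_outer_sigma_subadditive : sigma_subadditive loeb_outer.
Proof.
move=> F; have [|fin] := eqVneq (\sum_(i <oo) loeb_outer (F i))%E +oo%E.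
  by move=> ->; rewrite leey.
apply/lee_addgt0Pr => e e0.
have e2 : 0 < e / 2 by rewrite divr_gt0.
have /choice[B hB] : forall i, exists B, F i `<=` internal B /\
    uPr B < loeb_real (F i) + (e / 2) / (2 ^ i.+1)%:R.
  move=> i; have [|B FB hB] := @loeb_real_adherent (F i) ((e / 2) / (2 ^ i.+1)%:R).
    by rewrite divr_gt0// ltr0n expn_gt0.
  by exists B.
set s := (\sum_(i <oo) loeb_outer (F i))%E in fin *.
have s0 : (0 <= s)%E by apply: nneseries_ge0 => i _ _; exact: loeb_outer_ge0.
have sfin : s \is a fin_num by rewrite ge0_fin_numE// ltey.
have sumB m : \sum_(i < m) uPr (B i) <= fine s + e / 2.
  rewrite -lee_fin EFinD fineK// -sumEFin.
  apply: (@le_trans _ _ (\sum_(i < m) (loeb_outer (F i) + ((e / 2) / (2 ^ i.+1)%:R)%:E))%E).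
    by apply: lee_sum => i _; rewrite -EFinD lee_fin; apply: ltW; have [] := hB i.
  have h0 i : (0 <= loeb_outer (F i))%E by exact: loeb_outer_ge0.
  apply: le_trans (epsilon_trick xpredT h0 (ltW e2)).
  rewrite -(big_mkord xpredT (fun i => loeb_outer (F i) + ((e / 2) / (2 ^ i.+1)%:R)%:E)%E).
  apply: nneseries_lim_ge => i _ _; rewrite adde_ge0// lee_fin divr_ge0// ltW//.
have [C [Cr CD]] : exists C : forall n, set (Om n),
    (forall n, Pr (C n) <= fine s + e) /\
    forall m, U [set n | \big[setU/set0]_(i < m) B i n `<=` C n].
  apply: (saturation (D := fun m n => \big[setU/set0]_(i < m) B i n)).
  - by rewrite addr_ge0 ?fine_ge0// ltW.
  - by move=> m n; rewrite big_ord_recr; exact: subsetUl.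
  move=> m.
  have cv : (\sum_(i < m) Pr (B i n)) @[n --> U] --> \sum_(i < m) uPr (B i).
    by apply: cvg_sumr => i _; exact: uPr_cvg.
  have lt : \sum_(i < m) uPr (B i) < fine s + e.
    by apply: (le_lt_trans (sumB m)); rewrite ltrD2l gtr_pMr// invf_lt1// ltr1n.
  have := cvgr_lt _ cv _ lt => /(_ _) hcv.
  by apply: filterS hcv => n /= h; apply: (le_trans (Pr_bigU_le _ _ _)) => //; exact: ltW.
have FC : \bigcup_i F i `<=` internal C.
  move=> w [i _ Fw]; have [FB _] := hB i.
  apply: filterS (filterI (FB _ Fw) (CD i.+1)) => n /= [Bw]; apply.
  by rewrite big_ord_recr; right.
apply: (@le_trans _ _ (uPr C)%:E); first by rewrite lee_fin loeb_real_le.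
rewrite -(fineK sfin) -EFinD lee_fin; apply: uPr_le_cst.
by apply: filterE => n; exact: Cr.
Qed.

Lemma internalI A B : internal (fun n => A n `&` B n) = internal A `&` internal B.
Proof.
apply/seteqP; split => w /=.
  by move=> h; split; apply: filterS h => n [].
by move=> [h1 h2]; apply: filterS (filterI h1 h2) => n.
Qed.

Lemma internalC A : internal (fun n => ~` A n) = ~` internal A.
Proof.
apply/seteqP; split => w /=.
  by move=> h1 h2; have [n []] := filter_ex (filterI h1 h2).
by move=> /ultra_not.
Qed.

Lemma internalT : internal (fun n => setT) = setT.
Proof. by apply/seteqP; split => w // _; exact: filterE. Qed.

End LoebSpace.

(** An alias of the product that remembers the base point [pt], so that the structure of a pointed
    type can be attached to it. *)
Definition loeb_type (Om : nat -> finType) (pt : forall n, Om n) : Type := forall n, Om n.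

HB.instance Definition _ Om pt := gen_eqMixin (@loeb_type Om pt).
HB.instance Definition _ Om pt := gen_choiceMixin (@loeb_type Om pt).
HB.instance Definition _ Om pt := isPointed.Build (@loeb_type Om pt) pt.

Record free_ultrafilter := FreeUltrafilter {
  fultra :> set_system nat;
  fultraP : UltraFilter fultra;
  fultra_free : \oo `<=` fultra }.

Lemma free_ultrafilter_ex : exists U : free_ultrafilter, True.
Proof.
have [U [UU Uoo]] := @ultraFilterLemma nat \oo _.
by exists (FreeUltrafilter UU Uoo).
Qed.

#[global] Existing Instance fultraP.

Section LoebMeasure.
Context {R : realType} (U : free_ultrafilter).
Variables (Om : nat -> finType) (pt : forall n, Om n).

Definition loeb_mu (X : set (loeb_type pt)) : \bar R := loeb_outer (R := R) U X.

HB.instance Definition _ := isOuterMeasure.Build R (loeb_type pt) loeb_mu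
  (@loeb_outer0 R U _ Om pt) (@loeb_outer_ge0 R U _ Om pt) (@le_loeb_outer R U _ Om pt)
  (@loeb_outer_sigma_subadditive R U _ (@fultra_free U) Om pt).

Let om : {outer_measure set (loeb_type pt) -> \bar R} := loeb_mu.
Local Notation loeb_omega := (caratheodory_type loeb_mu).

(** The value is that of the outer measure, so it is defined and monotone on all sets; estimates
    from above need no measurability. *)
Definition loeb_P (X : set loeb_omega) : \bar R := loeb_mu X.

HB.instance Definition _ := isMeasure.Build _ loeb_omega R loeb_P
  (caratheodory_measure0 om) (caratheodory_measure_ge0 (mu := om))
  (caratheodory_measure_sigma_additive (mu := om)).

Lemma loeb_PE A : loeb_P (internal U A) = (uPr U A)%:E.
Proof. by rewrite /loeb_P /loeb_mu /loeb_outer loeb_real_internal. Qed.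

Lemma loeb_PT : loeb_P setT = 1%E.
Proof.
rewrite -(@internalT U _ Om) loeb_PE; congr EFin.
apply: ulim_cvg; rewrite (_ : (fun n => _) = (fun=> 1)); first exact: cvg_cst.
by apply/funext => n; apply: PrT; apply/card_gt0P; exists (pt n).
Qed.

HB.instance Definition _ := Measure_isProbability.Build _ _ R loeb_P loeb_PT.

Lemma loeb_P_le X B : X `<=` internal U B -> (loeb_P X <= (uPr U B)%:E)%E.
Proof. by move=> XB; rewrite lee_fin loeb_real_le. Qed.

(** Caratheodory's criterion: an internal superset B of X is cut by A into two internal sets, whose
    probabilities add up to that of B. *)
Lemma measurable_internal A : measurable (internal U A : set loeb_omega).
Proof.
apply: le_caratheodory_measurable => X.
rewrite -EFinD lee_fin; apply: loeb_real_ge => // B XB.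
rewrite (uPrID pt B A); apply: lerD; apply: loeb_real_le => //.
  by rewrite internalI; exact: setSI.
by rewrite internalI internalC; exact: setSI.
Qed.

Lemma loeb_negligible (X : set loeb_omega) : loeb_P X = 0%E -> loeb_P.-negligible X.
Proof.
move=> X0; exists X; split => //; apply: le_caratheodory_measurable => Y.
apply: (@le_trans _ _ (loeb_mu X + loeb_mu Y)%E).
  by apply: leeD; apply: le_loeb_outer => // w [].
by rewrite [loeb_mu X]X0 add0e.
Qed.

Lemma negligible_measurable (X : set loeb_omega) : loeb_P.-negligible X -> measurable X.
Proof.
move=> [N [mN N0 XN]]; apply: (@measure_is_complete_caratheodory _ _ loeb_mu).
by exists N.
Qed.

Lemma negligible_P0 (X : set loeb_omega) : loeb_P.-negligible X -> loeb_P X = 0%E.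
Proof.
move=> [N [mN N0 XN]]; apply/eqP; rewrite eq_le loeb_outer_ge0// andbT -N0.
exact: le_loeb_outer.
Qed.

End LoebMeasure.

(** * Standard parts, almost sure statements and sigma-algebras *)

Section LoebRandomVariables.
Context {R : realType} (U : free_ultrafilter).
Variables (Om : nat -> finType) (pt : forall n, Om n).
Local Notation P := (@loeb_P R U Om pt).
Local Notation Omega := (caratheodory_type (@loeb_mu R U Om pt)).
Local Notation V := (fultra U).
Implicit Types (f g : forall n, Om n -> R) (w : Omega).

Let UP : ProperFilter U := ultra_proper.

Lemma ae_negligible (X : set Omega) : P.-negligible (~` X) -> {ae P, forall w, X w}.
Proof. by []. Qed.

(* The standard part of f at w, with junk value 0 when f n (w n) has no limit. *)
Definition st f w : R := ulim U (fun n => f n (w n)).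

Definition stbdd f w : Prop := cvg (f n (w n) @[n --> fultra U]).

Lemma stbddP f w : stbdd f w <-> exists M : nat, V [set n | `|f n (w n)| < M%:R].
Proof.
split=> [h|[M hM]]; last first.
  by apply: (@ubounded_cvg R U _ _ M%:R); apply: filterS hM => n /= /ltW.
have /(_ (fultraP U)) hb := cvg_bounded h.
have [M hM] : exists M : nat, `|lim (f n (w n) @[n --> fultra U])| + 1 < M%:R.
  exists (Num.truncn (`|lim (f n (w n) @[n --> fultra U])| + 1)).+1.
  exact: truncnS_gt.
by exists M; apply: filterS hb => n /= h1; exact: le_lt_trans h1 hM.
Qed.

Lemma P_le (X Y : set Omega) : X `<=` Y -> (P X <= P Y)%E.
Proof. exact: (le_loeb_outer pt). Qed.

Lemma internal_negligible (X : set Omega) :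
  (forall e : R, 0 < e -> exists2 A, X `<=` internal U A & uPr U A <= e) ->
  P.-negligible X.
Proof.
move=> h; apply: loeb_negligible; apply/eqP; rewrite eq_le measure_ge0 andbT.
apply/lee_addgt0Pr => e e0; rewrite add0e.
by have [A XA Ae] := h e e0; apply: (le_trans (@loeb_P_le R U Om pt X A XA)); rewrite lee_fin.
Qed.

Lemma tight_stbdd f :
  (forall e, 0 < e -> exists M, V [set n | Pr (R := R) [set s | M <= `|f n s|] <= e]) ->
  {ae P, forall w, stbdd f w}.
Proof.
move=> h; apply: ae_negligible; apply: internal_negligible => e e0.
have [M hM] := h e e0; exists (fun n => [set s | M <= `|f n s|]).
  move=> w /= nb; apply: contrapT => /ultra_not hU; apply: nb.
  apply: (@ubounded_cvg R U _ _ M); apply: filterS hU => n /= /negP.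
  by rewrite -ltNge => /ltW.
exact: uPr_le_cst.
Qed.

Lemma st_tail f (a r : R) : 0 <= a ->
  V [set n | Pr (R := R) [set s | a <= `|f n s|] <= r] -> (P [set w | (a < `|st f w|)%R] <= r%:E)%E.
Proof.
move=> a0 h; apply: (@le_trans _ _ (uPr U (fun n => [set s | a <= `|f n s|]))%:E); last first.
  by rewrite lee_fin; exact: uPr_le_cst.
apply: loeb_P_le => w /= aw.
(* Where f diverges its standard part is the default 0, whose absolute value cannot exceed a. *)
have [cv|ncv] := pselect (stbdd f w); last first.
  by move: aw; rewrite /st ulim_junk// normr0 ltNge a0.
have cn : `|f n (w n)| @[n --> fultra U] --> `|st f w| by apply: cvg_norm; exact: cv.
by have := cvgr_gt _ cn _ aw => /(_ _) h1; apply: filterS h1 => n /= /ltW.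
Qed.

(** For each threshold 1 / (m + 1) the exceptional set is internal with probability of limit 0,
    hence null, and there are countably many thresholds. So along the ultrafilter smallness in
    probability already gives almost sure convergence. *)
Lemma prob0_ae f : (forall a e, 0 < a -> 0 < e -> V [set n | Pr (R := R) [set s | a <= `|f n s|] <= e]) ->
  {ae P, forall w, f n (w n) @[n --> fultra U] --> (0 : R)}.
Proof.
move=> h.
have hm (m : nat) : P.-negligible (internal U (fun n => [set s | m.+1%:R^-1 <= `|f n s|])).
  apply: internal_negligible => e e0.
  exists (fun n => [set s | m.+1%:R^-1 <= `|f n s|]) => //.
  have m0 : 0 < m.+1%:R^-1 :> R by rewrite invr_gt0.
  exact: uPr_le_cst (h _ _ m0 e0).
have := negligible_bigcup hm; apply: negligibleS => w /= nw.
apply: contrapT => hn; apply: nw; apply/cvgrPdist_lt => e e0.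
have [m me] : exists m : nat, m.+1%:R^-1 < e.
  exists (Num.truncn e^-1); rewrite -[ltRHS]invrK ltf_pV2 ?posrE ?invr_gt0//.
  exact: truncnS_gt.
have : ~ internal U (fun n => [set s | m.+1%:R^-1 <= `|f n s|]) w by move=> h1; apply: hn; exists m.
move=> /ultra_not; apply: filterS => n /= /negP; rewrite -ltNge sub0r normrN => h1.
exact: lt_trans h1 me.
Qed.

Lemma Ex0_ae f : Ex (fun s => `|f n s|) @[n --> fultra U] --> (0 : R) ->
  {ae P, forall w, f n (w n) @[n --> fultra U] --> (0 : R)}.
Proof.
move=> h; apply: prob0_ae => a e a0 e0.
have := cvgr_lt _ h _ (mulr_gt0 e0 a0) => /(_ _) h1; apply: filterS h1 => n /= h1.
apply: (le_trans (markov_Pr (f := fun s => `|f n s|) a0 _ _)) => //.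
by rewrite ler_pdivrMr// ltW.
Qed.

(** The bounds sum to K, so the limit superior of the internal sets is null. *)
Lemma internal_borel_cantelli (B : nat -> forall n, set (Om n)) (K : R) : 0 <= K ->
  (forall m, uPr U (B m) <= K / (2 ^ m.+1)%:R) ->
  {ae P, forall w, exists m0, forall m, (m0 <= m)%N -> ~ internal U (B m) w}.
Proof.
move=> K0 hB.
have h0 : P (lim_sup_set (fun m => internal U (B m))) = 0%E.
  apply: lim_sup_set_cvg0; first by move=> m; exact: measurable_internal.
  apply: (@le_lt_trans _ _ (\sum_(i <oo) ((0 : \bar R) + (K / (2 ^ i.+1)%:R)%:E))%E).
    apply: lee_nneseries => m *; first exact: measure_ge0.
    by rewrite add0e; apply: (le_trans (@loeb_P_le R U Om pt _ (B m) _)); rewrite ?lee_fin.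
  apply: (le_lt_trans (epsilon_trick xpredT (fun _ => lexx _) K0)).
  by rewrite eseries0// add0e ltry.
apply: ae_negligible; move: (loeb_negligible h0); apply: negligibleS => w /= nw m _ /=.
apply: contrapT => hn; apply: nw; exists m => p mp hp; apply: hn.
by exists p.
Qed.

Section SigmaAlgebras.
Variable D : forall n, set (set (Om n)).
Hypothesis D_C : forall n A, D (n := n) A -> D (n := n) (~` A).
Hypothesis D_I : forall n A B, D (n := n) A -> D (n := n) B -> D (n := n) (A `&` B).

Definition null_eq (X Y : set Omega) := P.-negligible ((X `\` Y) `|` (Y `\` X)).

(* The internal sets are closed under finite operations only, so the generated
   sigma-algebra is taken after adding every null modification of them. *)
Definition near_internal : set (set Omega) :=
  [set X | exists2 A, (forall n, D (n := n) (A n)) & null_eq X (internal U A)].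

Definition completed_sigma : set (set Omega) := <<s near_internal >>.

Lemma null_eqxx X : null_eq X X.
Proof. by rewrite /null_eq setDv setU0; exact: negligible_set0. Qed.

Lemma null_eq_sym X Y : null_eq X Y -> null_eq Y X.
Proof. by rewrite /null_eq setUC. Qed.

Lemma null_eq_P X Y : null_eq X Y -> P X = P Y.
Proof.
suff h A B : null_eq A B -> (P A <= P B)%E.
  by move=> XY; apply/eqP; rewrite eq_le !h//; exact: null_eq_sym.
move=> /negligible_P0 n0; apply: (@le_trans _ _ (P (B `|` (A `\` B)))).
  by apply: P_le => w Aw; have [Bw|nBw] := pselect (B w); [left|right].
apply: (le_trans (outer_measureU2 (@loeb_mu R U Om pt) _ _)); rewrite -[leRHS]adde0.
apply: leeD => //; rewrite -n0; apply: P_le; exact: subsetUl.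
Qed.

Lemma null_eqI X Y X' Y' : null_eq X X' -> null_eq Y Y' -> null_eq (X `&` Y) (X' `&` Y').
Proof.
move=> h1 h2; apply: negligibleS (negligibleU h1 h2) => w /=.
by case=> -[[Xw Yw] nXY]; have [?|?] := pselect (X' w); have [?|?] := pselect (Y' w);
  have [?|?] := pselect (X w); have [?|?] := pselect (Y w); tauto.
Qed.

Lemma null_eqM X Y : measurable Y -> null_eq X Y -> measurable X.
Proof.
move=> mY h.
have n1 : measurable (X `\` Y) by apply: negligible_measurable; apply: negligibleS h; exact: subsetUl.
have n2 : measurable (Y `\` X) by apply: negligible_measurable; apply: negligibleS h; exact: subsetUr.
have -> : X = (Y `\` (Y `\` X)) `|` (X `\` Y).
  apply/seteqP; split => w /=; first by have [?|?] := pselect (Y w); tauto.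
  by have [?|?] := pselect (X w); tauto.
by apply: measurableU => //; apply: measurableD.
Qed.

Lemma near_internal_measurable X : near_internal X -> measurable X.
Proof. by move=> [A _]; apply: null_eqM; exact: measurable_internal. Qed.

Lemma near_internal_setI : setI_closed near_internal.
Proof.
move=> X Y [A DA XA] [B DB YB]; exists (fun n => A n `&` B n).
  by move=> n; exact: D_I.
by rewrite internalI; exact: null_eqI.
Qed.

Lemma completed_sigma_sigma : sigma_algebra setT completed_sigma.
Proof. exact: smallest_sigma_algebra. Qed.

Lemma completed_sigma_measurable X : completed_sigma X -> measurable X.
Proof. by apply: smallest_sub; [exact: sigma_algebra_measurable|exact: near_internal_measurable]. Qed.

Lemma near_internal_completed X : near_internal X -> completed_sigma X.
Proof. exact: sub_sigma_algebra. Qed.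

Lemma internal_near_internal A : (forall n, D (n := n) (A n)) -> near_internal (internal U A).
Proof. by move=> DA; exists A => //; exact: null_eqxx. Qed.

Hypothesis D_T : forall n, D (n := n) setT.

Lemma negligible_completed_sigma X : P.-negligible X -> completed_sigma X.
Proof.
move=> h; apply: near_internal_completed; exists (fun n => set0).
  by move=> n; rewrite -setCT; exact: D_C.
have -> : internal U (fun n => set0) = set0 :> set Omega.
  by apply/seteqP; split => // w /= h1; have [] := filter_ex h1.
by rewrite /null_eq setD0 set0D setU0.
Qed.

Local Notation FT := (g_sigma_algebraType near_internal).

Lemma completed_sigma_null_eq X Y : completed_sigma Y -> null_eq X Y -> completed_sigma X.
Proof.
move=> FY h.
have n1 : completed_sigma (X `\` Y) by apply: negligible_completed_sigma; apply: negligibleS h; exact: subsetUl.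
have n2 : completed_sigma (Y `\` X) by apply: negligible_completed_sigma; apply: negligibleS h; exact: subsetUr.
have -> : X = (Y `\` (Y `\` X)) `|` (X `\` Y).
  apply/seteqP; split => w /=; first by have [?|?] := pselect (Y w); tauto.
  by have [?|?] := pselect (X w); tauto.
by apply: (@measurableU _ FT) => //; apply: (@measurableD _ FT).
Qed.

Lemma measurable_wrtP (Y : Omega -> R) :
  measurable_wrt completed_sigma Y <-> measurable_fun setT (Y : FT -> R).
Proof.
split=> [h _ A mA|h A mA]; first by rewrite setTI; exact: h.
by have := h measurableT A mA; rewrite setTI.
Qed.

Lemma measurable_wrt_ae (Y Z : Omega -> R) : measurable_wrt completed_sigma Y ->
  {ae P, forall w, Y w = Z w} -> measurable_wrt completed_sigma Z.
Proof.
move=> hY YZ A mA; apply: completed_sigma_null_eq (hY A mA) _; apply: negligibleS YZ => w /=.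
by move=> h e; rewrite e in h; tauto.
Qed.

Lemma measurable_wrt_fun (Y : Omega -> R) : measurable_wrt completed_sigma Y -> measurable_fun setT Y.
Proof. by move=> h _ A mA; rewrite setTI; apply: completed_sigma_measurable; exact: h. Qed.

(** The set where f stays bounded is a countable union of internal sets. On it, st f > c holds
    exactly when f n >= c + 1 / (m + 1) almost everywhere for some m; off it the standard part is
    0. *)
Lemma st_measurable_wrt f :
  (forall n (c : R), D (n := n) [set s | c <= f n s]) -> measurable_wrt completed_sigma (st f).
Proof.
move=> Df; apply/measurable_wrtP.
have mB : measurable ([set w | stbdd f w] : set FT).
  have -> : [set w | stbdd f w] = \bigcup_M (internal U (fun n =>
      [set s | - M%:R <= f n s] `&` ~` [set s | M%:R <= f n s])).
    apply/seteqP; split => w.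
      move=> /= /stbddP[M hM]; exists M => //; apply: filterS hM => n /=.
      by rewrite ltr_norml => /andP[/ltW h1 h2]; split => //; apply/negP; rewrite -ltNge.
    move=> [M _ hM]; apply/stbddP; exists M.+1; apply: filterS hM => n /= [h1 /negP].
    rewrite -ltNge => h2; rewrite ltr_norml; apply/andP; split; rewrite -natr1; lra.
  apply: (@bigcupT_measurable _ FT) => M; apply: near_internal_completed; apply: internal_near_internal => n.
  by apply: D_I => //; exact: D_C.
apply: (measurability _ (measurable_realfun.RGenOInfty.measurableE R)).
move=> _ [_ [c ->] <-]; rewrite setTI.
have -> : st f @^-1` `]c, +oo[ =
   ([set w | stbdd f w] `&` \bigcup_m internal U (fun n => [set s | c + m.+1%:R^-1 <= f n s]))
   `|` (~` [set w | stbdd f w] `&` [set w | c < 0]).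
  apply/seteqP; split => w /=; rewrite in_itv /= andbT.
    move=> cw; have [b|nb] := pselect (stbdd f w); last first.
      by right; split => //; move: cw; rewrite /st ulim_junk.
    left; split => //; have dp : 0 < st f w - c by rewrite subr_gt0.
    have [m me] : exists m : nat, m.+1%:R^-1 < st f w - c.
      exists (Num.truncn (st f w - c)^-1); rewrite -[ltRHS]invrK ltf_pV2 ?posrE ?invr_gt0//.
      exact: truncnS_gt.
    exists m => //; rewrite ltrBrDl in me.
    have := cvgr_gt _ b _ me => /(_ _) h1; apply: filterS h1 => n /= /ltW//.
  move=> [[b [m _ hm]]|[nb c0]]; last by rewrite /st ulim_junk.
  have h1 : c + m.+1%:R^-1 <= st f w.
    by apply: (ulim_le hm _ b); exact: cvg_cst.
  by apply: lt_le_trans h1; rewrite ltrDl invr_gt0.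
apply: (@measurableU _ FT).
  apply: (@measurableI _ FT) => //; apply: (@bigcupT_measurable _ FT) => m.
  by apply: near_internal_completed; apply: internal_near_internal.
apply: (@measurableI _ FT); first exact: (@measurableC _ FT).
case: (c < 0).
  by rewrite (_ : [set _ | _] = setT)//; apply/seteqP.
rewrite (_ : [set _ | _] = set0); first exact: (@measurable0 _ FT).
by apply/seteqP; split => // w.
Qed.

End SigmaAlgebras.

Lemma sub_completed_sigma (D D' : forall n, set (set (Om n))) :
  (forall n, D n `<=` D' n) -> completed_sigma D `<=` completed_sigma D'.
Proof.
move=> DD; apply: smallest_sub; first exact: smallest_sigma_algebra.
move=> X [A DA XA]; apply: sub_sigma_algebra; exists A => // n.
exact/DD/DA.
Qed.

Lemma P_EFin (X : set Omega) : P X = (loeb_real (R := R) U X)%:E.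
Proof. by []. Qed.

(** Measurability is made part of the class because the differences and increasing unions below use
    additivity and continuity of [P]. *)
Lemma lambda_indep (Y : set Omega) : measurable Y ->
  lambda_system setT [set X : set Omega | measurable X /\ P (X `&` Y) = (P X * P Y)%E].
Proof.
move=> mY; split => //.
- by split => //; rewrite setTI probability_setT mul1e.
- move=> A B BA [mA hA] [mB hB]; split; first exact: measurableD.
  have -> : (A `\` B) `&` Y = (A `&` Y) `\` (B `&` Y).
    by apply/seteqP; split => w /=; tauto.
  rewrite !measureD//; do ?[exact: measurableI|exact: measurableD].
  + rewrite (_ : A `&` Y `&` (B `&` Y) = B `&` Y); last first.
      by apply/seteqP; split => w /=; [tauto|move=> [/[dup] /BA]; tauto].
    rewrite (_ : A `&` B = B); last first.
      by apply/seteqP; split => w /=; [tauto|move=> /[dup] /BA; tauto].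
    change (P (A `&` Y) - P (B `&` Y) = (P A - P B) * P Y)%E.
    rewrite hA hB; have [a ->] : exists a, P A = a%:E by eexists.
    have [b ->] : exists b, P B = b%:E by eexists.
    have [y ->] : exists y, P Y = y%:E by eexists.
    transitivity ((a * y - b * y)%:E) => //.
    by rewrite -mulrBl.
  + exact: ltry.
  + exact: ltry.
- move=> F ndF hF; split; first by apply: bigcupT_measurable => i; have [] := hF i.
  have c1 : P (F i) @[i --> \oo] --> P (\bigcup_i F i).
    by apply: nondecreasing_cvg_mu => //; [move=> i; have [] := hF i|
      apply: bigcupT_measurable => i; have [] := hF i].
  have c2 : P (F i `&` Y) @[i --> \oo] --> P (\bigcup_i (F i `&` Y)).
    apply: nondecreasing_cvg_mu => //.
    - by move=> i; apply: measurableI => //; have [] := hF i.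
    - by apply: bigcupT_measurable => i; apply: measurableI => //; have [] := hF i.
    - by move=> i j ij; apply/subsetPset; apply: setSI; apply/subsetPset/ndF.
  rewrite setI_bigcupl; apply: (cvg_unique _ c2) => //.
  rewrite (_ : (fun i => _) = (fun i => P (F i) * P Y)%E); last first.
    by apply/funext => i; have [] := hF i.
  by apply: cvgeZr => //; rewrite P_EFin.
Qed.

(** The product rule passes to the limit on internal sets and is insensitive to null modifications.
    These sets form a pi-system, and the pi-lambda theorem is applied once in each of the two
    arguments. *)
Lemma completed_sigma_indep (D D' : forall n, set (set (Om n))) (X Y : set Omega) :
  (forall n A B, D n A -> D n B -> D n (A `&` B)) ->
  (forall n A B, D' n A -> D' n B -> D' n (A `&` B)) ->
  (forall n A A', D n A -> D' n A' -> Pr (R := R) (A `&` A') = Pr A * Pr A') ->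
  completed_sigma D X -> completed_sigma D' Y -> P (X `&` Y) = (P X * P Y)%E.
Proof.
move=> DI DI' ind FX FY.
have h1 X0 Y0 : near_internal D X0 -> near_internal D' Y0 -> P (X0 `&` Y0) = (P X0 * P Y0)%E.
  move=> [A DA XA] [B DB YB].
  rewrite (null_eq_P (null_eqI XA YB)) (null_eq_P XA) (null_eq_P YB) -internalI !loeb_PE -EFinM.
  congr EFin; apply: ulim_cvg.
  rewrite (_ : (fun n => _) = (fun n => Pr (A n) * Pr (B n))).
    by apply: cvgM; exact: uPr_cvg.
  by apply/funext => n; exact: ind.
have h2 X0 : near_internal D X0 -> P (X0 `&` Y) = (P X0 * P Y)%E.
  move=> gX.
  have : [set Z : set Omega | measurable Z /\ P (Z `&` X0) = (P Z * P X0)%E] Y.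
    apply: (lambda_system_subset (near_internal_setI DI') (lambda_indep (near_internal_measurable gX))) FY => //.
    by move=> Z gZ; split; [exact: near_internal_measurable gZ|rewrite setIC h1// muleC].
  by move=> [_]; rewrite setIC muleC.
have : [set Z : set Omega | measurable Z /\ P (Z `&` Y) = (P Z * P Y)%E] X.
  apply: (lambda_system_subset (near_internal_setI DI) (lambda_indep (completed_sigma_measurable FY))) FX => //.
  by move=> Z gZ; split; [exact: near_internal_measurable gZ|exact: h2].
by case.
Qed.

End LoebRandomVariables.

(** * Continuous versions *)

(** With c m = 2 / 2^m the tail of the geometric series, v - c is nondecreasing and v + c
    nonincreasing from m0 on, so v converges and stays within c of its limit. *)
Lemma dyadic_cvg {R : realType} (v : nat -> R) m0 :
  (forall m, (m0 <= m)%N -> `|v m.+1 - v m| <= (2 ^+ m)^-1) ->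
  cvg (v m @[m --> \oo]) /\
  forall m, (m0 <= m)%N -> `|lim (v m @[m --> \oo]) - v m| <= 2 * (2 ^+ m)^-1.
Proof.
move=> hv; pose c m : R := 2 * (2 ^+ m)^-1.
have cS m : c m.+1 = (2 ^+ m)^-1 by rewrite /c exprS invfM mulrA mulfV ?mul1r.
have c2 m : c m = (2 ^+ m)^-1 + (2 ^+ m)^-1 by rewrite /c; ring.
have up m p : (m0 <= m)%N -> v m - c m <= v (p + m)%N - c (p + m)%N.
  move=> mm; elim: p => // p IH; apply: (le_trans IH); rewrite addSn cS c2.
  have := hv (p + m)%N (leq_trans mm (leq_addl _ _)).
  rewrite ler_norml => /andP[h1 _]; lra.
have dn m p : (m0 <= m)%N -> v (p + m)%N + c (p + m)%N <= v m + c m.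
  move=> mm; elim: p => // p IH; apply: le_trans IH; rewrite addSn cS c2.
  have := hv (p + m)%N (leq_trans mm (leq_addl _ _)).
  rewrite ler_norml => /andP[_ h1]; lra.
have c_gt0 m : 0 < c m by rewrite mulr_gt0// invr_gt0 exprn_gt0.
have cc : c m @[m --> \oo] --> (0 : R).
  rewrite (_ : c = geometric 2 2^-1); first by apply: cvg_geometric; rewrite ger0_norm// invf_lt1// ltr1n.
  by apply/funext => m; rewrite /c /= exprVn.
have cva : cvg ((v (m + m0)%N - c (m + m0)%N) @[m --> \oo]).
  apply: nondecreasing_is_cvgn.
    apply/nondecreasing_seqP => m.
    by have := up (m + m0)%N 1%N (leq_addl _ _); rewrite add1n.
  exists (v m0 + c m0) => _ [m _ <-]; apply: le_trans (dn m0 m (leqnn _)).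
  by have := c_gt0 (m + m0)%N; lra.
have cv0 : cvg (v (m + m0)%N @[m --> \oo]).
  have -> : (fun m => v (m + m0)%N) = (fun m => (v (m + m0)%N - c (m + m0)%N) + c (m + m0)%N).
    by apply/funext => m; rewrite subrK.
  by apply: is_cvgD => //; apply: cvgP; rewrite -(cvg_shiftn m0) in cc; exact: cc.
have cv : v m @[m --> \oo] --> lim (v (m + m0)%N @[m --> \oo]) by rewrite -(cvg_shiftn m0).
split; first exact: cvgP cv.
move=> m mm; rewrite (cvg_lim _ cv)//; set l := lim _ in cv *.
have le1 : l <= v m + c m.
  apply: (@ler_cvg_to _ _ _ _ v (fun=> v m + c m) _ _ cv (cvg_cst _)).
  exists m => // p /= mp; rewrite -(subnK mp); apply: le_trans (dn m (p - m)%N mm).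
  by rewrite lerDl ltW.
have le2 : v m - c m <= l.
  apply: (@ler_cvg_to _ _ _ _ (fun=> v m - c m) v _ _ (cvg_cst _) cv).
  exists m => // p /= mp; rewrite -(subnK mp); apply: (le_trans (up m (p - m)%N mm)).
  by rewrite gerBl ltW.
rewrite ler_norml /c in le1 le2 *; apply/andP; split; lra.
Qed.

Section GridPaths.
Context {R : realType}.

(* With mesh 32^-m and oscillation 2^-m, the tail bound 32^(-2m) (2^m)^4 for each
   of the 32^m cells sums to 2^-m. *)
Definition grid_index (m : nat) (t : R) : nat := Num.truncn (32 ^+ m * t).
Definition grid_point (m i : nat) : R := i%:R / 32 ^+ m.

Lemma pow32_gt0 m : 0 < 32 ^+ m :> R. Proof. by rewrite exprn_gt0. Qed.

Lemma grid_index_itv m t : 0 <= t ->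
  (grid_index m t)%:R <= 32 ^+ m * t < (grid_index m t).+1%:R.
Proof. by move=> t0; apply: truncn_itv; rewrite mulr_ge0// ltW// pow32_gt0. Qed.

Lemma grid_point_dist m t : 0 <= t ->
  `|t - grid_point m (grid_index m t)| <= (32 ^+ m)^-1.
Proof.
move=> t0; have /andP[h1 h2] := grid_index_itv m t0; have p := pow32_gt0 m.
rewrite /grid_point -(ler_pM2l p) mulfV ?gt_eqF// -{1}(gtr0_norm p) -normrM mulrBr.
rewrite mulrCA mulfV ?gt_eqF// mulr1 ger0_norm ?subr_ge0//.
by rewrite lerBlDr addrC natr1 ltW.
Qed.

Lemma grid_point_le m t : 0 <= t -> grid_point m (grid_index m t) <= t.
Proof.
move=> t0; have /andP[h1 h2] := grid_index_itv m t0.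
by rewrite /grid_point ler_pdivrMr ?pow32_gt0// mulrC.
Qed.

Lemma grid_point_ge0 m i : 0 <= grid_point m i.
Proof. by rewrite divr_ge0// ltW// pow32_gt0. Qed.

Lemma grid_index_lt m t (L : nat) : 0 <= t -> t < L%:R -> (grid_index m t < L * 32 ^ m)%N.
Proof.
move=> t0 tL; have /andP[h1 h2] := grid_index_itv m t0.
rewrite -(ltr_nat R) natrM natrX; apply: (le_lt_trans h1).
by rewrite mulrC ltr_pM2r ?pow32_gt0.
Qed.

Lemma grid_indexS m t : 0 <= t -> exists2 j, (j < 32)%N &
  grid_index m.+1 t = (32 * grid_index m t + j)%N.
Proof.
move=> t0; have /andP[h1 h2] := grid_index_itv m t0.
have /andP[h3 h4] := grid_index_itv m.+1 t0.
move: h3 h4; rewrite exprS -mulrA; set i := grid_index m t in h1 h2 *.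
set i' := grid_index m.+1 t => h3 h4.
have a : (32 * i < i'.+1)%N.
  rewrite -(ltr_nat R) natrM; apply: le_lt_trans h4.
  by rewrite ler_pM2l.
have b : (i' < 32 * i.+1)%N.
  by rewrite -(ltr_nat R) natrM; apply: (le_lt_trans h3); rewrite ltr_pM2l.
by exists (i' - 32 * i)%N; lia.
Qed.

Lemma grid_index_close m s t : 0 <= s -> 0 <= t -> s <= t -> t - s < (32 ^+ m)^-1 ->
  grid_index m t = grid_index m s \/ grid_index m t = (grid_index m s).+1.
Proof.
move=> s0 t0 st h.
have /andP[h1 h2] := grid_index_itv m s0; have /andP[h3 h4] := grid_index_itv m t0.
have p := pow32_gt0 m.
have d1 : 32 ^+ m * t < 32 ^+ m * s + 1.
  by rewrite -ltrBlDl -mulrBr; move: h; rewrite -(ltr_pM2l p) mulfV ?gt_eqF.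
have d0 : 32 ^+ m * s <= 32 ^+ m * t by rewrite ler_pM2l.
set i := grid_index m s in h1 h2 *; set i' := grid_index m t in h3 h4 *.
have a : (i < i'.+1)%N by rewrite -(ltr_nat R); lra.
have b : (i' < i.+2)%N by rewrite -(ltr_nat R) -natr1; lra.
by move: a b; clear; case: (ltngtP i i') => ii ? ?; [right|exfalso|left]; lia.
Qed.

Variable y : nat -> nat -> R.
Hypothesis y_cons : forall m i, y m.+1 (32 * i) = y m i.
Hypothesis y_step : forall L, exists m0, forall m, (m0 <= m)%N ->
  forall i j, (i < L * 32 ^ m)%N -> (j < 33)%N -> `|y m.+1 (32 * i + j) - y m i| <= (2 ^+ m)^-1.

Definition grid_limit (t : R) : R := lim (y m (grid_index m t) @[m --> \oo]).

Lemma grid_limitP (L : nat) : exists m0, forall t, 0 <= t < L%:R ->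
  y m (grid_index m t) @[m --> \oo] --> grid_limit t /\
  forall m, (m0 <= m)%N -> `|grid_limit t - y m (grid_index m t)| <= 2 * (2 ^+ m)^-1.
Proof.
have [m0 hm0] := y_step L; exists m0 => t /andP[t0 tL].
have [|cv hl] := @dyadic_cvg R (fun m => y m (grid_index m t)) m0.
  move=> m mm; have [j j32 ->] := grid_indexS m t0.
  by apply: hm0 => //; [exact: grid_index_lt|exact: ltnW].
by split => //.
Qed.

Lemma grid_limit_continuous : {within `[0, +oo[, continuous grid_limit}.
Proof.
apply/subspace_continuousP => t; rewrite /= in_itv /= andbT => t0.
pose L := (Num.truncn t).+2.
have tL : t + 1 < L%:R.
  by rewrite /L -natr1 ltrD2r truncnS_gt.
have [m0 hm0] := grid_limitP L; have [m1 hm1] := y_step L.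
apply/cvgrPdist_lt => e e0.
have [m [mm0 mm1 me]] : exists m, [/\ (m0 <= m)%N, (m1 <= m)%N & 5 * (2 ^+ m)^-1 < e].
  have cc : geometric (5 : R) 2^-1 m @[m --> \oo] --> (0 : R).
    by apply: cvg_geometric; rewrite ger0_norm// invf_lt1// ltr1n.
  have [p _ hp] := cvgr_lt _ cc _ e0.
  exists (maxn p (maxn m0 m1)); split; [lia|lia|].
  have := hp (maxn p (maxn m0 m1)); rewrite /= exprVn; apply; exact: leq_maxl.
(* The 5 is 2 + 1 + 2: from each time to its grid value, and between the two grid values. *)
have key s u : 0 <= s -> s <= u -> u < L%:R -> u - s < (32 ^+ m)^-1 ->
    `|grid_limit s - grid_limit u| <= 5 * (2 ^+ m)^-1.
  move=> s0 su uL d; have u0 := le_trans s0 su; have sL := le_lt_trans su uL.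
  have [_ /(_ m mm0) h1] := hm0 s (introT andP (conj s0 sL)).
  have [_ /(_ m mm0) h2] := hm0 u (introT andP (conj u0 uL)).
  have h3 : `|y m (grid_index m u) - y m (grid_index m s)| <= (2 ^+ m)^-1.
    have [->|->] := grid_index_close s0 u0 su d.
      by rewrite subrr normr0 invr_ge0 exprn_ge0.
    (* The offset j = 32 is the next point of grid m itself, which is why [y_step] goes up to j <
       33: it also compares neighbours of the same grid. *)
    rewrite -y_cons mulnS addnC; apply: hm1 => //; exact: grid_index_lt.
  move: h1 h2 h3; rewrite !ler_norml => /andP[? ?] /andP[? ?] /andP[? ?].
  apply/andP; split; lra.
have p : 0 < Num.min 1 (32 ^+ m)^-1 :> R by rewrite lt_min ltr01 invr_gt0 pow32_gt0.
apply/nbhs_ballP; exists (Num.min 1 (32 ^+ m)^-1) => //= s.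
rewrite /ball /= lt_min => /andP[h1 h2]; rewrite in_itv /= andbT => s0.
apply: le_lt_trans me.
have [st|ts] := leP s t.
  rewrite distrC; apply: key => //; first by lra.
  by apply: le_lt_trans h2; exact: ler_norm.
apply: key => //; first exact: ltW.
  by move: h1; rewrite distrC => h1; have := le_lt_trans (ler_norm _) h1; lra.
by apply: le_lt_trans h2; rewrite distrC; exact: ler_norm.
Qed.

End GridPaths.

Section Kolmogorov.
Context {R : realType} (U : free_ultrafilter).
Variables (Om : nat -> finType) (pt : forall n, Om n).
Local Notation P := (@loeb_P R U Om pt).
Local Notation Omega := (caratheodory_type (@loeb_mu R U Om pt)).
Local Notation V := (fultra U).

Let UP : ProperFilter V := ultra_proper.

Lemma ae_forall_nat (Q : nat -> Omega -> Prop) :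
  (forall i, {ae P, forall w, Q i w}) -> {ae P, forall w, forall i, Q i w}.
Proof.
move=> h; apply: negligibleS (negligible_bigcup h) => w /= nw.
by apply: contrapT => hn; apply: nw => i; apply: contrapT => nQ; apply: hn; exists i.
Qed.

Variables (hn : nat -> R) (Y : R -> forall n, Om n -> R) (y0 : R).
Hypothesis hn_ge0 : forall n, 0 <= hn n.
Hypothesis hn_cvg : hn n @[n --> \oo] --> (0 : R).
Hypothesis Y0 : forall n s, Y 0 (n := n) s = y0.
(* The exponent 4 comes from martingale parts and the exponent 2 from drifts; hn
   is there because Y is constant between the points of the time grid. *)
Hypothesis Y_tail : forall L : nat, exists2 C : R, 0 <= C &
  forall (n : nat) (s t l : R), 0 <= s <= L%:R -> 0 <= t <= L%:R -> 0 < l ->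
    Pr (R := R) [set w | l <= `|Y t (n := n) w - Y s (n := n) w|] <=
      C * (`|t - s| + hn n) ^+ 2 * (l ^- 2 + l ^- 4).

Let hn_small (e : R) : 0 < e -> V [set n | hn n <= e].
Proof.
move=> e0; apply: fultra_free.
have := cvgr_lt _ hn_cvg _ e0 => /(_ _) h1.
by apply: filterS h1 => n /= /ltW.
Qed.

Lemma process_stbdd t : 0 <= t -> {ae P, forall w, stbdd (Y t) w}.
Proof.
move=> t0; pose L := (Num.truncn t).+1.
have tL : t <= L%:R by rewrite ltW// truncnS_gt.
have [C C0 hC] := Y_tail L; apply: tight_stbdd => e e0.
pose A := C * (t + 1) ^+ 2 * 2.
have A0 : 0 <= A by rewrite mulr_ge0// mulr_ge0// sqr_ge0.
pose l := 1 + A / e.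
have l1 : 1 <= l by rewrite lerDl divr_ge0// ltW.
have l0 : 0 < l by exact: lt_le_trans l1.
exists (`|y0| + l); apply: filterS (hn_small ltr01) => n /= hn1.
apply: (@le_trans _ _ (Pr (R := R) [set w | l <= `|Y t w - Y 0 w|])).
  apply: Pr_le => w /=; rewrite Y0 => h; have := ler_normD (Y t w - y0) y0; rewrite subrK; lra.
apply: (le_trans (hC n 0 t l _ _ l0)); rewrite ?lexx ?ler0n ?t0 ?tL//.
rewrite subr0 ger0_norm//.
have lm1 : l^-1 <= 1 by rewrite invf_le1.
have lm0 : 0 <= l^-1 by rewrite invr_ge0 ltW.
have e1 : l ^- 2 + l ^- 4 <= 2 * l^-1.
  rewrite mulr_natl mulr2n -!exprVn; apply: lerD.
    by rewrite expr2 ler_piMr.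
  by rewrite exprS ler_piMr// exprn_ile1.
apply: (@le_trans _ _ (C * (t + 1) ^+ 2 * (2 * l^-1))).
  apply: ler_pM => //.
  - by rewrite mulr_ge0// sqr_ge0.
  - by rewrite addr_ge0// invr_ge0 exprn_ge0// ltW.
  - by rewrite ler_wpM2l// sqr_le ?addr_ge0// lerD2l.
rewrite mulrA -/A ler_pdivrMr// mulrDr mulr1 mulrC divfK ?gt_eqF//.
by rewrite lerDr ltW.
Qed.

Definition grid_bad (L m n : nat) : set (Om n) :=
  \big[setU/set0]_(p : 'I_(L * 32 ^ m) * 'I_33)
    [set w | (2 ^+ m)^-1 <= `|Y (grid_point m.+1 (32 * p.1 + p.2)) w - Y (grid_point m p.1) w|].

Lemma pow_bound (C : R) m : 0 <= C ->
  C * ((32 ^+ m)^-1 + (32 ^+ m)^-1) ^+ 2 * (((2 ^+ m)^-1) ^- 2 + ((2 ^+ m)^-1) ^- 4) <=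
  8 * C * ((32 ^+ m)^-1 * (2 ^+ m)^-1).
Proof.
move=> C0; rewrite -!exprVn !invrK.
set a : R := 2^-1 ^+ m; set b : R := 32^-1 ^+ m; set c : R := 2 ^+ m.
have c1 : 1 <= c by rewrite exprn_ege1// ler1n.
have e32 : b = a ^+ 5 by rewrite /a /b -exprM mulnC exprM; congr (_ ^+ _); field.
have ac : a * c = 1 by rewrite /a /c -exprMn mulVf// expr1n.
have a0 : 0 < a by rewrite exprn_gt0.
have -> : 8 * C * (b * a) = C * (b + b) ^+ 2 * (2 * c ^+ 4).
  rewrite e32; have -> : (a ^+ 5 + a ^+ 5) ^+ 2 = 4 * (a * (a ^+ 5 * a ^+ 4)) by ring.
  have -> : C * (4 * (a * (a ^+ 5 * a ^+ 4))) * (2 * c ^+ 4) = 8 * C * (a ^+ 5 * a) * (a * c) ^+ 4 by ring.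
  by rewrite ac expr1n mulr1.
apply: ler_wpM2l; first by rewrite mulr_ge0// sqr_ge0.
rewrite (_ : 2 * c ^+ 4 = c ^+ 4 + c ^+ 4); last by ring.
by rewrite lerD2r ler_weXn2l.
Qed.

Lemma grid_bad_small L : exists2 K, 0 <= K & forall m, uPr (R := R) V (grid_bad L m) <= K / (2 ^ m.+1)%:R.
Proof.
(* There are 33 L 32^m pairs of points, each with probability at most 8 C / (32^m 2^m); the total is
   33 L 8 C / 2^m. *)
have [C C0 hC] := Y_tail L; exists (L%:R * 33 * (16 * C)) => [|m]; first by rewrite !mulr_ge0.
apply: (uPr_le_cst pt); have p32 := pow32_gt0 (R := R) m.
(* For fixed m, almost all n have [hn n] below the mesh of grid m, so the additional [hn n] in the
   tail bound at most doubles the allowed lag. *)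
have /hn_small : 0 < (32 ^+ m)^-1 :> R by rewrite invr_gt0.
apply: filterS => n /= hnm; apply: (le_trans (Pr_bigU_le _ _ _)).
  by apply/card_gt0P; exists (pt n).
apply: (@le_trans _ _ (\sum_(p : 'I_(L * 32 ^ m) * 'I_33) 8 * C * ((32 ^+ m)^-1 * (2 ^+ m)^-1))).
  apply: ler_sum => -[i j] _ /=.
  have ij : grid_point (R := R) m.+1 (32 * i + j) = grid_point m i + j%:R / 32 ^+ m.+1.
    rewrite /grid_point natrD mulrDl natrM exprS; congr (_ + _).
    by rewrite -mulf_div divff ?mul1r.
  have j32 : j%:R / 32 ^+ m.+1 <= (32 ^+ m)^-1 :> R.
    rewrite exprS invfM mulrA -[leRHS]mul1r ler_pM2r ?invr_gt0//.
    by rewrite ler_pdivrMr// mul1r ler_nat -ltnS.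
  have j0 : 0 <= j%:R / 32 ^+ m.+1 :> R by rewrite divr_ge0// exprn_ge0.
  have iL : grid_point (R := R) m i + (32 ^+ m)^-1 <= L%:R.
    rewrite /grid_point -[X in _ + X]mul1r -mulrDl ler_pdivrMr// natr1.
    by rewrite -natrX -natrM ler_nat.
  have g0 := grid_point_ge0 (R := R) m i.
  apply: (le_trans (hC n (grid_point m i) (grid_point m.+1 (32 * i + j)) (2 ^+ m)^-1 _ _ _)).
  - by rewrite g0 /= (le_trans _ iL)// lerDl invr_ge0 ltW.
  - by rewrite grid_point_ge0 /= ij (le_trans _ iL)// lerD2l.
  - by rewrite invr_gt0 exprn_gt0.
  apply: le_trans (pow_bound m C0).
  rewrite ler_wpM2r ?addr_ge0 ?invr_ge0 ?exprn_ge0 ?invr_ge0 ?exprn_ge0//.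
  rewrite ler_wpM2l// sqr_le ?addr_ge0// lerD// ij addrC addKr ger0_norm//.
rewrite sumr_const card_prod !card_ord -[leLHS]mulr_natl !natrM !natrX exprS invfM.
rewrite le_eqVlt; apply/orP; left; apply/eqP; field.
by rewrite !gt_eqF// exprn_gt0.
Qed.

Definition grid_good : set Omega := [set w |
  (forall m i, stbdd (Y (grid_point m i)) w) /\
  forall L, exists m0, forall m, (m0 <= m)%N -> ~ internal V (grid_bad L m) w].

Lemma grid_good_ae : P.-negligible (~` grid_good).
Proof.
have h1 : {ae P, forall w, forall m, forall i, stbdd (Y (grid_point m i)) w}.
  apply: ae_forall_nat => m; apply: ae_forall_nat => i.
  exact: process_stbdd (grid_point_ge0 _ _).
have h2 : {ae P, forall w, forall L, exists m0, forall m, (m0 <= m)%N -> ~ internal V (grid_bad L m) w}.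
  apply: ae_forall_nat => L; have [K K0 hK] := grid_bad_small L.
  exact: internal_borel_cantelli K0 hK.
apply: negligibleS (negligibleU h1 h2) => w /= nw.
by apply: contrapT => /not_orP[/contrapT h3 /contrapT h4]; apply: nw.
Qed.

Lemma st_dist_le (f g : forall n, Om n -> R) (a : R) (w : Omega) : stbdd f w -> stbdd g w ->
  V [set n | `|f n (w n) - g n (w n)| <= a] -> `|st f w - st g w| <= a.
Proof.
move=> cf cg h.
have cc : `|f n (w n) - g n (w n)| @[n --> V] --> `|st f w - st g w|.
  by apply: cvg_norm; apply: cvgB; [exact: cf|exact: cg].
by apply: (ler_cvg_to cc (cvg_cst a)).
Qed.

Let yw (w : Omega) (m i : nat) : R := st (Y (grid_point m i)) w.

Lemma yw_cons w m i : yw w m.+1 (32 * i) = yw w m i.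
Proof.
rewrite /yw (_ : grid_point m.+1 (32 * i) = grid_point m i)//.
by rewrite /grid_point natrM exprS -mulf_div divff ?mul1r.
Qed.

Lemma yw_step w : grid_good w -> forall L, exists m0, forall m, (m0 <= m)%N ->
  forall i j, (i < L * 32 ^ m)%N -> (j < 33)%N -> `|yw w m.+1 (32 * i + j) - yw w m i| <= (2 ^+ m)^-1.
Proof.
move=> [wb wg] L; have [m0 hm0] := wg L; exists m0 => m mm i j iL j33.
apply: st_dist_le => //; have /ultra_not := hm0 m mm.
apply: filterS => n /= hb; rewrite leNgt; apply/negP => lt; apply: hb.
rewrite /grid_bad (bigD1 (Ordinal iL, Ordinal j33))//=; left => /=.
exact: ltW.
Qed.

(** Only the countably many grid times enter, so one null set serves for all t at once. *)
Definition continuous_version (t : R) (w : Omega) : R := grid_limit (yw w) t.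

Lemma continuous_versionP w t : grid_good w -> 0 <= t ->
  st (Y (grid_point m (grid_index m t))) w @[m --> \oo] --> continuous_version t w.
Proof.
move=> gw t0.
have [m0 /(_ t)] := grid_limitP (yw_step gw) (Num.truncn t).+1.
by rewrite t0 truncnS_gt => /(_ isT) [].
Qed.

Lemma continuous_version_continuous w : grid_good w ->
  {within `[0, +oo[, continuous (fun t => continuous_version t w)}.
Proof. by move=> gw; exact: grid_limit_continuous (yw_cons w) (yw_step gw). Qed.

(** The given time t need not be a grid time. A second Borel-Cantelli argument, with the same tail
    bound, compares Y t with its values at the grid points below t, which tend to the continuous
    version. *)
Lemma continuous_version_ae t : 0 <= t ->
  {ae P, forall w, Y t (w n) @[n --> V] --> continuous_version t w}.
Proof.
move=> t0; pose L := (Num.truncn t).+1.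
have tL : t <= L%:R by rewrite ltW// truncnS_gt.
have [C C0 hC] := Y_tail L.
pose B m n : set (Om n) := [set w | (2 ^+ m)^-1 <= `|Y t w - Y (grid_point m (grid_index m t)) w|].
have hB : {ae P, forall w, exists m0, forall m, (m0 <= m)%N -> ~ internal V (B m) w}.
  apply: (@internal_borel_cantelli _ _ _ pt B (16 * C)) => [|m]; first by rewrite mulr_ge0.
  apply: (uPr_le_cst pt); have p32 := pow32_gt0 (R := R) m.
  have /hn_small : 0 < (32 ^+ m)^-1 :> R by rewrite invr_gt0.
  apply: filterS => n /= hnm.
  have gt := grid_point_le m t0.
  apply: (le_trans (hC n (grid_point m (grid_index m t)) t (2 ^+ m)^-1 _ _ _)).
  - by rewrite grid_point_ge0 (le_trans gt).
  - by rewrite t0.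
  - by rewrite invr_gt0 exprn_gt0.
  apply: (@le_trans _ _ (8 * C * ((32 ^+ m)^-1 * (2 ^+ m)^-1))).
    apply: le_trans (pow_bound m C0).
    rewrite ler_wpM2r ?addr_ge0 ?invr_ge0 ?exprn_ge0 ?invr_ge0 ?exprn_ge0//.
    by rewrite ler_wpM2l// sqr_le ?addr_ge0// lerD// grid_point_dist.
  rewrite natrX exprS invfM (_ : 16 * C * _ = 8 * C * (1 * (2 ^+ m)^-1)); last by field; rewrite gt_eqF// exprn_gt0.
  rewrite ler_wpM2l ?mulr_ge0// ler_pM2r ?invr_gt0 ?exprn_gt0// invf_le1//.
  by rewrite exprn_ege1// ler1n.
apply: negligibleS (negligibleU (negligibleU grid_good_ae (process_stbdd t0)) hB) => w /= nw.
apply: contrapT => /not_orP[/not_orP[/contrapT gw /contrapT bw] /contrapT [m0 hw]]; apply: nw.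
suff -> : continuous_version t w = st (Y t) w by exact: bw.
have cv := continuous_versionP gw t0.
have c2 : st (Y (grid_point m (grid_index m t))) w @[m --> \oo] --> st (Y t) w.
  apply/cvgrPdist_lt => e e0.
  have cc : geometric (1 : R) 2^-1 m @[m --> \oo] --> (0 : R).
    by apply: cvg_geometric; rewrite ger0_norm// invf_lt1// ltr1n.
  have [p _ hp] := cvgr_lt _ cc _ e0.
  exists (maxn p m0) => // m /= hm; have := hp m (leq_trans (leq_maxl _ _) hm).
  rewrite /= mul1r exprVn; apply: le_lt_trans; apply: st_dist_le => //; first exact: gw.1.
  have /ultra_not := hw m (leq_trans (leq_maxr _ _) hm).
  by apply: filterS => n /= /negP; rewrite -ltNge => /ltW.
exact: (cvg_unique _ cv c2).
Qed.

End Kolmogorov.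

(** * Central limit theorem by Stein's method *)

Lemma unif_continuous_itv {R : realType} (f : R -> R) (a b : R) :
  {within `[a, b], continuous f} -> forall e, 0 < e -> exists2 r, 0 < r &
    forall x y, a <= x <= b -> a <= y <= b -> `|x - y| < r -> `|f x - f y| < e.
Proof.
move=> /subspace_continuousP fc e e0.
have /compact_near_coveringP := @segment_compact R a b.
move=> /(_ R 0^'+ (fun r x => a <= x <= b -> forall y, a <= y <= b -> `|x - y| < r -> `|f x - f y| < e)).
case.
- move=> x xab; have e2 : 0 < e / 2 by rewrite divr_gt0.
  have := fc x xab => /cvgrPdist_lt /(_ _ e2) /nbhs_ballP [r /= r0 hr].
  exists (ball x (r / 2), [set r' | r' < r / 2]) => /=.
    split; first by apply: nbhsx_ballx; rewrite divr_gt0.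
    by apply: nbhs_right_lt; rewrite divr_gt0.
  move=> [x' r'] /= [xx' rr'] x'ab y yab x'y.
  have h1 : `|f x - f x'| < e / 2.
    have := hr x'; rewrite in_itv /=; apply => //.
    by apply: lt_le_trans xx' _; rewrite ler_pdivrMr// ler_peMr// ?ler1n// ltW.
  have h2 : `|f x - f y| < e / 2.
    have := hr y; rewrite in_itv /=; apply => //.
    rewrite /ball /= in xx' *; have := ler_distD x' x y; lra.
  by have := ler_distD (f x) (f x') (f y); rewrite (distrC (f x') (f x)); lra.
- move=> p [/= p0 hp]; exists (p / 2); first by rewrite divr_gt0.
  move=> x y xab yab xy.
  apply: (hp (p / 2) _ _ x) => //=.
  + by rewrite /= sub0r normrN gtr0_norm ?divr_gt0// ltr_pdivrMr// ltr_pMr// ltr1n.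
  + by rewrite divr_gt0.
Qed.

Section Tent.
Context {R : realType}.
Variables (c r e : R).
Hypothesis e_gt0 : 0 < e.

Definition tent (x : R) : R := Num.max 0 (Num.min 1 ((r + e - `|x - c|) / e)).

Lemma tent_ge0 x : 0 <= tent x. Proof. by rewrite le_max lexx. Qed.

Lemma tent_le1 x : tent x <= 1.
Proof. by rewrite ge_max ler01 ge_min lexx. Qed.

Lemma tent1 x : `|x - c| <= r -> tent x = 1.
Proof.
move=> h; rewrite /tent min_l ?max_r ?ler01//.
by rewrite ler_pdivlMr// mul1r; lra.
Qed.

Lemma tent0 x : r + e <= `|x - c| -> tent x = 0.
Proof.
move=> h; rewrite /tent max_l// ge_min; apply/orP; right.
by rewrite pmulr_lle0 ?invr_gt0// subr_le0.
Qed.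

Lemma tent_continuous : continuous tent.
Proof.
move=> x; apply: (@continuous_max _ R (fun=> 0) (fun x => Num.min 1 ((r + e - `|x - c|) / e))).
  exact: cvg_cst.
apply: (@continuous_min _ R (fun=> 1) (fun x => (r + e - `|x - c|) / e)).
  exact: cvg_cst.
apply: cvgM; last exact: cvg_cst.
apply: cvgB; first exact: cvg_cst.
by apply: cvg_norm; apply: cvgB; [exact: cvg_id|exact: cvg_cst].
Qed.

End Tent.

Section SteinEquation.
Context {R : realType}.
Variable sg : R.
Hypothesis sg_neq0 : sg != 0.
Local Notation mu := (@lebesgue_measure R).
Local Notation phi := (normal_pdf 0 sg).

Definition gauss (F : R -> R) : R := \int[mu]_x (F x * phi x).

Lemma gauss_integrable (F : R -> R) (C : R) : measurable_fun setT F -> (forall x, `|F x| <= C) ->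
  mu.-integrable setT (EFin \o (fun x => F x * phi x)).
Proof.
move=> mF FC; apply: (@le_integrable _ _ _ mu _ _ _ (fun x => (C * phi x)%:E)) => //.
- apply/measurable_realfun.measurable_EFinP; apply: measurable_funM => //; exact: measurable_normal_pdf.
- move=> x _ /=; rewrite lee_fin normrM [leRHS]ger0_norm ?mulr_ge0 ?normal_pdf_ge0//.
    by rewrite (ger0_norm (normal_pdf_ge0 _ _ _)) ler_wpM2r// normal_pdf_ge0.
  exact: le_trans (normr_ge0 _) (FC x).
- have := @integrableZl _ _ _ mu _ measurableT C _ (integrable_normal_pdf 0 sg).
  by apply: eq_integrable.
Qed.

(** The primitive Psi of u phi vanishes outside [-M, M], since u does and has Gaussian mean 0. Then
    f = Psi / (sg^2 phi) solves the equation, with 1 / phi written as a multiple of the exponential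
    E. The derivative f' is continuous with compact support, hence bounded and uniformly
    continuous. *)
Lemma stein_solution (u : R -> R) (C M : R) : 0 < M -> continuous u ->
  (forall x, `|u x| <= C) -> (forall x, M <= `|x| -> u x = 0) -> gauss u = 0 ->
  exists f f' : R -> R, [/\ forall x : R, is_derive x 1 f (f' x),
    forall x, sg ^+ 2 * f' x - x * f x = u x,
      forall e, 0 < e -> exists2 r, 0 < r & forall x y, `|x - y| < r -> `|f' x - f' y| < e
    & exists D, forall x, `|f' x| <= D].
Proof.
move=> M0 uc uC u0 gu0.
pose v x := u x * phi x.
have vc : continuous v by move=> x; apply: cvgM; [exact: uc|exact: continuous_normal_pdf].
have vi : mu.-integrable setT (EFin \o v) by apply: gauss_integrable uC; exact: continuous_measurable_fun.
pose Psi x := (\int[mu]_(t in [set` Interval -oo%O (BRight x)]) v t)%R.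
have dPsi (x : R) : is_derive x 1 Psi (v x).
  have [||||d1 d2] := @continuous_FTC1 _ v -oo%O x (x + 1).
  - by rewrite ltrDl.
  - by apply: integrableS vi => //.
  - exact: ltNyr.
  - exact: vc.
  by apply: (DeriveDef d1); rewrite -derive1E; exact: d2.
have Psi_r x : M <= x -> Psi x = 0.
  move=> Mx; rewrite /Psi -gu0 /gauss Rintegral_mkcond; apply: eq_Rintegral => t _.
  rewrite patchE; case: ifPn => // /negP; rewrite inE /= in_itv /= => /negP; rewrite -ltNge => xt.
  by rewrite u0 ?mul0r// ger0_norm; lra.
have Psi_l x : x <= - M -> Psi x = 0.
  move=> Mx; rewrite /Psi -(@Rintegral_set0 _ _ _ mu v) Rintegral_mkcond [RHS]Rintegral_mkcond.
  apply: eq_Rintegral => t _; rewrite !patchE; case: ifPn => [|_].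
    rewrite inE /= in_itv /= => tx; rewrite ifF; last by apply/negbTE/negP; rewrite inE.
    by rewrite /v u0 ?mul0r// ler0_norm; lra.
  by rewrite ifF//; apply/negbTE/negP; rewrite inE.
have s2 : 0 < sg ^+ 2 by rewrite exprn_even_gt0.
pose E x := expR (x ^+ 2 / (sg ^+ 2 *+ 2)).
have phiE x : phi x * E x = normal_peak sg.
  rewrite normal_pdfE// /normal_fun subr0 -mulrA -expRD -mulrDl addNr mul0r expR0.
  by rewrite mulr1.
pose p := normal_peak sg.
have p0 : 0 < p by exact: normal_peak_gt0.
pose f x := (p * sg ^+ 2)^-1 * (Psi x * E x).
pose f' x := (sg ^+ 2)^-1 * (u x + x * f x).
have dE (x : R) : is_derive x 1 E (E x * (x / sg ^+ 2)).
  have dq : is_derive x 1 (fun x : R => x ^+ 2 / (sg ^+ 2 *+ 2)) (x / sg ^+ 2).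
    apply: is_derive_eq; rewrite /GRing.scale /=; field.
    by rewrite sg_neq0.
  by apply: is_derive_eq; rewrite /GRing.scale /= mulrC.
have df (x : R) : is_derive x 1 f (f' x).
  apply: is_derive_eq; rewrite /GRing.scale /= /f' /f.
  rewrite /p -(phiE x).
  have h1 : phi x != 0 by apply/eqP => h; have := phiE x; rewrite h mul0r => h2; move: p0; rewrite /p -h2 ltxx.
  have h2 : E x != 0 by rewrite gt_eqF// expR_gt0.
  by rewrite /v; field; rewrite sg_neq0 h1 h2.
have f'c : continuous f'.
  move=> x; apply: cvgM; first exact: cvg_cst.
  apply: cvgD; first exact: uc.
  apply: cvgM; first exact: cvg_id.
  by apply: differentiable_continuous; apply/derivable1_diffP; case: (df x).
have f'0 x : M <= `|x| -> f' x = 0.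
  move=> Mx; rewrite /f' /f u0// (_ : Psi x = 0) ?mul0r ?mulr0 ?addr0 ?mulr0//.
  have [x0|x0] := leP 0 x; first by apply: Psi_r; rewrite ger0_norm in Mx.
  by apply: Psi_l; rewrite ltr0_norm// in Mx; lra.
exists f, f'; split => //.
- by move=> x; rewrite /f'; field.
- move=> e e0.
  have [|r r0 hr] := @unif_continuous_itv R f' (- M - 1) (M + 1) _ e e0.
  by apply: continuous_subspaceT.
exists (Num.min r 1) => [|x y]; first by rewrite lt_min r0 ltr01.
rewrite lt_min => /andP[xr x1].
have [xM|xM] := leP M `|x|.
  have [yM|yM] := leP M `|y|; first by rewrite !f'0// subrr normr0.
  apply: hr => //; move: yM; rewrite ltr_norml => /andP[? ?];
  move: x1; rewrite ltr_norml => /andP[? ?]; apply/andP; split; lra.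
move: xM; rewrite ltr_norml => /andP[? ?]; have := x1; rewrite ltr_norml => /andP[? ?].
by apply: hr => //; apply/andP; split; lra.
have MM : - M <= M by rewrite ge0_cp// ltW.
have cM : {within `[- M, M], continuous f'} by apply: continuous_subspaceT.
have [c1 _ h1] := EVT_max MM cM; have [c2 _ h2] := EVT_min MM cM.
exists (`|f' c1| + `|f' c2|) => x.
have [xM|xM] := leP M `|x|; first by rewrite f'0// normr0 addr_ge0.
have xi : x \in `[- M, M] by rewrite in_itv /= -ler_norml ltW.
have := h1 x xi; have := h2 x xi; have := ler_norm (f' c1); have := ler_norm (- f' c2).
rewrite normrN => ? ? ? ?; have := normr_ge0 (f' c1); have := normr_ge0 (f' c2).
rewrite ler_norml => ? ?; apply/andP; split; lra.
Qed.

Lemma gauss_le (F G : R -> R) (C : R) : measurable_fun setT F -> measurable_fun setT G ->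
  (forall x, `|F x| <= C) -> (forall x, `|G x| <= C) -> (forall x, F x <= G x) ->
  gauss F <= gauss G.
Proof.
move=> mF mG FC GC FG; apply: le_Rintegral => //; [exact: gauss_integrable FC|exact: gauss_integrable GC|].
by move=> x _; rewrite ler_wpM2r ?normal_pdf_ge0.
Qed.

Lemma gauss_indic (A : set R) : measurable A -> gauss \1_A = fine (normal_prob 0 sg A).
Proof.
move=> mA; rewrite /gauss /Rintegral /normal_prob [in RHS]integral_mkcond; congr fine.
apply: eq_integral => x _; rewrite patchE indicE.
by case: (x \in A); rewrite ?mul1r ?mul0r.
Qed.

Lemma gauss_cst1 : gauss (fun=> 1) = 1.
Proof.
by rewrite /gauss /Rintegral -[RHS](_ : fine 1%E = 1)// -(integral_normal_pdf 0 sg); congr fine;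
   apply: eq_integral => x _; rewrite mul1r.
Qed.

Lemma normal_prob_itv (a b : R) : a <= b ->
  (normal_prob 0 sg `[a, b] <= (normal_peak sg * (b - a))%:E)%E.
Proof.
move=> ab; rewrite /normal_prob.
apply: (@le_trans _ _ (\int[mu]_(x in `[a, b]) (normal_peak sg)%:E)%E).
  apply: ge0_le_integral => //.
  - by move=> x _; rewrite lee_fin normal_pdf_ge0.
  - by apply/measurable_EFinP; apply: measurable_funTS; exact: measurable_normal_pdf.
  - by move=> x _; rewrite lee_fin normal_pdf_ub.
rewrite integral_cst//= lebesgue_measure_itv /= lte_fin EFinM.
by case: ifPn => // ba; rewrite mule0 -EFinM lee_fin mulr_ge0 ?normal_peak_ge0// subr_ge0.
Qed.

Definition nball (c r : R) : set R := `[c - r, c + r].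

Lemma nballP c r x : nball c r x <-> `|x - c| <= r.
Proof. by rewrite /nball /= in_itv /= ler_distl. Qed.

(** The larger interval exceeds the smaller by two intervals of length e, on which the density is at
    most its peak. *)
Lemma gauss_nball_gap c r e : 0 <= r -> 0 <= e ->
  gauss \1_(nball c (r + e)) <= gauss \1_(nball c r) + 2 * normal_peak sg * e.
Proof.
move=> r0 e0; rewrite !gauss_indic; try exact: measurable_itv.
have mi (a b : R) : measurable (`[a, b] : set (measurableTypeR R)) by exact: measurable_itv.
rewrite -lee_fin EFinD !fineK ?fin_num_measure//; try exact: mi.
apply: (@le_trans _ _ (normal_prob 0 sg ((nball c r `|` `[c - (r + e), c - r]) `|` `[c + r, c + (r + e)]))).
  apply: le_measure; rewrite ?inE //; try (by do ?apply: measurableU; exact: mi).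
  move=> x; rewrite /nball /= !in_itv /= => /andP[h1 h2].
  have [h3|h3] := leP x (c - r); first by left; right; rewrite h1.
  have [h4|h4] := leP x (c + r); first by left; left; rewrite ltW.
  by right; rewrite h2 ltW.
apply: le_trans (measureU2 _ _ _) _; try (by do ?apply: measurableU; exact: mi).
rewrite (_ : 2 * normal_peak sg * e = normal_peak sg * e + normal_peak sg * e); last by ring.
rewrite EFinD addeA; apply: leeD.
  apply: le_trans (measureU2 _ _ _) _; try exact: mi.
  rewrite leeD2l//; apply: le_trans (normal_prob_itv _) _; first lra.
  by rewrite (_ : c - r - (c - (r + e)) = e)//; ring.
apply: le_trans (normal_prob_itv _) _; first lra.
by rewrite (_ : c + (r + e) - (c + r) = e)//; ring.
Qed.

Lemma gauss_nball_cvg e : 0 < e -> exists2 r, 0 < r & 1 - e <= gauss \1_(nball 0 r).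
Proof.
move=> e0.
have mi (n : nat) : measurable (nball 0 n%:R : set (measurableTypeR R)) by exact: measurable_itv.
have h : normal_prob 0 sg (nball 0 n%:R) @[n --> \oo] --> normal_prob 0 sg (\bigcup_n nball 0 n%:R).
  apply: nondecreasing_cvg_mu => //; first exact: bigcup_measurable.
  move=> m n mn; apply/subsetPset => x /nballP h; apply/nballP; apply: le_trans h _.
  by rewrite ler_nat.
have hT : \bigcup_n nball (0 : R) n%:R = setT.
  apply/seteqP; split => // x _; exists (Num.truncn `|x|).+1 => //; apply/nballP.
  by rewrite subr0 ltW// truncnS_gt.
rewrite hT probability_setT in h.
have [N _ hN] : \forall n \near \oo, 1 - e < fine (normal_prob 0 sg (nball 0 n%:R)).
  have h2 : fine (normal_prob 0 sg (nball 0 n%:R)) @[n --> \oo] --> (1 : R) by exact: fine_cvg h.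
  by apply: (cvgr_gt _ h2); rewrite gtrBl.
exists N.+1%:R; first by rewrite ltr0n.
by rewrite gauss_indic; [apply/ltW/hN; rewrite /= leqnSn|exact: mi].
Qed.

End SteinEquation.

Section SteinSums.
Context {R : realType} {S : finType}.
Hypothesis S_gt0 : (0 < #|S|)%N.
Variables (fl : nat -> S -> S) (xi : nat -> S -> R) (h : R) (m : nat).
Hypothesis fl_Ex : forall j (f : S -> R), Ex (fun s => f (fl j s)) = Ex f.
Hypothesis xi_fl : forall i j s, xi i (fl j s) = if i == j then - xi j s else xi i s.
Hypothesis xi_sqr : forall j s, (j < m)%N -> xi j s ^+ 2 = h.

Local Notation sm := (fun s => \sum_(j < m) xi j s).

Lemma sum_flip (j : 'I_m) s : sm (fl j s) = sm s - 2 * xi j s.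
Proof.
rewrite [in LHS](bigD1 j)//= [in RHS](bigD1 j)//= xi_fl eqxx.
rewrite (eq_bigr (fun i : 'I_m => xi i s)); first by ring.
by move=> i ij; rewrite xi_fl ifF//; apply/negbTE.
Qed.

Lemma mean_value (f f' : R -> R) (x y : R) : (forall x : R, is_derive x 1 f (f' x)) ->
  exists2 c, `|c - x| <= `|y - x| & f x - f y = f' c * (x - y).
Proof.
move=> df; have cf z : {for z, continuous f}.
  by apply: differentiable_continuous; apply/derivable1_diffP; case: (df z).
have [xy|yx] := leP x y.
  have [|c] := @MVT_segment R f f' x y xy (fun z _ => df z).
    by apply: continuous_subspaceT.
  rewrite in_itv /= => /andP[c1 c2] e; exists c.
    by rewrite !ger0_norm; lra.
  by rewrite -[LHS]opprB e; ring.
have [|c] := @MVT_segment R f f' y x (ltW yx) (fun z _ => df z).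
  by apply: continuous_subspaceT.
rewrite in_itv /= => /andP[c1 c2] e; exists c; last by [].
by rewrite !ler0_norm; lra.
Qed.

(* Flipping the sign of xi_j changes the sum by 2 xi_j: this is a discrete
   integration by parts. *)
Lemma stein_sum (f f' : R -> R) (w r : R) : 0 <= w -> 0 <= h -> (forall x : R, is_derive x 1 f (f' x)) ->
  4 * h < r ^+ 2 -> 0 < r -> (forall x y, `|x - y| < r -> `|f' x - f' y| < w) ->
  `|Ex (fun s => sm s * f (sm s)) - (m%:R * h) * Ex (fun s => f' (sm s))| <= m%:R * h * w.
Proof.
move=> w0 h0 df hr r0 hw.
have key (j : 'I_m) : `|Ex (fun s => xi j s * f (sm s)) - h * Ex (fun s => f' (sm s))| <= h * w.
  have -> : Ex (fun s => xi j s * f (sm s)) = Ex (fun s => 2^-1 * (xi j s * (f (sm s) - f (sm s - 2 * xi j s)))).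
    have -> : Ex (fun s => xi j s * f (sm s)) = 2^-1 * (Ex (fun s => xi j s * f (sm s)) + Ex (fun s => xi j s * f (sm s))).
      by field.
    rewrite -{2}(fl_Ex j) -ExD -ExZ; apply: eq_Ex => s.
    by rewrite xi_fl eqxx sum_flip; ring.
  have -> : Ex (fun s => 2^-1 * (xi j s * (f (sm s) - f (sm s - 2 * xi j s)))) - h * Ex (fun s => f' (sm s)) =
      Ex (fun s => 2^-1 * (xi j s * (f (sm s) - f (sm s - 2 * xi j s))) - h * f' (sm s)).
    by rewrite ExD; congr (_ + _); rewrite -mulNr -ExZ; apply: eq_Ex => s; rewrite mulNr.
  have hb s : `|2^-1 * (xi j s * (f (sm s) - f (sm s - 2 * xi j s))) - h * f' (sm s)| <= h * w.
    have [c hc ->] := mean_value (sm s) (sm s - 2 * xi j s) df.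
    have -> : 2^-1 * (xi j s * (f' c * (sm s - (sm s - 2 * xi j s)))) - h * f' (sm s) =
       h * (f' c - f' (sm s)) by rewrite -(@xi_sqr j s (ltn_ord j)); field.
    rewrite normrM (ger0_norm h0) ler_wpM2l//; apply/ltW/hw; apply: le_lt_trans hc _.
    (* The intermediate point is within 2 |xi_j| = 2 sqrt h of the sum, and [4 * h < r ^+ 2] keeps
       this below r. *)
    rewrite addrAC subrr add0r normrN.
    rewrite -(@ltr_pXn2r _ 2)// ?nnegrE ?ltW// -normrX ger0_norm ?sqr_ge0//.
    by rewrite exprMn (@xi_sqr j s)// -natrX.
  rewrite ler_norml; apply/andP; split.
    by rewrite -(Ex_cst S_gt0 (- (h * w))); apply: ler_Ex => s; have := hb s; rewrite ler_norml => /andP[].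
  by rewrite -(Ex_cst S_gt0 (h * w)); apply: ler_Ex => s; have := hb s; rewrite ler_norml => /andP[].
have -> : Ex (fun s => sm s * f (sm s)) = \sum_(j < m) Ex (fun s => xi j s * f (sm s)).
  by rewrite -Ex_sum; apply: eq_Ex => s; rewrite mulr_suml.
have -> : m%:R * h * Ex (fun s => f' (sm s)) = \sum_(j < m) h * Ex (fun s => f' (sm s)).
  by rewrite sumr_const card_ord -[RHS]mulr_natl mulrA.
rewrite -sumrB; apply: le_trans (ler_norm_sum _ _ _) _.
apply: (@le_trans _ _ (\sum_(j < m) h * w)); first by apply: ler_sum => j _; exact: key.
by rewrite sumr_const card_ord -[leLHS]mulr_natl mulrA.
Qed.

(** Averaging over the flip of coin j replaces xi_j times the sum by xi_j^2. *)
Lemma sum_moment2 : Ex (fun s => sm s ^+ 2) = m%:R * h.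
Proof.
have -> : m%:R * h = \sum_(j < m) h by rewrite sumr_const card_ord mulr_natl.
have -> : Ex (fun s => sm s ^+ 2) = Ex (fun s => \sum_(j < m) xi j s * sm s).
  by apply: eq_Ex => s; rewrite expr2 mulr_suml.
rewrite Ex_sum; apply: eq_bigr => j _.
have -> : Ex (fun s => xi j s * sm s) = 2^-1 * (Ex (fun s => xi j s * sm s) + Ex (fun s => xi j s * sm s)).
  by field.
rewrite -{2}(fl_Ex j) -ExD -ExZ -[RHS](Ex_cst S_gt0); apply: eq_Ex => s.
by rewrite xi_fl eqxx sum_flip -(@xi_sqr j s)//; field.
Qed.

End SteinSums.

Lemma ocitv_law_unique {R : realType} d (T : measurableType d) (P : probability T R)
    (X : T -> R) (nu : probability (measurableTypeR R) R) :
  (forall C : set R, measurable C -> measurable (X @^-1` C)) ->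
  (forall a b : R, a < b -> nu `]a, b]%classic = P (X @^-1` `]a, b]%classic)) ->
  forall C : set R, measurable C -> nu C = P (X @^-1` C).
Proof.
move=> mX eX C mC.
have mX' : measurable_fun (setT : set T) (X : T -> measurableTypeR R) by move=> _ A mA; rewrite setTI; exact: mX.
pose X' : {mfun T >-> measurableTypeR R} := @mfun_Sub _ _ T (measurableTypeR R) X (mem_set mX').
rewrite -[RHS]/(distribution P X' C).
refine (@measure_unique _ R (measurableTypeR R) (@ocitv R) (fun n => `](- n%:R), n%:R]%classic) _ _ _ _ nu (distribution P X') _ _ C mC) => //.
- exact: ocitvI.
- by move=> n; exact: is_ocitv.
- apply/seteqP; split => // x _; exists (Num.truncn `|x|).+1 => //=.
  have : `|x| < (Num.truncn `|x|).+1%:R by exact: truncnS_gt.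
  by rewrite in_itv /= ltr_norml => /andP[-> /ltW].
- move=> A /ocitvP[->|[[a b] /= ab ->]]; first by rewrite !measure0.
  exact: eX.
- by move=> n; rewrite -ge0_fin_numE// fin_num_measure//; exact: measurable_itv.
Qed.

Section CentralLimit.
Context {R : realType} (U : free_ultrafilter).
Variables (Om : nat -> finType) (pt : forall n, Om n).
Local Notation P := (@loeb_P R U Om pt).
Local Notation Omega := (caratheodory_type (@loeb_mu R U Om pt)).
Local Notation V := (fultra U).
Let UP : ProperFilter V := ultra_proper.

Variables (fl : forall n, nat -> Om n -> Om n) (xi : forall n, nat -> Om n -> R).
Variables (h : nat -> R) (m : nat -> nat) (sg : R).
Hypothesis sg_gt0 : 0 < sg.
Hypothesis h_gt0 : forall n, 0 < h n.
Hypothesis fl_Ex : forall n j (f : Om n -> R), Ex (fun s => f (fl j s)) = Ex f.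
Hypothesis xi_fl : forall n i j (s : Om n), xi i (fl j s) = if i == j then - xi j s else xi i s.
Hypothesis xi_sqr : forall n j (s : Om n), (j < m n)%N -> xi j s ^+ 2 = h n.
Hypothesis h_cvg : h n @[n --> V] --> (0 : R).
Hypothesis mh_cvg : (m n)%:R * h n @[n --> V] --> sg ^+ 2.

Definition coin_sum n (s : Om n) : R := \sum_(j < m n) xi j s.

Let Om_gt0 n : (0 < #|Om n|)%N.
Proof. by apply/card_gt0P; exists (pt n). Qed.

Lemma coin_sum_stein (u : R -> R) (C M : R) : 0 < M -> continuous u ->
  (forall x, `|u x| <= C) -> (forall x, M <= `|x| -> u x = 0) -> gauss sg u = 0 ->
  Ex (fun s => u (coin_sum (n := n) s)) @[n --> V] --> (0 : R).
Proof.
move=> M0 uc uC u0 gu.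
have [f [f' [df fu f'u [D hD]]]] := stein_solution (lt0r_neq0 sg_gt0) M0 uc uC u0 gu.
have D0 : 0 <= D by exact: le_trans (normr_ge0 _) (hD 0).
have s2 : 0 < sg ^+ 2 by rewrite exprn_gt0.
apply/cvgrPdist_lt => e e0.
pose w := e / (2 * (sg ^+ 2 + 1)).
have w0 : 0 < w by rewrite divr_gt0// mulr_gt0// addr_gt0.
have [r r0 hr] := f'u w w0.
pose e1 := Num.min 1 (e / (2 * (D + 1))).
have e10 : 0 < e1 by rewrite lt_min ltr01 divr_gt0// mulr_gt0// ltr_wpDl.
have r4 : 0 < r ^+ 2 / 4 by rewrite divr_gt0// exprn_gt0.
have h1 : \forall n \near V, h n < r ^+ 2 / 4 by apply: (cvgr_lt _ h_cvg).
have /cvgrPdist_lt /(_ _ e10) h2 := mh_cvg.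
apply: filterS2 h1 h2 => n /=.
rewrite ltr_pdivlMr// mulrC => h1; rewrite lt_min => /andP[h2 h3].
rewrite sub0r normrN.
(* Stein's equation at the coin sum, with sg^2 replaced by the actual variance m h: the first term
   is the error in the variance, the second the one bounded by [stein_sum]. *)
have -> : Ex (fun s => u (coin_sum (n := n) s)) = (sg ^+ 2 - (m n)%:R * h n) * Ex (fun s => f' (coin_sum (n := n) s)) -
   (Ex (fun s => coin_sum (n := n) s * f (coin_sum s)) - (m n)%:R * h n * Ex (fun s => f' (coin_sum (n := n) s))).
  rewrite (@eq_Ex _ _ _ (fun s => sg ^+ 2 * f' (coin_sum (n := n) s) + (-1) * (coin_sum s * f (coin_sum s)))).
    by rewrite ExD !ExZ; ring.
  by move=> s; rewrite -fu; ring.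
have st := @stein_sum R (Om n) (Om_gt0 n) (@fl n) (@xi n) (h n) (m n) (@fl_Ex n) (@xi_fl n) (@xi_sqr n) f f' w r
  (ltW w0) (ltW (h_gt0 n)) df h1 r0 hr.
have Db : `|Ex (fun s => f' (coin_sum (n := n) s))| <= D.
  rewrite ler_norml; apply/andP; split.
    by rewrite -(Ex_cst (Om_gt0 n) (- D)); apply: ler_Ex => s; have := hD (coin_sum s); rewrite ler_norml => /andP[].
  by rewrite -(Ex_cst (Om_gt0 n) D); apply: ler_Ex => s; have := hD (coin_sum s); rewrite ler_norml => /andP[].
apply: le_lt_trans (ler_normB _ _) _; rewrite normrM.
have a1 : `|sg ^+ 2 - (m n)%:R * h n| * `|Ex (fun s => f' (coin_sum (n := n) s))| <= `|sg ^+ 2 - (m n)%:R * h n| * D.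
  by rewrite ler_wpM2l.
have a2 : `|sg ^+ 2 - (m n)%:R * h n| * D < e / 2.
  apply: (@le_lt_trans _ _ (`|sg ^+ 2 - (m n)%:R * h n| * (D + 1) - `|sg ^+ 2 - (m n)%:R * h n|)); first by rewrite mulrDr mulr1 addrK.
  move: h3; rewrite ltr_pdivlMr; last by rewrite mulr_gt0// ltr_wpDl.
  have := normr_ge0 (sg ^+ 2 - (m n)%:R * h n); set q := `|_|; nra.
have a3 : (m n)%:R * h n * w <= e / 2.
  have : (m n)%:R * h n <= sg ^+ 2 + 1 by move: h2; rewrite ltr_norml => /andP[]; lra.
  move=> /(ler_wpM2r (ltW w0)) /le_trans; apply; rewrite /w le_eqVlt; apply/orP; left; apply/eqP.
  by field; rewrite gt_eqF// addr_gt0.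
apply: le_lt_trans (lerD a1 st) _; lra.
Qed.

Lemma coin_sum_small n r : 0 < r -> Pr [set s | r <= `|coin_sum (n := n) s|] <= (m n)%:R * h n / r ^+ 2.
Proof.
move=> r0.
have r2 : 0 < r ^+ 2 by rewrite exprn_gt0.
rewrite -(@sum_moment2 R (Om n) (Om_gt0 n) (@fl n) (@xi n) (h n) (m n) (@fl_Ex n) (@xi_fl n) (@xi_sqr n)).
apply: markov_Pr => // s; first exact: sqr_ge0.
by move=> /= h1; rewrite -[leRHS]ger0_norm ?sqr_ge0// normrX ler_pXn2r// ?nnegrE ltW.
Qed.

(** Stein's equation is solved for test functions with compact support and Gaussian mean 0, so F
    cannot be centred by a constant. It is centred by a multiple of a wide tent G, through gauss G *
    F - gauss F * G; both the Gaussian mean and the expectation of G are close to 1. *)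
Lemma coin_sum_clt (F : R -> R) (M : R) : 0 < M -> continuous F ->
  (forall x, 0 <= F x <= 1) -> (forall x, M <= `|x| -> F x = 0) ->
  Ex (fun s => F (coin_sum (n := n) s)) @[n --> V] --> gauss sg F.
Proof.
move=> M0 Fc F01 F0; have sg0 := lt0r_neq0 sg_gt0.
have s2 : 0 < sg ^+ 2 by rewrite exprn_gt0.
have F1 x : `|F x| <= 1 by have /andP[a b] := F01 x; rewrite ger0_norm.
have mF : measurable_fun setT F by exact: continuous_measurable_fun.
have m1 : measurable_fun (setT : set (measurableTypeR R)) (fun=> 1 : R) by exact: measurable_cst.
have gF0 : 0 <= gauss sg F.
  have -> : 0 = gauss sg (fun=> 0) by rewrite /gauss (eq_Rintegral _ (g := fun=> 0)) ?Rintegral_cst ?mul0r// => x _; rewrite mul0r.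
  by apply: (@gauss_le _ _ _ _ 1) => // x; [rewrite normr0|case/andP: (F01 x)].
have gF1 : gauss sg F <= 1.
  by rewrite -(gauss_cst1 sg); apply: (@gauss_le _ _ _ _ 1) => // x; [rewrite normr1|case/andP: (F01 x)].
apply/cvgrPdist_lt => e e0; pose e1 := e / 4; have e10 : 0 < e1 by rewrite divr_gt0.
have [r1 r10 hr1] := gauss_nball_cvg sg e10.
(* Wide enough for the Gaussian mass outside [-r, r] and for the Chebyshev bound (sg^2 + 1) / r^2 to
   be at most e / 4. *)
pose r := Num.max r1 (Num.max 1 ((sg ^+ 2 + 1) / e1)).
have rr1 : r1 <= r by rewrite le_max lexx.
have r1' : 1 <= r by rewrite !le_max lexx orbT.
have r0 : 0 < r by exact: lt_le_trans r1'.
have re : (sg ^+ 2 + 1) / r ^+ 2 <= e1.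
  have h1 : (sg ^+ 2 + 1) / e1 <= r by rewrite !le_max lexx !orbT.
  rewrite ler_pdivrMr ?exprn_gt0//; move: h1; rewrite ler_pdivrMr// => h1.
  apply: (le_trans h1); rewrite mulrC ler_pM2l// expr2 ler_peMr// ltW//.
pose G := tent 0 r 1.
have G1 x : `|G x| <= 1 by rewrite ger0_norm ?tent_le1// tent_ge0.
have Gc : continuous G by exact: tent_continuous.
have mG : measurable_fun setT G by exact: continuous_measurable_fun.
have gG1 : gauss sg G <= 1.
  by rewrite -(gauss_cst1 sg); apply: (@gauss_le _ _ _ _ 1) => // x; [rewrite normr1|exact: tent_le1].
have gGe : 1 - e1 <= gauss sg G.
  apply: (le_trans hr1); apply: (@gauss_le _ _ _ _ 1) => //.
  - by apply: measurable_indic; exact: measurable_itv.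
  - by move=> x; rewrite indicE; case: (_ \in _); rewrite ?normr1 ?normr0.
  move=> x; rewrite indicE; case: (boolP (x \in _)) => [|_]; last exact: tent_ge0.
  by rewrite inE => /nballP xr; rewrite /G tent1// (le_trans xr).
pose u x := gauss sg G * F x - gauss sg F * G x.
have iF : lebesgue_measure.-integrable setT (EFin \o (fun x => F x * normal_pdf 0 sg x)) by exact: gauss_integrable F1.
have iG : lebesgue_measure.-integrable setT (EFin \o (fun x => G x * normal_pdf 0 sg x)) by exact: gauss_integrable G1.
have gu : gauss sg u = 0.
  rewrite /gauss /u; transitivity (\int[lebesgue_measure]_x (gauss sg G * (F x * normal_pdf 0 sg x) - gauss sg F * (G x * normal_pdf 0 sg x))).
    by apply: eq_Rintegral => x _; ring.
  rewrite RintegralB//; last 2 first.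
  - by have := integrableZl measurableT (gauss sg G) iF; apply: eq_integrable.
  - by have := integrableZl measurableT (gauss sg F) iG; apply: eq_integrable.
  by rewrite !RintegralZl// -/(gauss sg F) -/(gauss sg G); ring.
have gG0 : 0 <= gauss sg G.
  have -> : 0 = gauss sg (fun=> 0) by rewrite /gauss (eq_Rintegral _ (g := fun=> 0)) ?Rintegral_cst ?mul0r// => x _; rewrite mul0r.
  by apply: (@gauss_le _ _ _ _ 1) => // x; [rewrite normr0|exact: tent_ge0].
have uc : continuous u.
  by move=> x; apply: cvgB; apply: cvgM; try exact: cvg_cst; [exact: Fc|exact: Gc].
have uC x : `|u x| <= 2.
  apply: (le_trans (ler_normB _ _)); rewrite !normrM (ger0_norm gF0) (ger0_norm gG0).
  by have := ler_pM gG0 (normr_ge0 _) gG1 (F1 x); have := ler_pM gF0 (normr_ge0 _) gF1 (G1 x); lra.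
have u0 x : M + (r + 1) <= `|x| -> u x = 0.
  move=> xM; rewrite /u F0 ?/G ?tent0 ?mulr0 ?subrr// ?subr0; lra.
have M1 : 0 < M + (r + 1) by lra.
have := coin_sum_stein M1 uc uC u0 gu => /cvgrPdist_lt /(_ _ e10) c1.
have /cvgrPdist_lt /(_ _ ltr01) c2 := mh_cvg.
apply: filterS2 c1 c2 => n /=; rewrite sub0r normrN => c1 c2.
have eu : Ex (fun s => u (coin_sum (n := n) s)) = gauss sg G * Ex (fun s => F (coin_sum (n := n) s)) - gauss sg F * Ex (fun s => G (coin_sum (n := n) s)).
  by rewrite -!ExZ -mulN1r -ExZ -ExD; apply: eq_Ex => s; rewrite mulN1r.
have eF0 : 0 <= Ex (fun s => F (coin_sum (n := n) s)) by apply: Ex_ge0 => s; case/andP: (F01 (coin_sum s)).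
have eF1 : Ex (fun s => F (coin_sum (n := n) s)) <= 1.
  by rewrite -[leRHS](Ex_cst (Om_gt0 n)); apply: ler_Ex => s; case/andP: (F01 (coin_sum s)).
have eG1 : Ex (fun s => G (coin_sum (n := n) s)) <= 1.
  by rewrite -[leRHS](Ex_cst (Om_gt0 n)); apply: ler_Ex => s; exact: tent_le1.
have eGe : 1 - e1 <= Ex (fun s => G (coin_sum (n := n) s)).
  have b1 : Pr [set s | r <= `|coin_sum (n := n) s|] <= e1.
    apply: (le_trans (coin_sum_small n r0)); apply: le_trans re.
    rewrite ler_pM2r ?invr_gt0 ?exprn_gt0//; move: c2; rewrite ltr_norml => /andP[]; lra.
  have b2 : 1 <= Ex (fun s => G (coin_sum (n := n) s)) + Pr [set s | r <= `|coin_sum (n := n) s|].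
    rewrite -ExD -[leLHS](Ex_cst (Om_gt0 n)); apply: ler_Ex => s.
    rewrite indicE; case: (boolP (s \in _)) => [_|]; first by rewrite lerDr tent_ge0.
    rewrite notin_setE /= => /negP; rewrite -ltNge => sr.
    by rewrite addr0 /G tent1// subr0 ltW.
  lra.
move: c1; rewrite eu ltr_norml => /andP[c1 c1'].
set x := Ex (fun s => F _) in c1 c1' eF0 eF1 *; set y := Ex (fun s => G _) in c1 c1' eG1 eGe *.
have p1 : (1 - gauss sg G) * x <= e1 by nra.
have p2 : 0 <= (1 - gauss sg G) * x by rewrite mulr_ge0// subr_ge0.
have p3 : gauss sg F * (1 - y) <= e1 by nra.
have p4 : 0 <= gauss sg F * (1 - y) by rewrite mulr_ge0// subr_ge0.
rewrite ltr_norml; apply/andP; split; rewrite /e1 in c1 c1' p1 p3; lra.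
Qed.

Lemma coin_sum_stbdd : {ae P, forall w, stbdd coin_sum w}.
Proof.
apply: tight_stbdd => e e0; pose r := Num.max 1 ((sg ^+ 2 + 1) / e).
have r1' : 1 <= r by rewrite !le_max lexx.
have r0 : 0 < r by exact: lt_le_trans r1'.
exists r; have /cvgrPdist_lt /(_ _ ltr01) := mh_cvg; apply: filterS => n /= c2.
apply: (le_trans (coin_sum_small n r0)).
have h1 : (sg ^+ 2 + 1) / e <= r by rewrite !le_max lexx !orbT.
rewrite ler_pdivrMr ?exprn_gt0//; move: h1; rewrite ler_pdivrMr// => h1.
apply: (@le_trans _ _ (r * e)); last by rewrite mulrC ler_pM2l// expr2 ler_peMr// ltW.
by apply: le_trans h1; move: c2; rewrite ltr_norml => /andP[]; lra.
Qed.

(** Intervals are enclosed between tents, to which the central limit theorem applies; passing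
    between the coin sum and its standard part costs an enlargement by e. The boundedness of the
    density makes all these enlargements negligible, and half-open intervals determine a law. *)
Lemma coin_sum_law (C : set R) : measurable C ->
  P [set w | C (st coin_sum w)] = normal_prob 0 sg C.
Proof.
have sg0 := lt0r_neq0 sg_gt0; set p := normal_peak sg.
have p0 : 0 < p by exact: normal_peak_gt0.
have mS : measurable_fun (setT : set Omega) (st coin_sum : Omega -> measurableTypeR R).
  by apply: (@measurable_wrt_fun R U Om pt (fun n => setT)) => //; apply: st_measurable_wrt.
have mi c r : measurable (nball c r : set (measurableTypeR R)) by exact: measurable_itv.
have i1 (A : set R) x : `|\1_A x| <= 1 :> R by rewrite indicE; case: (_ \in _); rewrite ?normr1 ?normr0.
have mI c r : measurable_fun (setT : set (measurableTypeR R)) (\1_(nball c r) : R -> R) by exact: measurable_indic (mi c r).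
have mT c r e : measurable_fun setT (tent c r e : R -> R).
  by apply: continuous_measurable_fun; exact: tent_continuous.
have t1 c r e x : `|tent c r e x| <= 1 :> R by rewrite ger0_norm ?tent_le1 ?tent_ge0.
have clt c r e : 0 < e -> 0 < r -> Ex (fun s => tent c r e (coin_sum (n := n) s)) @[n --> V] --> gauss sg (tent c r e).
  move=> e0 r0; apply: (@coin_sum_clt _ (`|c| + r + e)).
  - by have := normr_ge0 c; lra.
  - exact: tent_continuous.
  - by move=> x; rewrite tent_ge0 tent_le1.
  - move=> x hx; apply: tent0 => //; have := ler_distD c x 0; rewrite !subr0; lra.
have Pfin X : P X = (fine (P X))%:E by rewrite P_EFin.
have Ple X Y : X `<=` Y -> fine (P X) <= fine (P Y).
  by move=> XY; rewrite -lee_fin -!Pfin; exact: P_le.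
have Pin A : fine (P (internal U A)) = uPr U A by rewrite loeb_PE.
have ndiv : P [set w | ~ stbdd coin_sum w] = 0%E by apply: negligible_P0; exact: coin_sum_stbdd.
have Pdiv X : fine (P (X `|` [set w | ~ stbdd coin_sum w])) <= fine (P X).
  rewrite -lee_fin -!Pfin; apply: (@le_trans _ _ (P X + P [set w | ~ stbdd coin_sum w])%E).
    exact: (@outer_measureU2 _ _ (@loeb_mu R U Om pt)).
  by rewrite ndiv adde0.
have cU (A : forall n, set (Om n)) : Pr (A n) @[n --> V] --> uPr (R := R) V A by exact: uPr_cvg.
have up c r e : 0 < r -> 0 < e -> fine (P [set w | nball c r (st coin_sum w)]) <= gauss sg \1_(nball c r) + 4 * p * e.
  move=> r0 e0.
  have h1 : fine (P [set w | nball c r (st coin_sum w)]) <= uPr (R := R) U (fun n => [set s | nball c (r + e) (coin_sum (n := n) s)]).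
    rewrite -Pin; apply: le_trans (Pdiv _); apply: Ple => w /nballP h1.
    have [h2|h2] := pselect (stbdd coin_sum w); [left|by right].
    have /cvgrPdist_lt /(_ _ e0) : coin_sum (w n) @[n --> V] --> st coin_sum w by exact: h2.
    apply: filterS => n /= h3; apply/nballP.
    have := ler_distD (st coin_sum w) (coin_sum (w n)) c.
    by rewrite (distrC (coin_sum (w n)) (st coin_sum w)); lra.
  have re0 : 0 < r + e by rewrite addr_gt0.
  have h2 : uPr (R := R) U (fun n => [set s | nball c (r + e) (coin_sum (n := n) s)]) <= gauss sg (tent c (r + e) e).
    apply: (ler_cvg_to (cU _) (clt c _ _ e0 re0)); apply: filterE => n.
    apply: ler_Ex => s; rewrite indicE; case: (boolP (s \in _)) => [|_]; last exact: tent_ge0.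
    by rewrite inE => /nballP sn; rewrite tent1.
  have h3 : gauss sg (tent c (r + e) e) <= gauss sg \1_(nball c (r + (e + e))).
    apply: (gauss_le (C := 1) _ (mT _ _ _) (mI _ _)) => // x; rewrite indicE.
    case: (boolP (x \in _)) => [_|]; first exact: tent_le1.
    rewrite notin_setE => hx; rewrite tent0// -addrA leNgt; apply/negP => /ltW sn; apply: hx; exact/nballP.
  have ee : 0 <= e + e by lra.
  have h4 := gauss_nball_gap sg0 c (ltW r0) ee.
  rewrite -/p in h4; nra.
have low c r e : 0 < e -> 2 * e < r ->
    gauss sg \1_(nball c r) <= fine (P [set w | nball c (r - e) (st coin_sum w)]) + 4 * p * e.
  move=> e0 er; have r2 : 0 < r - (e + e) by lra.
  have h1 : gauss sg \1_(nball c (r - (e + e))) <= gauss sg (tent c (r - (e + e)) e).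
    apply: (gauss_le (C := 1) _ (mI _ _) (mT _ _ _)) => // x; rewrite indicE.
    case: (boolP (x \in _)) => [|_]; last exact: tent_ge0.
    by rewrite inE => /nballP sn; rewrite tent1.
  have h2 : gauss sg (tent c (r - (e + e)) e) <= uPr (R := R) U (fun n => [set s | nball c (r - e) (coin_sum (n := n) s)]).
    apply: (ler_cvg_to (clt c _ _ e0 r2) (cU _)); apply: filterE => n.
    apply: ler_Ex => s; rewrite indicE; case: (boolP (s \in _)) => [_|]; first exact: tent_le1.
    rewrite notin_setE => hx; rewrite tent0// leNgt; apply/negP => sn; apply: hx; apply/nballP; lra.
  have h3 : uPr (R := R) U (fun n => [set s | nball c (r - e) (coin_sum (n := n) s)]) <= fine (P [set w | nball c (r - e) (st coin_sum w)]).
    rewrite -Pin; apply: le_trans (Pdiv _); apply: Ple => w hw.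
    have [h2'|h2'] := pselect (stbdd coin_sum w); [left|by right].
    have c1 : `|coin_sum (w n) - c| @[n --> V] --> `|st coin_sum w - c|.
      by apply: cvg_norm; apply: cvgB; [exact: h2'|exact: cvg_cst].
    apply/nballP; apply: (ler_cvg_to c1 (cvg_cst (r - e))).
    by apply: filterS hw => n /nballP.
  have ee : 0 <= e + e by lra.
  have h4 := gauss_nball_gap sg0 c (ltW r2) ee; rewrite subrK -/p in h4; nra.
move=> mC; apply/esym.
have mX (X : set R) : measurable X -> measurable (st coin_sum @^-1` X : set Omega).
  by move=> hX; rewrite -[X in measurable X]setTI; exact: mS.
apply: (ocitv_law_unique mX) => // a b ab.
change (normal_prob 0 sg `]a, b]%classic = P (st coin_sum @^-1` `]a, b]%classic)).
have mab : measurable (`]a, b] : set (measurableTypeR R)) by exact: measurable_itv.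
rewrite [RHS]Pfin -(fineK (fin_num_measure (normal_prob 0 sg) _ mab)); congr EFin.
rewrite -gauss_indic//; pose c := (a + b) / 2; pose r := (b - a) / 2.
have r0 : 0 < r by rewrite divr_gt0// subr_gt0.
have sub1 : `]a, b] `<=` nball c r.
  by move=> x; rewrite /= in_itv /= => /andP[h1 h2]; apply/nballP; rewrite ler_distl /c /r; lra.
have sub2 e : 0 < e -> nball c (r - e) `<=` `]a, b].
  by move=> e0 x /nballP; rewrite ler_distl /c /r /= in_itv /= => /andP[h1 h2]; apply/andP; split; lra.
have gsub (X Y : set R) : measurable X -> measurable Y -> X `<=` Y -> gauss sg \1_X <= gauss sg \1_Y.
  move=> hX hY XY; apply: (@gauss_le _ _ _ _ 1) => //.
  move=> x; rewrite !indicE; case: (boolP (x \in X)) => [|_]; last by rewrite ler0n.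
  by rewrite inE => /XY xY; rewrite mem_set.
have key e : 0 < e -> 2 * e < r -> `|gauss sg \1_`]a, b] - fine (P (st coin_sum @^-1` `]a, b]))| <= 6 * p * e.
  move=> e0 er; rewrite ler_distl.
  have re : 0 < r - e by lra.
  have := up c r e r0 e0; have := low c r e e0 er.
  have := gauss_nball_gap sg0 c (ltW re) (ltW e0); rewrite subrK -/p.
  have := gsub _ _ mab (mi c r) sub1; have := gsub _ _ (mi c (r - e)) mab (sub2 e e0).
  have : fine (P [set w | nball c (r - e) (st coin_sum w)]) <= fine (P (st coin_sum @^-1` `]a, b])).
    by apply: Ple => w /=; exact: sub2.
  have : fine (P (st coin_sum @^-1` `]a, b])) <= fine (P [set w | nball c r (st coin_sum w)]).
    by apply: Ple => w; exact: sub1.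
  have : 0 < p * e by rewrite mulr_gt0.
  by move=> *; apply/andP; split; nra.
apply/eqP; rewrite -subr_eq0 -normr_le0; apply/ler_addgt0Pr => e e0; rewrite add0r.
pose e1 := Num.min (e / (6 * p)) (r / 3).
have e10 : 0 < e1 by rewrite lt_min; apply/andP; split; apply: divr_gt0 => //; exact: mulr_gt0.
apply: le_trans (key e1 e10 _) _.
  have : e1 <= r / 3 by rewrite ge_min lexx orbT.
  lra.
have : e1 <= e / (6 * p) by rewrite ge_min lexx.
by rewrite ler_pdivlMr ?mulr_gt0// mulrC.
Qed.

End CentralLimit.

(** * Brownian motion *)

Section TimeGrid.
Context {R : realType}.
Variable hn : nat -> R.
Hypothesis hn_gt0 : forall n, 0 < hn n.

Definition time_index (n : nat) (t : R) : nat := Num.truncn (t / hn n).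

Lemma time_index_itv n t : 0 <= t -> hn n * (time_index n t)%:R <= t < hn n * (time_index n t).+1%:R.
Proof.
move=> t0; have /truncn_itv /andP[h1 h2] : 0 <= t / hn n by rewrite divr_ge0// ltW.
by rewrite mulrC -ler_pdivlMr// h1 /= mulrC -ltr_pdivrMr.
Qed.

Lemma time_index_le n t : 0 <= t -> hn n * (time_index n t)%:R <= t.
Proof. by move=> /(time_index_itv n)/andP[]. Qed.

Lemma time_index0 n : time_index n 0 = 0%N.
Proof. by rewrite /time_index mul0r truncn0. Qed.

Lemma time_index_mono n s t : s <= t -> (time_index n s <= time_index n t)%N.
Proof. by move=> st; apply: le_truncn; rewrite ler_pM2r ?invr_gt0. Qed.

Lemma time_index_sub n s t : 0 <= s -> s <= t ->
  hn n * (time_index n t - time_index n s)%:R <= t - s + hn n.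
Proof.
move=> s0 st; have /andP[h1 h2] := time_index_itv n (le_trans s0 st).
have /andP[h3 h4] := time_index_itv n s0.
rewrite natrB ?time_index_mono// mulrBr; move: h4; rewrite -natr1 mulrDr mulr1; lra.
Qed.

Lemma time_index_cvg t : 0 <= t -> hn n @[n --> \oo] --> (0 : R) ->
  hn n * (time_index n t)%:R @[n --> \oo] --> t.
Proof.
move=> t0 hc; apply/cvgrPdist_lt => e e0.
move/cvgrPdist_lt : hc => /(_ _ e0); apply: filterS => n /=.
rewrite sub0r normrN gtr0_norm// => hne.
have /andP[h1 h2] := time_index_itv n t0.
by rewrite ger0_norm ?subr_ge0//; move: h2; rewrite -natr1 mulrDr mulr1; lra.
Qed.

End TimeGrid.

Section CoinWalk.
Context {R : realType} (U : free_ultrafilter) {d : nat}.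
Variables (hn : nat -> R) (Nn : nat -> nat).
Hypothesis hn_gt0 : forall n, 0 < hn n.
Hypothesis hn_cvg : hn n @[n --> \oo] --> (0 : R).
Hypothesis Nn_big : forall n, n%:R <= hn n * (Nn n)%:R.

Definition coins n : finType := @coin_space d (Nn n).
Definition coins0 n : coins n := [ffun=> false].
Local Notation P := (@loeb_P R U coins coins0).
Local Notation Omega := (caratheodory_type (@loeb_mu R U coins coins0)).
Local Notation V := (fultra U).
Local Notation time_index := (time_index hn).
Let UP : ProperFilter V := ultra_proper.

Let hn_ge0 n : 0 <= hn n. Proof. exact: ltW. Qed.

Lemma time_index_N n t : 0 <= t -> t <= n%:R -> (time_index n t <= Nn n)%N.
Proof.
move=> t0 tn; rewrite -(ler_nat R) -(ler_pM2l (hn_gt0 n)).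
exact: le_trans (time_index_le hn_gt0 n t0) (le_trans tn (Nn_big n)).
Qed.

Definition coin_sets (S : forall n, {set @coin_index d (Nn n)}) n : set (set (coins n)) :=
  [set A | depends_on (S n) (A : {ffun _ -> bool} -> Prop)].
Arguments coin_sets : clear implicits.
Implicit Types S : forall n, {set @coin_index d (Nn n)}.

Lemma coin_setsC S n A : coin_sets S n A -> coin_sets S n (~` A).
Proof. by move=> hA s s' ss; rewrite /setC /mkset (hA s s' ss). Qed.

Lemma coin_setsI S n A B : coin_sets S n A -> coin_sets S n B -> coin_sets S n (A `&` B).
Proof. by move=> hA hB s s' ss; rewrite /setI /mkset (hA s s' ss) (hB s s' ss). Qed.

Lemma coin_setsT S n : coin_sets S n setT.
Proof. by []. Qed.

Lemma coin_sets_sub S S' n : S n \subset S' n -> coin_sets S n `<=` coin_sets S' n.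
Proof. by move=> /fintype.subsetP SS A hA s s' ss; apply: hA => u /SS; exact: ss. Qed.

Lemma coin_sets_fun S n (f : coins n -> R) c : depends_on (S n) (f : {ffun _ -> bool} -> R) ->
  coin_sets S n [set s | c <= f s].
Proof. by move=> hf s s' ss; rewrite /mkset (hf s s' ss). Qed.

Lemma coin_sets_indep S S' n A B : (forall u, u \in S n -> u \in S' n -> False) -> coin_sets S n A -> coin_sets S' n B ->
  Pr (R := R) (A `&` B) = Pr A * Pr B.
Proof.
move=> SS hA hB; rewrite /Pr -(@coins_indep _ _ (S n)).
- by apply: eq_Ex => s; rewrite indicI.
- by move=> s s' ss; rewrite !indicE; congr (nat_of_bool _)%:R;
    apply/idP/idP; rewrite !inE (hA s s' ss).
- move=> s s' ss; rewrite !indicE; congr (nat_of_bool _)%:R.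
  have h : B s = B s'.
    apply: hB => u uS'; apply: ss; rewrite inE; apply/negP => uS.
    exact: SS uS uS'.
  by apply/idP/idP; rewrite !inE h.
Qed.

Definition coin_sigma S : set (set Omega) := completed_sigma (U := U) (pt := coins0) (coin_sets S).

Lemma coin_sigma_indep S S' (X Y : set Omega) : (forall n u, u \in S n -> u \in S' n -> False) ->
  coin_sigma S X -> coin_sigma S' Y -> P (X `&` Y) = (P X * P Y)%E.
Proof.
move=> SS; apply: completed_sigma_indep.
- by move=> n A B; exact: coin_setsI.
- by move=> n A B; exact: coin_setsI.
- by move=> n A B; apply: coin_sets_indep; exact: SS.
Qed.

Lemma coin_sigma_sub S S' : (forall n, S n \subset S' n) -> coin_sigma S `<=` coin_sigma S'.
Proof. by move=> SS; apply: sub_completed_sigma => n; exact: coin_sets_sub. Qed.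

Lemma coin_sigma_st S (f : forall n, coins n -> R) (Y : Omega -> R) :
  (forall n, depends_on (S n) (f n : {ffun _ -> bool} -> R)) ->
  {ae P, forall w, st f w = Y w} -> measurable_wrt (coin_sigma S) Y.
Proof.
move=> hf; apply: measurable_wrt_ae.
- exact: coin_setsC.
- exact: coin_setsT.
- by apply: st_measurable_wrt; [exact: coin_setsC|exact: coin_setsI|move=> n c; exact: coin_sets_fun].
Qed.

Lemma xi_depends n (S : {set @coin_index d (Nn n)}) lm j :
  (forall i : 'I_(Nn n), i = j :> nat -> (i, lm) \in S) ->
  depends_on S (xi (hn n) lm j : {ffun _ -> bool} -> R).
Proof.
move=> hS s s' ss; rewrite /xi; case: insubP => [i _ ij|//].
by rewrite /coin ss// hS.
Qed.

Definition walk (lm : 'I_d * 'I_d) (t : R) n (s : coins n) : R := \sum_(j < time_index n t) xi (hn n) lm j s.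

(** The shape is that of a weight a j times an integrand H j in [mtransf_moment4]: the indicator is
    the weight, and the factor 1 the integrand. *)
Lemma walk_sub lm s t n w : 0 <= s -> s <= t ->
  walk lm t (n := n) w - walk lm s w = \sum_(j < time_index n t) ((time_index n s <= j)%:R * 1) * xi (hn n) lm j w.
Proof.
move=> s0 st; have le := time_index_mono hn_gt0 n st.
rewrite /walk -!(big_mkord xpredT (fun j => xi (hn n) lm j w)) -(big_mkord xpredT (fun j => ((time_index n s <= j)%:R * 1) * xi (hn n) lm j w)).
rewrite (big_cat_nat (n := time_index n s))//= [RHS](big_cat_nat (n := time_index n s))//= addrAC subrr add0r.
rewrite [X in _ = X + _]big_nat_cond [X in _ = X + _]big1 ?add0r.
  by apply: eq_big_nat => j /andP[-> _]; rewrite !mul1r.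
by move=> j /andP[/andP[_ js] _]; rewrite leqNgt js !mul0r.
Qed.

Lemma walk_tail lm (L : nat) : exists2 C : R, 0 <= C & forall (n : nat) (s t l : R),
  0 <= s <= L%:R -> 0 <= t <= L%:R -> 0 < l ->
  Pr (R := R) [set w | l <= `|walk lm t (n := n) w - walk lm s w|] <=
    C * (`|t - s| + hn n) ^+ 2 * (l ^- 2 + l ^- 4).
Proof.
(* The constant is 3^2, from the fourth moment bound (3 (t - s + h))^2; the walk has no drift part,
   so the term l^-2 is mere slack. *)
exists 9 => // n s t l.
have key s' t' : 0 <= s' -> s' <= t' -> 0 < l ->
  Pr (R := R) [set w | l <= `|walk lm t' (n := n) w - walk lm s' w|] <=
    9 * (t' - s' + hn n) ^+ 2 * (l ^- 2 + l ^- 4).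
  move=> s0 st l0.
  have cg := @card_coins (@coin_index d (Nn n)).
  have m4 := @mtransf_moment4 R (coins n) cg (@xi_flip d (Nn n) lm) (fun j => xi (hn n) lm j) (fun _ _ => 1) (hn n)
    (xi_flip_Ex lm) (xi_flip1 (hn n) lm) (fun _ _ _ _ => erefl) (xi_sqr (hn_gt0 n) lm)
    (fun j => (time_index n s' <= j)%:R) 1 ler01 (time_index n t').
  have {}m4 := m4 (fun j _ => _); rewrite /mtransf in m4.
  have e1 : Ex (fun w => (walk lm t' (n := n) w - walk lm s' w) ^+ 4) <= (3 * (t' - s' + hn n)) ^+ 2.
    under eq_Ex do rewrite walk_sub//.
    apply: (le_trans (m4 _)); first by rewrite !expr1n Ex_cst.
    have -> : \sum_(j < time_index n t') (time_index n s' <= j)%:R ^+ 2 = (time_index n t' - time_index n s')%:R :> R.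
      rewrite -(big_mkord xpredT (fun j => (time_index n s' <= j)%:R ^+ 2)).
      rewrite (big_cat_nat (n := time_index n s'))//= ?time_index_mono// big_nat_cond big1 ?add0r.
        rewrite (@eq_big_nat _ _ _ _ _ _ (fun=> 1)); first by rewrite sumr_const_nat.
        by move=> j /andP[-> _]; rewrite expr1n.
      by move=> j /andP[/andP[_ js] _]; rewrite leqNgt js expr0n.
    have := time_index_sub hn_gt0 n s0 st; set q := hn n * _ => hq.
    rewrite mulr1 -mulrA -/q; apply: sqr_le; first by rewrite !mulr_ge0.
    by rewrite ler_wpM2l.
  have l4 : 0 < l ^+ 4 by rewrite exprn_gt0.
  apply: (@le_trans _ _ ((3 * (t' - s' + hn n)) ^+ 2 / l ^+ 4)).
    apply: (@le_trans _ _ (Ex (fun w => (walk lm t' (n := n) w - walk lm s' w) ^+ 4) / l ^+ 4)); last first.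
      by rewrite ler_pM2r// invr_gt0.
    apply: markov_Pr => // w; first by rewrite (_ : 4 = 2 * 2)%N// exprM sqr_ge0.
    move=> /= lw; rewrite [leRHS](_ : _ = `|walk lm t' w - walk lm s' w| ^+ 4).
      by rewrite ler_pXn2r ?nnegrE// ltW.
    by rewrite -normrX ger0_norm// (_ : 4 = 2 * 2)%N// exprM sqr_ge0.
  rewrite exprMn (_ : 3 ^+ 2 = 9 :> R); last by ring.
  apply: ler_wpM2l; first by rewrite mulr_ge0// sqr_ge0.
  by rewrite lerDr invr_ge0 exprn_ge0// ltW.
move=> /andP[s0 sL] /andP[t0 tL] l0; have [st|ts] := leP s t.
  by rewrite ger0_norm ?subr_ge0//; exact: key.
rewrite ltr0_norm ?subr_lt0// opprB.
by have := key t s t0 (ltW ts) l0; under eq_set do rewrite distrC.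
Qed.

Lemma walk0 lm n (w : coins n) : walk lm 0 w = 0.
Proof. by rewrite /walk time_index0 big_ord0. Qed.

Lemma ae_forall_fin (I : finType) (Q : I -> Omega -> Prop) :
  (forall i, {ae P, forall w, Q i w}) -> {ae P, forall w, forall i, Q i w}.
Proof.
move=> h; have : {ae P, forall w, forall k : nat, if unpickle k is Some i then Q i w else True}.
  by apply: ae_forall_nat => k; case: (unpickle k) => // ; exact: aeW.
by apply: filterS => w hw i; have := hw (pickle i); rewrite pickleK.
Qed.

Definition brownian_good : set Omega := [set w | forall lm, grid_good (walk lm) w].

Lemma brownian_good_ae : {ae P, forall w, brownian_good w}.
Proof.
apply: ae_forall_fin => lm; apply: ae_negligible.
exact: (grid_good_ae U coins0 hn_ge0 hn_cvg (walk0 lm) (walk_tail lm)).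
Qed.

(** The value 0 on a null set makes every path continuous, as [brownian_matrix] requires. *)
Definition brownian (t : R) (w : Omega) : 'M[R]_d :=
  if `[< brownian_good w >] then \matrix_(i, j) continuous_version (walk (i, j)) t w else 0.

Lemma brownian_ae t i j : 0 <= t ->
  {ae P, forall w, walk (i, j) t (w n) @[n --> V] --> brownian t w i j}.
Proof.
move=> t0; have := continuous_version_ae U coins0 hn_ge0 hn_cvg (walk0 (i, j)) (walk_tail (i, j)) t0.
apply: filterS2 brownian_good_ae => w gw; rewrite /brownian.
by rewrite asboolT// mxE.
Qed.

Lemma brownian_st t i j : 0 <= t -> {ae P, forall w, st (walk (i, j) t) w = brownian t w i j}.
Proof. by move=> t0; apply: negligibleS (brownian_ae i j t0) => w; apply: contra_not; exact: ulim_cvg. Qed.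

End CoinWalk.

Lemma mx_continuous {R : realType} {m n : nat} (D : set R) (M : R -> 'M[R]_(m, n)) :
  (forall i j, {within D, continuous (fun t => M t i j)}) -> {within D, continuous M}.
Proof.
move=> h; apply/subspace_continuousP => t Dt; apply/cvg_ballP => e e0.
have hij i j : \forall u \near within D (nbhs t), ball (M t i j) e (M u i j).
  by have /subspace_continuousP/(_ t Dt)/cvg_ballP/(_ _ e0) := h i j.
have : \forall u \near within D (nbhs t), forall i j, ball (M t i j) e (M u i j).
  by apply: filter_forall => i; apply: filter_forall => j; exact: hij.
by apply: filterS => u hu; split => // i j; exact: hu.
Qed.

Section BrownianMatrix.
Context {R : realType} (U : free_ultrafilter) {d : nat}.
Variables (hn : nat -> R) (Nn : nat -> nat).
Hypothesis hn_gt0 : forall n, 0 < hn n.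
Hypothesis hn_cvg : hn n @[n --> \oo] --> (0 : R).
Hypothesis Nn_big : forall n, n%:R <= hn n * (Nn n)%:R.

Local Notation coins := (coins (d := d) Nn).
Local Notation coins0 := (@coins0 d Nn).
Local Notation P := (@loeb_P R U coins coins0).
Local Notation Omega := (caratheodory_type (@loeb_mu R U coins coins0)).
Local Notation V := (fultra U).
Local Notation time_index := (time_index hn).
Local Notation W := (@brownian R U d hn Nn).
Local Notation walk := (@walk R d hn Nn).
Let UP : ProperFilter V := ultra_proper.

Lemma P_ae_eq (X Y : set Omega) : {ae P, forall w, X w <-> Y w} -> P X = P Y.
Proof. by move=> h; apply: null_eq_P; apply: negligibleS h => w /= []; tauto. Qed.

Definition past (t : R) n : {set @coin_index d (Nn n)} := 
  finset.finset (fun u : @coin_index d (Nn n) => u.1 < time_index n t)%N.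

Definition coin_filtration (t : R) : set (set Omega) := coin_sigma (past t).

Lemma coin_filtrationP : filtration coin_filtration.
Proof.
split=> [t t0|t t0 X|s t s0 st].
- exact: completed_sigma_sigma.
- exact: completed_sigma_measurable.
- apply: coin_sigma_sub => n; apply/fintype.subsetP => u; rewrite !inE => us.
  exact: leq_trans us (time_index_mono hn_gt0 n st).
Qed.

Lemma walk_past lm t n : depends_on (past t n) (walk lm t (n := n) : {ffun _ -> bool} -> R).
Proof.
move=> s s' ss; apply: eq_bigr => j _.
apply: (@xi_depends _ _ _ _ _ (past t n)) ss => i ij; by rewrite inE /= ij.
Qed.

(** A list of coordinates, so that the independence of the entries can be proved by adding one
    coordinate at a time. *)
Definition slice (s t : R) (l : seq ('I_d * 'I_d)) n : {set @coin_index d (Nn n)} :=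
  finset.finset (fun u : @coin_index d (Nn n) =>
    [&& time_index n s <= u.1, u.1 < time_index n t & u.2 \in l])%N.

Lemma walk_slice lm s t n : 0 <= s -> s <= t -> depends_on (slice s t [:: lm] n)
  ((fun w => walk lm t (n := n) w - walk lm s w) : {ffun _ -> bool} -> R).
Proof.
move=> s0 st w w' ww; rewrite !walk_sub//; apply: eq_bigr => j _.
have [sj|js] := leqP (time_index n s) j; last by rewrite !mul0r.
congr (_ * _); apply: (@xi_depends _ _ _ _ _ (slice s t [:: lm] n)) ww => i ij.
by rewrite inE /= ij sj ltn_ord inE eqxx.
Qed.

Lemma brownian_sub_ae s t i j : 0 <= s -> s <= t ->
  {ae P, forall w, walk (i, j) t (w n) - walk (i, j) s (w n) @[n --> V] --> W t w i j - W s w i j}.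
Proof.
move=> s0 st; have h1 := brownian_ae U Nn hn_gt0 hn_cvg i j s0.
have h2 := brownian_ae U Nn hn_gt0 hn_cvg i j (le_trans s0 st).
apply: negligibleS (negligibleU h1 h2) => w /= nw; apply: contrapT => /not_orP[/contrapT c1 /contrapT c2].
by apply: nw; apply: cvgB.
Qed.

Lemma brownian_slice s t i j : 0 <= s -> s <= t ->
  measurable_wrt (coin_sigma (slice s t [:: (i, j)])) (fun w => W t w i j - W s w i j).
Proof.
move=> s0 st.
apply: (coin_sigma_st (f := fun n w => walk (i, j) t (n := n) w - walk (i, j) s w)).
  by move=> n; exact: walk_slice.
apply: negligibleS (brownian_sub_ae i j s0 st) => w; apply: contra_not; exact: ulim_cvg.
Qed.

Lemma cvg_fultra (u : nat -> R) (l : R) : u n @[n --> \oo] --> l -> u n @[n --> V] --> l.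
Proof. by move=> h A /h; exact: fultra_free. Qed.

Lemma ultra_natr (t : R) : V [set n | t <= n%:R].
Proof.
apply: fultra_free; exists (Num.truncn t).+1 => // n /= tn.
by apply/ltW; apply: lt_le_trans (truncnS_gt t) _; rewrite ler_nat.
Qed.

Lemma brownian_law s t i j (C : set R) : 0 <= s -> s < t -> measurable C ->
  P [set w | C (W t w i j - W s w i j)] = normal_prob 0 (Num.sqrt (t - s)) C.
Proof.
move=> s0 lt_st mC; set lm := (i, j); have t0 := le_trans s0 (ltW lt_st).
(* The central limit theorem asks for coins of square h at every n, but only [Nn n] coins exist. As
   soon as t <= n the minimum is [time_index n t], so it does not affect the limit. *)
pose m n := (minn (time_index n t) (Nn n) - time_index n s)%N.
pose xi' n j := xi (hn n) lm (time_index n s + j) : coins n -> R.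
pose fl' n j := @xi_flip d (Nn n) lm (time_index n s + j).
have sg0 : 0 < Num.sqrt (t - s) by rewrite sqrtr_gt0 subr_gt0.
have mN n : t <= n%:R -> m n = (time_index n t - time_index n s)%N.
  by move=> tn; rewrite /m (minn_idPl _)// (time_index_N hn_gt0 Nn_big).
rewrite -(@coin_sum_law R U coins coins0 fl' xi' hn m _ sg0 hn_gt0) //.
- apply: P_ae_eq; apply: negligibleS (brownian_sub_ae i j s0 (ltW lt_st)) => w /=.
  apply: contra_not => cw; suff -> : st (coin_sum xi' m) w = W t w i j - W s w i j by [].
  apply: ulim_cvg; apply: cvg_trans cw; apply: near_eq_cvg.
  apply: filterS (ultra_natr t) => n tn /=.
  rewrite walk_sub// ?ltW// /coin_sum mN//.
  rewrite -(big_mkord xpredT (fun j => ((time_index n s <= j)%:R * 1) * xi (hn n) lm j (w n))).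
  have le := time_index_mono hn_gt0 n (ltW lt_st).
  rewrite (big_cat_nat (n := time_index n s))//= big_nat_cond big1 ?add0r.
    rewrite -{1}[time_index n s]add0n big_addn big_mkord; apply: eq_bigr => q _.
    by rewrite leq_addl !mul1r /xi' addnC.
  by move=> q /andP[/andP[_ qs] _]; rewrite leqNgt qs !mul0r.
- by move=> n q f; exact: xi_flip_Ex.
- by move=> n p q w; rewrite /xi' /fl' xi_flip1 eqn_add2l.
- move=> n q w; rewrite /m => qm; apply: xi_sqrE => //.
  have : (q < minn (time_index n t) (Nn n) - time_index n s)%N by [].
  by rewrite ltn_subRL => /leq_trans; apply; rewrite geq_minr.
- exact: cvg_fultra.
- rewrite sqr_sqrtr ?subr_ge0 ?ltW//.
  have : hn n * (time_index n t)%:R - hn n * (time_index n s)%:R @[n --> V] --> t - s.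
    by apply: cvgB; apply: cvg_fultra; apply: time_index_cvg.
  apply: cvg_trans; apply: near_eq_cvg; apply: filterS (ultra_natr t) => n tn /=.
  by rewrite mN// natrB ?time_index_mono ?ltW// -mulrBr mulrC.
Qed.

Lemma coin_sigmaI S (X Y : set Omega) : coin_sigma S X -> coin_sigma S Y -> coin_sigma S (X `&` Y).
Proof.
exact: (@measurableI _ (g_sigma_algebraType (near_internal (pt := coins0) (coin_sets S)))).
Qed.

(** Induction on the list of coordinates. The first conjunct is what lets the induction go on: the
    event built so far depends on the past and on the slices already used, and the next coordinate
    uses other coins. *)
Lemma brownian_indep s t (A : set Omega) (C : 'I_d -> 'I_d -> set R) (l : seq ('I_d * 'I_d)) :
  0 <= s -> s < t -> coin_filtration s A -> (forall i j, measurable (C i j)) -> uniq l ->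
  coin_sigma (fun n => finset.setU (past s n) (slice s t l n))
    (A `&` [set w | forall p, p \in l -> C p.1 p.2 (W t w p.1 p.2 - W s w p.1 p.2)]) /\
  P (A `&` [set w | forall p, p \in l -> C p.1 p.2 (W t w p.1 p.2 - W s w p.1 p.2)]) =
  (P A * \prod_(p <- l) P [set w | C p.1 p.2 (W t w p.1 p.2 - W s w p.1 p.2)%R])%E.
Proof.
move=> s0 st FA mC; elim: l => [_|q l IH /= /andP[ql ul]].
  have -> : A `&` [set w | forall p, p \in [::] -> C p.1 p.2 (W t w p.1 p.2 - W s w p.1 p.2)] = A.
    by apply/seteqP; split => w // [].
  rewrite big_nil mule1; split => //; apply: coin_sigma_sub FA => n.
  by apply: finset.subsetUl.
have {IH}[h1 h2] := IH ul.
set E := A `&` _ in h1 h2; pose G := [set w | C q.1 q.2 (W t w q.1 q.2 - W s w q.1 q.2)].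
have -> : A `&` [set w | forall p, p \in q :: l -> C p.1 p.2 (W t w p.1 p.2 - W s w p.1 p.2)] = E `&` G.
  apply/seteqP; split => w [].
    move=> Aw hw; split; last by apply: hw; rewrite inE eqxx.
    by split => // p pl; apply: hw; rewrite inE pl orbT.
  move=> [Aw hw] Gw; split => // p; rewrite inE => /orP[/eqP->//|]; exact: hw.
have hG : coin_sigma (slice s t [:: q]) G.
  have := @brownian_slice s t q.1 q.2 s0 (ltW st); rewrite -surjective_pairing => h; exact: h (mC q.1 q.2).
split.
  apply: coin_sigmaI.
    apply: coin_sigma_sub h1 => n; apply: finset.setUS; apply/fintype.subsetP => u.
    by rewrite !inE => /and3P[-> -> ->]; rewrite orbT.
  apply: coin_sigma_sub hG => n; apply/fintype.subsetP => u.
  by rewrite !inE => /and3P[-> -> ->]; rewrite orbT.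
rewrite (coin_sigma_indep _ h1 hG) ?h2.
  by rewrite big_cons -muleA; congr (_ * _)%E; rewrite muleC.
move=> n u; rewrite !inE => /orP[us|/and3P[_ _ ul2]].
  by move=> /and3P[su _ _]; rewrite ltnNge su in us.
by move=> /and3P[_ _ /eqP uq]; rewrite uq (negbTE ql) in ul2.
Qed.

Lemma brownian_matrixP : brownian_matrix P coin_filtration W.
Proof.
split.
- move=> t i j t0; apply: (coin_sigma_st (f := walk (i, j) t)); first by move=> n; exact: walk_past.
  exact: brownian_st.
- have : {ae P, forall w, forall p : 'I_d * 'I_d, W 0 w p.1 p.2 = 0}.
    apply: ae_forall_fin => -[i j] /=.
    apply: negligibleS (brownian_ae U Nn hn_gt0 hn_cvg i j (lexx 0)) => w; apply: contra_not => cw.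
    have c0 : walk (i, j) 0 (w n) @[n --> V] --> (0 : R).
      by under eq_fun do rewrite walk0; exact: cvg_cst.
    exact: (cvg_unique _ cw c0).
  apply: negligibleS => w; apply: contra_not => hw; apply/matrixP => i j.
  by rewrite (hw (i, j)) mxE.
- move=> w; apply: mx_continuous => i j; rewrite /brownian.
  have [gw|ngw] := pselect (brownian_good hn w).
    rewrite (_ : (fun t => _) = (fun t => continuous_version (walk (i, j)) t w)).
      exact: continuous_version_continuous.
    by apply/funext => t; rewrite asboolT// mxE.
  rewrite (_ : (fun t => _) = (fun=> 0)); last by apply/funext => t; rewrite asboolF// mxE.
  by apply: continuous_subspaceT => t; exact: cvg_cst.
- by move=> s t i j C s0 st mC; exact: brownian_law.
- move=> s t A C s0 st FA mC.
  have [_] := brownian_indep s0 st FA mC (index_enum_uniq ('I_d * 'I_d)%type).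
  rewrite pair_bigA /= => <-; congr (P (_ `&` _)); apply/seteqP; split => w /= hw.
    by move=> [i j] _ /=; exact: hw.
  by move=> i j; apply: (hw (i, j)); rewrite mem_index_enum.
Qed.

End BrownianMatrix.

(** * Stochastic integrals *)

(** A nonincreasing predicate switches only once, so a single weight survives. Both the cells of a
    partition of time and the blocks of grid indices are evaluated this way. *)
Lemma step_sum_eval {R : realType} (a : nat -> bool) m : a 0%N -> ~~ a m ->
  (forall i, a i.+1 -> a i) ->
  exists i, [/\ (i < m)%N, a i, ~~ a i.+1 &
    forall c : nat -> R, \sum_(p < m) c p * (a p && ~~ a p.+1)%:R = c i].
Proof.
move=> a0 + aS.
have mono q : forall p, (p <= q)%N -> a q -> a p.
  elim: q => [|q IHq] p; first by rewrite leqn0 => /eqP->.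
  by rewrite leq_eqVlt => /orP[/eqP->//|pq /aS]; exact: IHq.
elim: m => [|m IH]; first by rewrite a0.
move=> nm; have [am|am] := boolP (a m).
  exists m; split => // c; rewrite big_ord_recr /= am nm mulr1 big1 ?add0r// => i _.
  by rewrite (mono m i.+1)// andbF mulr0.
have [i [im ai ni e]] := IH am; exists i; split => // [|c]; first exact: ltnW.
by rewrite big_ord_recr /= (negbTE am) mulr0 addr0.
Qed.

Section Partition.
Context {R : realType}.
Variable t : R.
Hypothesis t_ge0 : 0 <= t.

Definition node (m i : nat) : R := t * (i%:R / m.+1%:R).

Lemma node0 m : node m 0 = 0. Proof. by rewrite /node mul0r mulr0. Qed.

Lemma node_last m : node m m.+1 = t.
Proof. by rewrite /node mulfV ?pnatr_eq0// mulr1. Qed.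

Lemma node_ge0 m i : 0 <= node m i.
Proof. by rewrite mulr_ge0// divr_ge0. Qed.

Lemma node_mono m i j : (i <= j)%N -> node m i <= node m j.
Proof. by move=> ij; rewrite ler_wpM2l// ler_pM2r ?invr_gt0// ler_nat. Qed.

Lemma node_le m i : (i <= m.+1)%N -> node m i <= t.
Proof. by move=> im; rewrite -[leRHS](node_last m) node_mono. Qed.

Lemma nodeS m i : node m i.+1 - node m i = t / m.+1%:R.
Proof. by rewrite /node -mulrBr -mulrBl -natrB ?subSnn// mul1r. Qed.

Lemma mesh_small (e : R) : 0 < e -> exists M, forall m, (M <= m)%N -> t / m.+1%:R < e.
Proof.
move=> e0; exists (Num.truncn (t / e)).+1 => m hm.
rewrite ltr_pdivrMr// mulrC -ltr_pdivrMr//; apply: lt_le_trans (truncnS_gt _) _.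
by rewrite ler_nat; apply: leq_trans hm _.
Qed.

Lemma node_indic m i u : \1_(`]node m i, node m i.+1] : set R) u =
  ((node m i < u) && ~~ (node m i.+1 < u))%:R :> R.
Proof.
by rewrite indicE -leNgt; congr (nat_of_bool _)%:R; apply/idP/idP; rewrite inE /= in_itv.
Qed.

Lemma node_sum_eval m (c : nat -> R) u : 0 < u -> u <= t ->
  exists i, [/\ (i < m.+1)%N, `|node m i - u| <= t / m.+1%:R &
   \sum_(p < m.+1) c p * \1_(`]node m p, node m p.+1] : set R) u = c i].
Proof.
move=> u0 ut; have [||i im|i [im a1 a2 e]] := @step_sum_eval R (fun i => node m i < u) m.+1.
- by rewrite node0.
- by rewrite -leNgt node_last.
- by apply: le_lt_trans im; exact: node_mono.
exists i; split => //; last by under eq_bigr do rewrite node_indic.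
rewrite -leNgt in a2; rewrite -(nodeS m i) distrC ger0_norm; first by rewrite lerD2r.
by rewrite subr_ge0 ltW.
Qed.

End Partition.

Section Clip.
Context {R : realType}.

Definition clip (M x : R) : R := Num.max (- M) (Num.min M x).

Lemma clip_bound M x : 0 <= M -> `|clip M x| <= M.
Proof.
move=> M0; rewrite ler_norml /clip le_max lexx /= ge_max ge_min lexx andbT.
by rewrite ge0_cp.
Qed.

Lemma clip_id M x : `|x| <= M -> clip M x = x.
Proof. by rewrite ler_norml => /andP[h1 h2]; rewrite /clip min_r// max_r. Qed.

(** Clipping acts only where |x| > M, and there x^2 <= x^4 / M^2: this is where fourth moments of
    the integrand pay. *)
Lemma clip_err M x : 0 < M -> (clip M x - x) ^+ 2 <= x ^+ 4 / M ^+ 2.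
Proof.
move=> M0; have M2 : 0 < M ^+ 2 by rewrite exprn_gt0.
have x4 : 0 <= x ^+ 4 by rewrite (_ : 4 = 2 * 2)%N// exprM sqr_ge0.
have [h|h] := leP `|x| M; first by rewrite clip_id// subrr expr0n divr_ge0// ltW.
rewrite ler_pdivlMr//.
have h1 : `|clip M x - x| <= `|x|.
  rewrite /clip; have [x0|x0] := leP 0 x.
    rewrite ger0_norm// in h *; rewrite min_l ?(ltW h)// max_r ?ge0_cp ?(ltW M0)//.
    by rewrite ler0_norm; lra.
  rewrite ltr0_norm// in h *; rewrite min_r; last by lra.
  by rewrite max_l; [rewrite ger0_norm; lra|lra].
have h2 : (clip M x - x) ^+ 2 <= x ^+ 2.
  by rewrite -[leLHS]ger0_norm ?sqr_ge0// -[leRHS]ger0_norm ?sqr_ge0// !normrX sqr_le.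
have h3 : M ^+ 2 <= x ^+ 2.
  by rewrite -[leRHS]ger0_norm ?sqr_ge0// normrX sqr_le// ltW.
rewrite (_ : x ^+ 4 = x ^+ 2 * x ^+ 2); last by rewrite -exprD.
by apply: ler_pM => //; [exact: sqr_ge0|exact: ltW].
Qed.

Lemma clip_continuous M : continuous (clip M).
Proof.
move=> x; apply: (@continuous_max _ R (fun=> - M) (fun x => Num.min M x)); first exact: cvg_cst.
by apply: (@continuous_min _ R (fun=> M) id); [exact: cvg_cst|exact: cvg_id].
Qed.

End Clip.

Lemma process_integral_cst {R : realType} (f : R -> R) (a b c e : R) : a <= b ->
  lebesgue_measure.-integrable `]a, b] (EFin \o f) ->
  (forall u, `]a, b]%classic u -> `|f u - c| <= e) ->
  `|(\int[lebesgue_measure]_(u in `]a, b]) f u)%R - c * (b - a)| <= e * (b - a).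
Proof.
move=> ab fi fc.
have mu_ab : fine (lebesgue_measure (`]a, b]%classic : set R)) = b - a.
  rewrite lebesgue_measure_itv /= lte_fin; case: ifP => [//|/negbT]; rewrite -leNgt => ba.
  by rewrite (@le_anti _ _ a b) ?subrr// ab.
have ci (q : R) : lebesgue_measure.-integrable `]a, b] (EFin \o (fun=> q)).
  apply: measurable_bounded_integrable => //.
    change (lebesgue_measure (`]a, b]%classic : set R) < +oo)%E.
    by rewrite lebesgue_measure_itv /=; case: ifP => _; rewrite ?ltry// -EFinD ltry.
  by exists `|q|; split => // y qy u _ /=; exact: ltW.
have ec q : (\int[lebesgue_measure]_(u in `]a, b]) q)%R = q * (b - a) by rewrite Rintegral_cst// mu_ab.
rewrite -(ec c) -(ec e).
have iB : lebesgue_measure.-integrable `]a, b] (EFin \o (fun u => f u - c)).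
  have mI : measurable (`]a, b]%classic : set (measurableTypeR R)) by exact: measurable_itv.
  by have := integrableB mI fi (ci c); apply: eq_integrable.
rewrite -RintegralB//; apply: le_trans (le_normr_Rintegral _ iB) _ => //.
apply: le_Rintegral => //.
by have := integrable_abse iB; apply: eq_integrable.
Qed.

Section ContinuousProcess.
Context {R : realType} d (T : measurableType d) (P : probability T R).
Local Notation mu := (@lebesgue_measure R).
Variables (t : R) (H : R -> T -> R).
Hypothesis t_ge0 : 0 <= t.
Hypothesis H_cont : forall w, {within `[0, t], continuous (fun u => H u w)}.
Hypothesis H_meas : forall u, 0 <= u <= t -> measurable_fun setT (H u).
Local Notation node := (node t).
Local Notation D := ((`[0, t]%classic : set (measurableTypeR R)) `*` [set: T]).

Definition step_process (G : nat -> R -> T -> R) m (u : R) (w : T) : R :=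
  \sum_(p < m.+1) G m (node m p) w * \1_(`]node m p, node m p.+1] : set R) u.

Let step_meas (G : nat -> R -> T -> R) m : (forall p, (p < m.+1)%N -> measurable_fun setT (G m (node m p))) ->
  measurable_fun setT (fun z : measurableTypeR R * T => step_process G m z.1 z.2).
Proof.
move=> mG; rewrite /step_process.
rewrite (_ : (fun _ => _) = (fun z : measurableTypeR R * T => \sum_(p <- index_enum 'I_m.+1)
   G m (node m p) z.2 * \1_(`]node m p, node m p.+1] : set R) z.1))//.
apply: measurable_sum => p; apply: measurable_funM.
  by apply: measurableT_comp (mG p (ltn_ord p)) _; exact: measurable_snd.
apply: measurableT_comp; last exact: measurable_fst.
by apply: measurable_indic; exact: measurable_itv.
Qed.

Lemma process_modulus w e : 0 < e -> exists M, forall m, (M <= m)%N -> forall u v,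
  0 <= u <= t -> 0 <= v <= t -> `|u - v| <= t / m.+1%:R -> `|H u w - H v w| < e.
Proof.
move=> e0; have [r r0 hr] := unif_continuous_itv (@H_cont w) e0.
have [M hM] := mesh_small t r0; exists M => m mM u v ut vt uv.
by apply: hr => //; apply: le_lt_trans uv (hM m mM).
Qed.

Lemma node_itv m p : (p < m.+1)%N -> 0 <= node m p <= t.
Proof. by move=> pm; rewrite node_ge0// node_le// ltnW. Qed.

Lemma process_measurable : measurable_fun D (fun z : measurableTypeR R * T => H z.1 z.2).
Proof.
(* The cells are open on the left and miss u = 0, which gets a term of its own. *)
pose h m (z : measurableTypeR R * T) := step_process (fun=> H) m z.1 z.2 + \1_[set 0%R : R] z.1 * H 0 z.2.
apply: (@measurable_fun_cvg _ _ _ _ h).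
  move=> m; apply: measurable_funTS; apply: measurable_funD.
    by apply: step_meas => p pm; apply: H_meas; exact: node_itv.
  apply: measurable_funM.
    by apply: measurableT_comp; [apply: measurable_indic; exact: measurable_set1|exact: measurable_fst].
  by apply: measurableT_comp; [apply: H_meas; rewrite lexx|exact: measurable_snd].
move=> [u w] [/=]; rewrite in_itv /= => /andP[u0 ut] _; rewrite /h /=.
have [->|un0] := eqVneq u 0.
  rewrite (_ : (fun _ => _) = fun=> H 0 w); first exact: cvg_cst.
  apply/funext => m; rewrite indicE mem_set// mul1r /step_process big1 ?add0r// => p _.
  by rewrite node_indic ltNge node_ge0// mulr0.
have {}u0 : 0 < u by rewrite lt_neqAle eq_sym un0.
apply/cvgrPdist_lt => e e0; have [M hM] := process_modulus w e0.
exists M => // m /= mM; have [i [im iu]] := node_sum_eval t_ge0 m (fun p => H (node m p) w) u0 ut.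
rewrite /step_process => ->; rewrite indicE memNset ?mul0r ?addr0; last by move=> /= u00; rewrite u00 ltxx in u0.
by rewrite distrC; apply: (hM m mM) => //; [exact: node_itv|rewrite (ltW u0)].
Qed.

Lemma process_bounded w : exists2 B, 0 <= B & forall u, 0 <= u <= t -> `|H u w| <= B.
Proof.
have [c1 _ h1] := EVT_max t_ge0 (@H_cont w); have [c2 _ h2] := EVT_min t_ge0 (@H_cont w).
exists (`|H c1 w| + `|H c2 w|); first by rewrite addr_ge0.
move=> u ut; have ui : u \in `[0, t] by rewrite in_itv.
have := h1 u ui; have := h2 u ui; have := ler_norm (H c1 w); have := ler_norm (- H c2 w).
rewrite normrN => ? ? ? ?; have := normr_ge0 (H c1 w); have := normr_ge0 (H c2 w).
rewrite ler_norml => ? ?; apply/andP; split; lra.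
Qed.

Lemma process_path_integrable w : mu.-integrable `[0, t] (fun u => (H u w)%:E).
Proof. by apply: continuous_compact_integrable; [exact: segment_compact|exact: H_cont]. Qed.

Lemma process_sqr_integral w : (\int[mu]_(u in `[0%R, t]) ((H u w) ^+ 2)%:E < +oo)%E.
Proof.
have [B B0 hB] := process_bounded w.
have mH : measurable_fun `[0, t] (fun u => H u w).
  by apply: subspace_continuous_measurable_fun => //; exact: H_cont.
apply: (@le_lt_trans _ _ (\int[mu]_(u in `[0%R, t]) (B ^+ 2)%:E)%E).
  apply: ge0_le_integral => //.
  - by move=> u _; rewrite lee_fin sqr_ge0.
  - by apply/measurable_EFinP; apply: measurable_funX.
  - move=> u /=; rewrite in_itv /= => ut; rewrite lee_fin.
    by rewrite -[leLHS]ger0_norm ?sqr_ge0// normrX sqr_le// hB.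
by rewrite integral_cst//= lebesgue_measure_itv /=; case: ifP => _; rewrite ?mule0 ?ltry// -EFinD -EFinM ltry.
Qed.

(** The sets where some later f p is at least e decrease to the empty set, so their probabilities
    tend to 0. *)
Lemma vanish_pointwise (f : nat -> T -> \bar R) :
  (forall m, measurable_fun setT (f m)) ->
  (forall w e, 0 < e -> exists M, forall m, (M <= m)%N -> (f m w < e%:E)%E) ->
  vanish_in_probability P f.
Proof.
move=> mf hf e e0; pose A m := \bigcup_(p in [set p | (m <= p)%N]) [set w | (e%:E <= f p w)%E].
have m1 p : measurable [set w | (e%:E <= f p w)%E].
  by have := emeasurable_fun_c_infty measurableT (mf p) e%:E; rewrite setTI.
have mA m : measurable (A m) by apply: bigcup_measurable.
have A0 : \bigcap_m A m = set0.
  rewrite -subset0 => w hw; have [M hM] := hf w e e0.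
  by have [p /= Mp] := hw M I; rewrite leNgt hM.
have cA : P (A m) @[m --> \oo] --> (0 : \bar R)%E.
  rewrite -(measure0 P) -A0; apply: nonincreasing_cvg_mu => //.
  - by rewrite -ge0_fin_numE// fin_num_measure.
  - by rewrite A0.
  - move=> m p mp; apply/subsetPset => w [q /= pq hq]; exists q => //=.
    exact: leq_trans mp pq.
apply: (squeeze_cvge _ (cvg_cst 0%E) cA); apply: nearW => m.
rewrite measure_ge0 /= le_measure ?inE//.
by move=> w hw; exists m => /=.
Qed.

Lemma step_process_vanish : vanish_in_probability P (fun m w =>
  \int[mu]_(u in `[0%R, t]) ((step_process (fun m u w => clip m.+1%:R (H u w)) m u w - H u w) ^+ 2)%:E)%E.
Proof.
set S := step_process _.
have mS m : measurable_fun setT (fun z : measurableTypeR R * T => S m z.1 z.2).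
  apply: step_meas => p pm; apply: measurableT_comp; last by apply: H_meas; exact: node_itv.
  by apply: continuous_measurable_fun; exact: clip_continuous.
have mD : measurable D by apply: measurableX => //; exact: measurable_itv.
apply: vanish_pointwise.
  move=> m; pose g (z : measurableTypeR R * T) := ((S m z.1 z.2 - H z.1 z.2) ^+ 2)%:E.
  have mg : measurable_fun setT (g \_ D).
    apply/measurable_restrict => //; rewrite setTI; apply/measurable_EFinP; apply: measurable_funX.
    by apply: measurable_funB; [exact: measurable_funTS|exact: process_measurable].
  have g0 z : (0 <= (g \_ D) z)%E by apply: erestrict_ge0 => x _; rewrite lee_fin sqr_ge0.
  have := @measurable_fun_fubini_tonelli_G _ _ (measurableTypeR R) T R mu (g \_ D)%E mg g0.
  rewrite /fubini_G; apply: eq_measurable_fun => w _.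
    rewrite [RHS]integral_mkcond; apply: eq_integral => u _; rewrite !patchE.
    by rewrite (_ : ((u, w) \in D) = (u \in `[0%R, t]%classic))//; apply/idP/idP; rewrite !inE /= => -[].
move=> w e e0; pose e1 := Num.min 1 (e / (t + 1)).
have t1 : 0 < t + 1 by rewrite ltr_wpDl.
have e10 : 0 < e1 by rewrite lt_min ltr01 divr_gt0.
have [M1 hM1] := process_modulus w e10; have [B B0 hB] := process_bounded w.
(* For this fixed w the path is bounded by B, so from here on the clipping does nothing. *)
exists (maxn M1 (Num.truncn B)) => m hm.
have Bm : B <= m.+1%:R.
  apply/ltW; apply: lt_le_trans (truncnS_gt B) _; rewrite ler_nat ltnS.
  exact: leq_trans (leq_maxr _ _) hm.
have mH : measurable_fun `[0, t] (fun u => H u w).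
  by apply: subspace_continuous_measurable_fun => //; exact: H_cont.
have mSw : measurable_fun setT (fun u : measurableTypeR R => S m u w).
  by have := measurableT_comp (mS m) (measurable_pair2 w); apply: eq_measurable_fun.
have mI : measurable_fun `[0, t] (fun u => ((S m u w - H u w) ^+ 2)%:E).
  by apply/measurable_EFinP; apply: measurable_funX; apply: measurable_funB => //; exact: measurable_funTS.
rewrite -integral_itv_obnd_cbnd; last by apply: measurable_funS mI => //; exact: subset_itv_oc_cc.
apply: (@le_lt_trans _ _ (\int[mu]_(u in `]0%R, t]) e1%:E)%E).
  apply: ge0_le_integral => //.
  - by move=> u _; rewrite lee_fin sqr_ge0.
  - by apply: measurable_funS mI => //; exact: subset_itv_oc_cc.
  - move=> u /=; rewrite in_itv /= => /andP[u0 ut]; rewrite lee_fin.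
    have [i [im iu]] := node_sum_eval t_ge0 m (fun p => clip m.+1%:R (H (node m p) w)) u0 ut.
    rewrite /S /step_process => ->; rewrite clip_id; last by rewrite (le_trans (hB _ _))// node_itv.
    have h : `|H (node m i) w - H u w| < e1.
      by apply: (hM1 m (leq_trans (leq_maxl _ _) hm)) => //; [exact: node_itv|rewrite (ltW u0)].
    have e11 : e1 <= 1 by rewrite ge_min lexx.
    rewrite -[leLHS]ger0_norm ?sqr_ge0// normrX; apply: (@le_trans _ _ (e1 ^+ 2)).
      by rewrite sqr_le// ltW.
    by rewrite expr2 ler_piMr// ltW.
rewrite integral_cst//= lebesgue_measure_itv /= lte_fin.
have : e1 * (t + 1) <= e by rewrite -ler_pdivlMr// ge_min lexx orbT.
case: ifP => _ h; last by rewrite mule0 lte_fin.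
by rewrite -EFinB -EFinM lte_fin subr0; nra.
Qed.

Lemma riemann_sum_cvg w : \sum_(p < m.+1) H (node m p) w * (t / m.+1%:R) @[m --> \oo] -->
  (\int[mu]_(u in `[0, t]) H u w)%R.
Proof.
apply/cvgrPdist_lt => e e0; have t1 : 0 < t + 1 by rewrite ltr_wpDl.
have e10 : 0 < e / (t + 1) by rewrite divr_gt0.
have [M hM] := process_modulus w e10; exists M => // m /= mM.
set D := t / m.+1%:R; have D0 : 0 <= D by rewrite divr_ge0.
have iH := process_path_integrable w.
have sub a b : 0 <= a -> b <= t -> `]a, b] `<=` (`[0, t] : set R).
  by move=> a0 bt u; rewrite /= !in_itv /= => /andP[au ub]; rewrite (ltW (le_lt_trans a0 au)) (le_trans ub).
have iHs a b : 0 <= a -> b <= t -> mu.-integrable `]a, b] (EFin \o (fun u => H u w)).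
  by move=> a0 bt; apply: integrableS iH => //; exact: sub.
have key i : (i <= m.+1)%N ->
    `|(\int[mu]_(u in `]0%R, node m i]) H u w)%R - \sum_(p < i) H (node m p) w * D| <= e / (t + 1) * (i%:R * D).
  elim: i => [_|i IH im].
    by rewrite node0 set_itvoc0 Rintegral_set0 big_ord0 subrr normr0 mul0r mulr0.
  have qi := node_itv im; have /andP[qi0 qit] := qi; have qt := node_le t_ge0 im.
  have qS : node m i <= node m i.+1 by exact: node_mono.
  rewrite big_ord_recr /= (_ : `]0%R, node m i.+1]%classic = `]0%R, node m i] `|` `]node m i, node m i.+1]); last first.
    by rewrite -itv_bndbnd_setU ?bnd_simp.
  rewrite Rintegral_setU//; last 2 first.
  - by rewrite -itv_bndbnd_setU ?bnd_simp//; exact: iHs.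
  - apply/disj_setPS => u []; rewrite /= !in_itv /= => /andP[_ h1] /andP[h2 _].
    by have := lt_le_trans h2 h1; rewrite ltxx.
  have h1 := process_integral_cst (f := fun u => H u w) (c := H (node m i) w) (e := e / (t + 1)) qS (iHs _ _ qi0 qt) _.
  rewrite nodeS -/D in h1.
  rewrite opprD addrACA; apply: (le_trans (ler_normD _ _)).
  rewrite -[in leRHS]natr1 mulrDl mul1r mulrDr; apply: lerD; first exact: IH (ltnW im).
  apply: h1 => u /=; rewrite in_itv /= => /andP[u1 u2]; apply/ltW; apply: (hM m mM) => //.
  - by rewrite (le_trans qi0 (ltW u1)) (le_trans u2).
  - rewrite ger0_norm; last by rewrite subr_ge0 ltW.
    apply: (@le_trans _ _ (node m i.+1 - node m i)); last by rewrite nodeS.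
    by rewrite lerD2r.
have := key m.+1 (leqnn _); rewrite node_last Rintegral_itv_obnd_cbnd; last exact: iHs.
have -> : m.+1%:R * D = t by rewrite /D mulrC divfK ?pnatr_eq0.
move=> /le_lt_trans; apply.
by rewrite mulrAC ltr_pdivrMr// ltr_pM2l// ltrDl.
Qed.

End ContinuousProcess.

(** * Internal sums and their standard parts *)

Section InternalIntegrand.
Context {R : realType} (U : free_ultrafilter) {d : nat}.
Variables (hn : nat -> R) (Nn : nat -> nat).
Hypothesis hn_gt0 : forall n, 0 < hn n.
Hypothesis hn_cvg : hn n @[n --> \oo] --> (0 : R).
Hypothesis Nn_big : forall n, n%:R <= hn n * (Nn n)%:R.

Local Notation coins := (coins (d := d) Nn).
Local Notation coins0 := (@coins0 d Nn).
Local Notation P := (@loeb_P R U coins coins0).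
Local Notation Omega := (caratheodory_type (@loeb_mu R U coins coins0)).
Local Notation V := (fultra U).
Local Notation time_index := (time_index hn).
Local Notation W := (@brownian R U d hn Nn).
Local Notation walk := (@walk R d hn Nn).
Local Notation past := (@past R d hn Nn).
Local Notation coin_filtration := (@coin_filtration R U d hn Nn).
Let UP : ProperFilter V := ultra_proper.

Variables (t : R) (H : R -> Omega -> R) (Hn : forall n, nat -> coins n -> R).
Hypothesis t_ge0 : 0 <= t.
Hypothesis H_dep : forall n j,
  depends_on (finset.finset (fun u : @coin_index d (Nn n) => u.1 < j)%N) (Hn (n := n) j : {ffun _ -> bool} -> R).
Hypothesis H_lim : forall u, 0 <= u <= t ->
  {ae P, forall w, Hn (time_index n u) (w n) @[n --> V] --> H u w}.
Hypothesis H_cont : forall w, {within `[0, t], continuous (fun u => H u w)}.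
Hypothesis H_osc : forall e, 0 < e -> exists2 r, 0 < r & V [set n | forall i j,
  (i <= j)%N -> (j <= time_index n t)%N -> hn n * (j - i)%:R <= r ->
  Ex (fun s => (Hn (n := n) j s - Hn i s) ^+ 2) <= e].
Local Notation node := (node t).

Let coins_gt0 n : (0 < #|coins n|)%N. Proof. exact: card_coins. Qed.

Lemma integrand_adapted u : 0 <= u <= t -> measurable_wrt (coin_filtration u) (H u).
Proof.
move=> ut; apply: (coin_sigma_st (f := fun n => Hn (n := n) (time_index n u))) => [n|].
  exact: H_dep.
apply: negligibleS (H_lim ut) => w; apply: contra_not; exact: ulim_cvg.
Qed.

Lemma integrand_measurable u : 0 <= u <= t -> measurable_fun setT (H u : Omega -> R).
Proof. by move=> ut; apply: measurable_wrt_fun; exact: integrand_adapted. Qed.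

Lemma sum_window (F : nat -> R) a b J : (a <= b)%N -> (b <= J)%N ->
  \sum_(j < J) ((a <= j)%N && ~~ (b <= j)%N)%:R * F j = \sum_(a <= j < b) F j.
Proof.
move=> ab bJ; rewrite -(big_mkord xpredT (fun j => ((a <= j)%N && ~~ (b <= j)%N)%:R * F j)).
rewrite (big_cat_nat (n := b))//= (big_cat_nat (n := a))//=.
rewrite big_nat_cond big1 ?add0r; last first.
  by move=> j /andP[/andP[_ ja] _]; rewrite leqNgt ja mul0r.
rewrite [X in _ + X]big_nat_cond [X in _ + X]big1 ?addr0; last first.
  by move=> j /andP[/andP[bj _] _]; rewrite bj andbF mul0r.
by apply: eq_big_nat => j /andP[aj jb]; rewrite aj -ltnNge jb mul1r.
Qed.

Definition window n m p j : bool := (time_index n (node m p) <= j)%N && ~~ (time_index n (node m p.+1) <= j)%N.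

Let time_index_node n m p : (p < m.+1)%N ->
  (time_index n (node m p) <= time_index n (node m p.+1))%N /\ (time_index n (node m p.+1) <= time_index n t)%N.
Proof. by move=> pm; split; apply: time_index_mono => //; [exact: node_mono|exact: node_le]. Qed.

Lemma window_eval n m j : (j < time_index n t)%N -> exists p, [/\ (p < m.+1)%N,
  (time_index n (node m p) <= j)%N, hn n * (j - time_index n (node m p))%:R <= t / m.+1%:R + hn n &
  forall c : nat -> R, \sum_(p < m.+1) c p * (window n m p j)%:R = c p].
Proof.
move=> jt; have [||i im|p [pm a1 a2 e]] := @step_sum_eval R (fun p => (time_index n (node m p) <= j)%N) m.+1.
- by rewrite node0 time_index0.
- by rewrite -ltnNge node_last.
- by apply: leq_trans im; apply: time_index_mono => //; exact: node_mono.
exists p; split => //; rewrite -(nodeS t m p).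
apply: le_trans (time_index_sub hn_gt0 n (node_ge0 t_ge0 m p) (node_mono t_ge0 m (leqnSn p))).
rewrite ler_pM2l// ler_nat leq_sub2r//; rewrite -ltnNge in a2; exact: ltnW.
Qed.

Lemma walk_window lm n m p w : (p < m.+1)%N ->
  walk lm (node m p.+1) (n := n) w - walk lm (node m p) w =
  \sum_(j < time_index n t) (window n m p j)%:R * xi (hn n) lm j w.
Proof.
move=> pm; have [ab bJ] := time_index_node n pm.
rewrite /window (sum_window (fun j => xi (hn n) lm j w))//.
rewrite /walk -!(big_mkord xpredT (fun j => xi (hn n) lm j w)).
by rewrite (big_cat_nat (n := time_index n (node m p)))//= addrAC subrr add0r.
Qed.

Lemma length_window n m p : (p < m.+1)%N ->
  hn n * (time_index n (node m p.+1))%:R - hn n * (time_index n (node m p))%:R =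
  \sum_(j < time_index n t) (window n m p j)%:R * hn n.
Proof.
move=> pm; have [ab bJ] := time_index_node n pm; rewrite /window (sum_window (fun=> hn n))//.
by rewrite sumr_const_nat -mulrBr -natrB// mulr_natr.
Qed.

Lemma window_osc e : 0 < e -> exists M, forall m, (M <= m)%N -> V [set n |
  forall j p, (j < time_index n t)%N -> (time_index n (node m p) <= j)%N ->
  hn n * (j - time_index n (node m p))%:R <= t / m.+1%:R + hn n ->
  Ex (fun s => (Hn (n := n) (time_index n (node m p)) s - Hn j s) ^+ 2) <= e].
Proof.
move=> e0; have [r r0 hr] := H_osc e0; have r2 : 0 < r / 2 by rewrite divr_gt0.
have [M hM] := mesh_small t r2; exists M => m /hM hm.
have hs : V [set n | hn n < r / 2].
  by apply: fultra_free; apply: (cvgr_lt _ hn_cvg).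
apply: filterS2 hr hs => n /= hr hs j p jt pj hj.
rewrite (@eq_Ex _ _ _ (fun s => (Hn j s - Hn (time_index n (node m p)) s) ^+ 2)); last by move=> s; ring.
apply: hr => //; first exact: ltnW.
apply: (le_trans hj); apply/ltW; rewrite [ltRHS]splitr; exact: ltrD.
Qed.

Let hJ n : hn n * (time_index n t)%:R <= t. Proof. exact: time_index_le. Qed.

Definition drift_sum n (s : coins n) : R := \sum_(j < time_index n t) hn n * Hn j s.

Definition coarse_drift m n (s : coins n) : R := \sum_(p < m.+1)
  Hn (time_index n (node m p)) s * (hn n * (time_index n (node m p.+1))%:R - hn n * (time_index n (node m p))%:R).

Lemma coarse_drift_close e : 0 < e -> exists M, forall m, (M <= m)%N -> V [set n |
  Ex (fun s => `|coarse_drift m (n := n) s - drift_sum s|) <= t * e].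
Proof.
move=> e0; have e20 : 0 < e ^+ 2 by rewrite exprn_gt0.
have [M hM] := window_osc e20; exists M => m /hM; apply: filterS => n /= hm.
apply: (@le_trans _ _ (\sum_(j < time_index n t) hn n * e)); last first.
  by rewrite sumr_const card_ord -[leLHS]mulr_natr mulrAC ler_wpM2r// ltW.
apply: (@le_trans _ _ (Ex (fun s => \sum_(j < time_index n t) hn n *
    `|\sum_(p < m.+1) Hn (n := n) (time_index n (node m p)) s * (window n m p j)%:R - Hn j s|))).
  apply: ler_Ex => s; have -> : coarse_drift m s - drift_sum s = \sum_(j < time_index n t) hn n *
      (\sum_(p < m.+1) Hn (time_index n (node m p)) s * (window n m p j)%:R - Hn j s).
    rewrite /coarse_drift (eq_bigr (fun p : 'I_m.+1 => \sum_(j < time_index n t) hn n * (Hn (time_index n (node m p)) s * (window n m p j)%:R))).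
      rewrite exchange_big /= -sumrB; apply: eq_bigr => j _.
      by rewrite mulrBr mulr_sumr.
    move=> p _; rewrite length_window// mulr_sumr; apply: eq_bigr => j _; ring.
  apply: (le_trans (ler_norm_sum _ _ _)); apply: ler_sum => j _.
  by rewrite normrM (gtr0_norm (hn_gt0 n)).
rewrite Ex_sum; apply: ler_sum => j _; rewrite ExZ ler_pM2l//.
have [p [pm pj hj e1]] := window_eval m (ltn_ord j).
rewrite (@eq_Ex _ _ _ (fun s => `|Hn (time_index n (node m p)) s - Hn j s|)); last first.
  by move=> s; rewrite (e1 (fun p => Hn (time_index n (node m p)) s)).
by apply: Ex_norm_le => //; [exact: ltW|exact: hm].
Qed.

Lemma node_cvg m : {ae P, forall w, forall p, (p < m.+1)%N ->
  Hn (time_index n (node m p)) (w n) @[n --> V] --> H (node m p) w}.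
Proof.
apply: ae_forall_nat => p; have [pm|pm] := ltnP p m.+1; last by apply: aeW => w.
apply: negligibleS (H_lim (node_itv t_ge0 pm)) => w; apply: contra_not => hw _.
exact: hw.
Qed.

Lemma coarse_drift_cvg m w : (forall p, (p < m.+1)%N ->
  Hn (time_index n (node m p)) (w n) @[n --> V] --> H (node m p) w) ->
  coarse_drift m (w n) @[n --> V] --> \sum_(p < m.+1) H (node m p) w * (t / m.+1%:R).
Proof.
move=> hw; rewrite /coarse_drift; apply: cvg_sumr => p _; apply: cvgM; first exact: hw.
rewrite -(nodeS t m p); apply: cvgB; apply: cvg_fultra; apply: time_index_cvg => //; exact: node_ge0.
Qed.

(** A coarse sum has a fixed number of terms, so its standard part is a Riemann sum of the limit
    path. Partitions are chosen with mean error t / 4^k from the full sum; Markov's inequality at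
    level 2^-k then leaves a summable t / 2^k for Borel-Cantelli. *)
Lemma drift_limit : {ae P, forall w,
  drift_sum (w n) @[n --> V] --> (\int[lebesgue_measure]_(u in `[0, t]) H u w)%R}.
Proof.
have hk (k : nat) : exists m, (k <= m)%N /\ V [set n |
    Ex (fun s => `|coarse_drift m (n := n) s - drift_sum s|) <= t * (4 ^+ k)^-1].
  have e0 : 0 < (4 ^+ k)^-1 :> R by rewrite invr_gt0 exprn_gt0.
  have [M hM] := coarse_drift_close e0; exists (maxn k M); rewrite leq_maxl; split => //.
  exact/hM/leq_maxr.
have [mk hmk] := choice hk.
pose Bd k n : set (coins n) := [set s | (2 ^+ k)^-1 <= `|coarse_drift (mk k) s - drift_sum s|].
have bc := @internal_borel_cantelli R U coins coins0 Bd (2 * t) (mulr_ge0 (ler0n _ 2) t_ge0).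
have {}bc := bc (fun k => _).
have hB k : uPr (R := R) V (Bd k) <= 2 * t / (2 ^ k.+1)%:R.
  apply: (uPr_le_cst coins0); have [_] := hmk k; apply: filterS => n /= hn'.
  have p2 : 0 < (2 ^+ k)^-1 :> R by rewrite invr_gt0 exprn_gt0.
  apply: (le_trans (@markov_Pr R _ (Bd k n) (fun s => `|coarse_drift (mk k) s - drift_sum s|) _ p2 _ _)) => //.
  rewrite invrK; apply: (le_trans (ler_wpM2r _ hn')); first by rewrite exprn_ge0.
  rewrite natrX exprS (_ : (4 : R) = 2 * 2); last by ring.
  rewrite exprMn le_eqVlt; apply/orP; left; apply/eqP; field.
  by rewrite gt_eqF// exprn_gt0.
have {}bc := bc hB.
have h1 : {ae P, forall w, forall m p, (p < m.+1)%N ->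
    Hn (time_index n (node m p)) (w n) @[n --> V] --> H (node m p) w}.
  by apply: ae_forall_nat => m; exact: node_cvg.
apply: negligibleS (negligibleU bc h1) => w /= nw; apply: contrapT.
move=> /not_orP[/contrapT [k0 hk0] /contrapT hw]; apply: nw.
apply/cvgrPdist_lt => e e0; have e3 : 0 < e / 3 by rewrite divr_gt0.
have rc := @riemann_sum_cvg R _ Omega t H t_ge0 H_cont w.
move/cvgrPdist_lt : rc => /(_ _ e3) [M _ hM].
have cc : geometric (1 : R) 2^-1 m @[m --> \oo] --> (0 : R).
  by apply: cvg_geometric; rewrite ger0_norm// invf_lt1// ltr1n.
have [p _ hp] := cvgr_lt _ cc _ e3.
pose k := maxn k0 (maxn M p).
have k1 : `|(\int[lebesgue_measure]_(u in `[0, t]) H u w)%R - \sum_(p < (mk k).+1) H (node (mk k) p) w * (t / (mk k).+1%:R)| < e / 3.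
  apply: (hM (mk k)) => /=; apply: leq_trans (hmk k).1; rewrite /k; lia.
have k2 : (2 ^+ k)^-1 < e / 3.
  have := hp k; rewrite /= mul1r exprVn; apply; rewrite /k; lia.
have k3 : (k0 <= k)%N by rewrite /k; lia.
have /ultra_not hV := hk0 k k3.
have /cvgrPdist_lt /(_ _ e3) hC := coarse_drift_cvg (hw (mk k)).
apply: filterS2 hV hC => n /= /negP; rewrite -ltNge => h2 h3.
set I := (\int[_]_(u in _) _)%R in k1 *; set S := \sum_(p < _) _ in k1 h3.
have := ler_distD S I (drift_sum (w n)).
have := ler_distD (coarse_drift (mk k) (w n)) S (drift_sum (w n)).
lra.
Qed.

Variables (lm : 'I_d * 'I_d) (C : R).
Hypothesis C_ge0 : 0 <= C.
Hypothesis H_m4 : forall n j, (j <= time_index n t)%N -> Ex (fun s => Hn (n := n) j s ^+ 4) <= C ^+ 2.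

Definition ito_sum n (s : coins n) : R := \sum_(j < time_index n t) Hn j s * xi (hn n) lm j s.

Lemma internal_moment2 n (G : nat -> coins n -> R) (q : R) : 0 <= q ->
  (forall i j s, (i <= j)%N -> G i (xi_flip lm j s) = G i s) ->
  (forall j, (j < time_index n t)%N -> Ex (fun s => G j s ^+ 2) <= q) ->
  Ex (fun s => (\sum_(j < time_index n t) G j s * xi (hn n) lm j s) ^+ 2) <= t * q.
Proof.
move=> q0 Gfl Gq.
have := @mtransf_moment2 R (coins n) (coins_gt0 n) (@xi_flip d (Nn n) lm) (fun j => xi (hn n) lm j) G (hn n)
    (xi_flip_Ex lm) (xi_flip1 (hn n) lm) Gfl (xi_sqr (hn_gt0 n) lm) (time_index n t).
move=> /le_trans; apply; apply: (@le_trans _ _ (\sum_(j < time_index n t) hn n * q)).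
  by apply: ler_sum => j _; rewrite ler_pM2l//; exact: Gq.
by rewrite sumr_const card_ord -[leLHS]mulr_natr mulrAC ler_wpM2r.
Qed.

Lemma Hn_flip n i j (s : coins n) : (i <= j)%N -> Hn i (xi_flip lm j s) = Hn i s.
Proof.
move=> ij; apply: H_dep => u; rewrite inE => ui; rewrite /xi_flip.
case: insubP => [j' _ ej|//]; rewrite ffunE ifF//; apply/negbTE/eqP => uj.
by move: ui; rewrite uj /= ej ltnNge ij.
Qed.

Lemma Hn_moment2 n j : (j <= time_index n t)%N -> Ex (fun s => Hn (n := n) j s ^+ 2) <= C.
Proof.
move=> jt; rewrite (@eq_Ex _ _ _ (fun s => `|Hn j s ^+ 2|)); last first.
  by move=> s; rewrite ger0_norm ?sqr_ge0.
apply: Ex_norm_le => //; rewrite (@eq_Ex _ _ _ (fun s => Hn j s ^+ 4)); first exact: H_m4.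
by move=> s; rewrite -exprM.
Qed.

Lemma markov_sqr n (f : coins n -> R) (a q : R) : 0 < a -> Ex (fun s => f s ^+ 2) <= q ->
  Pr [set s | a <= `|f s|] <= q / a ^+ 2.
Proof.
move=> a0 hq; have a2 : 0 < a ^+ 2 by rewrite exprn_gt0.
apply: (@le_trans _ _ (Ex (fun s => f s ^+ 2) / a ^+ 2)); last by rewrite ler_pM2r ?invr_gt0.
apply: markov_Pr => // s; first exact: sqr_ge0.
by move=> /= h; rewrite -[leRHS]ger0_norm ?sqr_ge0// normrX sqr_le// ltW.
Qed.

Lemma sqr_bound_stbdd (f : forall n, coins n -> R) (q : R) : 0 <= q ->
  V [set n | Ex (fun s => f n s ^+ 2) <= q] -> {ae P, forall w, stbdd f w}.
Proof.
move=> q0 hf; apply: tight_stbdd => e e0; pose r := 1 + q / e.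
have r1 : 1 <= r by rewrite lerDl divr_ge0// ltW.
have r0 : 0 < r by exact: lt_le_trans r1.
exists r; apply: filterS hf => n /= hn'; apply: (le_trans (markov_sqr r0 hn')).
rewrite ler_pdivrMr ?exprn_gt0//; apply: (@le_trans _ _ (e * r)).
  by rewrite /r mulrDr mulr1 mulrCA mulfV ?gt_eqF// mulr1 lerDr ltW.
by rewrite ler_pM2l// expr2 ler_peMr// ltW.
Qed.

Lemma ito_sum_stbdd : {ae P, forall w, stbdd ito_sum w}.
Proof.
apply: (@sqr_bound_stbdd _ (t * C)); first exact: mulr_ge0.
apply: filterE => n /=; apply: internal_moment2 => //; first exact: Hn_flip.
by move=> j jt; apply: Hn_moment2; exact: ltnW.
Qed.

Definition coarse_ito m n (s : coins n) : R := \sum_(p < m.+1)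
  clip m.+1%:R (Hn (time_index n (node m p)) s) * (walk lm (node m p.+1) s - walk lm (node m p) s).

Lemma coarse_ito_close e : 0 < e -> exists M, forall m, (M <= m)%N -> V [set n |
  Ex (fun s => (coarse_ito m (n := n) s - ito_sum s) ^+ 2) <= e].
Proof.
move=> e0; have t1 : 0 < t + 1 by rewrite ltr_wpDl.
pose e1 := e / (4 * (t + 1)); have e10 : 0 < e1 by rewrite divr_gt0// mulr_gt0.
have [M hM] := window_osc e10.
(* The clipping level m + 1 grows with the partition, so the clipping error, at most C^2 / (m + 1)^2
   by the fourth moments, also vanishes. *)
have [M2 hM2] : exists M2 : nat, forall m, (M2 <= m)%N -> C ^+ 2 / m.+1%:R ^+ 2 <= e1.
  exists (Num.truncn (C ^+ 2 / e1)) => m hm.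
  have h1 : C ^+ 2 / e1 <= m.+1%:R.
    by apply/ltW; apply: lt_le_trans (truncnS_gt _) _; rewrite ler_nat ltnS.
  rewrite ler_pdivrMr ?exprn_gt0//; move: h1; rewrite ler_pdivrMr// mulrC => /le_trans; apply.
  by rewrite ler_pM2l// expr2 ler_peMr// ler1n.
exists (maxn M M2) => m hm.
have := hM m (leq_trans (leq_maxl _ _) hm); apply: filterS => n /= osc.
pose G j s := \sum_(p < m.+1) clip m.+1%:R (Hn (n := n) (time_index n (node m p)) s) * (window n m p j)%:R - Hn j s.
rewrite (@eq_Ex _ _ _ (fun s => (\sum_(j < time_index n t) G j s * xi (hn n) lm j s) ^+ 2)); last first.
  move=> s; congr (_ ^+ 2); rewrite /coarse_ito /ito_sum.
  rewrite (eq_bigr (fun p : 'I_m.+1 => \sum_(j < time_index n t) clip m.+1%:R (Hn (time_index n (node m p)) s) * (window n m p j)%:R * xi (hn n) lm j s)).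
    rewrite exchange_big /= -sumrB; apply: eq_bigr => j _.
    by rewrite /G mulrBl mulr_suml.
  by move=> p _; rewrite walk_window// mulr_sumr; apply: eq_bigr => j _; rewrite mulrA.
apply: (@le_trans _ _ (t * (4 * e1))).
  apply: internal_moment2; first by rewrite mulr_ge0// ltW.
    (* Cells that start after index i have weight zero there, so the difference at i involves
       integrands at indices up to i only and remains predictable. *)
    move=> i j s ij; rewrite /G Hn_flip//; congr (_ - _); apply: eq_bigr => p _.
    rewrite /window; case: leqP => pi; last by rewrite !mulr0.
    by rewrite Hn_flip// (leq_trans pi).
  move=> j jt; have [p [pm pj hj e2]] := window_eval m jt.
  pose q := time_index n (node m p).
  apply: (@le_trans _ _ (Ex (fun s => 2 * (Hn (n := n) q s ^+ 4 / m.+1%:R ^+ 2) + 2 * (Hn q s - Hn j s) ^+ 2))).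
    apply: ler_Ex => s; rewrite /G (e2 (fun p => clip m.+1%:R (Hn (time_index n (node m p)) s))) -/q.
    have := @clip_err R m.+1%:R (Hn q s) (ltr0Sn _ _).
    set a := clip _ _; set b := Hn q s; set c := Hn j s => h.
    have h2 : (a - c) ^+ 2 <= 2 * (a - b) ^+ 2 + 2 * (b - c) ^+ 2.
      rewrite -subr_ge0 (_ : _ - _ = (a - 2 * b + c) ^+ 2); last by ring.
      exact: sqr_ge0.
    by apply: (le_trans h2); rewrite lerD2r ler_pM2l.
  rewrite ExD !ExZ.
  have -> : Ex (fun s => Hn (n := n) q s ^+ 4 / m.+1%:R ^+ 2) = Ex (fun s => Hn (n := n) q s ^+ 4) / m.+1%:R ^+ 2.
    by rewrite mulrC -ExZ; apply: eq_Ex => s; rewrite mulrC.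
  have a1 : Ex (fun s => Hn (n := n) q s ^+ 4) / m.+1%:R ^+ 2 <= e1.
    apply: le_trans (hM2 m (leq_trans (leq_maxr _ _) hm)).
    by rewrite ler_pM2r ?invr_gt0 ?exprn_gt0//; apply: H_m4; rewrite (leq_trans pj)// ltnW.
  have a2 : Ex (fun s : coins n => (Hn q s - Hn j s) ^+ 2) <= e1 := osc j p jt pj hj.
  by apply: (le_trans (lerD (ler_wpM2l _ a1) (ler_wpM2l _ a2))) => //; lra.
have : e1 * (4 * (t + 1)) = e by rewrite /e1 divfK// gt_eqF// mulr_gt0.
nra.
Qed.

Lemma simple_bounded m : exists M : R, forall p w, (p < m.+1)%N -> `|clip m.+1%:R (H (node m p) w)| <= M.
Proof. by exists m.+1%:R => p w _; exact: clip_bound. Qed.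

Lemma simple_meas m p : (p < m.+1)%N ->
  measurable_wrt (coin_filtration (node m p)) (fun w => clip m.+1%:R (H (node m p) w)).
Proof.
move=> pm A mA; apply: (integrand_adapted (node_itv t_ge0 pm) (A := clip m.+1%:R @^-1` A)).
rewrite -[X in measurable X]setTI; apply: continuous_measurable_fun mA => //.
exact: clip_continuous.
Qed.

(* Simple processes have coefficients bounded uniformly in w, hence the clipping. *)
Definition simple_approx m : simple_process coin_filtration :=
  @SimpleProcess R _ Omega coin_filtration m.+1 (node m) (fun p w => clip m.+1%:R (H (node m p) w))
    (node_ge0 t_ge0 m 0) (fun p _ => node_mono t_ge0 m (leqnSn p)) (@simple_meas m) (simple_bounded m).

(** At a fixed partition the coarse internal sum has the simple integral against the Brownian motion
    as its standard part. Its mean-square distance to the full internal sum is small uniformly along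
    the ultrafilter, and [st_tail] turns this into convergence in probability of the simple
    integrals. *)
Lemma ito_integralP :
  is_ito_integral P coin_filtration (fun u w => W u w lm.1 lm.2) t H (st ito_sum : Omega -> R).
Proof.
split.
- exact: process_measurable t_ge0 H_cont integrand_measurable.
- exact: integrand_adapted.
- by apply: aeW => w; exact: process_sqr_integral.
- apply: (@measurable_wrt_fun R U coins coins0 (fun n => setT)).
  by apply: st_measurable_wrt.
exists simple_approx; split; first exact: step_process_vanish t_ge0 H_cont integrand_measurable.
move=> e e0; have e2 : 0 < e / 2 by rewrite divr_gt0.
have Pfin X : P X = (fine (P X))%:E by rewrite P_EFin.
have vanish (A : nat -> set Omega) : (forall q, 0 < q -> exists M, forall m, (M <= m)%N -> (P (A m) <= q%:E)%E) ->
    P (A m) @[m --> \oo] --> (0 : \bar R)%E.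
  move=> hA; apply/fine_cvgP; split; first by apply: nearW => m; rewrite Pfin.
  apply/cvgrPdist_lt => q q0; have q2 : 0 < q / 2 by rewrite divr_gt0.
  have [M hM] := hA _ q2; exists M => // m mM.
  have p0 : 0 <= fine (P (A m)) by apply: fine_ge0; exact: measure_ge0.
  change (`|0 - fine (P (A m))| < q); rewrite sub0r normrN ger0_norm//.
  have := hM m mM; rewrite Pfin lee_fin => /le_lt_trans; apply.
  by rewrite gtr_pMr// invf_lt1// ltr1n.
apply: vanish => q q0.
have [M hM] := coarse_ito_close (mulr_gt0 q0 (exprn_gt0 2 e2)).
exists M => m mM; set A := [set w | _].
have hw : {ae P, forall w, coarse_ito m (w n) @[n --> V] --> simple_integral (simple_approx m) (fun u w => W u w lm.1 lm.2) t w}.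
  have hW : {ae P, forall w, forall p, walk lm (node m p) (w n) @[n --> V] --> W (node m p) w lm.1 lm.2}.
    apply: ae_forall_nat => p; have := brownian_ae U Nn hn_gt0 hn_cvg lm.1 lm.2 (node_ge0 t_ge0 m p).
    by rewrite -surjective_pairing.
  apply: negligibleS (negligibleU hW (node_cvg m)) => w /= nw; apply: contrapT.
  move=> /not_orP[/contrapT hW' /contrapT hH]; apply: nw.
  rewrite /coarse_ito /simple_integral /=; apply: cvg_sumr => p _.
  have pm := ltn_ord p; rewrite !min_l ?node_le// ?(ltnW pm)//.
  apply: cvgM; last by apply: cvgB; exact: hW'.
  by apply: (cvg_comp _ _ (hH p pm)); exact: clip_continuous.
(* Off a null set the error is the standard part of the internal difference. Going from e to e / 2
   gives the strict inequality that [st_tail] takes. *)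
have -> : P A = P (A `&` [set w | e / 2 < `|st (fun n s => coarse_ito m (n := n) s - ito_sum s) w|]).
  apply: P_ae_eq; apply: negligibleS (negligibleU hw ito_sum_stbdd) => w /= nw; apply: contrapT.
  move=> /not_orP[/contrapT cw /contrapT iw]; apply: nw; split=> [Aw|[]//]; split => //=.
  have -> : st (fun n s => coarse_ito m (n := n) s - ito_sum s) w =
     simple_integral (simple_approx m) (fun u w => W u w lm.1 lm.2) t w - st ito_sum w.
    by apply: ulim_cvg; apply: cvgB; [exact: cw|exact: iw].
  apply: lt_le_trans (_ : e <= _); first by rewrite gtr_pMr// invf_lt1// ltr1n.
  by move: Aw; rewrite /A /= lee_fin.
apply: (@le_trans _ _ (P [set w | e / 2 < `|st (fun n s => coarse_ito m (n := n) s - ito_sum s) w|])).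
  exact: P_le.
apply: st_tail; first exact: ltW.
have := hM m mM; apply: filterS => n /= /(markov_sqr e2); rewrite mulfK// gt_eqF// exprn_gt0//.
Qed.

End InternalIntegrand.

(** * The solution *)

Lemma within_cvg {R : realType} {T : Type} (F : set_system T) {FF : Filter F} (D : set R) (f : R -> R)
    (z : T -> R) (l : R) : {within D, continuous f} -> D l -> (\forall x \near F, D (z x)) ->
  z x @[x --> F] --> l -> f (z x) @[x --> F] --> f l.
Proof.
move=> /subspace_continuousP fc Dl Dz zl A /(fc l Dl) hA.
have := zl _ hA; apply: filterS2 Dz => x Dx /=; exact.
Qed.

Lemma psd_cvg {R : realType} {d : nat} {T : Type} (F : set_system T) {FF : ProperFilter F}
    (M : T -> 'M[R]_d) (L : 'M[R]_d) :
  (forall x, psd (M x)) -> (forall i j, M x i j @[x --> F] --> L i j) -> psd L.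
Proof.
move=> pM ML; apply/psdP; split=> [|u].
  apply/matrixP => i j; rewrite mxE.
  have h : M x j i @[x --> F] --> L i j.
    rewrite (_ : (fun x => M x j i) = (fun x => M x i j)); first exact: ML.
    by apply/funext => x; rewrite -[in LHS](psd_tr (pM x)) mxE.
  exact: (cvg_unique _ (ML j i) h).
have h : bform (M x) u u @[x --> F] --> bform L u u.
  rewrite bformE (_ : (fun x => bform (M x) u u) = (fun x => \sum_i \sum_j u i 0 * M x i j * u j 0)).
    apply: cvg_sumr => i _; apply: cvg_sumr => j _.
    by apply: cvgM; [apply: cvgM; [exact: cvg_cst|exact: ML]|exact: cvg_cst].
  by apply/funext => x; rewrite bformE.
rewrite leNgt; apply/negP => neg.
have hF : \forall x \near F, bform (M x) u u < 0 by apply: (cvgr_lt _ h).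
by have [x] := filter_ex hF; rewrite ltNge psd_ge0.
Qed.

Lemma l1mx_cvg {R : realType} {d : nat} {T : Type} (F : set_system T) {FF : Filter F}
    (M : T -> 'M[R]_d) (L : 'M[R]_d) :
  (forall i j, M x i j @[x --> F] --> L i j) -> l1mx (M x - L) @[x --> F] --> (0 : R).
Proof.
move=> ML; rewrite [X in _ --> X](_ : 0 = \sum_(i < d) \sum_(j < d) `|(0 : R)|); last first.
  by rewrite big1// => i _; rewrite big1// => j _; rewrite normr0.
rewrite /l1mx; apply: cvg_sumr => i _; apply: cvg_sumr => j _.
apply: cvg_norm; rewrite (_ : (fun x => (M x - L) i j) = (fun x => M x i j - L i j)).
  by rewrite -[X in _ --> X](subrr (L i j)); apply: cvgB; [exact: ML|exact: cvg_cst].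
by apply/funext => x; rewrite !mxE.
Qed.

Section Regular.
Context {R : realType} {d : nat}.

(** A common frame for noise and drift coefficients. The term linear in [l1mx] accommodates the
    square root, of Hoelder exponent 1/2, and the quadratic term the linear map B. *)
Definition regular_const (C : R) (f : 'M[R]_d -> R) : Prop := [/\ 0 <= C,
  forall x y, psd x -> psd y -> (f x - f y) ^+ 2 <= C * (l1mx (x - y) + l1mx (x - y) ^+ 2) &
  forall x, psd x -> f x ^+ 2 <= C * (1 + \tr x) ^+ 2].

Lemma regular_cvg C f {T : Type} (F : set_system T) {FF : Filter F}
    (M : T -> 'M[R]_d) (L : 'M[R]_d) : regular_const C f ->
  (\forall x \near F, psd (M x)) -> psd L ->
  (forall i j, M x i j @[x --> F] --> L i j) -> f (M x) @[x --> F] --> f L.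
Proof.
move=> [C0 f1 _] pM pL ML; apply/cvgrPdist_lt => e e0.
have h1 : l1mx (M x - L) @[x --> F] --> (0 : R) by exact: l1mx_cvg.
have h2 : C * (l1mx (M x - L) + l1mx (M x - L) ^+ 2) @[x --> F] --> (0 : R).
  rewrite [X in _ --> X](_ : 0 = C * (0 + 0 * 0)); last by ring.
  by apply: cvgM; [exact: cvg_cst|apply: cvgD => //; exact: (cvgM h1 h1)].
have h3 := cvgr_lt _ h2 _ (exprn_gt0 2 e0).
apply: filterS2 pM (h3 _) => x px hx; rewrite distrC.
rewrite -(@ltr_pXn2r _ 2)// ?nnegrE ?(ltW e0)// -normrX ger0_norm ?sqr_ge0//.
exact: le_lt_trans (f1 _ _ px pL) hx.
Qed.

Lemma regular_sqrt (c : R) i j : regular_const (c ^+ 2) (fun x => c * psd_sqrt x i j).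
Proof.
split; first exact: sqr_ge0.
- move=> x y px py; rewrite -mulrBr exprMn ler_wpM2l ?sqr_ge0//.
  apply: (@le_trans _ _ (l1mx (x - y))); last by rewrite lerDl sqr_ge0.
  rewrite -[leRHS]sqr_sqrtr ?l1mx_ge0// -[leLHS]ger0_norm ?sqr_ge0// normrX sqr_le//.
  exact: psd_sqrt_holder.
- move=> x px; rewrite exprMn ler_wpM2l ?sqr_ge0//; apply: (le_trans (psd_sqrt_entry i j px)).
  by have := psd_tr_ge0 px; nra.
Qed.

Lemma regular_sqrt4 (c : R) i j (x : 'M[R]_d) : psd x -> (c * psd_sqrt x i j) ^+ 4 <= c ^+ 4 * (1 + \tr x) ^+ 2.
Proof.
move=> px; have c4 : 0 <= c ^+ 4 by rewrite (_ : 4 = 2 * 2)%N// exprM sqr_ge0.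
rewrite exprMn ler_wpM2l// (_ : 4 = 2 * 2)%N// exprM sqr_le ?sqr_ge0//.
by apply: (le_trans (psd_sqrt_entry i j px)); rewrite lerDr.
Qed.

Lemma regular_drift (b0 : 'M[R]_d) (B : 'M[R]_d -> 'M[R]_d) i j : sym_linear B ->
  exists C, regular_const C (fun x => (b0 + B x) i j).
Proof.
move=> hB; set q := sym_linear_bound B; have q0 : 0 <= q by exact: sym_linear_bound_ge0.
pose C := q ^+ 2 + (`|b0 i j| + q * d%:R ^+ 2) ^+ 2.
have C1 : q ^+ 2 <= C by rewrite lerDl sqr_ge0.
have C2 : (`|b0 i j| + q * d%:R ^+ 2) ^+ 2 <= C by rewrite lerDr sqr_ge0.
have C0 : 0 <= C by rewrite addr_ge0 ?sqr_ge0.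
exists C; split => //.
- move=> x y px py; have l0 := l1mx_ge0 (x - y).
  have -> : (b0 + B x) i j - (b0 + B y) i j = B (x - y) i j.
    have := hB.2 (- 1) y x py.1 px.1.
    by rewrite !scaleN1r (addrC (- y)) => ->; rewrite !mxE; ring.
  have s : (x - y)^T = x - y by rewrite linearB /= (psd_tr px) (psd_tr py).
  apply: (@le_trans _ _ (q ^+ 2 * l1mx (x - y) ^+ 2)).
    rewrite -exprMn -[leLHS]ger0_norm ?sqr_ge0// normrX sqr_le//; exact: sym_linear_entry.
  by apply: ler_pM => //; rewrite ?sqr_ge0// lerDr.
- move=> x px; have t0 := psd_tr_ge0 px.
  apply: (@le_trans _ _ ((`|b0 i j| + q * d%:R ^+ 2) ^+ 2 * (1 + \tr x) ^+ 2)); last first.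
    by rewrite ler_wpM2r// sqr_ge0.
  rewrite -exprMn -[leLHS]ger0_norm ?sqr_ge0// normrX sqr_le// mxE.
  apply: (le_trans (ler_normD _ _)).
  have h1 := sym_linear_entry hB i j (psd_tr px).
  have h2 := l1mx_psd_le px.
  have h3 : q * l1mx x <= q * d%:R ^+ 2 * \tr x by rewrite -mulrA ler_wpM2l.
  have := normr_ge0 (b0 i j); have : 0 <= q * d%:R ^+ 2 by rewrite mulr_ge0// exprn_ge0.
  rewrite -/q in h1; set a := q * d%:R ^+ 2 in h3 *; nra.
Qed.

End Regular.

Section SolutionProcess.
Context {R : realType} (U : free_ultrafilter) {d : nat}.
Variables (Q b0 : 'M[R]_d) (B : 'M[R]_d -> 'M[R]_d) (k : R -> R) (X0 : 'M[R]_d) (T : R).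
Hypothesis k_ge0 : forall t : R, 0 <= t -> 0 <= k t.
Hypothesis k0_gt0 : 0 < k 0.
Hypothesis k_continuous : {within `[0, +oo[, continuous k}.
Hypothesis k_nonincreasing : forall s t : R, 0 <= s -> s <= t -> k t <= k s.
Hypothesis k_preserves : preserves_nonnegativity k.
Hypothesis hB : sym_linear B.
Hypothesis B_inward : forall x u : 'M[R]_d, psd x -> psd u -> \tr (x *m u) = 0 -> 0 <= \tr (B x *m u).
Hypothesis b0_ge : loewner_ge b0 ((k 0 * (d%:R - 1)) *: (Q^T *m Q)).
Hypothesis hb0 : b0 \is symmetricmx.
Hypothesis hX0 : psd X0.
Hypothesis T_gt0 : 0 < T.

Variables (hn thn : nat -> R) (Nn : nat -> nat).
Hypothesis hn_gt0 : forall n, 0 < hn n.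
Hypothesis hn_cvg : hn n @[n --> \oo] --> (0 : R).
Hypothesis Nn_big : forall n, n%:R <= hn n * (Nn n)%:R.
Hypothesis thn_gt0 : forall n, 0 < thn n.
Hypothesis thn_lt1 : forall n, thn n < 1.
Hypothesis thn_cvg : thn n @[n --> \oo] --> (0 : R).
Hypothesis small1 : forall n, k 0 * hn n * inward_const B ^+ 2 <= 4 * thn n * thn n.
Hypothesis small2 : forall n, hn n * noise_size Q (k 0) <= (1 - thn n) * thn n.

Local Notation coins := (coins (d := d) Nn).
Local Notation coins0 := (@coins0 d Nn).
Local Notation P := (@loeb_P R U coins coins0).
Local Notation Omega := (caratheodory_type (@loeb_mu R U coins coins0)).
Local Notation V := (fultra U).
Local Notation time_index := (time_index hn).
Local Notation W := (@brownian R U d hn Nn).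
Local Notation walk := (@walk R d hn Nn).
Local Notation past := (@past R d hn Nn).
Local Notation coin_filtration := (@coin_filtration R U d hn Nn).
Let UP : ProperFilter V := ultra_proper.
Let coins_gt0 n : (0 < #|coins n|)%N. Proof. exact: card_coins. Qed.
Let hn_ge0 n : 0 <= hn n. Proof. exact: ltW. Qed.
Let T_ge0 : 0 <= T. Proof. exact: ltW. Qed.

Definition grid_path n (J : nat) (s : coins n) : 'M[R]_d :=
  euler_path Q b0 B k X0 (thn n) (hn n) (N := Nn n) J s.
Arguments grid_path : clear implicits.

Let Xpsd n J s : psd (grid_path n J s).
Proof.
exact: (path_psd (hn_gt0 n) k_ge0 k0_gt0 k_nonincreasing k_preserves hB B_inward
  b0_ge hb0 hX0 (thn_gt0 n) (thn_lt1 n) (small1 n) (small2 n)).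
Qed.

Let Xtail n a b I J (l : R) : (I <= J)%N -> hn n * J%:R <= T -> 0 < l ->
  Pr [set s | l <= `|grid_path n J s a b - grid_path n I s a b|] <=
  tail_const Q b0 B k X0 T * (hn n * (J - I)%:R) ^+ 2 * (l ^- 2 + l ^- 4).
Proof.
exact: (incr_tail (Nn n) (hn_gt0 n) k_ge0 k0_gt0 k_nonincreasing k_preserves hB B_inward
  b0_ge hb0 hX0 (thn_gt0 n) (thn_lt1 n) (small1 n) (small2 n) T_ge0).
Qed.

Let Xincr n a b I J : (I <= J)%N -> hn n * J%:R <= T ->
  Ex (fun s => (grid_path n J s a b - grid_path n I s a b) ^+ 2) <=
  sq_const Q b0 B k X0 T * (hn n * (J - I)%:R).
Proof.
exact: (incr_moment2 (Nn n) (hn_gt0 n) k_ge0 k0_gt0 k_nonincreasing k_preserves hB B_inward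
  b0_ge hb0 hX0 (thn_gt0 n) (thn_lt1 n) (small1 n) (small2 n) T_ge0).
Qed.

Let mm := moment_max Q b0 B k X0 T.

Let Xmoment n J : hn n * J%:R <= T -> Ex (fun s => (1 + \tr (grid_path n J s)) ^+ 2) <= mm.
Proof.
exact: (moment_le (Nn n) (hn_gt0 n) k_ge0 k0_gt0 k_nonincreasing k_preserves hB B_inward
  b0_ge hb0 hX0 (thn_gt0 n) (thn_lt1 n) (small1 n) (small2 n) T_ge0).
Qed.

Let Xerror n a b J : (J <= Nn n)%N -> hn n * J%:R <= T ->
  Ex (fun s : coins n => scheme_error Q b0 B k X0 (thn n) (hn n) a b J s ^+ 2) <=
  error_const Q b0 B k X0 T * (thn n + hn n).
Proof.
exact: (scheme_error_moment2 (hn_gt0 n) k_ge0 k0_gt0 k_nonincreasing k_preserves hB B_inward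
  b0_ge hb0 hX0 (thn_gt0 n) (thn_lt1 n) (small1 n) (small2 n) T_ge0).
Qed.

Lemma grid_path_depends n J : depends_on (finset.finset (fun u : @coin_index d (Nn n) => u.1 < J)%N)
  (grid_path n J : {ffun _ -> bool} -> 'M[R]_d).
Proof.
move=> s s' ss; apply: eq_state => j jJ; apply/matrixP => l m; rewrite !mxE.
apply: (@xi_depends _ _ _ _ _ (finset.finset (fun u : @coin_index d (Nn n) => u.1 < J)%N)) ss => i ij.
by rewrite inE /= ij.
Qed.

(** Stopped at T, since the moment bounds hold on [0, T] while the continuous version is built on
    the whole half-line. *)
Definition entry_process (p : 'I_d * 'I_d) (t : R) n (s : coins n) : R :=
  grid_path n (time_index n (Num.min t T)) s p.1 p.2.

Let min_ge0 t : 0 <= t -> 0 <= Num.min t T.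
Proof. by move=> t0; rewrite le_min t0 T_ge0. Qed.

Let time_index_T n t : 0 <= t -> t <= T -> hn n * (time_index n t)%:R <= T.
Proof. by move=> t0 tT; apply: le_trans tT; exact: time_index_le. Qed.

Lemma entry_process0 p n (s : coins n) : entry_process p 0 s = X0 p.1 p.2.
Proof. by rewrite /entry_process min_l// time_index0 /grid_path /euler_path state0. Qed.

Lemma entry_process_tail p (L : nat) : exists2 C : R, 0 <= C & forall (n : nat) (s t l : R),
  0 <= s <= L%:R -> 0 <= t <= L%:R -> 0 < l ->
  Pr (R := R) [set w | l <= `|entry_process p t (n := n) w - entry_process p s w|] <=
    C * (`|t - s| + hn n) ^+ 2 * (l ^- 2 + l ^- 4).
Proof.
set C := tail_const Q b0 B k X0 T; exists `|C| => // n s t l.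
have key s' t' : 0 <= s' -> s' <= t' -> 0 < l ->
  Pr (R := R) [set w | l <= `|entry_process p t' (n := n) w - entry_process p s' w|] <=
    `|C| * (t' - s' + hn n) ^+ 2 * (l ^- 2 + l ^- 4).
  move=> s0 st l0; have t0 := le_trans s0 st.
  have mst : Num.min s' T <= Num.min t' T by rewrite le_min ge_min st /= ge_min lexx orbT.
  have tT : Num.min t' T <= T by rewrite ge_min lexx orbT.
  have d1 : Num.min t' T - Num.min s' T <= t' - s'.
    by have [|] := leP t' T; have [|] := leP s' T; lra.
  rewrite /entry_process.
  have hh := @Xtail n p.1 p.2 _ _ l (time_index_mono hn_gt0 n mst) (time_index_T n (min_ge0 t0) tT) l0.
  apply: (le_trans hh) => {hh}.
  apply: ler_wpM2r; first by rewrite addr_ge0// invr_ge0 exprn_ge0// ltW.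
  apply: (@le_trans _ _ (`|C| * (hn n * (time_index n (Num.min t' T) - time_index n (Num.min s' T))%:R) ^+ 2)).
    by rewrite ler_wpM2r ?sqr_ge0// ler_norm.
  rewrite ler_wpM2l// sqr_le ?mulr_ge0//.
  by apply: (le_trans (time_index_sub hn_gt0 n (min_ge0 s0) mst)); rewrite lerD2r.
move=> /andP[s0 sL] /andP[t0 tL] l0; have [st|ts] := leP s t.
  by rewrite (ger0_norm (_ : 0 <= t - s)) ?subr_ge0//; exact: key.
rewrite (ltr0_norm (_ : t - s < 0)) ?subr_lt0// opprB.
by have := key t s t0 (ltW ts) l0; under eq_set do rewrite distrC.
Qed.

Definition solution_good : set Omega := [set w | forall p, grid_good (entry_process p) w].

Lemma solution_good_ae : {ae P, forall w, solution_good w}.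
Proof.
apply: ae_forall_fin => p; apply: ae_negligible.
exact: (grid_good_ae U coins0 hn_ge0 hn_cvg (entry_process0 p) (entry_process_tail p)).
Qed.

(** The exceptional value X0 is constant in time and positive semidefinite, so continuity and
    positivity hold at every sample point. *)
Definition solution (t : R) (w : Omega) : 'M[R]_d :=
  if `[< solution_good w >] then \matrix_(i, j) continuous_version (entry_process (i, j)) t w else X0.

Lemma solution_ae t i j : 0 <= t <= T ->
  {ae P, forall w, grid_path n (time_index n t) (w n) i j @[n --> V] --> solution t w i j}.
Proof.
move=> /andP[t0 tT].
have h := continuous_version_ae U coins0 hn_ge0 hn_cvg (entry_process0 (i, j)) (entry_process_tail (i, j)) t0.
apply: negligibleS (negligibleU solution_good_ae h) => w /= nw; apply: contrapT.
move=> /not_orP[/contrapT gw /contrapT cw]; apply: nw.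
rewrite /solution asboolT// mxE; move: cw; rewrite /entry_process.
by under eq_fun do rewrite min_l//.
Qed.

(** The cone is closed under limits of entries, used twice: along the ultrafilter at a grid time,
    then along the grid times tending to t. This gives every w, not only almost every one. *)
Lemma solution_psd t w : 0 <= t -> psd (solution t w).
Proof.
move=> t0; rewrite /solution; case: asboolP => // gw.
pose M m : 'M[R]_d := \matrix_(i, j) st (entry_process (i, j) (grid_point m (grid_index m t))) w.
apply: (@psd_cvg R d nat \oo _ M).
  move=> m; apply: (@psd_cvg R d nat V _ (fun n => grid_path n (time_index n (Num.min (grid_point m (grid_index m t)) T)) (w n))).
    by move=> n; exact: Xpsd.
  by move=> i j; rewrite mxE; exact: (gw (i, j)).1.
move=> i j; rewrite mxE /M; under eq_fun do rewrite mxE.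
exact: continuous_versionP (gw (i, j)) t0.
Qed.

Lemma entry_continuous w i j : {within `[0, +oo[, continuous (fun t => solution t w i j)}.
Proof.
rewrite /solution; have [gw|ngw] := pselect (solution_good w).
  rewrite (_ : (fun t => _) = (fun t => continuous_version (entry_process (i, j)) t w)).
    exact: continuous_version_continuous (gw (i, j)).
  by apply/funext => t; rewrite asboolT// mxE.
rewrite (_ : (fun t => _) = (fun=> X0 i j)); last by apply/funext => t; rewrite asboolF.
by apply: continuous_subspaceT => t; exact: cvg_cst.
Qed.

Lemma solution_continuous w : {within `[0, T], continuous (fun t => solution t w)}.
Proof.
apply: mx_continuous => i j; apply: continuous_subspaceW (@entry_continuous w i j).
by move=> u /=; rewrite !in_itv /= => /andP[->].
Qed.

Lemma solution_adapted t i j : 0 <= t <= T -> measurable_wrt (coin_filtration t) (fun w => solution t w i j).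
Proof.
move=> tT; apply: (coin_sigma_st (f := fun n s => grid_path n (time_index n t) s i j)).
  by move=> n s s' ss; rewrite (@grid_path_depends n _ _ _ ss).
apply: negligibleS (solution_ae i j tT) => w; apply: contra_not; exact: ulim_cvg.
Qed.

Section Integrand.
Variables (t : R) (f : 'M[R]_d -> R) (C : R).
Hypothesis tT : 0 <= t <= T.
Hypothesis fC : regular_const C f.

Let t_ge0 : 0 <= t. Proof. by case/andP: tT. Qed.
Let t_leT : t <= T. Proof. by case/andP: tT. Qed.
Let hJT n : hn n * (time_index n t)%:R <= T. Proof. exact: time_index_T. Qed.

Definition integrand (u : R) (w : Omega) : R := k (t - u) * f (solution u w).

Definition grid_integrand n (j : nat) (s : coins n) : R :=
  kgrid k (hn n) (time_index n t - j) * f (grid_path n j s).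

Lemma grid_integrand_depends n j :
  depends_on (finset.finset (fun u : @coin_index d (Nn n) => u.1 < j)%N)
    (grid_integrand (n := n) j : {ffun _ -> bool} -> R).
Proof. by move=> s s' ss; rewrite /grid_integrand (@grid_path_depends n j s s' ss). Qed.

Lemma integrand_lim u : 0 <= u <= t ->
  {ae P, forall w, grid_integrand (time_index n u) (w n) @[n --> V] --> integrand u w}.
Proof.
move=> /andP[u0 ut]; have uT : 0 <= u <= T by rewrite u0 (le_trans ut).
have h : {ae P, forall w, forall p : 'I_d * 'I_d, grid_path n (time_index n u) (w n) p.1 p.2 @[n --> V] --> solution u w p.1 p.2}.
  by apply: ae_forall_fin => p; exact: solution_ae.
apply: negligibleS h => w; apply: contra_not => hw; apply: cvgM; last first.
  apply: (regular_cvg (M := fun n => grid_path n (time_index n u) (w n)) fC).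
  - by apply: filterE => n; exact: Xpsd.
  - exact: solution_psd.
  - by move=> i j; exact: (hw (i, j)).
apply: (within_cvg k_continuous).
- by rewrite /= in_itv /= andbT subr_ge0.
- by apply: filterE => n; rewrite /= in_itv /= andbT mulr_ge0.
- rewrite (_ : (fun n => _) = (fun n => hn n * (time_index n t)%:R - hn n * (time_index n u)%:R)).
    by apply: cvgB; apply: cvg_fultra; apply: time_index_cvg.
  by apply/funext => n; rewrite natrB ?mulrBr//; exact: time_index_mono.
Qed.

Lemma integrand_continuous w : {within `[0, t], continuous (fun u => integrand u w)}.
Proof.
apply/subspace_continuousP => u ut; have := ut; rewrite /= in_itv /= => /andP[u0 ut'].
have wD : \forall v \near within `[0, t] (nbhs u), (`[0, t]%classic : set R) v by exact: withinT.
have w0 : \forall v \near within `[0, t] (nbhs u), 0 <= v.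
  by apply: filterS wD => v; rewrite /= in_itv /= => /andP[].
have idc : v @[v --> within `[0, t] (nbhs u)] --> u by apply: cvg_within_filter; exact: cvg_id.
apply: cvgM.
  apply: (within_cvg k_continuous).
  - by rewrite /= in_itv /= andbT subr_ge0.
  - by apply: filterS wD => v; rewrite /= !in_itv /= andbT subr_ge0 => /andP[].
  - by apply: cvgB; [exact: cvg_cst|exact: idc].
apply: (regular_cvg (M := fun v => solution v w) fC).
- by apply: filterS w0 => v; exact: solution_psd.
- exact: solution_psd.
- move=> i j; apply: (within_cvg (@entry_continuous w i j)).
  + by rewrite /= in_itv /= andbT.
  + by apply: filterS w0 => v; rewrite /= in_itv /= andbT.
  + exact: idc.
Qed.

Let mm_ge0 : 0 <= mm. Proof. exact: moment_max_ge0. Qed.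

Lemma grid_f_moment n j : (j <= time_index n t)%N -> Ex (fun s => f (grid_path n j s) ^+ 2) <= C * mm.
Proof.
have [C0 _ f2] := fC; move=> jt.
apply: (@le_trans _ _ (Ex (fun s => C * (1 + \tr (grid_path n j s)) ^+ 2))).
  by apply: ler_Ex => s; apply: f2; exact: Xpsd.
rewrite ExZ ler_wpM2l//; apply: Xmoment.
by apply: le_trans (hJT n); rewrite ler_pM2l// ler_nat.
Qed.

Lemma grid_f_incr n i j e : 0 <= e -> e <= 1 -> (i <= j)%N -> (j <= time_index n t)%N ->
  `|sq_const Q b0 B k X0 T| * (hn n * (j - i)%:R) <= e ^+ 2 ->
  Ex (fun s => (f (grid_path n j s) - f (grid_path n i s)) ^+ 2) <= C * ((d%:R ^+ 2 + d%:R ^+ 4) * e).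
Proof.
have [C0 f1 _] := fC; move=> e0 e1 ij jt he.
have jT : hn n * j%:R <= T by apply: le_trans (hJT n); rewrite ler_pM2l// ler_nat.
pose D a b s := grid_path n j s a b - grid_path n i s a b.
have D2 a b : Ex (fun s => D a b s ^+ 2) <= e ^+ 2.
  apply: (le_trans (Xincr _ _ ij jT)); apply: le_trans he.
  by rewrite ler_wpM2r ?mulr_ge0// ler_norm.
have D1 a b : Ex (fun s => `|D a b s|) <= e by apply: Ex_norm_le => //; exact: D2.
have lE s : l1mx (grid_path n j s - grid_path n i s) = \sum_(p : 'I_d * 'I_d) `|D p.1 p.2 s|.
  rewrite /l1mx pair_bigA; by apply: eq_bigr => p _; rewrite /D /= !mxE.
apply: (@le_trans _ _ (Ex (fun s => C * (\sum_(p : 'I_d * 'I_d) `|D p.1 p.2 s| +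
     #|{: 'I_d * 'I_d}|%:R * \sum_(p : 'I_d * 'I_d) D p.1 p.2 s ^+ 2)))).
  apply: ler_Ex => s; have h := f1 (grid_path n j s) (grid_path n i s) (@Xpsd n j s) (@Xpsd n i s); apply: (le_trans h).
  rewrite lE ler_wpM2l// lerD2l; apply: (le_trans (sqr_sum_le_fin _)).
  by rewrite ler_wpM2l//; apply: ler_sum => p _; rewrite -normrX ger0_norm ?sqr_ge0.
rewrite ExZ ler_wpM2l// ExD ExZ !Ex_sum card_prod card_ord natrM -expr2.
have s1 (c : R) : \sum_(p : 'I_d * 'I_d) c = d%:R ^+ 2 * c.
  by rewrite sumr_const card_prod card_ord -[LHS]mulr_natl natrM -expr2.
rewrite mulrDl; apply: lerD.
  by rewrite -s1; apply: ler_sum => p _; exact: D1.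
rewrite (_ : 4 = 2 + 2)%N// exprD -mulrA ler_wpM2l ?exprn_ge0//.
rewrite -s1; apply: ler_sum => p _; apply: (le_trans (D2 _ _)).
by rewrite expr2 ler_piMr.
Qed.

(** The difference of products splits into a kernel increment times f, small by uniform continuity
    of k on [0, T] and the moments of f, and a bounded kernel value times an increment of f, small
    by [grid_f_incr]. *)
Lemma grid_integrand_osc e : 0 < e -> exists2 r, 0 < r & V [set n | forall i j,
  (i <= j)%N -> (j <= time_index n t)%N -> hn n * (j - i)%:R <= r ->
  Ex (fun s => (grid_integrand (n := n) j s - grid_integrand i s) ^+ 2) <= e].
Proof.
move=> e0; have [C0 _ _] := fC.
(* The denominators that leave e / 2 to each of the two parts; the added 1 keeps them positive. *)
pose a := 4 * (C * mm) + 1; pose b := 4 * k 0 ^+ 2 * (C * (d%:R ^+ 2 + d%:R ^+ 4)) + 1.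
have CM0 : 0 <= C * mm by rewrite mulr_ge0.
have CD0 : 0 <= C * (d%:R ^+ 2 + d%:R ^+ 4) by rewrite mulr_ge0// addr_ge0// exprn_ge0.
have kD0 : 0 <= k 0 ^+ 2 * (C * (d%:R ^+ 2 + d%:R ^+ 4)) by rewrite mulr_ge0// sqr_ge0.
have a0 : 0 < a by rewrite ltr_wpDl// mulr_ge0.
have b0' : 0 < b by rewrite ltr_wpDl// -mulrA mulr_ge0.
pose q := Num.min 1 (e / b); have q0 : 0 < q by rewrite lt_min ltr01 divr_gt0.
have q1 : q <= 1 by rewrite ge_min lexx.
have qb : b * q <= e by rewrite mulrC -ler_pdivlMr// ge_min lexx orbT.
have se : 0 < Num.sqrt (e / a) by rewrite sqrtr_gt0 divr_gt0.
have kT : {within `[0, T], continuous k}.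
  by apply: continuous_subspaceW k_continuous => u /=; rewrite !in_itv /= => /andP[->].
have [r1 r10 hr1] := unif_continuous_itv kT se.
pose sq := `|sq_const Q b0 B k X0 T| + 1.
have sq0 : 0 < sq by rewrite ltr_wpDl.
pose r := Num.min (r1 / 2) (q ^+ 2 / sq).
have r0 : 0 < r by rewrite lt_min !divr_gt0// exprn_gt0.
exists r => //; apply: filterE => n i j ij jt hij.
have rr1 : hn n * (j - i)%:R < r1.
  apply: (le_lt_trans hij); apply: (@le_lt_trans _ _ (r1 / 2)); first by rewrite ge_min lexx.
  by rewrite gtr_pMr// invf_lt1// ltr1n.
have rr2 : `|sq_const Q b0 B k X0 T| * (hn n * (j - i)%:R) <= q ^+ 2.
  have h : hn n * (j - i)%:R <= q ^+ 2 / sq by apply: (le_trans hij); rewrite ge_min lexx orbT.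
  move: h; rewrite ler_pdivlMr// mulrC => /(le_trans _); apply.
  by rewrite ler_wpM2r ?mulr_ge0// lerDl.
have hf := grid_f_incr (ltW q0) q1 ij jt rr2.
pose G m := kgrid k (hn n) (time_index n t - m).
have Gk m : 0 <= hn n * (time_index n t - m)%:R <= T.
  rewrite mulr_ge0//=; apply: le_trans (hJT n); by rewrite ler_pM2l// ler_nat leq_subr.
have dG : (G j - G i) ^+ 2 <= e / a.
  rewrite -[leRHS]sqr_sqrtr ?divr_ge0 ?(ltW e0) ?(ltW a0)//.
  rewrite -[leLHS]ger0_norm ?sqr_ge0// normrX sqr_le//; apply/ltW; apply: hr1 => //.
  have -> : hn n * (time_index n t - j)%:R - hn n * (time_index n t - i)%:R = - (hn n * (j - i)%:R).
    by rewrite !natrB ?(leq_trans ij)//; ring.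
  by rewrite normrN ger0_norm ?mulr_ge0.
apply: (@le_trans _ _ (Ex (fun s => 2 * (G j - G i) ^+ 2 * f (grid_path n j s) ^+ 2 +
    2 * G i ^+ 2 * (f (grid_path n j s) - f (grid_path n i s)) ^+ 2))).
  apply: ler_Ex => s; rewrite /grid_integrand -/(G j) -/(G i).
  set x := f _; set y := f _; rewrite -subr_ge0.
  rewrite (_ : _ - _ = ((G j - G i) * x - G i * (x - y)) ^+ 2); last by ring.
  exact: sqr_ge0.
rewrite ExD !ExZ.
have Gi : G i ^+ 2 <= k 0 ^+ 2.
  rewrite sqr_le ?kgrid_ge0//; rewrite -(kgrid0 k (hn n)); exact: kgrid_noninc.
have hm := grid_f_moment jt.
have x0 : 0 <= Ex (fun s => f (grid_path n j s) ^+ 2) by apply: Ex_ge0 => s; exact: sqr_ge0.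
have y0 : 0 <= Ex (fun s => (f (grid_path n j s) - f (grid_path n i s)) ^+ 2) by apply: Ex_ge0 => s; exact: sqr_ge0.
have h1 : 2 * (G j - G i) ^+ 2 * Ex (fun s => f (grid_path n j s) ^+ 2) <= e / 2.
  apply: (@le_trans _ _ (2 * (e / a) * (C * mm))).
    by apply: ler_pM => //; [rewrite mulr_ge0// sqr_ge0|rewrite ler_wpM2l].
  rewrite (_ : 2 * (e / a) * (C * mm) = e / 2 * (4 * (C * mm) / a)); last by field; rewrite gt_eqF.
  rewrite ler_piMr ?divr_ge0 ?(ltW e0)//.
  by rewrite ler_pdivrMr// mul1r lerDl.
have h2 : 2 * G i ^+ 2 * Ex (fun s => (f (grid_path n j s) - f (grid_path n i s)) ^+ 2) <= e / 2.
  apply: (@le_trans _ _ (2 * k 0 ^+ 2 * (C * ((d%:R ^+ 2 + d%:R ^+ 4) * q)))).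
    by apply: ler_pM => //; [rewrite mulr_ge0// sqr_ge0|rewrite ler_wpM2l].
  apply: (@le_trans _ _ (b * q / 2)); last by rewrite ler_pM2r.
  rewrite /b; have := mulr_ge0 kD0 (ltW q0); set D := d%:R ^+ 2 + d%:R ^+ 4 => hD.
  rewrite (_ : 2 * k 0 ^+ 2 * (C * (D * q)) = 4 * k 0 ^+ 2 * (C * D) * q / 2); last by field.
  by rewrite ler_pM2r ?invr_gt0// ler_pM2r// lerDl.
by rewrite [leRHS]splitr; exact: lerD.
Qed.

Lemma integrand_drift_limit : {ae P, forall w,
  drift_sum hn t (@grid_integrand) (w n) @[n --> V] --> (\int[lebesgue_measure]_(u in `[0, t]) integrand u w)%R}.
Proof.
apply: drift_limit => //.
- exact: integrand_lim.
- exact: integrand_continuous.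
- exact: grid_integrand_osc.
Qed.

Hypothesis f4 : exists2 C4, 0 <= C4 & forall x, psd x -> f x ^+ 4 <= C4 * (1 + \tr x) ^+ 2.

(** Only second moments of the trace are bounded. They suffice for noise coefficients because the
    fourth power of an entry of the square root is at most quadratic in the trace, which is what
    [f4] records. *)
Lemma grid_integrand_m4 : exists2 C', 0 <= C' & forall n j, (j <= time_index n t)%N ->
  Ex (fun s => grid_integrand (n := n) j s ^+ 4) <= C' ^+ 2.
Proof.
have [C4 C40 hC4] := f4; pose c := k 0 ^+ 4 * (C4 * mm).
have k4 : 0 <= k 0 ^+ 4 by rewrite exprn_ge0// ltW.
have c0 : 0 <= c by rewrite mulr_ge0// mulr_ge0.
exists (1 + c); first by rewrite addr_ge0.
move=> n j jt; apply: (@le_trans _ _ c); last by nra.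
apply: (@le_trans _ _ (Ex (fun s => k 0 ^+ 4 * (C4 * (1 + \tr (grid_path n j s)) ^+ 2)))).
  apply: ler_Ex => s; rewrite /grid_integrand exprMn.
  have G0 := kgrid_ge0 k_ge0 (time_index n t - j) (hn_gt0 n).
  have Gk : kgrid k (hn n) (time_index n t - j) <= k 0 by rewrite -(kgrid0 k (hn n)); exact: kgrid_noninc.
  apply: ler_pM; [by rewrite exprn_ge0| |by rewrite lerXn2r ?nnegrE// ltW|exact/hC4/Xpsd].
  by rewrite (_ : 4 = 2 * 2)%N// exprM sqr_ge0.
rewrite !ExZ !ler_wpM2l//; apply: Xmoment.
by apply: le_trans (hJT n); rewrite ler_pM2l// ler_nat.
Qed.

Lemma integrand_ito lm : is_ito_integral P coin_filtration (fun u w => W u w lm.1 lm.2) t integrand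
    (st (ito_sum hn t (@grid_integrand) lm) : Omega -> R).
Proof.
have [C' C0 hC'] := grid_integrand_m4.
apply: (@ito_integralP _ _ _ _ _ hn_gt0 hn_cvg _ _ _ t_ge0 _ _ _ _ _ _ C0 hC').
- exact: grid_integrand_depends.
- exact: integrand_lim.
- exact: integrand_continuous.
- exact: grid_integrand_osc.
Qed.

Lemma integrand_ito_stbdd lm : {ae P, forall w, stbdd (ito_sum hn t (@grid_integrand) lm) w}.
Proof.
have [C' C0 hC'] := grid_integrand_m4.
by apply: ito_sum_stbdd C0 hC' => //; exact: grid_integrand_depends.
Qed.

End Integrand.

Section Equation.
Variable t : R.
Hypothesis tT : 0 <= t <= T.

Let t_ge0 : 0 <= t. Proof. by case/andP: tT. Qed.
Let t_leT : t <= T. Proof. by case/andP: tT. Qed.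

Let f1 (i j l m : 'I_d) (x : 'M[R]_d) : R := Q m j * psd_sqrt x i l.
Let f2 (i j l m : 'I_d) (x : 'M[R]_d) : R := Q l i * psd_sqrt x m j.
Let g (i j : 'I_d) (x : 'M[R]_d) : R := (b0 + B x) i j.

Definition noise_sum (f : 'M[R]_d -> R) (lm : 'I_d * 'I_d) n : coins n -> R :=
  ito_sum hn t (@grid_integrand t f) lm (n := n).

Let sqrt4 (c : R) (i j : 'I_d) : exists2 C4, 0 <= C4 &
  forall x : 'M[R]_d, psd x -> (c * psd_sqrt x i j) ^+ 4 <= C4 * (1 + \tr x) ^+ 2.
Proof.
exists (c ^+ 4); last by move=> x; exact: regular_sqrt4.
by rewrite (_ : 4 = 2 * 2)%N// exprM sqr_ge0.
Qed.

Definition left_noise (w : Omega) : 'M[R]_d :=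
  \matrix_(i, j) \sum_(l < d) \sum_(m < d) st (noise_sum (f1 i j l m) (l, m)) w.

(** The transposed Brownian motion exchanges the two indices of a coin, hence (m, l) where the left
    noise has (l, m). *)
Definition right_noise (w : Omega) : 'M[R]_d :=
  \matrix_(i, j) \sum_(l < d) \sum_(m < d) st (noise_sum (f2 i j l m) (m, l)) w.

Lemma left_noiseP : is_mx_ito_integral P coin_filtration W t
  (fun s w => (k (t - s))%:M *m psd_sqrt (solution s w)) (fun _ _ => Q) left_noise.
Proof.
exists (fun i j l m => st (noise_sum (f1 i j l m) (l, m)) : Omega -> R).
split; last by move=> w i j; rewrite mxE.
move=> i j l m; have := integrand_ito tT (regular_sqrt (Q m j) i l) (sqrt4 (Q m j) i l) (l, m).
rewrite (_ : (fun u w => ((k (t - u))%:M *m psd_sqrt (solution u w)) i l * Q m j) = integrand t (f1 i j l m))//.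
by apply/funext => u; apply/funext => w; rewrite mul_scalar_mx mxE /integrand /f1; ring.
Qed.

Lemma right_noiseP : is_mx_ito_integral P coin_filtration (fun s w => (W s w)^T) t
  (fun s _ => (k (t - s))%:M *m Q^T) (fun s w => psd_sqrt (solution s w)) right_noise.
Proof.
exists (fun i j l m => st (noise_sum (f2 i j l m) (m, l)) : Omega -> R).
split; last by move=> w i j; rewrite mxE.
move=> i j l m; have := integrand_ito tT (regular_sqrt (Q l i) m j) (sqrt4 (Q l i) m j) (m, l).
rewrite (_ : (fun u w => ((k (t - u))%:M *m Q^T) i l * _) = integrand t (f2 i j l m)); last first.
  by apply/funext => u; apply/funext => w; rewrite mul_scalar_mx !mxE /integrand /f2; ring.
rewrite (_ : (fun u w => (W u w)^T l m) = (fun u w => W u w m l))//.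
by apply/funext => u; apply/funext => w; rewrite mxE.
Qed.

Lemma grid_path_split n (s : coins n) i j : grid_path n (time_index n t) s i j =
  X0 i j + drift_sum hn t (@grid_integrand t (g i j)) s +
  (\sum_(l < d) \sum_(m < d) noise_sum (f1 i j l m) (l, m) s +
   \sum_(l < d) \sum_(m < d) noise_sum (f2 i j l m) (m, l) s) +
  scheme_error Q b0 B k X0 (thn n) (hn n) i j (time_index n t) s.
Proof.
rewrite /scheme_error -/(grid_path n _ s).
have -> : drift_sum hn t (@grid_integrand t (g i j)) s =
    \sum_(p < time_index n t) kgrid k (hn n) (time_index n t - p) * (hn n * (b0 + B (euler_path Q b0 B k X0 (thn n) (hn n) p s)) i j).
  by apply: eq_bigr => p _; rewrite /grid_integrand /g /grid_path; ring.
have -> : \sum_(q : 'I_d * 'I_d) \sum_(p < time_index n t) kgrid k (hn n) (time_index n t - p) *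
      sqrt_coef Q (euler_path Q b0 B k X0 (thn n) (hn n) p s) i j q * xi (hn n) q p s =
    \sum_(l < d) \sum_(m < d) noise_sum (f1 i j l m) (l, m) s +
    \sum_(l < d) \sum_(m < d) noise_sum (f2 i j l m) (m, l) s.
  rewrite [X in _ = _ + X]exchange_big /= !pair_bigA /= -big_split; apply: eq_bigr => -[[l m] p] _ /=.
  rewrite /grid_integrand /f1 /f2 /sqrt_coef /= -/(grid_path n p s).
  rewrite -[psd_sqrt (grid_path n p s) j l](_ : (psd_sqrt (grid_path n p s))^T l j = _); last by rewrite mxE.
  by rewrite (psd_tr (psd_sqrtP (@Xpsd n p s)).1); ring.
ring.
Qed.

Lemma scheme_error_ae i j : {ae P, forall w,
  scheme_error Q b0 B k X0 (thn n) (hn n) i j (time_index n t) (w n : coins n) @[n --> V] --> (0 : R)}.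
Proof.
apply: (@Ex0_ae R U coins coins0 (fun n s => scheme_error Q b0 B k X0 (thn n) (hn n) i j (time_index n t) s)).
set E := error_const Q b0 B k X0 T; have E1 : 0 < `|E| + 1 by rewrite ltr_wpDl.
apply/cvgrPdist_lt => e e0.
have c0 : thn n + hn n @[n --> V] --> (0 : R).
  by rewrite -[X in _ --> X](addr0 0); apply: cvgD; apply: cvg_fultra.
have e1 : 0 < (e / 2) ^+ 2 / (`|E| + 1) by rewrite divr_gt0// exprn_gt0// divr_gt0.
have h1 : \forall n \near V, thn n + hn n < (e / 2) ^+ 2 / (`|E| + 1) by apply: (cvgr_lt _ c0).
have h2 := ultra_natr U t; apply: filterS2 h1 h2 => n /=; rewrite ltr_pdivlMr// => h1 h2.
rewrite sub0r normrN ger0_norm; last by apply: Ex_ge0 => s.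
apply: (@le_lt_trans _ _ (e / 2)); last by rewrite gtr_pMr// invf_lt1// ltr1n.
have tn0 : 0 <= thn n + hn n by rewrite addr_ge0// ltW.
apply: Ex_norm_le => //; first by rewrite divr_ge0// ltW.
have hE := @Xerror n i j _ (time_index_N hn_gt0 Nn_big t_ge0 h2) (time_index_T n t_ge0 t_leT).
apply: (le_trans hE); apply: ltW; apply: le_lt_trans h1; rewrite mulrC ler_wpM2l//.
by apply: (le_trans (ler_norm _)); rewrite lerDl.
Qed.

Lemma solution_equation : {ae P, forall w, solution t w = X0
  + \matrix_(i, j) (\int[lebesgue_measure]_(s in `[0, t]) ((k (t - s))%:M *m (b0 + B (solution s w))) i j)%R
  + (left_noise w + right_noise w)}.
Proof.
have hp (p : 'I_d * 'I_d) : {ae P, forall w, solution t w p.1 p.2 = (X0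
  + \matrix_(i, j) (\int[lebesgue_measure]_(s in `[0, t]) ((k (t - s))%:M *m (b0 + B (solution s w))) i j)%R
  + (left_noise w + right_noise w)) p.1 p.2}.
  case: p => i j /=.
  have [C hC] := regular_drift b0 i j hB.
  have n1 : {ae P, forall w, forall q : 'I_d * 'I_d, stbdd (noise_sum (f1 i j q.1 q.2) q) w}.
    apply: ae_forall_fin => -[l m] /=.
    by have h := integrand_ito_stbdd tT (sqrt4 (Q m j) i l) (l, m).
  have n2 : {ae P, forall w, forall q : 'I_d * 'I_d, stbdd (noise_sum (f2 i j q.1 q.2) (q.2, q.1)) w}.
    apply: ae_forall_fin => -[l m] /=.
    by have h := integrand_ito_stbdd tT (sqrt4 (Q l i) m j) (m, l).
  have hs := solution_ae i j tT; have hd := integrand_drift_limit tT hC; have he := scheme_error_ae i j.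
  apply: negligibleS (negligibleU (negligibleU hs hd) (negligibleU he (negligibleU n1 n2))) => w /= nw.
  apply: contrapT => /not_orP[/not_orP[/contrapT cs /contrapT cd] /not_orP[/contrapT ce /not_orP[/contrapT c1 /contrapT c2]]].
  apply: nw; rewrite !mxE.
  have -> : (\int[lebesgue_measure]_(s in `[0, t]) ((k (t - s))%:M *m (b0 + B (solution s w))) i j)%R =
      (\int[lebesgue_measure]_(s in `[0, t]) integrand t (g i j) s w)%R.
    by apply: eq_Rintegral => s _; rewrite mul_scalar_mx mxE.
  have cR : grid_path n (time_index n t) (w n) i j @[n --> V] --> X0 i j + (\int[lebesgue_measure]_(s in `[0, t]) integrand t (g i j) s w)%R +
     (\sum_(l < d) \sum_(m < d) st (noise_sum (f1 i j l m) (l, m)) w + \sum_(l < d) \sum_(m < d) st (noise_sum (f2 i j l m) (m, l)) w) + 0.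
    under eq_fun do rewrite grid_path_split.
    apply: cvgD; last exact: ce.
    apply: cvgD; first by apply: cvgD; [exact: cvg_cst|exact: cd].
    apply: cvgD; apply: cvg_sumr => l _; apply: cvg_sumr => m _.
      exact: (c1 (l, m)).
    exact: (c2 (l, m)).
  by rewrite -[RHS]addr0; exact: (cvg_unique _ cs cR).
apply: negligibleS (ae_forall_fin hp) => w; apply: contra_not => hw.
by apply/matrixP => i j; exact: (hw (i, j)).
Qed.

End Equation.

Lemma solutionP : sve_solution P coin_filtration W T (fun t => (k t)%:M) (fun x => b0 + B x) Q X0 solution.
Proof.
split.
- by move=> t w /andP[t0 _]; exact: solution_psd.
- by move=> t i j; exact: solution_adapted.
- exact: solution_continuous.
- move=> t tT; exists (left_noise t), (right_noise t); split.
  + exact: left_noiseP.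
  + exact: right_noiseP.
  + exact: solution_equation.
Qed.

End SolutionProcess.

(** The threshold 1 / (n + 2) comes first, and the mesh is then taken below the two bounds it
    imposes and below 1 / (n + 1). The denominators a + 1 and |b| + 1 avoid division by zero, and N
    is large enough for the grid to reach time n. *)
Lemma scheme_parameters {R : realType} (a b : R) : 0 <= a ->
  exists (h th : nat -> R) (N : nat -> nat),
    [/\ forall n, 0 < h n /\ n%:R <= h n * (N n)%:R, h n @[n --> \oo] --> (0 : R),
        (forall n, 0 < th n) /\ (forall n, th n < 1), th n @[n --> \oo] --> (0 : R)
      & forall n, a * h n <= 4 * th n * th n /\ h n * b <= (1 - th n) * th n].
Proof.
move=> a0; pose th n : R := n.+2%:R^-1.
have th0 n : 0 < th n by rewrite invr_gt0.
have th1 n : th n < 1 by rewrite invf_lt1// ltr1n.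
have c1 : 0 < a + 1 by rewrite ltr_wpDl.
have c2 : 0 < `|b| + 1 by rewrite ltr_wpDl.
pose h n : R := Num.min n.+1%:R^-1 (Num.min (4 * th n * th n / (a + 1)) ((1 - th n) * th n / (`|b| + 1))).
have h0 n : 0 < h n.
  rewrite !lt_min invr_gt0 ltr0Sn/=; apply/andP; split; apply: divr_gt0 => //.
    by rewrite mulr_gt0// mulr_gt0.
  by rewrite mulr_gt0// subr_gt0.
have h1 n : h n <= n.+1%:R^-1 by rewrite ge_min lexx.
have hc : n.+1%:R^-1 @[n --> \oo] --> (0 : R) by exact: cvg_harmonic.
exists h, th, (fun n => (Num.truncn (n%:R / h n)).+1); split => //.
- move=> n; split => //.
  by rewrite -ler_pdivrMl// mulrC ltW// truncnS_gt.
- apply: (squeeze_cvgr _ (cvg_cst (0 : R)) hc); apply: nearW => n.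
  by rewrite (ltW (h0 n)) h1.
- have tc := hc; rewrite -(cvg_shiftS (fun n => n.+1%:R^-1 : R)) in tc.
  exact: tc.
- move=> n; split.
    have : h n <= 4 * th n * th n / (a + 1) by rewrite !ge_min lexx !orbT.
    rewrite ler_pdivlMr// mulrC => /(le_trans _); apply.
    by rewrite ler_pM2r// lerDl.
  have : h n <= (1 - th n) * th n / (`|b| + 1) by rewrite !ge_min lexx !orbT.
  rewrite ler_pdivlMr// => /(le_trans _); apply; rewrite ler_pM2l//.
  by apply: (le_trans (ler_norm b)); rewrite lerDl.
Qed.

Theorem theorem2p13 (R : realType) (d : nat) (T : R) (hT : 0 < T)
  (Q b0 : 'M[R]_d) (hb0 : b0 \is symmetricmx)
  (B : 'M[R]_d -> 'M[R]_d) (hB : sym_linear B)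
  (k : R -> R)
  (k_ge0 : forall t : R, 0 <= t -> 0 <= k t)
  (k_bounded : exists M : R, forall t : R, 0 <= t -> k t <= M)
  (k0_gt0 : 0 < k 0)
  (k_continuous : {within `[0, +oo[, continuous k})
  (k_nonincreasing : forall s t : R, 0 <= s -> s <= t -> k t <= k s)
  (k_preserves : preserves_nonnegativity k)
  (b0_ge : loewner_ge b0 ((k 0 * (d%:R - 1)) *: (Q^T *m Q)))
  (B_inward : forall x u : 'M[R]_d, psd x -> psd u ->
     \tr (x *m u) = 0 -> 0 <= \tr (B x *m u))
  (gamma c : R) (gamma_gt0 : 0 < gamma) (gamma_le1 : gamma <= 1) (c_gt0 : 0 < c)
  (k_int : forall s t : R, 0 <= s -> s < t -> t <= T ->
     (\int[lebesgue_measure]_(u in `[s, t]) (`|k (t - u)| ^+ 2)%:E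
        <= (c * (t - s) `^ gamma)%:E)%E)
  (k_int_diff : forall s t : R, 0 <= s -> s < t -> t <= T ->
     (\int[lebesgue_measure]_(u in `[0%R, s]) ((k (t - u) - k (s - u)) ^+ 2)%:E
        <= (c * (t - s) `^ gamma)%:E)%E)
  (X0 : 'M[R]_d) (hX0 : psd X0) :
  has_weak_solution T (fun t => (k t)%:M) (fun x => b0 + B x) Q X0.
Proof.
have [U _] := free_ultrafilter_ex.
have a0 : 0 <= k 0 * inward_const B ^+ 2 by rewrite mulr_ge0 ?sqr_ge0// ltW.
have [h [th [N [hN hc [th0 th1] tc hs]]]] := scheme_parameters (noise_size Q (k 0)) a0.
have h0 n := (hN n).1; have Nb n := (hN n).2.
have s1 n : k 0 * h n * inward_const B ^+ 2 <= 4 * th n * th n by rewrite mulrAC; exact: (hs n).1.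
have s2 n : h n * noise_size Q (k 0) <= (1 - th n) * th n by exact: (hs n).2.
exists _, (caratheodory_type (@loeb_mu R U (coins (d := d) N) (@coins0 d N))), (@loeb_P R U (coins (d := d) N) (@coins0 d N)).
exists (@coin_filtration R U d h N), (@brownian R U d h N), (@solution R U d Q b0 B k X0 T h th N).
split.
- exact: coin_filtrationP.
- exact: brownian_matrixP.
- exact: solutionP.
Qed.
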